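(* The problem \textsc{$k$-Reversals} is solvable in polynomial time on (unweighted) cactus graphs. Here \textsc{$k$-Reversals} is: given a digraph $D=(V,A)$ with diameter $d_D$ and two integers $d,k$ with $2 \leq d < d_D$ and $k \geq 0$, decide whether a digraph of diameter at most $d$ can be obtained from $D$ by performing at most $k$ arc reversals.
   Context: For a digraph, the distance from $u$ to $v$ is the length (number of arcs) of a shortest directed path from $u$ to $v$, and is $\infty$ if no such path exists. The diameter of a digraph is the maximum distance over all ordered pairs of vertices. An arc reversal of an arc $(u,v)$ in a digraph $(V,A)$ produces the digraph $(V,(A\setminus\{(u,v)\})\cup\{(v,u)\})$. A cactus graph is a connected graph in which any two simple cycles share at most one vertex; a digraph is a cactus graph if its underlying undirected graph is one. *)

(* Defs.v *)
From mathcomp Require Import all_boot.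
Set Implicit Arguments. Unset Strict Implicit. Unset Printing Implicit Defensive.

Definition arcs n := {set 'I_n * 'I_n}.

Definition loopless n (A : arcs n) : Prop := forall v, (v, v) \notin A.

Definition arcrel n (A : arcs n) : rel 'I_n := fun u v => (u, v) \in A.

Definition dist_le n (A : arcs n) (u v : 'I_n) (m : nat) : Prop :=
  exists p : seq 'I_n, [/\ path (arcrel A) u p, last u p = v & size p <= m].

Definition diam_le n (A : arcs n) (m : nat) : Prop :=
  forall u v : 'I_n, dist_le A u v m.

Definition reverse_arc n (A : arcs n) (a : 'I_n * 'I_n) : arcs n :=
  (A :\ a) :|: [set (a.2, a.1)].

Inductive revs n : nat -> arcs n -> arcs n -> Prop :=
| revs0 (A : arcs n) : revs 0 A A
| revsS j (A B : arcs n) (a : 'I_n * 'I_n) : a \in A -> revs j (reverse_arc A a) B -> revs j.+1 A B.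

Definition kReversals n (A : arcs n) (d k : nat) : Prop :=
  exists j (B : arcs n), [/\ j <= k, revs j A B & diam_le B d].

Definition uadj n (A : arcs n) : rel 'I_n :=
  fun u v => ((u, v) \in A) || ((v, u) \in A).

Definition simple_cycle n (A : arcs n) (s : seq 'I_n) : bool :=
  [&& 3 <= size s, uniq s & cycle (uadj A) s].

Definition cycle_edges n (s : seq 'I_n) : {set 'I_n * 'I_n} :=
  [set e | [&& e.1 \in s, e.2 \in s & (next s e.1 == e.2) || (next s e.2 == e.1)]].

Definition cactus n (A : arcs n) : Prop :=
  (forall u v : 'I_n, connect (uadj A) u v) /\
  (forall s1 s2 : seq 'I_n, simple_cycle A s1 -> simple_cycle A s2 ->
     cycle_edges s1 != cycle_edges s2 ->
     #|[set x : 'I_n | (x \in s1) && (x \in s2)]| <= 1).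

(* Machine model: deterministic single-tape Turing machines over the    *)
(* tape alphabet {0,1,blank} (blank = None), two-way infinite tape.     *)
Inductive move := MoveL | MoveR | Stay.

Record TM := {
  tm_state : finType;
  tm_start : tm_state;
  tm_accept : tm_state;
  tm_reject : tm_state;
  tm_delta : tm_state -> option bool -> tm_state * option bool * move
}.

(* configuration: state, left part (reversed, nearest cell first),
   scanned symbol, right part *)
Definition config (M : TM) :=
  (tm_state M * seq (option bool) * option bool * seq (option bool))%type.

Definition halted (M : TM) (q : tm_state M) : bool :=
  (q == tm_accept M) || (q == tm_reject M).

Definition step (M : TM) (c : config M) : config M :=
  let: (q, l, x, r) := c in
  if halted q then c else
  let: (q', y, mv) := tm_delta q x in
  match mv with
  | Stay => (q', l, y, r)
  | MoveL => match l with
             | [::] => (q', [::], None, y :: r)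
             | z :: l' => (q', l', z, y :: r)
             end
  | MoveR => match r with
             | [::] => (q', y :: l, None, [::])
             | z :: r' => (q', y :: l, z, r')
             end
  end.

Definition init (M : TM) (w : seq bool) : config M :=
  (tm_start M, [::], head None (map Some w), behead (map Some w)).

Definition run (M : TM) (t : nat) (w : seq bool) : config M :=
  iter t (@step M) (init M w).

Definition state_of (M : TM) (c : config M) : tm_state M :=
  let: (q, _, _, _) := c in q.

Definition decides_within (M : TM) (w : seq bool) (t : nat) (P : Prop) : Prop :=
  halted (state_of (run M t w)) /\
  (state_of (run M t w) = tm_accept M <-> P).

Fixpoint bits_aux (fuel m : nat) : seq bool :=
  match fuel with
  | 0 => [::]
  | f.+1 => if m == 0 then [::] else odd m :: bits_aux f m./2
  end.

Definition nat_bits (m : nat) : seq bool := bits_aux m m.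

(* tokens: Some b = a bit, None = separator; token code 0->00, 1->11, sep->01 *)
Definition tok_bits (t : option bool) : seq bool :=
  match t with Some b => [:: b; b] | None => [:: false; true] end.

Definition adj_bits n (A : arcs n) : seq bool :=
  [seq (i, j) \in A | i <- enum 'I_n, j <- enum 'I_n].

Definition encode n (A : arcs n) (d k : nat) : seq bool :=
  flatten (map tok_bits
    (map Some (nat_bits n) ++ None :: map Some (adj_bits A) ++
     None :: map Some (nat_bits d) ++ None :: map Some (nat_bits k))).

(* Main.v *)
(* A set B of arcs arises from A by k reversals, up to double reversals, iff B reorients at
   most k arcs of A. On a cactus these orientations are composed along the rings (cycles and
   bridges): the graph hanging at a vertex v only matters through its cost and its in- and
   out-radius at v, and the parts hanging along a ring are attached one position at a time.
   The pairs still to be compared would require a quadratic amount of information, but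
   when the ring is traversed in three lanes (the two halves of its longest bidirected
   stretch, then the rest), the maxima of the radii plus ring distances to two terminals
   suffice, so that a state of the dynamic program is a tuple of boundedly many numbers
   below the input length. The program is thus a least fixed point definable in first-order
   logic over positions of the input, and such fixed points are evaluated in polynomial
   time: by loops over counters, these by sweeps of a machine over its tape. *)
Require Import Defs.
From mathcomp Require Import all_boot zify.
From Stdlib Require Import Classical.
Set Implicit Arguments. Unset Strict Implicit. Unset Printing Implicit Defensive.

(** * Sweeping Turing machines *)

(** Soundness only ever concatenates walks, so arcs may be dropped and any guessed table of upper
    bounds that obeys the inequalities is admissible. Exactness matters only for completeness: there
    the radii are attained, and a diameter bound splits at cut vertices into sums of radii. A
    strongly connected orientation that keeps every adjacency makes each ring a directed cycle one
    way or the other, so a ring walk runs forward, or backward within a stretch of two-way edges.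
    The obstacle is that the shorter side depends on the pair of positions. Only one two-way stretch
    can exceed half the ring; it is cut so that inside each half the direct route is shortest, and
    its halves are filled alternately, so that all routes from a new position to the attached part
    of the other half take the same side, and likewise all routes back. Any other stretch is at most
    half the ring, and what precedes it is reached around the ring through position 0. As rows of
    numbers cannot hold a ring, a ring is given by its first edge, and successors are recovered from
    connectivity after deletion of a vertex. *)

Section Reach.
Variables (T : Type) (f : T -> T).

Definition reach (x y : T) (b : nat) := exists2 t, t <= b & iter t f x = y.

Lemma reach_refl x b : reach x x b.
Proof. by exists 0. Qed.

Lemma reach_trans y x z b1 b2 : reach x y b1 -> reach y z b2 -> reach x z (b1 + b2).
Proof.
by move=> [t1 l1 e1] [t2 l2 e2]; exists (t2 + t1); [lia | rewrite iterD e1].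
Qed.

Lemma reach_step x y b : reach (f x) y b -> reach x y b.+1.
Proof. by move=> [t l e]; exists t.+1; rewrite // iterSr. Qed.

Lemma reach_weak x y b b' : b <= b' -> reach x y b -> reach x y b'.
Proof. by move=> lb [t l e]; exists t => //; lia. Qed.

End Reach.

Section SweepMachine.
Variables (K' P : nat).
Local Notation K := K'.+1.
Local Notation cell := (K.-tuple bool).
Variables (tr : nat -> bool * bool -> cell -> (bool * bool) * cell)
          (gr : nat -> bool) (nx : nat -> bool -> nat) (cell0 : bool -> cell).

(** Phases 0 to 7 carry the input bits, one by one from the right end, to the other side of a blank
    separator, where each becomes a cell. Phases 8 to 13 perform one sweep: return to the left end,
    read the first cell, read and rewrite, flush, append a cell, branch. The pair of flags is the
    state of the transducer [tr]; during the conversion its first flag holds the bit being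
    carried. *)
Definition control : finType := ('I_14 * 'I_P.+1 * (bool * bool) * 'I_K.+1 * cell)%type.
Definition tmst : finType := (bool + control)%type.

Definition mkst (ph pc : nat) (q : bool * bool) (cnt : nat) (buf : cell) : tmst :=
  inr (inord ph, inord pc, q, inord cnt, buf).

Definition push (buf : cell) (b : bool) : cell := [tuple of rcons (behead buf) b].

Definition blank_cell : cell := [tuple of nseq K false].

(** Leaving the program at address [P] accepts, at a larger address rejects. *)
Definition next_pc (pc : nat) (q : bool * bool) : tmst * option bool * move :=
  let p := nx pc q.1 in
  if p < P then (mkst 8 p (false, false) 0 blank_cell, None, MoveL)
  else (inl (p == P), None, Stay).

Definition sweep_on (ph pc : nat) q (cnt : nat) buf (b : bool) : tmst :=
  if cnt.+1 == K then
    let r := tr pc q (push buf b) in mkst 10 pc r.1 0 r.2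
  else mkst ph pc q cnt.+1 (push buf b).

Definition delta (s : tmst) (x : option bool) : tmst * option bool * move :=
  match s with
  | inl b => (inl b, x, Stay)
  | inr (ph, pc, q, cnt, buf) =>
    let pc : nat := pc in let cnt : nat := cnt in
    match (ph : nat), x with
    | 0, Some _ => (s, x, MoveR)
    | 0, None => (mkst 1 pc q cnt buf, None, MoveL)
    | 1, Some b => (mkst 2 pc (b, false) cnt buf, None, MoveL)
    | 2, Some _ => (s, x, MoveL)
    | 2, None => (mkst 3 pc q cnt buf, None, MoveL)
    | 3, Some _ => (s, x, MoveL)
    | 3, None => (mkst 4 pc q K buf, None, Stay)
    | 4, _ => if cnt is j.+1 then
                (mkst 4 pc q j buf, Some (nth false (cell0 q.1) j), MoveL)
              else (mkst 5 pc q 0 buf, x, MoveR)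
    | 5, Some _ => (s, x, MoveR)
    | 5, None => (mkst 6 pc q cnt buf, None, MoveR)
    | 6, Some _ => (mkst 0 pc q cnt buf, x, Stay)
    | 6, None => (mkst 7 pc (false, false) cnt buf, None, MoveL)
    | 7, _ => (mkst 8 pc (false, false) cnt buf, None, MoveL)
    | 8, Some _ => (s, x, MoveL)
    | 8, None => (mkst 9 pc (false, false) 0 blank_cell, None, MoveR)
    | 9, Some b => (sweep_on 9 pc q cnt buf b, None, MoveR)
    | 10, Some b => (sweep_on 10 pc q cnt buf b, Some (head false buf), MoveR)
    | 10, None => (mkst 11 pc q 0 buf, None, Stay)
    | 11, _ => if cnt < K then (mkst 11 pc q cnt.+1 (push buf false), Some (head false buf), MoveR)
               else (mkst (if gr pc then 12 else 13) pc q 0 buf, x, Stay)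
    | 12, _ => if cnt < K then (mkst 12 pc q cnt.+1 buf, Some false, MoveR)
               else (mkst 13 pc q 0 buf, x, Stay)
    | 13, _ => next_pc pc q
    | _, _ => (inl false, x, Stay)
    end
  end.

Definition machine : TM :=
  {| tm_state := tmst; tm_start := mkst 0 0 (false, false) 0 blank_cell;
     tm_accept := inl true; tm_reject := inl false; tm_delta := delta |}.

Local Notation stepM := (@step machine).

(** Joining the scanned symbol to the right part makes the blank end of the tape a case like any
    other. *)
Definition mk (s : tmst) (l r : seq (option bool)) : config machine :=
  (s, l, head None r, behead r).

Lemma mk_blank s l k : mk s l (nseq k None) = mk s l (None :: nseq k.-1 None).
Proof. by case: k. Qed.

Lemma head_blanks k : head None (nseq k (@None bool)) = None.
Proof. by case: k. Qed.

Lemma behead_blanks k : behead (nseq k (@None bool)) = nseq k.-1 None.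
Proof. by case: k. Qed.

Lemma step_mk ph pc q cnt buf l x r :
  stepM (mk (mkst ph pc q cnt buf) l (x :: r)) =
  let: (s', y, mv) := delta (mkst ph pc q cnt buf) x in
  match mv with
  | Stay => mk s' l (y :: r)
  | MoveL => mk s' (behead l) (head None l :: y :: r)
  | MoveR => mk s' (y :: l) r
  end.
Proof.
have -> : stepM (mk (mkst ph pc q cnt buf) l (x :: r)) =
  let: (q', y, mv) := delta (mkst ph pc q cnt buf) x in
  match mv with
  | Stay => (q', l, y, r)
  | MoveL => match l with
             | [::] => (q', [::], None, y :: r)
             | z :: l' => (q', l', z, y :: r)
             end
  | MoveR => match r with
             | [::] => (q', y :: l, None, [::])
             | z :: r' => (q', y :: l, z, r')
             end
  end by [].
move: (delta _ _) => [[s' y] mv]; by case: mv => //=; [case: l | case: r].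
Qed.

Lemma deltaE ph pc q cnt buf x : ph < 14 -> pc < P.+1 -> cnt < K.+1 ->
  delta (mkst ph pc q cnt buf) x =
    let s := mkst ph pc q cnt buf in
    match ph, x with
    | 0, Some _ => (s, x, MoveR)
    | 0, None => (mkst 1 pc q cnt buf, None, MoveL)
    | 1, Some b => (mkst 2 pc (b, false) cnt buf, None, MoveL)
    | 2, Some _ => (s, x, MoveL)
    | 2, None => (mkst 3 pc q cnt buf, None, MoveL)
    | 3, Some _ => (s, x, MoveL)
    | 3, None => (mkst 4 pc q K buf, None, Stay)
    | 4, _ => if cnt is j.+1 then
                (mkst 4 pc q j buf, Some (nth false (cell0 q.1) j), MoveL)
              else (mkst 5 pc q 0 buf, x, MoveR)
    | 5, Some _ => (s, x, MoveR)
    | 5, None => (mkst 6 pc q cnt buf, None, MoveR)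
    | 6, Some _ => (mkst 0 pc q cnt buf, x, Stay)
    | 6, None => (mkst 7 pc (false, false) cnt buf, None, MoveL)
    | 7, _ => (mkst 8 pc (false, false) cnt buf, None, MoveL)
    | 8, Some _ => (s, x, MoveL)
    | 8, None => (mkst 9 pc (false, false) 0 blank_cell, None, MoveR)
    | 9, Some b => (sweep_on 9 pc q cnt buf b, None, MoveR)
    | 10, Some b => (sweep_on 10 pc q cnt buf b, Some (head false buf), MoveR)
    | 10, None => (mkst 11 pc q 0 buf, None, Stay)
    | 11, _ => if cnt < K then (mkst 11 pc q cnt.+1 (push buf false), Some (head false buf), MoveR)
               else (mkst (if gr pc then 12 else 13) pc q 0 buf, x, Stay)
    | 12, _ => if cnt < K then (mkst 12 pc q cnt.+1 buf, Some false, MoveR)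
               else (mkst 13 pc q 0 buf, x, Stay)
    | 13, _ => next_pc pc q
    | _, _ => (inl false, x, Stay)
    end.
Proof.
by move=> hp hc hk; rewrite {1}/mkst /delta !inordK //.
Qed.

Definition bits (t : seq cell) : seq bool := flatten (map val t).

(* The sweep emits each transformed cell one cell to the right of where it was
   read, so that the written tape drifts to the right by one cell per sweep. *)
Fixpoint scan (f : bool * bool -> cell -> (bool * bool) * cell) q (t : seq cell) :=
  if t is c :: t' then
    let r := f q c in let r' := scan f r.1 t' in (r'.1, r.2 :: r'.2)
  else (q, [::]).

Definition tape_step (pc : nat) (t : seq cell) : nat * seq cell :=
  let r := scan (tr pc) (false, false) t in
  (nx pc r.1.1, r.2 ++ (if gr pc then [:: blank_cell] else [::])).

Lemma size_scan f q t : size (scan f q t).2 = size t.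
Proof. by elim: t q => //= c t IH q; rewrite IH. Qed.

Lemma size_bits t : size (bits t) = K * size t.
Proof.
elim: t => [|c t IH]; first by rewrite muln0.
by rewrite /bits /= size_cat size_tuple -/(bits t) IH mulnS.
Qed.

Lemma bits_cons c t : bits (c :: t) = c ++ bits t. Proof. by []. Qed.

Lemma bits_cat t1 t2 : bits (t1 ++ t2) = bits t1 ++ bits t2.
Proof. by rewrite /bits map_cat flatten_cat. Qed.

Lemma push_drop (buf : cell) (u : seq bool) b : push buf b = rcons (behead buf) b :> seq bool.
Proof. by []. Qed.

Lemma push_cons (buf : cell) x (s : seq bool) b :
  (buf : seq bool) = x :: s -> push buf b = rcons s b :> seq bool.
Proof. by rewrite push_drop; case: (tval buf) => // ? ? [_ ->]. Qed.

Section Sweep.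
Variable (pc : nat).
Hypothesis pcP : pc < P.+1.

(** The buffer is a queue: reading a bit pushes out one bit of the previous cell. Here [v] is the
    part of the current cell already read, [u] the part still unread, and [o] the part of the
    previous cell still to be written. In phase 9 there is no previous cell, and blanks are written
    instead. *)
Lemma sweep_cell ph q (c : cell) (u v o : seq bool) (buf : cell) l R :
  ph = 9 \/ ph = 10 -> (buf : seq bool) = o ++ v -> size o = size u -> 0 < size u ->
  v ++ u = c ->
  reach stepM (mk (mkst ph pc q (size v) buf) l (map Some u ++ R))
    (mk (mkst 10 pc (tr pc q c).1 0 (tr pc q c).2)
        (rev (if ph == 9 then nseq (size o) None else map Some o) ++ l) R)
    (size u).
Proof.
move=> hph; elim: u v o buf l => [|b u IH] v [|a o] buf l //= eb [so] _ ec.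
have sz : size v + (size u).+1 = K.
  by have := congr1 size ec; rewrite size_cat /= size_tuple.
have hb : (push buf b : seq bool) = o ++ rcons v b.
  by rewrite (push_cons _ eb) rcons_cat.
apply: reach_step.
have -> : stepM (mk (mkst ph pc q (size v) buf) l (Some b :: map Some u ++ R)) =
   mk (sweep_on ph pc q (size v) buf b) ((if ph == 9 then None else Some a) :: l) (map Some u ++ R).
  rewrite step_mk deltaE; try (case: hph => ->; lia); try lia.
  by case: hph => ->; rewrite /= ?eb.
case: u IH so ec sz => [|b' u] IH so ec sz.
  case: o so hb eb => // _ hb eb; rewrite /sweep_on.
  have -> : ((size v).+1 == K) by move: sz => /=; lia.
  have -> : push buf b = c by apply: val_inj => /=; rewrite -ec -cats1 in hb *.
  exists 0 => //=; rewrite /= /rev /=; by case: (ph == 9).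
rewrite /sweep_on ifF; last by move: sz => /=; lia.
have := IH (rcons v b) o (push buf b) ((if ph == 9 then None else Some a) :: l) hb so isT.
rewrite size_rcons cat_rcons => /(_ ec).
by case: (ph == 9); rewrite /= ?rev_cons ?cat_rcons.
Qed.

Lemma sweep_cells q (t : seq cell) (buf : cell) l R :
  let r := scan (tr pc) q t in
  reach stepM (mk (mkst 10 pc q 0 buf) l (map Some (bits t) ++ R))
   (mk (mkst 10 pc r.1 0 (last buf r.2)) (rev (map Some (bits (belast buf r.2))) ++ l) R)
   (size (bits t)).
Proof.
elim: t q buf l => [|c t IH] q buf l; first by exists 0.
rewrite bits_cons map_cat -catA size_cat.
apply: reach_trans.
  apply: (@sweep_cell 10 q c c [::] buf); rewrite ?cats0 ?size_tuple //; by right.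
rewrite /= bits_cons map_cat rev_cat -catA; exact: IH.
Qed.

(** Flushing shifts in [false], so that only a prefix [u] of the buffer keeps its meaning. *)
Lemma flush q j (u : seq bool) (buf : cell) l k :
  j + size u = K -> prefix u buf ->
  exists k' (buf' : cell), reach stepM (mk (mkst 11 pc q j buf) l (nseq k None))
   (mk (mkst 11 pc q K buf') (rev (map Some u) ++ l) (nseq k' None)) (size u).
Proof.
elim: u j buf l k => [|b u IH] j buf l k.
  by rewrite addn0 => -> _; exists k, buf; exists 0.
move=> /= hj; case E: (tval buf) => [|x s] //= /andP[/eqP eb pu].
have pu' : prefix u (push buf false).
  by rewrite (push_cons _ E) -cats1; apply: prefix_trans pu _; rewrite prefix_prefix.
have hj' : j.+1 + size u = K by lia.
have [k' [buf' h]] := IH j.+1 (push buf false) (Some b :: l) k.-1 hj' pu'.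
exists k', buf'; apply: reach_step; rewrite mk_blank step_mk deltaE //; last by lia.
by rewrite ifT ?E /= -?eb ?rev_cons ?cat_rcons; last lia.
Qed.

Lemma grow_cell q j i buf l k : j + i = K ->
  exists k', reach stepM (mk (mkst 12 pc q j buf) l (nseq k None))
   (mk (mkst 12 pc q K buf) (map Some (nseq i false) ++ l) (nseq k' None)) i.
Proof.
elim: i j l k => [|i IH] j l k hj.
  by exists k; exists 0 => //; rewrite -hj addn0.
have hj' : j.+1 + i = K by lia.
have [k' h] := IH j.+1 (Some false :: l) k.-1 hj'.
exists k'; apply: reach_step; rewrite mk_blank step_mk deltaE //; last by lia.
rewrite ifT; last lia.
have -> // : map Some (nseq i.+1 false) ++ l = map Some (nseq i false) ++ Some false :: l.
by elim: i {IH hj hj' h} => //= i ->.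
Qed.

Lemma go_left ph q cnt buf (u : seq bool) l r :
  ph = 8 \/ ph = 2 \/ ph = 3 -> cnt <= K -> head None l = None ->
  reach stepM (mk (mkst ph pc q cnt buf) (behead (map Some u ++ l)) (head None (map Some u ++ l) :: r))
   (mk (mkst ph pc q cnt buf) (behead l) (None :: rev (map Some u) ++ r)) (size u).
Proof.
move=> hph hc hl; elim: u r => [|b u IH] r.
  by rewrite /= hl; exact: reach_refl.
apply: reach_step; rewrite [behead _]/= [head _ _]/=.
rewrite step_mk deltaE; try (case: hph => [|[]] ->; lia); try lia.
by case: hph IH => [|[]] -> IH; rewrite rev_cons cat_rcons; exact: IH.
Qed.

Lemma go_right ph q cnt buf (u : seq bool) l r :
  ph = 0 \/ ph = 5 -> cnt <= K ->
  reach stepM (mk (mkst ph pc q cnt buf) l (map Some u ++ r))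
   (mk (mkst ph pc q cnt buf) (rev (map Some u) ++ l) r) (size u).
Proof.
move=> hph hc; elim: u l => [|b u IH] l; first exact: reach_refl.
apply: reach_step; rewrite [map _ _ ++ _]/= step_mk deltaE; try (case: hph => ->; lia); try lia.
by case: hph IH => -> IH; rewrite /= rev_cons cat_rcons; exact: IH.
Qed.

Lemma write_cell q j buf k r : j <= K ->
  exists k', reach stepM (mk (mkst 4 pc q j buf) (nseq k None) (None :: r))
    (mk (mkst 4 pc q 0 buf) (nseq k' None) (None :: map Some (take j (cell0 q.1)) ++ r)) j.
Proof.
elim: j k r => [|j IH] k r hj; first by exists k; rewrite take0; exact: reach_refl.
have [|k' h] := IH k.-1 (Some (nth false (cell0 q.1) j) :: r); first by lia.
exists k'; apply: reach_step; rewrite step_mk deltaE //=.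
have -> : head None (nseq k (@None bool)) = None by case: k {h}.
have -> : behead (nseq k (@None bool)) = nseq k.-1 None by case: k {h}.
rewrite (take_nth false) ?size_tuple // map_rcons cat_rcons; exact: h.
Qed.

End Sweep.

Lemma rev_map_Some (u : seq bool) : rev (map Some u) = map Some (rev u).
Proof. by rewrite map_rev. Qed.

(** The numbers of blanks on both sides are left open, because they change with every sweep as the
    written tape drifts. *)
Definition at_tape (c : config machine) (pc : nat) (t : seq cell) :=
  exists k k', c = mk (mkst 9 pc (false, false) 0 blank_cell) (nseq k None)
                      (map Some (bits t) ++ nseq k' None).

(** A sweep reads [s] cells, writes at most two more at the end, and returns over at most [s.+1];
    the bound leaves slack for the turning points. *)
Definition sweep_time (s : nat) := 4 * K * s.+2 + 8.

Lemma tape_step_sim c pc t : pc < P -> t != [::] -> at_tape c pc t ->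
  let r := tape_step pc t in
  if r.1 < P then exists2 c', reach stepM c c' (sweep_time (size t)) & at_tape c' r.1 r.2
  else exists2 c', reach stepM c c' (sweep_time (size t)) & c'.1.1.1 = inl (r.1 == P).
Proof.
move=> hpc t0 [k [k' ->]] r.
have hp : pc < P.+1 by lia.
case: t t0 @r => // c1 t _ r.
pose R := nseq k' (@None bool).
pose q1 := (tr pc (false,false) c1).1; pose b1 := (tr pc (false, false) c1).2.
pose r1 := scan (tr pc) q1 t.
have s1 := @sweep_cell pc hp 9 (false, false) c1 c1 [::] blank_cell blank_cell (nseq k None)
   (map Some (bits t) ++ R).
have {s1} := s1 (or_introl erefl).
rewrite cats0 !size_tuple => /(_ erefl erefl isT erefl) /= s1.
have s2 := @sweep_cells pc hp q1 t b1 (rev (None :: nseq K' None) ++ nseq k None) R.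
have ps : prefix (last b1 r1.2) (last b1 r1.2) by rewrite prefix_refl.
have sz0 : 0 + size (last b1 r1.2) = K by rewrite size_tuple.
have [k2 [b2 s3]] := @flush pc hp r1.1 0 (last b1 r1.2) (last b1 r1.2)
  (rev [seq Some i | i <- bits (belast b1 r1.2)] ++ rev (None :: nseq K' None) ++ nseq k None) k'.-1.+1 sz0 ps.
have s12 : reach stepM (mk (mkst 9 pc (false, false) 0 blank_cell) (nseq k None)
     ([seq Some i | i <- bits (c1 :: t)] ++ R))
   (mk (mkst 11 pc r1.1 K b2) (map Some (rev (bits (b1 :: r1.2))) ++ nseq (K + k) None) (nseq k2 None))
   (K + (size (bits t) + (1 + K))).
  rewrite bits_cons map_cat -catA.
  apply: reach_trans s1 _; apply: reach_trans s2 _.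
  apply: reach_step; rewrite /R mk_blank step_mk deltaE // -/r1.
  move: s3; rewrite add0n in sz0; rewrite {1}sz0.
  suff -> : forall l, rev (map Some (last b1 r1.2)) ++ (rev (map Some (bits (belast b1 r1.2))) ++ l)
     = map Some (rev (bits (b1 :: r1.2))) ++ l :> seq (option bool).
    have -> : rev (None :: nseq K' None) ++ nseq k None = nseq (K + k) (@None bool).
      by rewrite -[None :: _]/(nseq K None) rev_nseq cat_nseq /ncons; elim: (K) => //= n ->.
    by move=> h; exact: h.
  move=> l; rewrite catA -rev_cat -map_cat map_rev; congr (_ ++ _).
  by congr (rev (map _ _)); rewrite lastI -cats1 bits_cat /bits /= cats0.
pose L := rev (bits r.2).
have s13 : exists k3, exists b3, reach stepM (mk (mkst 9 pc (false, false) 0 blank_cell) (nseq k None)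
     ([seq Some i | i <- bits (c1 :: t)] ++ R))
   (mk (mkst 13 pc r1.1 0 b3) (map Some L ++ nseq (K + k) None) (nseq k3 None))
   ((K + (size (bits t) + (1 + K))) + (K + 2)).
  rewrite /L /r /tape_step /= -/q1 -/b1 -/r1.
  case g: (gr pc); last first.
    exists k2.-1.+1, b2; apply: reach_trans s12 _.
    apply: (@reach_weak _ _ _ _ 1); first lia.
    apply: reach_step; rewrite mk_blank step_mk deltaE // ltnn g cats0 /=; exact: reach_refl.
  have hK : 0 + K = K by [].
  have [k3 h3] := @grow_cell pc hp r1.1 0 K b2 (map Some (rev (bits (b1 :: r1.2))) ++ nseq (K + k) None) k2.-1.+1 hK.
  exists k3.-1.+1, b2; apply: reach_trans s12 _.
  apply: (@reach_weak _ _ _ _ (K + 1).+1); first lia.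
  apply: reach_step; rewrite mk_blank step_mk deltaE // ltnn g.
  apply: reach_trans h3 _.
  apply: reach_step; rewrite mk_blank step_mk deltaE // ltnn.
  rewrite -[_ :: _ ++ _]cat_cons bits_cat rev_cat map_cat catA [map Some (rev _)]/=.
  have -> : rev (bits [:: blank_cell]) = nseq K false.
    by rewrite /bits /= cats0 -[false :: _]/(nseq K false) rev_nseq.
  by rewrite -catA; exact: reach_refl.
have [k3 [b3 {}s13]] := s13.
have bound : ((K + (size (bits t) + (1 + K))) + (K + 2)) + (1 + (size L + 1)) <= sweep_time (size (c1 :: t)).
  have sr : size r.2 <= (size t).+2.
    by rewrite /r /tape_step /= size_cat size_scan; case: (gr pc) => /=; lia.
  have : K * size r.2 <= K * (size t).+2 by rewrite leq_mul2l sr orbT.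
  rewrite /L size_rev !size_bits /sweep_time [size (c1 :: t)]/=.
  move: (size r.2) (size t) => x y; move: (K) => z.
  by rewrite -mulnA !mulnS; lia.
case: ifP => hr.
  eexists.
    apply: (reach_weak bound); apply: reach_trans s13 _.
    apply: reach_trans.
      apply: reach_step; rewrite mk_blank step_mk deltaE // /next_pc.
      rewrite -[nx pc _]/(r.1) hr; exact: reach_refl.
    apply: reach_trans.
      have hr' : r.1 < P.+1 by rewrite ltnS ltnW.
      have := @go_left r.1 hr' 8 (false, false) 0 blank_cell L (nseq (K + k) None) (None :: nseq k3.-1 None).
      by apply => //; left.
    apply: reach_step; rewrite behead_blanks step_mk deltaE //; last by rewrite ltnS ltnW.
    exact: reach_refl.
  by exists (K + k).-1.+1, k3.-1.+1; rewrite /L rev_map_Some revK.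
refine (ex_intro2 _ _ (mk (inl (r.1 == P) : tmst) (map Some L ++ nseq (K + k) None) (None :: nseq k3.-1 None)) _ _); last by [].
apply: (reach_weak bound); apply: reach_trans s13 _.
  apply: (@reach_weak _ _ _ _ 1); first by lia.
  apply: reach_step; rewrite mk_blank step_mk deltaE // /next_pc.
  rewrite -[nx pc _]/(r.1) hr; exact: reach_refl.
Qed.

(** Next to the unread input stands one blank separator, and beyond it the cells made so far. The
    form [head None l = None] also covers the empty left part of the start configuration. *)
Definition conv_inv (l : seq (option bool)) (v : seq bool) :=
  head None l = None /\
  exists k, behead l = map Some (rev (bits (map cell0 v))) ++ nseq k None.

Definition conv_time (n : nat) := 2 * (K + 1) * n.+1 + 16.

Lemma convert_bit q cnt buf l u b v k' : cnt <= K -> conv_inv l v ->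
  exists q' l' k'', conv_inv l' (b :: v) /\
   reach stepM (mk (mkst 0 0 q cnt buf) l (map Some (rcons u b) ++ nseq k' None))
    (mk (mkst 6 0 q' 0 buf) l' (map Some u ++ nseq k'' None)) (conv_time (size u + size v)).
Proof.
move=> hc [hl [k hk]].
pose bv := bits (map cell0 v).
have [k3 hw] := @write_cell 0 isT (b, false) K buf k.-1
   (map Some bv ++ None :: map Some u ++ [:: None, None & nseq k'.-1 None]) (leqnn K).
exists (b, false), (None :: rev (map Some (bits (map cell0 (b :: v)))) ++ None :: nseq k3 None), k'.-1.+2.
split; first by split=> //; exists k3.+1; rewrite /= rev_map_Some.
have e : conv_time (size u + size v) >=
  (size u).+1 + (2 + (size u + (1 + (size bv + (1 + (K + (1 + (size bv + K + 1)))))))).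
  rewrite /conv_time /bv size_bits size_map.
  by move: (size u) (size v) => x y; move: (K) => z; rewrite !mulnS !mulnDr !mulnDl; lia.
apply: (reach_weak e).
apply: reach_trans.
  have := @go_right 0 isT 0 q cnt buf (rcons u b) l (nseq k' None).
  by rewrite size_rcons; apply=> //; left.
apply: reach_trans.
  apply: reach_step; rewrite mk_blank step_mk deltaE // map_rcons rev_rcons [behead _]/= [head _ _]/=.
  apply: reach_step; rewrite step_mk deltaE //.
  exact: reach_refl.
apply: reach_trans.
  have := @go_left 0 isT 2 (b, false) cnt buf (rev u) l [:: None, None & nseq k'.-1 None].
  rewrite size_rev -rev_map_Some; apply=> //; by right; left.
rewrite revK.
apply: reach_trans.
  apply: reach_step; rewrite step_mk deltaE // hk.
  exact: reach_refl.
apply: reach_trans.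
  have := @go_left 0 isT 3 (b, false) cnt buf (rev bv) (nseq k None).
  rewrite size_rev; apply=> //; [by right; right | exact: head_blanks].
rewrite -map_rev revK behead_blanks.
apply: reach_trans.
  apply: reach_step; rewrite step_mk deltaE //.
  exact: reach_refl.
apply: reach_trans hw _.
apply: reach_trans.
  apply: reach_step; rewrite step_mk deltaE //.
  exact: reach_refl.
rewrite take_oversize ?size_tuple // catA -map_cat -bits_cons.
apply: reach_trans.
  have := @go_right 0 isT 5 (b, false) 0 buf (bits (map cell0 (b :: v))).
  rewrite bits_cons size_cat size_tuple addnC -/bv => h; apply: h => //; by right.
apply: reach_step; rewrite step_mk deltaE //.
exact: reach_refl.
Qed.

Lemma convert_all q buf l u v k' : conv_inv l v -> u ++ v != [::] ->
  exists2 c, reach stepM (mk (mkst 6 0 q 0 buf) l (map Some u ++ nseq k' None)) c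
       (size u * (conv_time (size u + size v) + 1) + conv_time (size v + size u))
     & at_tape c 0 (map cell0 (u ++ v)).
Proof.
elim/last_ind: u q l v k' => [|u b IH] q l v k' hi nz.
  case: hi => hl [k hk].
  pose bv := bits (map cell0 v).
  eexists.
    rewrite mul0n add0n.
    apply: (@reach_weak _ _ _ _ (2 + (size bv + 1))).
      rewrite /conv_time /bv size_bits size_map; move: (size v) (K) => x y.
      by rewrite !mulnS !mulnDr !mulnDl; lia.
    apply: reach_trans.
      apply: reach_step; rewrite cat0s mk_blank step_mk deltaE //.
      apply: reach_step; rewrite hl step_mk deltaE //.
      exact: reach_refl.
    apply: reach_trans.
      have := @go_left 0 isT 8 (false, false) 0 buf (rev bv) (nseq k None).
      rewrite size_rev hk; apply=> //; [by left | exact: head_blanks].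
    apply: reach_step; rewrite step_mk deltaE // -map_rev revK behead_blanks.
    exact: reach_refl.
  exists k.-1.+1, k'.-1.+2; by rewrite cat0s.
have [q' [l' [k'' [hi' h]]]] := @convert_bit q 0 buf l u b v k' isT hi.
have [|c hc1 hc2] := IH q' l' (b :: v) k'' hi'; first by case: (u).
exists c; last by rewrite cat_rcons.
have mono x y : x <= y -> conv_time x <= conv_time y.
  by move=> xy; rewrite /conv_time leq_add2r leq_mul2l ltnS xy orbT.
apply: (@reach_weak _ _ _ _ (1 + (conv_time (size u + size v) +
   (size u * (conv_time (size u + size (b :: v)) + 1) + conv_time (size (b :: v) + size u))))).
  have := mono (size u + size v) (size u + size v).+1 (leqnSn _).
  have e1 : size u + (size v).+1 = (size u + size v).+1 by lia.
  have e2 : (size v).+1 + size u = (size u + size v).+1 by lia.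
  have e3 : (size u).+1 + size v = (size u + size v).+1 by lia.
  have e4 : size v + (size u).+1 = (size u + size v).+1 by lia.
  by rewrite size_rcons [size (b :: v)]/= e1 e2 e3 e4 mulSn; lia.
apply: reach_trans.
  apply: (@reach_step _ _ _ _ 0).
  have -> : stepM (mk (mkst 6 0 q 0 buf) l (map Some (rcons u b) ++ nseq k' None)) =
     mk (mkst 0 0 q 0 buf) l (map Some (rcons u b) ++ nseq k' None).
    by case: (u) => [|a u']; rewrite [map _ _ ++ _]/= step_mk deltaE.
  exact: reach_refl.
apply: reach_trans h _; exact: hc1.
Qed.

(** Each bit crosses all that has been written so far, which makes the conversion quadratic. The
    empty left part satisfies [conv_inv], so the start configuration is an instance of
    [convert_bit]. *)
Lemma convert_input (w : seq bool) : w != [::] ->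
  exists2 c, reach stepM (init machine w) c ((size w).+2 * (conv_time (size w) + 1))
   & at_tape c 0 (map cell0 w).
Proof.
case/lastP: w => // u b _.
have hi : conv_inv [::] [::] by split => //; exists 0.
have [q' [l' [k'' [hi' h]]]] := @convert_bit (false, false) 0 blank_cell [::] u b [::] 0 isT hi.
have [|c hc1 hc2] := @convert_all q' blank_cell l' u [:: b] k'' hi'; first by case: (u).
exists c; last by rewrite -cats1.
move: h; rewrite /= cats0 -[mk _ _ _]/(init machine (rcons u b)) => h.
apply: reach_weak (reach_trans h hc1).
rewrite size_rcons addn0.
have : conv_time (size u) <= conv_time (size u).+1.
  by rewrite /conv_time leq_add2r leq_mul2l leqnSn orbT.
rewrite [size [:: b]]/= !addn1 add1n; move: (conv_time _) (conv_time _) => x y hxy.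
by rewrite mulSn; nia.
Qed.

End SweepMachine.

(** * Counter programs *)

Record store := Store { ctr : nat -> nat; memo : nat -> nat -> bool; top : nat }.

Inductive op := Zero of nat | Copy of nat & nat | Inc of nat | Fill of nat
  | SetM of nat & nat | Grow.
Inductive test := TLt of nat & nat | TMem of nat & nat.
Inductive com := Skip | Do of op | Seq of com & com | If of test & com & com
  | For of nat & nat & com.

Definition setc (s : store) x v := Store (fun y => if y == x then v else ctr s y) (memo s) (top s).

(** [Inc] saturates at [top] and [SetM] ignores larger positions: there is no cell in which the
    change could be recorded. Only [Grow] adds a cell. *)
Definition do_op (o : op) (s : store) : store :=
  match o with
  | Zero x => setc s x 0
  | Copy x y => setc s x (ctr s y)
  | Inc x => setc s x (if ctr s x < top s then (ctr s x).+1 else ctr s x)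
  | Fill x => setc s x (top s)
  | SetM m x => Store (ctr s)
      (fun m' i => memo s m' i || [&& m' == m, i == ctr s x & i < top s]) (top s)
  | Grow => Store (ctr s) (memo s) (top s).+1
  end.

Definition do_test (t : test) (s : store) : bool :=
  match t with
  | TLt x y => ctr s x < ctr s y
  | TMem m x => memo s m (ctr s x)
  end.

Fixpoint sem (c : com) (s : store) : store :=
  match c with
  | Skip => s
  | Do o => do_op o s
  | Seq a b => sem b (sem a s)
  | If t a b => if do_test t s then sem a s else sem b s
  | For x y c => iter (ctr s y) (fun s' => do_op (Inc x) (sem c s')) (setc s x 0)
  end.

Definition wr_op (o : op) : seq nat :=
  match o with
  | Zero x | Copy x _ | Inc x | Fill x => [:: x]
  | _ => [::]
  end.

Fixpoint wr (c : com) : seq nat :=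
  match c with
  | Skip => [::]
  | Do o => wr_op o
  | Seq a b | If _ a b => wr a ++ wr b
  | For x _ c => x :: wr c
  end.

Lemma sem_frame c s x : x \notin wr c -> ctr (sem c s) x = ctr s x.
Proof.
elim: c s => //= [o|a IHa b IHb|t a IHa b IHb|z y c IH] s.
- by case: o => //= [z|z y|z|z]; rewrite inE => /negPf ->.
- by rewrite mem_cat negb_or => /andP[ha hb]; rewrite IHb // IHa.
- by rewrite mem_cat negb_or => /andP[ha hb]; case: ifP => _; [rewrite IHa | rewrite IHb].
rewrite inE negb_or => /andP[/negPf hz hc].
elim: (ctr s y) => [|n IHn] /=; first by rewrite hz.
by rewrite hz IH.
Qed.

Section Compile.
Variables (nc' nm : nat).
Local Notation nc := nc'.+1.
Local Notation K' := (nc' + nm).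
Local Notation K := K'.+1.
Local Notation cell := (K.-tuple bool).

Definition inv (s : store) :=
  (forall x, x < nc -> ctr s x <= top s) /\ (forall m i, memo s m i -> i < top s).

(** Counters are stored in unary across the cells. The first cell in which the bit of counter [x] is
    unset is therefore the one at position [ctr s x]; this is how a sweep addresses a relation at
    the value of a counter. *)
Definition mkcell (s : store) (i : nat) : cell :=
  [tuple (if j < nc then i < ctr s j else memo s (j - nc) i) | j < K].

Definition tape (s : store) : seq cell := [seq mkcell s i | i <- iota 0 (top s)].

Definition get (c : cell) x := nth false c x.
Definition put (c : cell) x v : cell := [tuple (if j == x :> nat then v else tnth c j) | j < K].

Lemma nth_mktuple (f : 'I_K -> bool) x (hx : x < K) : nth false [tuple f j | j < K] x = f (Ordinal hx).
Proof. by rewrite -(tnth_nth _ _ (Ordinal hx)) tnth_mktuple. Qed.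

Lemma get_ctr s i x : x < nc -> get (mkcell s i) x = (i < ctr s x).
Proof.
move=> hx; have hK : x < K by lia.
by rewrite /get nth_mktuple /= hx.
Qed.

Lemma get_mem s i m : m < nm -> get (mkcell s i) (nc + m) = memo s m i.
Proof.
move=> hx; have hK : nc + m < K by lia.
rewrite /get nth_mktuple /= ifF; last by lia.
by have -> : nc + m - nc = m by lia.
Qed.

Lemma put_ctr s i x v : x < nc -> put (mkcell s i) x (i < v) = mkcell (setc s x v) i.
Proof.
move=> hx; apply: eq_from_tnth => j; rewrite !tnth_mktuple /=.
by case: ifP => [/eqP -> | _ //]; rewrite hx.
Qed.

(** The second flag records that the first cell with unset bit [x] has been passed; [Inc] and [SetM]
    act on that cell alone. *)
Definition cell_op (o : op) (q : bool * bool) (c : cell) : (bool * bool) * cell :=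
  match o with
  | Zero x => (q, put c x false)
  | Copy x y => (q, put c x (get c y))
  | Inc x => if ~~ q.2 && ~~ get c x then ((q.1, true), put c x true) else (q, c)
  | Fill x => (q, put c x true)
  | SetM m x => if ~~ q.2 && ~~ get c x then ((q.1, true), put c (nc + m) true) else (q, c)
  | Grow => (q, c)
  end.

Definition cell_test (t : test) (q : bool * bool) (c : cell) : (bool * bool) * cell :=
  match t with
  | TLt x y => ((q.1 || (get c y && ~~ get c x), q.2), c)
  | TMem m x => if ~~ q.2 && ~~ get c x then ((get c (nc + m), true), c) else (q, c)
  end.

Definition ok_op (o : op) : bool :=
  match o with
  | Zero x | Inc x | Fill x => x < nc
  | Copy x y => (x < nc) && (y < nc)
  | SetM m x => (m < nm) && (x < nc)
  | Grow => true
  end.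

Definition ok_test (t : test) : bool :=
  match t with TLt x y => (x < nc) && (y < nc) | TMem m x => (m < nm) && (x < nc) end.

(** Compiled loops compare the two counters anew in each round, whereas [sem] fixes the number of
    rounds on entry. Forbidding the body to write either counter makes the two agree. *)
Fixpoint ok (c : com) : bool :=
  match c with
  | Skip => true
  | Do o => ok_op o
  | Seq a b => ok a && ok b
  | If t a b => [&& ok_test t, ok a & ok b]
  | For x y c => [&& x < nc, y < nc, x != y, x \notin wr c, y \notin wr c & ok c]
  end.

Lemma inv_op o s : ok_op o -> inv s -> inv (do_op o s).
Proof.
move=> hok [h1 h2]; split => [x hx|m i]; case: o hok => //=.
- by move=> z _; case: ifP => // _; exact: h1.
- by move=> z y /andP[_ hy]; case: ifP => _; exact: h1.
- by move=> z hz; case: ifP => _; [case: ifP => // _; exact: h1 | exact: h1].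
- by move=> z _; case: ifP => // _; exact: h1.
- by move=> z y _; exact: h1.
- by move=> _; have := h1 x hx; lia.
- by move=> z _; exact: h2.
- by move=> z y _; exact: h2.
- by move=> z _; exact: h2.
- by move=> z _; exact: h2.
- by move=> z y _ /orP[/h2//|/and3P[]].
by move=> _ /h2; lia.
Qed.

Lemma top_op o s : top s <= top (do_op o s).
Proof. by case: o => //=. Qed.

Lemma scan_map (g : cell -> cell) (f : bool * bool -> cell -> (bool * bool) * cell) q t :
  (forall q c, f q c = (q, g c)) -> scan f q t = (q, map g t).
Proof. by move=> h; elim: t => //= c t IH; rewrite h IH. Qed.

Lemma scan_id (f : bool * bool -> cell -> (bool * bool) * cell) q t :
  (forall c, f q c = (q, c)) -> scan f q t = (q, t).
Proof. by move=> h; elim: t => //= c t IH; rewrite h IH. Qed.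

Lemma scan_first (f : bool * bool -> cell -> (bool * bool) * cell) (g : cell -> bool * cell) b s x a n :
  x < nc -> a <= ctr s x ->
  (forall q c, f q c = if ~~ q.2 && ~~ get c x then (((g c).1, true), (g c).2) else (q, c)) ->
  scan f (b, false) [seq mkcell s i | i <- iota a n] =
   (if ctr s x < a + n then ((g (mkcell s (ctr s x))).1, true) else (b, false),
    [seq if i == ctr s x then (g (mkcell s i)).2 else mkcell s i | i <- iota a n]).
Proof.
move=> hx + h; elim: n a => [|n IH] a ha /=; first by rewrite ifF //; lia.
rewrite h /= get_ctr //.
case: ltnP => hlt /=.
  rewrite IH //=; congr (_, _); first by rewrite addSnnS.
  by congr (_ :: _); rewrite ifF //; lia.
have e : a = ctr s x by lia.
rewrite scan_id; last by move=> c; rewrite h.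
rewrite e eqxx /= ifT; last by lia.
congr (_, _ :: _); apply/eq_in_map => i; rewrite mem_iota => hi.
by rewrite ifF //; lia.
Qed.

Lemma scan_lt x y b s a n : x < nc -> y < nc ->
  scan (cell_test (TLt x y)) b [seq mkcell s i | i <- iota a n] =
   ((b.1 || has (fun i => (i < ctr s y) && ~~ (i < ctr s x)) (iota a n), b.2),
    [seq mkcell s i | i <- iota a n]).
Proof.
move=> hx hy; elim: n a b => [|n IH] a b /=; first by rewrite orbF; case: b.
by rewrite IH !get_ctr //= orbA.
Qed.

Inductive instr := IOp of op | ITst of test & nat & nat.

Variable prog : seq instr.
Local Notation P := (size prog).
Local Notation at_pc := (nth (IOp Grow) prog).

Definition istep (pc : nat) (s : store) : nat * store :=
  match at_pc pc with
  | IOp o => (pc.+1, do_op o s)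
  | ITst t j1 j2 => (if do_test t s then j1 else j2, s)
  end.

Definition prog_tr (pc : nat) (q : bool * bool) (c : cell) :=
  match at_pc pc with IOp o => cell_op o q c | ITst t _ _ => cell_test t q c end.

Definition prog_gr (pc : nat) := if at_pc pc is IOp Grow then true else false.

Definition prog_nx (pc : nat) (b : bool) :=
  match at_pc pc with IOp o => pc.+1 | ITst t j1 j2 => if b then j1 else j2 end.

Definition ok_instr (i : instr) := match i with IOp o => ok_op o | ITst t _ _ => ok_test t end.

Lemma tape_setc s x v : tape (setc s x v) = [seq mkcell (setc s x v) i | i <- iota 0 (top s)].
Proof. by []. Qed.

Lemma tape_step_istep pc s : ok_instr (at_pc pc) -> inv s ->
  tape_step prog_tr prog_gr prog_nx pc (tape s) = ((istep pc s).1, tape (istep pc s).2).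
Proof.
rewrite /tape_step /istep /prog_tr /prog_gr /prog_nx => hok [i1 i2].
case: (at_pc pc) hok => [o|t j1 j2] /=.
  case: o => [x|x y|x|x|m x|] /=; rewrite ?cats0.
  - move=> hx; rewrite (scan_map (g := fun c => put c x false)) //=; congr (_, _).
    rewrite tape_setc /tape -map_comp; apply: eq_map => i /=.
    by rewrite -(put_ctr _ _ 0).
  - move=> /andP[hx hy]; rewrite (scan_map (g := fun c => put c x (get c y))) //=; congr (_, _).
    rewrite tape_setc /tape -map_comp; apply: eq_map => i /=.
    by rewrite -(put_ctr _ _ (ctr s y)) // get_ctr.
  - move=> hx; rewrite /tape.
    have -> : scan (cell_op (Inc x)) (false, false) [seq mkcell s i | i <- iota 0 (top s)] =
      scan (fun q c => if ~~ q.2 && ~~ get c x then ((false, true), put c x true) else (q, c))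
         (false, false) [seq mkcell s i | i <- iota 0 (top s)].
      have : (false, false).1 = false by [].
      elim: [seq _ | i <- _] (false, false) => //= c t IH q hq.
      by case: ifP => h; rewrite ?hq /= IH.
    rewrite (@scan_first _ (fun c => (false, put c x true)) _ _ x) //=; congr (_, _).
    apply/eq_in_map => i; rewrite mem_iota => /= hi; rewrite -put_ctr //.
    have hK : x < K by lia.
    case: eqP => [e|ne].
      by rewrite ifT; [congr (put _ _ _); lia | lia].
    apply: eq_from_tnth => j; rewrite !tnth_mktuple; case: eqP => // ->.
    by rewrite hx; case: ifP => _; lia.
  - move=> hx; rewrite (scan_map (g := fun c => put c x true)) //=; congr (_, _).
    rewrite tape_setc /tape -map_comp; apply/eq_in_map => i /=.
    by rewrite mem_iota -put_ctr // => /= ->.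
  - move=> /andP[hm hx]; rewrite /tape.
    have -> : scan (cell_op (SetM m x)) (false, false) [seq mkcell s i | i <- iota 0 (top s)] =
      scan (fun q c => if ~~ q.2 && ~~ get c x then ((false, true), put c (nc + m) true) else (q, c))
         (false, false) [seq mkcell s i | i <- iota 0 (top s)].
      have : (false, false).1 = false by [].
      elim: [seq _ | i <- _] (false, false) => //= c t IH q hq.
      by case: ifP => h; rewrite ?hq /= IH.
    rewrite (@scan_first _ (fun c => (false, put c (nc + m) true)) _ _ x) //=; congr (_, _).
    apply/eq_in_map => i; rewrite mem_iota => /= hi.
    apply: eq_from_tnth => j; case: eqP => [e|ne]; rewrite !tnth_mktuple /=.
      rewrite hi andbT; case: eqP => [->|nj].
        have -> : (nc + m < nc) = false by lia.
        have -> : nc + m - nc = m by lia.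
        by rewrite e !eqxx orbT.
      case: ifP => // hj; have -> : (j - nc == m) = false by lia.
      by rewrite orbF.
    case: ifP => // hj; move/eqP/negPf: ne => ->; by rewrite ?andbF ?orbF.
  (* The appended blank cell is the right one: counters are at most [top], and no relation holds at
     [top]. *)
  move=> _; rewrite scan_id // /tape /=; congr (_, _).
  set f := mkcell _; rewrite -[RHS]/[seq f i | i <- iota 0 (top s).+1] -(addn1 (top s)) iotaD map_cat; congr (_ ++ [:: _]).
  apply: eq_from_tnth => j; rewrite [RHS]tnth_mktuple.
  have -> : tnth (blank_cell K') j = false.
    by rewrite (tnth_nth false) -[tval _]/(nseq K false) nth_nseq if_same.
  rewrite /= add0n; case: (ltnP j nc) => hc; first by have := i1 _ hc; lia.
  by apply/esym/negP => /i2; rewrite ltnn.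
case: t => [x y|m x] /=; rewrite cats0.
  move=> /andP[hx hy]; rewrite /tape scan_lt //=; congr (_, _).
  suff -> : has (fun i => (i < ctr s y) && ~~ (i < ctr s x)) (iota 0 (top s)) = (ctr s x < ctr s y) by [].
  apply/hasP/idP => [[i _ /andP[]]|h]; first by lia.
  exists (ctr s x); last by rewrite h ltnn.
  by rewrite mem_iota; have := i1 _ hy; lia.
move=> /andP[hm hx]; rewrite /tape.
rewrite (@scan_first (cell_test (TMem m x)) (fun c => (get c (nc + m), c)) _ _ x) //=; congr (_, _).
  rewrite add0n; case: ltnP => h /=; first by rewrite get_mem.
  by rewrite ifF //; apply/negP => /i2; lia.
by apply: eq_map => i; rewrite if_same.
Qed.

End Compile.

Fixpoint len (c : com) : nat :=
  match c with
  | Skip => 0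
  | Do _ => 1
  | Seq a b => len a + len b
  | If _ a b => 1 + (len a + (1 + len b))
  | For _ _ c => 2 + (len c + 2)
  end.

(** An unconditional jump is a test whose two targets coincide. *)
Fixpoint compile (c : com) (p : nat) : seq instr :=
  match c with
  | Skip => [::]
  | Do o => [:: IOp o]
  | Seq a b => compile a p ++ compile b (p + len a)
  | If t a b =>
    let q := p + 2 + len a in let r := q + len b in
    [:: ITst t p.+1 q] ++ (compile a p.+1 ++ ([:: ITst t r r] ++ compile b q))
  | For x y c =>
    let q := p + 4 + len c in
    [:: IOp (Zero x); ITst (TLt x y) p.+2 q] ++
      (compile c p.+2 ++ [:: IOp (Inc x); ITst (TLt x y) p.+1 p.+1])
  end.

Lemma size_compile c p : size (compile c p) = len c.
Proof.
elim: c p => //= [a IHa b IHb|t a IHa b IHb|x y c IH] p.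
- by rewrite size_cat IHa IHb.
- by rewrite size_cat /= IHa IHb.
by rewrite size_cat IH.
Qed.

(** Here [B] bounds [top], hence every counter and every number of rounds. *)
Fixpoint cost (c : com) (B : nat) : nat :=
  match c with
  | Skip => 0
  | Do _ => 1
  | Seq a b => cost a B + cost b B
  | If _ a b => 2 + (cost a B + cost b B)
  | For _ _ c => 2 + B * (cost c B + 3)
  end.

Section Exec.
Variables (nc' nm : nat).
Local Notation nc := nc'.+1.
Local Notation K' := (nc' + nm).
Local Notation K := K'.+1.
Local Notation cell := (K.-tuple bool).
Variable prog : seq instr.
Local Notation P := (size prog).

(** All counters start at 0. The bit after the counters is relation 0, which holds throughout the
    input, and the next one is relation 1, the input bit itself. *)
Definition cell0 (b : bool) : cell := [tuple (j == nc :> nat) || ((j == nc.+1 :> nat) && b) | j < K].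

Definition tm : TM := machine P (@prog_tr nc' nm prog) (prog_gr prog) (prog_nx prog) cell0.

Definition simu (B : nat) (p : nat) (s : store) (p' : nat) (s' : store) n :=
  forall c, @at_tape K' P (@prog_tr nc' nm prog) (prog_gr prog) (prog_nx prog) cell0 c p (tape nc' nm s) ->
   exists2 c', reach (@step tm) c c' (n * sweep_time K' B) &
    @at_tape K' P (@prog_tr nc' nm prog) (prog_gr prog) (prog_nx prog) cell0 c' p' (tape nc' nm s').

Lemma simu_refl B p s : simu B p s p s 0.
Proof. by move=> c h; exists c => //; exact: reach_refl. Qed.

Lemma simu_trans B p2 s2 p1 s1 p3 s3 n1 n2 :
  simu B p1 s1 p2 s2 n1 -> simu B p2 s2 p3 s3 n2 -> simu B p1 s1 p3 s3 (n1 + n2).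
Proof.
move=> h1 h2 c hc; have [c1 r1 /h2 [c2 r2 e2]] := h1 c hc.
by exists c2 => //; rewrite mulnDl; exact: reach_trans r1 r2.
Qed.

Lemma simu_weak B p s p' s' n n' : n <= n' -> simu B p s p' s' n -> simu B p s p' s' n'.
Proof.
move=> hn h c /h [c' r e]; exists c' => //.
by apply: reach_weak r; rewrite leq_mul2r hn orbT.
Qed.

Local Notation at_pc := (nth (IOp Grow) prog).

Lemma simu_step B p s p' s' : p < P -> ok_instr nc' nm (at_pc p) -> inv nc' s -> 0 < top s <= B ->
  istep prog p s = (p', s') -> p' < P -> simu B p s p' s' 1.
Proof.
move=> hp hok hi ht e hp' c hc.
have t0 : tape nc' nm s != [::] by rewrite -size_eq0 size_map size_iota; lia.
have := tape_step_sim hp t0 hc; rewrite tape_step_istep // e /= hp' => -[c' r h].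
exists c' => //; rewrite mul1n; apply: reach_weak r.
by rewrite /sweep_time size_map size_iota leq_add2r leq_mul2l; lia.
Qed.

Local Ltac sim_step e :=
  apply: simu_step; [lia | rewrite e; first [done | exact/andP] | | | rewrite /istep e | lia].

Definition code_at p (f : seq instr) := forall i, i < size f -> at_pc (p + i) = nth (IOp Grow) f i.

Lemma code_cat p f1 f2 : code_at p (f1 ++ f2) -> code_at p f1 /\ code_at (p + size f1) f2.
Proof.
move=> h; split=> i hi.
  by rewrite h ?nth_cat ?hi // size_cat; lia.
rewrite -addnA h ?nth_cat ?size_cat; last lia.
by rewrite ifF; [congr nth; lia | lia].
Qed.

Lemma code_cons p i f : code_at p (i :: f) -> at_pc p = i /\ code_at p.+1 f.
Proof.
move=> h; split; first by have := h 0 isT; rewrite addn0.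
by move=> j hj; have := h j.+1 hj; rewrite addnS addSn.
Qed.

Lemma sem_inv c s : ok nc' nm c -> inv nc' s -> inv nc' (sem c s).
Proof.
elim: c s => [|o|a IHa b IHb|t a IHa b IHb|x y c IH] s //=.
- exact: inv_op.
- by move=> /andP[oa ob] hi; apply: IHb => //; exact: IHa.
- by move=> /and3P[_ oa ob] hi; case: ifP => _; [exact: IHa | exact: IHb].
move=> /and5P[hx hy _ _ /andP[_ hc]] hi.
elim: (ctr s y) => [|n IHn]; first exact: (@inv_op nc' nm (Zero x) _ hx hi).
apply: (@inv_op nc' nm (Inc x) _ hx); by apply: IH.
Qed.

Lemma sem_top c s : top s <= top (sem c s).
Proof.
elim: c s => [|o|a IHa b IHb|t a IHa b IHb|x y c IH] s //=.
- exact: top_op.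
- exact: leq_trans (IHa s) (IHb _).
- by case: ifP.
elim: (ctr s y) => [|n IHn] //=; exact: leq_trans IHn (IH _).
Qed.

Lemma exec c B p s : ok nc' nm c -> code_at p (compile c p) -> p + len c < P ->
  inv nc' s -> 0 < top s -> top (sem c s) <= B -> simu B p s (p + len c) (sem c s) (cost c B).
Proof.
elim: c p s => [|o|a IHa b IHb|t a IHa b IHb|x y c IH] p s hok hc hp hi ht hB.
- rewrite addn0; exact: simu_refl.
- have [e _] := code_cons hc.
  rewrite /= in hp hB; apply: (simu_step (B := B)) => //; rewrite ?e //; try lia.
    by rewrite ht; have := top_op o s; lia.
  by rewrite /istep e addn1.
- move: hok hc => /= /andP[oa ob] /code_cat[ca cb].
  rewrite size_compile in cb; rewrite /= in hp hB.
  apply: (@simu_trans _ (p + len a) (sem a s)).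
    by apply: IHa => //; [lia | exact: leq_trans (sem_top _ _) hB].
  rewrite addnA; apply: IHb => //; [lia | exact: sem_inv | have := sem_top a s; lia].
- move: hok hc => /= /and3P[ot oa ob].
  rewrite -cat1s => /code_cat[/code_cons[e1 _]]; rewrite [size _]/= addn1.
  move=> /code_cat[ca]; rewrite -cat1s size_compile.
  move=> /code_cat[/code_cons[e2 _]]; rewrite /=.
  have -> : p.+1 + len a + 1 = p + 2 + len a by lia.
  move=> cb; rewrite /= in hp.
  have hs : 0 < top s <= B.
    by rewrite ht /=; move: hB => /=; case: ifP => _; have := sem_top a s; have := sem_top b s; lia.
  have hplt : p < P by lia.
  move: hB => /=; case: ifP => ht' hB.
    apply: (simu_weak (n := 1 + (cost a B + 1))); first lia.
    apply: (@simu_trans _ p.+1 s).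
      by sim_step e1 => //; rewrite ht'.
    apply: (@simu_trans _ (p.+1 + len a) (sem a s)).
      by apply: IHa => //; lia.
    sim_step e2; [exact: sem_inv | have := sem_top a s; lia |].
    rewrite if_same; congr (_, _); lia.
  apply: (simu_weak (n := 1 + cost b B)); first lia.
  apply: (@simu_trans _ (p + 2 + len a) s).
    by sim_step e1 => //; rewrite ht'.
  have -> : p + (1 + (len a + (1 + len b))) = (p + 2 + len a) + len b by lia.
  by apply: IHb => //; lia.
move: hok hc => /= /and5P[hx hy hxy hxc /andP[hyc hok]].
rewrite -cat1s => /code_cat[/code_cons[e1 _]]; rewrite /= -cat1s addn1.
move=> /code_cat[/code_cons[e2 _]]; rewrite /= addn1 => /code_cat[cc].
rewrite size_compile => /code_cons[e3 /code_cons[e4 _]].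
rewrite /= in hp hB.
set body := (fun s' => _ : store) in hB *.
have hplt : p < P by lia.
have hz : inv nc' (setc s x 0) by exact: (@inv_op nc' nm (Zero x) _ hx hi).
pose st i := iter i body (setc s x 0).
have st0 : st 0 = setc s x 0 by [].
have stS i : st i.+1 = do_op (Inc x) (sem c (st i)) by [].
have sti i : inv nc' (st i).
  elim: i => // i IHi; rewrite stS; apply: (@inv_op nc' nm (Inc x) _ hx); exact: sem_inv.
have stt i j : i <= j -> top (st i) <= top (st j).
  elim: j => [|j IHj]; first by rewrite leqn0 => /eqP ->.
  rewrite leq_eqVlt => /orP[/eqP -> //|/IHj h]; apply: leq_trans h _.
  by rewrite stS /=; exact: sem_top.
have sty i : ctr (st i) y = ctr s y.
  elim: i => [|i IHi] /=; rewrite (negPf (_ : y != x)) ?(eq_sym y) //.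
  by rewrite sem_frame.
(* The increment does not saturate, because [i] is below counter [y], which never exceeds [top]. *)
have stx i : i <= ctr s y -> ctr (st i) x = i.
  elim: i => [|i IHi] hiy; first by rewrite st0 /= eqxx.
  rewrite stS /= eqxx sem_frame // IHi; last lia.
  rewrite ifT //; apply: leq_trans (sem_top _ _).
  have [h _] := sti i; have := h y hy; rewrite sty; lia.
have hyB : ctr s y <= B.
  have [h _] := sti (ctr s y); have := h y hy; rewrite sty => h'; exact: leq_trans h' hB.
have hend : p + (2 + (len c + 2)) = p + 4 + len c by lia.
(* The induction is on the number [k] of rounds that remain. *)
have loop k : k <= ctr s y ->
   simu B p.+1 (st (ctr s y - k)) (p + (2 + (len c + 2))) (st (ctr s y)) (1 + k * (cost c B + 3)).
  elim: k => [|k IHk] hk.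
    rewrite subn0 hend addn0.
    sim_step e2; [by [] | |].
      by rewrite hB andbT; apply: leq_trans ht (stt 0 _ isT).
    by rewrite /= sty stx // ltnn.
  set i := ctr s y - k.+1.
  have hi1 : i.+1 = ctr s y - k by rewrite /i; lia.
  have hsi : 0 < top (st i) <= B.
    apply/andP; split; first by apply: leq_trans ht (stt 0 _ isT).
    by apply: leq_trans (stt i (ctr s y) _) hB; rewrite /i; lia.
  have hsi' : 0 < top (sem c (st i)) <= B.
    apply/andP; split; first by have := sem_top c (st i); lia.
    by apply: leq_trans (stt i.+1 (ctr s y) _) hB; lia.
  apply: (simu_weak (n := 1 + (cost c B + (1 + (1 + (1 + k * (cost c B + 3)))))));
    first by rewrite mulSn; lia.
  apply: (@simu_trans _ p.+2 (st i)).
    sim_step e2 => //.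
    by rewrite /= sty stx ?ifT //; rewrite /i; lia.
  apply: (@simu_trans _ (p.+2 + len c) (sem c (st i))).
    by apply: IH => //; [lia | case/andP: hsi | case/andP: hsi'].
  apply: (@simu_trans _ (p.+2 + len c).+1 (st i.+1)).
    by sim_step e3 => //; exact: sem_inv.
  apply: (@simu_trans _ p.+1 (st i.+1)).
    by sim_step e4 => //; rewrite if_same.
  by rewrite hi1; apply: IHk; lia.
apply: (simu_weak (n := 1 + (1 + ctr s y * (cost c B + 3)))).
  rewrite addnA leq_add2l leq_mul2r; apply/orP; right; exact: hyB.
apply: (@simu_trans _ p.+1 (setc s x 0)).
  sim_step e1 => //.
  by rewrite ht /=; apply: leq_trans (stt 0 _ isT) hB.
by have := loop (ctr s y) (leqnn _); rewrite subnn.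
Qed.

End Exec.

Definition store0 (w : seq bool) : store :=
  Store (fun _ => 0)
    (fun m i => match m with 0 => i < size w | 1 => nth false w i | _ => false end) (size w).

Lemma inv_store0 nc' w : inv nc' (store0 w).
Proof.
split=> [//|[|[|m]] i] //=.
by case: ltnP => // h; rewrite nth_default.
Qed.

Lemma tape_store0 nc' nm w : 1 < nm -> tape nc' nm (store0 w) = map (cell0 nc' nm) w.
Proof.
move=> hm; rewrite /tape -[in RHS](mkseq_nth false w) /mkseq -map_comp.
apply/eq_in_map => i; rewrite mem_iota => /= hi.
apply: eq_from_tnth => j; rewrite !tnth_mktuple /=.
case: ltnP => hj.
  by have [-> ->] : (j == nc'.+1 :> nat) = false /\ (j == nc'.+2 :> nat) = false by lia.
have [k ->] : exists k, nat_of_ord j = nc'.+1 + k by exists (j - nc'.+1); lia.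
have -> : nc'.+1 + k - nc'.+1 = k by lia.
case: k => [|[|k]] /=.
- by rewrite addn0 eqxx hi.
- rewrite addn1 eqxx /=; suff -> : (nc'.+2 == nc'.+1) = false by []. lia.
by have [-> ->] : (nc'.+1 + k.+2 == nc'.+1) = false /\ (nc'.+1 + k.+2 == nc'.+2) = false by lia.
Qed.

Definition run_time K' B n size_w :=
  size_w.+2 * (conv_time K' size_w + 1) + (n + 1) * sweep_time K' B.

(** The appended test leaves the program either at its own length, which accepts, or one beyond,
    which rejects. Halted configurations do not move, so the actual running time may be rounded up
    to the bound. *)
Lemma decides (nc' nm : nat) (c : com) (t : test) (w : seq bool) B :
  ok nc' nm c -> ok_test nc' nm t -> 1 < nm -> w != [::] -> top (sem c (store0 w)) <= B ->
  let P := (len c).+1 in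
  decides_within (tm nc' nm (compile c 0 ++ [:: ITst t P P.+1])) w
    (run_time (nc' + nm) B (cost c B) (size w)) (do_test t (sem c (store0 w))).
Proof.
move=> hok hot hm hw hB P.
set prog := compile c 0 ++ _.
have sp : size prog = P by rewrite size_cat size_compile addn1.
have hcode : code_at prog 0 (compile c 0).
  by move=> i hi; rewrite /prog nth_cat add0n hi.
have elast : nth (IOp Grow) prog (len c) = ITst t P P.+1.
  by rewrite /prog nth_cat size_compile ltnn subnn.
have [c1 r1 a1] := @convert_input (nc' + nm) (size prog) (@prog_tr nc' nm prog)
   (prog_gr prog) (prog_nx prog) (cell0 nc' nm) w hw.
have hs0 : 0 < top (store0 w) by rewrite /=; case: (w) hw.
have hexec : simu nc' nm prog B 0 (store0 w) (len c) (sem c (store0 w)) (cost c B).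
  apply: (exec (p := 0)) => //; first by rewrite sp.
  exact: inv_store0.
rewrite -tape_store0 // in a1.
have [c2 r2 a2] := hexec c1 a1.
have hp : len c < size prog by rewrite sp.
have t0 : tape nc' nm (sem c (store0 w)) != [::].
  by rewrite -size_eq0 size_map size_iota; have := sem_top c (store0 w); lia.
have hinv : inv nc' (sem c (store0 w)) by apply: (sem_inv hok); exact: inv_store0.
have := tape_step_sim hp t0 a2.
rewrite tape_step_istep ?elast // /istep elast [fst _]/= [snd _]/=.
rewrite ifF; last by rewrite sp; case: ifP; lia.
move=> [c3 r3 e3].
have [T hT eT] : reach (@step (tm nc' nm prog)) (init (tm nc' nm prog) w) c3
    (run_time (nc' + nm) B (cost c B) (size w)).
  rewrite /run_time mulnDl mul1n.
  apply: reach_trans r1 _; apply: reach_trans r2 _; apply: reach_weak r3.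
  rewrite /sweep_time size_map size_iota leq_add2r leq_mul2l; lia.
have hstop k : iter k (@step (tm nc' nm prog)) c3 = c3.
  elim: k => //= k ->; move: e3; case: (c3) => [[[q l] x] r] /= ->.
  rewrite /step /halted /=; by case: (_ == size prog).
have hrun : run (tm nc' nm prog) (run_time (nc' + nm) B (cost c B) (size w)) w = c3.
  by rewrite /run -(subnK hT) iterD eT hstop.
have es : state_of c3 = inl (do_test t (sem c (store0 w))).
  have <- : ((if do_test t (sem c (store0 w)) then P else P.+1) == size prog) =
      do_test t (sem c (store0 w)) by rewrite sp; case: (do_test _ _); lia.
  by move: e3; case: (c3) => [[[q l] x] r] /= ->.
split; rewrite hrun es; first by rewrite /halted /=; case: (do_test _ _).
by split => [[->]|->].
Qed.

(** * First-order formulas and least fixed points *)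

(** Variables are de Bruijn indices, and an index beyond the environment denotes 0. Arithmetic
    beyond zero, order and successor has to be defined by relations. *)
Inductive fm := FZ of nat | FEq of nat & nat | FLt of nat & nat | FSuc of nat & nat
  | FRel of nat & seq nat | FAnd of fm & fm | FOr of fm & fm | FNot of fm | FEx of fm.

Definition interp := nat -> seq nat -> bool.

Section Formulas.
Variables (N : nat) (I : interp).

Fixpoint satb (e : seq nat) (f : fm) : bool :=
  match f with
  | FZ i => nth 0 e i == 0
  | FEq i j => nth 0 e i == nth 0 e j
  | FLt i j => nth 0 e i < nth 0 e j
  | FSuc i j => (nth 0 e i).+1 == nth 0 e j
  | FRel r xs => I r (map (nth 0 e) xs)
  | FAnd a b => satb e a && satb e b
  | FOr a b => satb e a || satb e b
  | FNot a => ~~ satb e a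
  | FEx a => has (fun v => satb (v :: e) a) (iota 0 N)
  end.

Fixpoint holds (e : seq nat) (f : fm) : Prop :=
  match f with
  | FZ i => nth 0 e i = 0
  | FEq i j => nth 0 e i = nth 0 e j
  | FLt i j => nth 0 e i < nth 0 e j
  | FSuc i j => (nth 0 e i).+1 = nth 0 e j
  | FRel r xs => I r (map (nth 0 e) xs)
  | FAnd a b => holds e a /\ holds e b
  | FOr a b => holds e a \/ holds e b
  | FNot a => ~ holds e a
  | FEx a => exists2 v, v < N & holds (v :: e) a
  end.

Lemma satP e f : reflect (holds e f) (satb e f).
Proof.
elim: f e => [i|i j|i j|i j|r xs|a IHa b IHb|a IHa b IHb|a IHa|a IHa] e /=; try exact: eqP; try exact: idP.
- by apply: (iffP andP) => -[/IHa ? /IHb].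
- by apply: (iffP orP) => -[/IHa|/IHb]; [left|right|left|right].
- by apply: (iffP negP) => h /IHa.
apply: (iffP hasP) => [[v]|[v hv /IHa h]].
  by rewrite mem_iota => /= hv /IHa h; exists v.
by exists v; rewrite ?mem_iota.
Qed.

End Formulas.

Lemma satb_ext N (I J : interp) e f : I =2 J -> satb N I e f = satb N J e f.
Proof.
move=> h; elim: f e => //= [a IHa b IHb|a IHa b IHb|a IHa|a IHa] e; rewrite ?IHa ?IHb //.
by apply: eq_has => v; rewrite IHa.
Qed.

Fixpoint depth (f : fm) : nat :=
  match f with
  | FAnd a b | FOr a b => maxn (depth a) (depth b)
  | FNot a => depth a
  | FEx a => (depth a).+1
  | _ => 0
  end.

Fixpoint arity (f : fm) : nat :=
  match f with
  | FAnd a b | FOr a b => maxn (arity a) (arity b)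
  | FNot a | FEx a => arity a
  | FRel _ xs => size xs
  | _ => 0
  end.

Fixpoint rels_lt (m : nat) (f : fm) : bool :=
  match f with
  | FAnd a b | FOr a b => rels_lt m a && rels_lt m b
  | FNot a | FEx a => rels_lt m a
  | FRel r _ => r < m
  | _ => true
  end.

Definition addr (N : nat) (t : seq nat) := foldl (fun a x => a * N + x) 0 t.

Lemma addr_rcons N t x : addr N (rcons t x) = addr N t * N + x.
Proof. by rewrite /addr -cats1 foldl_cat. Qed.

Lemma addr_lt N t : all (fun x => x < N) t -> addr N t < N ^ size t.
Proof.
elim/last_ind: t => // t x IH; rewrite all_rcons size_rcons addr_rcons expnSr => /andP[hx /IH h].
have : (addr N t).+1 * N <= N ^ size t * N by rewrite leq_mul2r h orbT.
by rewrite mulSn; lia.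
Qed.

Lemma addr_inj N t1 t2 : all (fun x => x < N) t1 -> all (fun x => x < N) t2 ->
  size t1 = size t2 -> addr N t1 = addr N t2 -> t1 = t2.
Proof.
elim/last_ind: t1 t2 => [|t1 x IH] t2; first by case: t2.
case/lastP: t2 => [|t2 y]; first by rewrite size_rcons.
rewrite !all_rcons !size_rcons !addr_rcons => /andP[hx h1] /andP[hy h2] [hs] e.
have e1 : addr N t1 = addr N t2.
  have N0 : 0 < N by lia.
  by have := congr1 (fun z => z %/ N) e; rewrite !divnMDl // !divn_small // !addn0.
rewrite (IH t2) //; congr (rcons _ _); move: e; rewrite e1; lia.
Qed.

Lemma for_ind (P : nat -> store -> Prop) x y c s :
  P 0 (setc s x 0) ->
  (forall i s', i < ctr s y -> P i s' -> P i.+1 (do_op (Inc x) (sem c s'))) ->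
  P (ctr s y) (sem (For x y c) s).
Proof.
move=> h0 hS /=; suff : forall n, n <= ctr s y ->
  P n (iter n (fun s' => do_op (Inc x) (sem c s')) (setc s x 0)) by apply.
by elim=> [//|n IH] hn; apply: hS => //; apply: IH; lia.
Qed.

Fixpoint pure (c : com) : bool :=
  match c with
  | Skip => true
  | Do (SetM _ _) | Do Grow => false
  | Do _ => true
  | Seq a b | If _ a b => pure a && pure b
  | For _ _ c => pure c
  end.

Lemma sem_pure c s : pure c -> memo (sem c s) = memo s /\ top (sem c s) = top s.
Proof.
elim: c s => [|o|a IHa b IHb|t a IHa b IHb|x y c IH] s //=; first by case: o.
- by move=> /andP[ha hb]; have [-> ->] := IHb (sem a s) hb; exact: IHa.
- by move=> /andP[ha hb]; case: ifP => _; [exact: IHa | exact: IHb].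
move=> hc; elim: (ctr s y) => [|n [IH1 IH2]] //=.
by have [-> ->] := IH (iter n (fun s' => setc (sem c s') x
   (if ctr (sem c s') x < top (sem c s') then (ctr (sem c s') x).+1 else ctr (sem c s') x)) (setc s x 0)) hc.
Qed.

(** * Evaluation of formulas and fixed points by counter programs *)

Section Evaluation.
Variable H : nat.

(* counters: 0 holds the universe size, 1 holds zero, 2 the number of passes of a
   stage, 3 the current pass; from 4 on, each variable comes with the accumulator
   of its quantifier; scratch counters lie beyond H *)
Notation cb := H.
Notation cad := H.+1.
Notation ctmp := H.+2.
Notation ci := H.+3.
Notation cj := H.+4.

(** A variable is addressed by the depth of its quantifier, so it keeps its counter when further
    quantifiers are entered. Indices out of range read counter 1, which holds zero. *)
Definition vc (k i : nat) := if i < k then 4 + 2 * (k.-1 - i) else 1.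

Definition one := Seq (Do (Zero cb)) (Do (Inc cb)).
Definition zero := Do (Zero cb).

Definition addr_step (v : nat) :=
  Seq (Do (Zero ctmp)) (Seq (For ci cad (For cj 0 (Do (Inc ctmp))))
   (Seq (For ci v (Do (Inc ctmp))) (Do (Copy cad ctmp)))).

Definition addr_com (k : nat) (xs : seq nat) :=
  Seq (Do (Zero cad)) (foldr (fun x c => Seq (addr_step (vc k x)) c) Skip xs).

Arguments addr_com : simpl never.

(** The truth value is left in [cb] as 0 or 1. Each quantifier needs its own accumulator, since
    evaluating its body overwrites [cb]. *)
Fixpoint ev (k : nat) (f : fm) : com :=
  match f with
  | FZ i => If (TLt 1 (vc k i)) zero one
  | FEq i j => If (TLt (vc k i) (vc k j)) zero (If (TLt (vc k j) (vc k i)) zero one)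
  | FLt i j => If (TLt (vc k i) (vc k j)) one zero
  | FSuc i j => Seq (Seq (Do (Copy ctmp (vc k i))) (Do (Inc ctmp)))
      (If (TLt ctmp (vc k j)) zero (If (TLt (vc k j) ctmp) zero one))
  | FRel r xs => Seq (addr_com k xs) (If (TMem r cad) one zero)
  | FAnd a b => Seq (ev k a) (If (TLt 1 cb) (ev k b) Skip)
  | FOr a b => Seq (ev k a) (If (TLt 1 cb) Skip (ev k b))
  | FNot a => Seq (ev k a) (If (TLt 1 cb) zero one)
  | FEx a => let x := 4 + 2 * k in
      Seq (Do (Zero x.+1)) (Seq (For x 0 (Seq (ev k.+1 a) (If (TLt 1 cb) (Do (Copy x.+1 cb)) Skip)))
        (Do (Copy cb x.+1)))
  end.

Lemma wr_addr k xs x : x \in wr (addr_com k xs) -> H <= x.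
Proof.
rewrite /addr_com /= inE => /orP[/eqP -> //|]; elim: xs => //= a xs IH.
by rewrite !inE => /or4P[/eqP->|/eqP->|/eqP->|/or4P[/eqP->|/eqP->|/eqP->|/orP[/eqP->|/IH]]]; lia.
Qed.

Lemma wr_ev k f x : x \in wr (ev k f) -> 4 + 2 * (k + depth f) <= H -> 4 + 2 * k <= x.
Proof.
elim: f k x => [i|i j|i j|i j|r xs|a IHa b IHb|a IHa b IHb|a IHa|a IHa] k x /=.
1-4: by rewrite ?inE => h hH; move: h; rewrite -?orbA; repeat case/orP; move=> /eqP ->; lia.
- move=> h; have {h} : x \in wr (addr_com k xs) ++ [:: cb; cb; cb] := h.
  rewrite mem_cat => /orP[/wr_addr|]; first lia.
  by rewrite !inE -?orbA => h hH; move: h; repeat case/orP; move=> /eqP ->; lia.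
- by rewrite !mem_cat => /orP[h|/orP[h|//]] hH; [apply: (IHa k)|apply: (IHb k)] => //; lia.
- by rewrite !mem_cat => /orP[h|h] hH; [apply: (IHa k)|apply: (IHb k)] => //; lia.
- rewrite !mem_cat => /orP[h|h] hH; first by apply: (IHa k).
  by move: h; rewrite !inE -?orbA; repeat case/orP; move=> /eqP ->; lia.
rewrite !(inE, mem_cat) -?orbA => h hH; move: h.
by repeat case/orP; move=> // h; try (move/eqP: h => ->; lia); have := IHa k.+1 x h; lia.
Qed.

Lemma pure_addr k xs : pure (addr_com k xs).
Proof. by rewrite /addr_com /=; elim: xs. Qed.

Lemma pure_ev k f : pure (ev k f).
Proof.
elim: f k => //= [r xs|a IHa b IHb|a IHa b IHb|a IHa|a IHa] k; rewrite ?IHa ?IHb //.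
by rewrite andbT; exact: pure_addr.
Qed.

Section Spec.
Variables (N kk : nat).
Hypothesis N0 : 0 < N.

(** The bound [N ^ kk <= top] lets the address of every tuple of length at most [kk] be computed
    without saturation. *)
Definition env_ok (e : seq nat) (s : store) :=
  [/\ ctr s 0 = N, ctr s 1 = 0, N ^ kk <= top s /\ N <= top s, all (fun x => x < N) e &
      forall i, i < size e -> ctr s (vc (size e) i) = nth 0 e i].

Definition interp_of (s : store) : interp := fun r t => memo s r (addr N t).

Lemma env_ok_frame e s s' : (forall x, x < 4 + 2 * size e -> ctr s' x = ctr s x) ->
  top s <= top s' -> env_ok e s -> env_ok e s'.
Proof.
move=> h ht [h0 h1 [h2 h2'] h3 h4]; split; rewrite ?h //; try lia.
by move=> i hi; rewrite h ?h4 // /vc hi; lia.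
Qed.

Lemma env_nth e s i : env_ok e s -> ctr s (vc (size e) i) = nth 0 e i.
Proof.
move=> [_ h1 _ _ h]; case: (ltnP i (size e)) => hi; first exact: h.
by rewrite /vc ltnNge hi /= h1 nth_default.
Qed.

Lemma nth_ltN e i : all (fun x => x < N) e -> nth 0 e i < N.
Proof.
move=> h; case: (ltnP i (size e)) => hi; last by rewrite nth_default.
by apply: (allP h); exact: mem_nth.
Qed.

Lemma count_loop x y s n : y != x -> ctr s y = n -> ctr s x + n <= top s ->
  forall i, i != x -> i != y ->
  let s' := sem (For i y (Do (Inc x))) s in
  [/\ ctr s' x = ctr s x + n, memo s' = memo s, top s' = top s &
      forall z, z != x -> z != i -> ctr s' z = ctr s z].
Proof.
move=> hyx hy ht i hix hiy s'.
pose P k s1 := [/\ ctr s1 x = ctr s x + k, memo s1 = memo s, top s1 = top s &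
      forall z, z != x -> z != i -> ctr s1 z = ctr s z].
suff : P (ctr s y) s' by rewrite hy.
apply: for_ind; first by split=> //= [|z _ /negPf ->//]; rewrite eq_sym (negPf hix) addn0.
move=> k s1; rewrite hy => hk [h1 h2 h3 h4]; split=> //=.
- by rewrite eqxx eq_sym (negPf hix) h1 h3 ifT; lia.
by move=> z hz hzi; rewrite (negPf hz) (negPf hzi) h4.
Qed.

Lemma addr_step_spec s v a : v < H -> 0 < H -> ctr s 0 = N -> ctr s cad = a -> a * N + ctr s v <= top s ->
  ctr (sem (addr_step v) s) cad = a * N + ctr s v.
Proof.
move=> hv hH0 h0 ha ht; rewrite /addr_step.
set s1 := sem (Do (Zero ctmp)) s.
set s2 := sem (For ci cad (For cj 0 (Do (Inc ctmp)))) s1.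
set s3 := sem (For ci v (Do (Inc ctmp))) s2.
suff h3 : ctr s3 ctmp = a * N + ctr s v by rewrite /= -/s1 -/s2 -/s3 eqxx.
have P2 : [/\ ctr s2 ctmp = a * N, memo s2 = memo s, top s2 = top s &
    forall z, z != ctmp -> z != ci -> z != cj -> ctr s2 z = ctr s z].
  pose P k s' := [/\ ctr s' ctmp = k * N, memo s' = memo s, top s' = top s &
    forall z, z != ctmp -> z != ci -> z != cj -> ctr s' z = ctr s z].
  have e1 : ctr s1 cad = a by rewrite /= ifF //; lia.
  rewrite -{1}e1 -/(P _ _); apply: for_ind.
    split=> //=; first by rewrite eqxx ifF //; lia.
    by move=> z /negPf hz /negPf hz2 _; rewrite hz hz2.
  move=> k s'; rewrite e1 => hk [q1 q2 q3 q4].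
  have e0 : ctr s' 0 = N by rewrite q4 //; lia.
  have hle : k * N + N <= a * N.
    by rewrite -mulSnr leq_mul2r hk orbT.
  have htop : ctr s' ctmp + N <= top s' by rewrite q1 q3; lia.
  have hne1 : 0 != ctmp by [].
  have hne2 : cj != ctmp by lia.
  have hne3 : cj != 0 by [].
  have [r1 r2 r3 r4] := count_loop hne1 e0 htop hne2 hne3.
  split=> /=.
  - by rewrite -[iter _ _ _]/(sem (For cj 0 (Do (Inc ctmp))) s') ifF ?r1 ?q1 ?mulSnr //; lia.
  - by rewrite -[iter _ _ _]/(sem (For cj 0 (Do (Inc ctmp))) s') r2.
  - by rewrite -[iter _ _ _]/(sem (For cj 0 (Do (Inc ctmp))) s') r3.
  move=> z hz hzi hzj; rewrite (negPf hzi).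
  by rewrite -[iter _ _ _]/(sem (For cj 0 (Do (Inc ctmp))) s') r4 ?q4.
have [q1 q2 q3 q4] := P2.
have ev : ctr s2 v = ctr s v by apply: q4; lia.
have hne1 : v != ctmp by lia.
have hne2 : ci != ctmp by lia.
have hne3 : ci != v by lia.
have htop : ctr s2 ctmp + ctr s v <= top s2 by rewrite q1 q3.
by have [r1 _ _ _] := count_loop hne1 ev htop hne2 hne3; rewrite /s3 r1 q1.
Qed.

Lemma wr_step v x : x \in wr (addr_step v) -> H < x.
Proof. by rewrite /= !inE -?orbA; repeat case/orP; move/eqP => ->; lia. Qed.

Lemma addr_com_spec e s xs : env_ok e s -> 4 + 2 * size e <= H -> size xs <= kk ->
  ctr (sem (addr_com (size e) xs) s) cad = addr N (map (nth 0 e) xs).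
Proof.
move=> he hH hxs.
suff gen : forall ys s1 m a, a < N ^ m -> env_ok e s1 -> ctr s1 cad = a -> m + size ys <= kk ->
    ctr (sem (foldr (fun x c => Seq (addr_step (vc (size e) x)) c) Skip ys) s1) cad =
    foldl (fun a x => a * N + x) a (map (nth 0 e) ys).
  rewrite /addr_com /addr; apply: (gen xs (setc s cad 0) 0 0) => //; last by rewrite /= eqxx.
  apply: env_ok_frame he => //= x hx; by rewrite ifF //; lia.
clear xs s he hxs => xs; elim: xs => [|x xs IH] s1 m a ham he ha hm //.
have he' := he; case: he' => h0 h1 [h2 h2'] h3 h4.
have hx : ctr s1 (vc (size e) x) = nth 0 e x by exact: env_nth.
have hlt := nth_ltN x h3.
have hbound : a * N + nth 0 e x < N ^ m.+1.
  have : a.+1 * N <= N ^ m * N by rewrite leq_mul2r ham orbT.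
  by rewrite expnSr mulSn; lia.
have hle : N ^ m.+1 <= N ^ kk by rewrite leq_pexp2l //=; move: hm => /=; lia.
have hv : vc (size e) x < H by rewrite /vc; case: ifP; lia.
apply: (IH (sem (addr_step (vc (size e) x)) s1) m.+1) => //; last by rewrite addSnnS.
  apply: env_ok_frame he; last by have [_ ->] := @sem_pure (addr_step (vc (size e) x)) s1 isT.
  move=> y hy; apply: sem_frame; apply/negP => /wr_step; lia.
rewrite (addr_step_spec hv _ h0 ha) ?hx //; lia.
Qed.

Lemma ctr_one s : 0 < top s -> ctr (sem one s) cb = 1.
Proof. by move=> h; rewrite /= !eqxx h. Qed.

Lemma ctr_zero s : ctr (sem zero s) cb = 0.
Proof. by rewrite /= eqxx. Qed.

Lemma ev_spec f e s : env_ok e s -> 4 + 2 * (size e + depth f) <= H -> arity f <= kk ->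
  ctr (sem (ev (size e) f) s) cb = satb N (interp_of s) e f.
Proof.
elim: f e s => [i|i j|i j|i j|r xs|a IHa b IHb|a IHa b IHb|a IHa|a IHa] e s he hH har;
  have [h0 h1 [h2 h2'] h3 h4] := he; have ht : 0 < top s by lia.
- rewrite -[sem _ _]/(if ctr s 1 < ctr s (vc (size e) i) then sem zero s else sem one s).
  rewrite (env_nth _ he) h1 /satb.
  by case: (nth 0 e i) => [|n]; rewrite ?ctr_one ?ctr_zero.
- rewrite -[sem _ _]/(if ctr s (vc (size e) i) < ctr s (vc (size e) j) then sem zero s else
     if ctr s (vc (size e) j) < ctr s (vc (size e) i) then sem zero s else sem one s).
  rewrite !(env_nth _ he) /satb; case: (ltngtP (nth 0 e i) (nth 0 e j)) => _; by rewrite ?ctr_one ?ctr_zero.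
- rewrite -[sem _ _]/(if ctr s (vc (size e) i) < ctr s (vc (size e) j) then sem one s else sem zero s).
  by rewrite !(env_nth _ he) /satb; case: ifP => _; rewrite ?ctr_one ?ctr_zero.
- set s1 := sem (Seq (Do (Copy ctmp (vc (size e) i))) (Do (Inc ctmp))) s.
  rewrite -[sem _ _]/(if ctr s1 ctmp < ctr s1 (vc (size e) j) then sem zero s1 else
     if ctr s1 (vc (size e) j) < ctr s1 ctmp then sem zero s1 else sem one s1).
  have hvj : ctr s1 (vc (size e) j) = nth 0 e j.
    rewrite -(env_nth _ he) /s1 sem_frame // !inE orbb; rewrite /vc; case: ifP; lia.
  have hvi : ctr s1 ctmp = (nth 0 e i).+1.
    rewrite /s1 /= !eqxx !(env_nth _ he) ifT //; have := nth_ltN i h3; lia.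
  have ht1 : 0 < top s1 by [].
  rewrite hvj hvi /satb; case: (ltngtP (nth 0 e i).+1 (nth 0 e j)) => _; by rewrite ?ctr_one ?ctr_zero.
- set s1 := sem (addr_com (size e) xs) s.
  have [em et] := @sem_pure _ s (pure_addr (size e) xs).
  rewrite -[sem _ _]/(if memo s1 r (ctr s1 cad) then sem one s1 else sem zero s1).
  rewrite /s1 addr_com_spec ?em //; last by move: hH => /=; lia.
  by rewrite /satb /interp_of; case: (memo s _ _); rewrite ?ctr_one ?ctr_zero // et.
- move: hH har => /= hH har.
  set s1 := sem (ev (size e) a) s.
  have e1 : ctr s1 cb = satb N (interp_of s) e a by apply: IHa => //; lia.
  have [em et] := sem_pure s (pure_ev (size e) a).
  have fr x : x < 4 + 2 * size e -> ctr s1 x = ctr s x.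
    by move=> hx; apply: sem_frame; apply/negP => /wr_ev; lia.
  have he1 : env_ok e s1 by apply: env_ok_frame he => //; rewrite /s1 et.
  rewrite fr // h1 e1; case: (satb N (interp_of s) e a) e1 => //= e1.
  rewrite IHb //; try lia.
  by congr nat_of_bool; apply: satb_ext => r t; rewrite /interp_of em.
- move: hH har => /= hH har.
  set s1 := sem (ev (size e) a) s.
  have e1 : ctr s1 cb = satb N (interp_of s) e a by apply: IHa => //; lia.
  have [em et] := sem_pure s (pure_ev (size e) a).
  have fr x : x < 4 + 2 * size e -> ctr s1 x = ctr s x.
    by move=> hx; apply: sem_frame; apply/negP => /wr_ev; lia.
  have he1 : env_ok e s1 by apply: env_ok_frame he => //; rewrite /s1 et.
  rewrite fr // h1 e1; case: (satb N (interp_of s) e a) e1 => //= e1.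
  rewrite IHb //; try lia.
  by congr nat_of_bool; apply: satb_ext => r t; rewrite /interp_of em.
- move: hH har => /= hH har.
  set s1 := sem (ev (size e) a) s.
  have e1 : ctr s1 cb = satb N (interp_of s) e a by apply: IHa => //; lia.
  have [em et] := sem_pure s (pure_ev (size e) a).
  have -> : ctr s1 1 = 0 by rewrite /s1 sem_frame //; apply/negP => /wr_ev; lia.
  rewrite e1; case: (satb N (interp_of s) e a) => /=; first by rewrite eqxx.
  by rewrite !eqxx et ht.
move: hH har => /= hH har.
set x := 4 + 2 * size e.
set body := Seq (ev (size e).+1 a) (If (TLt 1 cb) (Do (Copy x.+1 cb)) Skip).
rewrite eqxx -[iter _ _ _]/(sem (For x 0 body) (setc s x.+1 0)).
pose P n s' := [/\ ctr s' x = n, ctr s' x.+1 = has (fun v => satb N (interp_of s) (v :: e) a) (iota 0 n),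
  memo s' = memo s, top s' = top s & forall y, y < x -> ctr s' y = ctr s y].
have e0 : ctr (setc s x.+1 0) 0 = N by rewrite /= h0.
suff : P (ctr (setc s x.+1 0) 0) (sem (For x 0 body) (setc s x.+1 0)).
  by rewrite e0 => -[_ -> _ _ _].
apply: for_ind.
  split=> //=; first by rewrite eqxx.
    by rewrite ifF ?eqxx //; lia.
  by move=> y hy; rewrite !ifF //; lia.
move=> n s'; rewrite e0 => hn [p1 p2 p3 p4 p5].
have he' : env_ok (n :: e) s'.
  split=> /=; rewrite ?p5 ?p4 //; first by rewrite hn h3.
  move=> i hi; rewrite /vc hi /=; case: i hi => [|i] hi; first by rewrite subn0 -/x p1.
  have -> : size e - i.+1 = (size e).-1 - i by lia.
  have hi' : i < size e by [].
  have hlt : 4 + 2 * ((size e).-1 - i) < x by rewrite /x; lia.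
  by rewrite p5 //= -h4 // /vc hi'.
set s1 := sem (ev (size e).+1 a) s'.
have e1 : ctr s1 cb = satb N (interp_of s) (n :: e) a.
  rewrite /s1 -[(size e).+1]/(size (n :: e)) IHa //=; last lia.
  by congr nat_of_bool; apply: satb_ext => r t; rewrite /interp_of p3.
have [em et] := sem_pure s' (pure_ev (size e).+1 a).
have fr y : y < 4 + 2 * (size e).+1 -> ctr s1 y = ctr s' y.
  by move=> hy; apply: sem_frame; apply/negP => /wr_ev; lia.
have eb : sem body s' = if 0 < ctr s1 cb then setc s1 x.+1 (ctr s1 cb) else s1.
  by rewrite /= -/s1 fr // p5 // h1.
have [b1 b2] : ctr (sem body s') x.+1 = has (fun v => satb N (interp_of s) (v :: e) a) (iota 0 n.+1) /\
   forall y, y <= x -> ctr (sem body s') y = ctr s' y.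
  rewrite eb -(addn1 n) iotaD has_cat /= orbF e1; split=> [|y hy].
    case: (satb _ _ (n :: e) a); first by rewrite /= eqxx orbT.
    by rewrite orbF /= fr ?p2 // /x; lia.
  by case: (satb _ _ (n :: e) a) => /=; rewrite ?ifF ?fr //; rewrite /x; lia.
have [bm bt] : memo (sem body s') = memo s /\ top (sem body s') = top s.
  by rewrite eb; case: ifP => _ /=; rewrite /s1 em et p3 p4.
split=> //=.
- by rewrite eqxx b2 // bt p1 ifT //; lia.
- by rewrite ifF ?b1 //; lia.
by move=> y hy; rewrite ifF ?b2 ?p5 //; lia.
Qed.

Section Stage.
Variables (r k : nat) (f : fm).
Hypothesis hH : 4 + 2 * (k + depth f) <= H.
Hypothesis har : arity f <= kk.
Hypothesis hk : k <= kk.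

(** With [k - m] variables fixed, the remaining [m] are looped over; the innermost body adds the
    tuple if [f] holds of it. Additions take effect at once, within the same pass. *)
Fixpoint nest (m : nat) : com :=
  match m with
  | 0 => Seq (ev k f) (If (TLt 1 cb) (Seq (addr_com k (iota 0 k)) (Do (SetM r cad))) Skip)
  | m'.+1 => For (4 + 2 * (k - m)) 0 (nest m')
  end.

Definition stage := For 3 2 (nest k).

Definition meq (s s' : store) := forall r' i, memo s' r' i = memo s r' i.
Definition cnt (s : store) := count (memo s r) (iota 0 (top s)).
Definition valid_tuple (t : seq nat) := (size t == k) && all (fun x => x < N) t.
Definition same_others (s s' : store) := forall r' i, r' != r -> memo s' r' i = memo s r' i.

(** One application of the rule preserves [Q], from any contents of relation [r] that lie within
    [Q]. Quantifying over these contents serves for the intermediate stores of a pass and avoids a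
    syntactic positivity condition on [f]. *)
Definition rule_sound (s : store) (Q : seq nat -> Prop) :=
  forall s1, same_others s s1 -> (forall t, valid_tuple t -> interp_of s1 r t -> Q t) ->
    forall t, valid_tuple t -> satb N (interp_of s1) t f -> Q t.

(** The progress measure of a pass: either the relation grows, or nothing has changed and the store
    was closed. Closedness must also imply that nothing changes, so that it persists through later
    passes. *)
Definition advance (s s' : store) (C : store -> Prop) :=
  [/\ top s' = top s, same_others s s',
      forall Q, rule_sound s Q -> (forall t, valid_tuple t -> interp_of s r t -> Q t) ->
        forall t, valid_tuple t -> interp_of s' r t -> Q t,
      cnt s < cnt s' \/ (meq s s' /\ C s) & C s -> meq s s'].

Definition closed_at (m : nat) (e : seq nat) (s : store) :=
  forall u, size u = m -> all (fun x => x < N) u ->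
    satb N (interp_of s) (u ++ e) f -> interp_of s r (u ++ e).

Lemma meq_cnt s s' : meq s s' -> top s' = top s -> cnt s' = cnt s.
Proof. by move=> h ht; rewrite /cnt ht; apply: eq_count => i; exact: h. Qed.

Lemma closed_meq m e s s' : meq s s' -> closed_at m e s' -> closed_at m e s.
Proof.
move=> h hc u hu au hs; rewrite /interp_of -h; apply: hc => //.
by rewrite -(satb_ext _ (I := interp_of s)) // => r' t; rewrite /interp_of h.
Qed.

Lemma meq_sym s s' : meq s s' -> meq s' s.
Proof. by move=> h r' i; rewrite h. Qed.

Lemma advance_trans s1 s2 s3 C1 C2 : (forall s s', meq s s' -> C2 s' -> C2 s) ->
  advance s1 s2 C1 -> advance s2 s3 C2 -> advance s1 s3 (fun s => C1 s /\ C2 s).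
Proof.
move=> hC [t1 o1 q1 c1 d1] [t2 o2 q2 c2 d2]; split.
- by rewrite t2.
- by move=> r' i hr; rewrite o2 ?o1.
- move=> Q hQ h1; apply: q2 => //; last exact: q1.
  move=> s hs; apply: hQ => r' i hr; by rewrite hs ?o1.
- case: c1 => [lt1|[m1 cc1]].
    left; apply: leq_trans lt1 _.
    case: c2 => [/ltnW//|[m2 _]]; by rewrite (meq_cnt m2).
  case: c2 => [lt2|[m2 cc2]]; [left | right].
    by rewrite -(meq_cnt m1).
  split; last by split=> //; exact: hC m1 cc2.
  by move=> r' i; rewrite m2 m1.
move=> [cc1 cc2]; have m1 := d1 cc1.
have m2 : meq s2 s3 by apply: d2; apply: hC (meq_sym m1) cc2.
by move=> r' i; rewrite m2 m1.
Qed.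

Lemma wr_nest m x : m <= k -> x \in wr (nest m) -> 4 + 2 * (k - m) <= x.
Proof.
clear -hH.
elim: m => [|m IH] hm /=; last first.
  by rewrite inE => /orP[/eqP -> //|/IH]; lia.
rewrite -[wr _ ++ _]/(wr (ev k f) ++ (wr (addr_com k (iota 0 k)) ++ [::]) ++ [::]).
rewrite !cats0 mem_cat subn0 => /orP[/wr_ev|/wr_addr]; lia.
Qed.

Lemma map_nth_iota0 e : map (nth 0 e) (iota 0 (size e)) = e.
Proof. by rewrite -[RHS](mkseq_nth 0). Qed.

Lemma nest_spec m e s : m <= k -> size e = k - m -> env_ok e s ->
  advance s (sem (nest m) s) (closed_at m e).
Proof.
elim: m e s => [|m IH] e s hm he hs.
  have sk : size e = k by lia.
  have [h0 h1 [h2 h2'] h3 h4] := hs.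
  set s1 := sem (ev k f) s.
  have e1 : ctr s1 cb = satb N (interp_of s) e f.
    by rewrite /s1 -sk ev_spec // sk.
  have [em1 et1] := sem_pure s (pure_ev k f).
  have fr x : x < 4 + 2 * size e -> ctr s1 x = ctr s x.
    by move=> hx; apply: sem_frame; apply/negP => /wr_ev; lia.
  have hs1 : env_ok e s1 by apply: env_ok_frame hs => //; rewrite /s1 et1.
  set s2 := sem (addr_com k (iota 0 k)) s1.
  have e2 : ctr s2 cad = addr N e.
    by rewrite /s2 -sk addr_com_spec // ?size_iota ?map_nth_iota0 //; lia.
  have [em2 et2] := sem_pure s1 (pure_addr k (iota 0 k)).
  have hlt : addr N e < top s.
    have : N ^ k <= N ^ kk by rewrite leq_pexp2l.
    have := addr_lt h3; rewrite sk; lia.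
  have c0 : closed_at 0 e s <-> (satb N (interp_of s) e f -> interp_of s r e).
    by split=> [h|h u]; [apply: (h [::]) | case: u => // _ _; exact: h].
  have vale : valid_tuple e by rewrite /valid_tuple sk eqxx.
  have es : sem (nest 0) s = if 0 < ctr s1 cb then do_op (SetM r cad) s2 else s1.
    by rewrite -[sem _ _]/(if ctr s1 1 < ctr s1 cb then do_op (SetM r cad) s2 else s1) fr // h1.
  rewrite es e1; case hsat : (satb N (interp_of s) e f) => /=; last first.
    split=> //.
    - by move=> r' i _; rewrite /s1 em1.
    - by move=> Q _ hQ t hv; rewrite /interp_of /s1 em1; exact: hQ.
    - right; split; first by move=> r' i; rewrite /s1 em1.
      by apply/c0; rewrite hsat.
    by move=> _ r' i; rewrite /s1 em1.
  have em : memo s2 = memo s by rewrite /s2 em2 /s1 em1.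
  have et : top s2 = top s by rewrite /s2 et2 /s1 et1.
  split=> /=; rewrite ?em ?et //.
  - by move=> r' i /negPf hr /=; rewrite hr orbF ?em.
  - move=> Q hQ hR t hv; rewrite /interp_of /= ?em e2 eqxx /= => /orP[|/andP[/eqP ea _]]; first exact: hR.
    have -> : t = e.
      by move: hv => /andP[/eqP st at']; apply: addr_inj ea; rewrite ?sk.
    by apply: (hQ s) => // r' i.
  - case hin : (interp_of s r e).
      right; split; last by apply/c0.
      move=> r' i /=; rewrite ?em e2; case: eqP => [->|_]; last by rewrite orbF.
      by case: eqP => [->|_]; rewrite ?andbF ?orbF // /= -[memo s r _]/(interp_of s r e) hin.
    left; rewrite /cnt /= ?em ?et e2 eqxx /=.
    have hcat : iota 0 (top s) = iota 0 (addr N e) ++ addr N e :: iota (addr N e).+1 (top s - (addr N e).+1).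
      by rewrite -[_ :: _]/(iota _ (top s - (addr N e).+1).+1) -iotaD; congr iota; lia.
    rewrite hcat !count_cat /= eqxx hlt /= orbT -[memo s r (addr N e)]/(interp_of s r e) hin add0n.
    have le' a : count (memo s r) a <= count (fun i => memo s r i || (i == addr N e) && (i < top s)) a.
      by apply: sub_count => i /= ->.
    have := le' (iota 0 (addr N e)); have := le' (iota (addr N e).+1 (top s - (addr N e).+1)); lia.
  move/c0/(_ hsat) => hin r' i /=; rewrite ?em e2; case: eqP => [->|_]; last by rewrite orbF.
  by case: eqP => [->|_]; rewrite ?andbF ?orbF // /= -[memo s r _]/(interp_of s r e) hin.
set l := 4 + 2 * (k - m.+1).
have [h0 h1 [h2 h2'] h3 h4] := hs.
pose P n s' := [/\ ctr s' l = n, forall x, x < l -> ctr s' x = ctr s x &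
  advance s s' (fun s => forall v, v < n -> closed_at m (v :: e) s)].
have e0 : ctr s 0 = N by [].
suff [_ _ [t1 o1 q1 c1 d1]] : P (ctr s 0) (sem (nest m.+1) s).
  have hcl s' : closed_at m.+1 e s' <-> forall v, v < N -> closed_at m (v :: e) s'.
    split=> [h v hv u hu au|h u]; first by rewrite -cat_rcons; apply: h; rewrite ?size_rcons ?hu // all_rcons hv.
    case/lastP: u => // u v; rewrite size_rcons all_rcons cat_rcons => -[hu] /andP[hv hau].
    exact: (h v hv u).
  rewrite h0 in c1 d1; split=> //; last by move/hcl/d1.
  by case: c1 => [|[? /hcl]]; [left|right].
apply: for_ind.
  split; first by rewrite /= eqxx.
    by move=> x hx /=; rewrite ifF //; lia.
  split=> //; by right.
move=> n s'; rewrite h0 => hn [p1 p2 p3].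
have [t3 _ _ _ _] := p3.
have he' : env_ok (n :: e) s'.
  split=> /=; rewrite ?p2 ?t3 //; first by rewrite hn h3.
  move=> i hi; rewrite /vc hi /=; case: i hi => [|i] hi; first by rewrite subn0 he -/l p1.
  have hlt : 4 + 2 * (size e - i.+1) < l by rewrite /l; lia.
  have hi' : i < size e by [].
  rewrite p2 //= -h4 // /vc hi'; congr (ctr s (4 + 2 * _)); lia.
have hm' : m <= k by lia.
have hse : size (n :: e) = k - m by rewrite /=; lia.
have adv := IH (n :: e) s' hm' hse he'.
have fr x : x < l.+1 -> ctr (sem (nest m) s') x = ctr s' x.
  by move=> hx; apply: sem_frame; apply/negP => /(wr_nest hm'); rewrite /l in hx; lia.
have [t4 _ _ _ _] := adv.
split=> /=.
- by rewrite eqxx fr // t4 t3 p1 ifT //; lia.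
- by move=> x hx; rewrite ifF ?fr ?p2 //; lia.
have := advance_trans (@closed_meq m (n :: e)) p3 adv.
case=> [a1 a2 a3 a4 a5]; split=> //.
  case: a4 => [|[? [b1 b2]]]; [by left | right; split=> // v].
  by rewrite ltnS leq_eqVlt => /orP[/eqP -> //|]; exact: b1.
by move=> hv; apply: a5; split=> [v hlt|]; apply: hv; lia.
Qed.

(** A relation has only [top] positions and every pass that does not end in a closed store fills a
    new one, so [top] passes suffice. *)
Lemma stage_spec s : env_ok [::] s -> ctr s 2 = top s -> (forall t, valid_tuple t -> ~~ interp_of s r t) ->
  let s' := sem stage s in
  [/\ env_ok [::] s', ctr s' 2 = top s', top s' = top s, same_others s s' &
   (forall Q, rule_sound s Q -> forall t, valid_tuple t -> interp_of s' r t -> Q t) /\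
   (forall t, valid_tuple t -> satb N (interp_of s') t f -> interp_of s' r t)].
Proof.
move=> hs h2 hempty s'.
pose P n s1 := [/\ env_ok [::] s1, ctr s1 2 = top s1, top s1 = top s, same_others s s1 &
   (forall Q, rule_sound s Q -> forall t, valid_tuple t -> interp_of s1 r t -> Q t) /\
   (n <= cnt s1 \/ closed_at k [::] s1)].
have : P (ctr s 2) s'.
  apply: for_ind.
    split=> //.
    split; last by left.
    by move=> Q _ t /hempty /negP.
  move=> n s1 hn [a1 a2 a3 a4 [a5 a6]].
  have hk0 : size (@nil nat) = k - k by rewrite subnn.
  have [t1 o1 q1 c1 d1] := nest_spec (leqnn k) hk0 a1.
  have fr x : x < 4 -> ctr (sem (nest k) s1) x = ctr s1 x.
    by move=> hx; apply: sem_frame; apply/negP => /(wr_nest (leqnn k)); lia.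
  split=> //=.
  - by have [h0 h1 ht _ _] := a1; split=> //=; rewrite ?fr ?t1.
  - by rewrite fr // t1.
  - by rewrite t1.
  - by move=> r' i hr; rewrite o1 ?a4.
  split=> [Q hQ|].
    apply: q1; last exact: a5.
    by move=> s2 hs2; apply: hQ => r' i hr; rewrite hs2 ?a4.
  rewrite /cnt /=; set s2 := sem (nest k) s1 in c1 d1 t1 *.
  rewrite -/(cnt s2).
  case: c1 => [lt1|[m1 cl]]; last first.
    by right; apply: closed_meq cl => r' i; rewrite -m1.
  case: a6 => [hle|cl]; first by left; lia.
  have m1 := d1 cl.
  by right; apply: closed_meq cl => r' i; rewrite -m1.
move=> [a1 a2 a3 a4 [a5 a6]]; split=> //; split=> // t hv.
case: a6 => [hle _|cl hsat]; last first.
  by have := cl t; rewrite cats0; apply=> //; [case/andP: hv => /eqP | case/andP: hv].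
(* If every pass has added a position, then the relation holds everywhere, and closedness is
   trivial. *)
have hall : all (memo s' r) (iota 0 (top s')).
  rewrite all_count; apply/eqP/anti_leq; rewrite count_size size_iota /= -a2.
  by rewrite a2 -/(cnt s') a3 -h2.
have hlt : addr N t < top s'.
  have [_ _ [hN _] _ _] := a1.
  have : N ^ k <= N ^ kk by rewrite leq_pexp2l.
  by case/andP: hv => /eqP sk /addr_lt; rewrite sk; lia.
by apply: (allP hall); rewrite mem_iota.
Qed.

End Stage.

End Spec.
End Evaluation.

(** * Polynomial bounds on running times *)

Definition polyb (f : nat -> nat) := exists c, forall n, f n <= n.+2 ^ c.

Lemma polyb_le f g : (forall n, f n <= g n) -> polyb g -> polyb f.
Proof. by move=> h [c hc]; exists c => n; exact: leq_trans (h n) (hc n). Qed.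

Lemma polyb_const m : polyb (fun=> m).
Proof.
exists m => n; apply: leq_trans (ltnW (ltn_expl m (ltnSn 1))) _.
by case: m => // m; rewrite leq_exp2r.
Qed.

Lemma polyb_id : polyb id.
Proof. by exists 1 => n; rewrite expn1; lia. Qed.

Lemma polyb_add f g : polyb f -> polyb g -> polyb (fun n => f n + g n).
Proof.
move=> [c1 h1] [c2 h2]; exists (c1 + c2).+1 => n.
have : n.+2 ^ c1 <= n.+2 ^ (c1 + c2) by rewrite leq_pexp2l // leq_addr.
have : n.+2 ^ c2 <= n.+2 ^ (c1 + c2) by rewrite leq_pexp2l // leq_addl.
have := h1 n; have := h2 n; rewrite expnS; nia.
Qed.

Lemma polyb_mul f g : polyb f -> polyb g -> polyb (fun n => f n * g n).
Proof.
move=> [c1 h1] [c2 h2]; exists (c1 + c2) => n.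
by rewrite expnD; apply: leq_mul.
Qed.

Lemma polyb_exp f k : polyb f -> polyb (fun n => f n ^ k).
Proof.
move=> hf; elim: k => [|k IH]; first exact: polyb_const.
by apply: polyb_le (polyb_mul hf IH) => n; rewrite expnS.
Qed.

Lemma polyb_cost c B : polyb B -> polyb (fun n => cost c (B n)).
Proof.
move=> hB; elim: c => [|o|a IHa b IHb|t a IHa b IHb|x y c IH]; try exact: polyb_const.
- exact: polyb_add.
- exact: (polyb_add (polyb_const 2) (polyb_add IHa IHb)).
exact: (polyb_add (polyb_const 2) (polyb_mul hB (polyb_add IH (polyb_const 3)))).
Qed.

Lemma polyb_run_time K' B n : polyb B -> polyb n -> polyb (fun m => run_time K' (B m) (n m) m).
Proof.
move=> hB hn; rewrite /run_time /conv_time /sweep_time.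
have hS f : polyb f -> polyb (fun m => (f m).+1).
  by move=> hf; apply: polyb_le (polyb_add hf (polyb_const 1)) => m; rewrite addn1.
have hc := polyb_const; have hid := polyb_id.
have hS1 := hS id hid; have hSB := hS B hB; have hS2 := hS _ hS1; have hSB2 := hS _ hSB.
apply: polyb_add; apply: polyb_mul; repeat first
  [exact: hc | exact: hid | exact: hB | exact: hn | exact: hS1 | exact: hS2 | exact: hSB2 | apply: polyb_add | apply: polyb_mul].
Qed.

Lemma decides_mono (M : TM) w t t' Q : t <= t' -> decides_within M w t Q -> decides_within M w t' Q.
Proof.
move=> ht; have -> : t' = (t' - t) + t by lia.
rewrite /decides_within /run iterD -/(run M t w) => -[h1 h2].
suff -> : iter (t' - t) (@step M) (run M t w) = run M t w by [].
elim: (t' - t) => //= k ->; case: (run M t w) h1 => [[[q l] x] r] /= hq.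
by rewrite hq.
Qed.

Lemma satb_local N (I J : interp) m e f : rels_lt m f -> (forall r, r < m -> I r =1 J r) ->
  satb N I e f = satb N J e f.
Proof.
move=> + h; elim: f e => //= [r xs e hr|a IHa b IHb e|a IHa b IHb e|a IHa e|a IHa e].
- by rewrite h.
- by move=> /andP[ha hb]; rewrite IHa ?IHb.
- by move=> /andP[ha hb]; rewrite IHa ?IHb.
- by move=> ha; rewrite IHa.
by move=> ha; apply: eq_has => v; rewrite IHa.
Qed.

Definition tuple_in (N k : nat) (t : seq nat) := (size t == k) && all (fun x => x < N) t.

(* [I r] is the least relation closed under [f], given the relations below [r] *)
Definition stage_lfp (N : nat) (I : interp) (r k : nat) (f : fm) :=
  (forall t, tuple_in N k t -> holds N I t f -> I r t) /\
  (forall Q : seq nat -> Prop,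
     (forall J : interp, (forall r', r' < r -> J r' =1 I r') ->
        (forall t, tuple_in N k t -> J r t -> Q t) ->
        forall t, tuple_in N k t -> holds N J t f -> Q t) ->
     forall t, tuple_in N k t -> I r t -> Q t).

Fixpoint stages_lfp (N : nat) (I : interp) (r : nat) (st : seq (nat * fm)) : Prop :=
  match st with
  | [::] => True
  | (k, f) :: st' => stage_lfp N I r k f /\ stages_lfp N I r.+1 st'
  end.

Fixpoint stages_wf (r : nat) (st : seq (nat * fm)) : bool :=
  match st with
  | [::] => true
  | (_, f) :: st' => rels_lt r.+1 f && stages_wf r.+1 st'
  end.

Fixpoint stages_com (H r : nat) (st : seq (nat * fm)) : com :=
  match st with
  | [::] => Skip
  | (k, f) :: st' => Seq (stage H r k f) (stages_com H r.+1 st')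
  end.

(** Nested loops that lengthen the tape by [N ^ j] cells, to make room for the addresses of
    tuples. *)
Fixpoint power_com (j : nat) : com :=
  if j is j'.+1 then For (4 + 2 * j') 0 (power_com j') else Do Grow.

Lemma wr_power j x : x \in wr (power_com j) -> 4 <= x < 4 + 2 * j.
Proof. by elim: j => //= j IH; rewrite inE => /orP[/eqP ->|/IH]; lia. Qed.

Lemma power_spec j s N : ctr s 0 = N ->
  let s' := sem (power_com j) s in top s' = top s + N ^ j /\ memo s' = memo s.
Proof.
elim: j s => [|j IH] s hN s'; first by rewrite /s' /= addn1.
pose P n s1 := [/\ ctr s1 0 = N, top s1 = top s + n * N ^ j & memo s1 = memo s].
suff : P (ctr s 0) s' by rewrite hN expnS => -[_ -> ->].
apply: for_ind; first by split; rewrite //= addn0.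
move=> n s1 _ [h1 h2 h3]; have [t1 m1] := IH s1 h1.
split; rewrite /= ?m1 //; last by rewrite t1 h2 mulSnr addnA.
by rewrite sem_frame //; apply/negP => /wr_power; lia.
Qed.

Section Program.
Variables (st : seq (nat * fm)) (acc : fm).

(** Sums over the stages, rather than maxima, dominate the needs of each single stage and pass
    easily to a suffix of the list. *)
Definition max_arity := (arity acc + \sum_(p <- st) (p.1 + arity p.2)).+1.
Definition scratch := 4 + 2 * (max_arity + (depth acc + \sum_(p <- st) (p.1 + depth p.2))).
Local Notation kk := max_arity.
Local Notation H := scratch.

Definition program : com :=
  Seq (Do (Fill 0)) (Seq (power_com kk) (Seq (Do (Fill 2))
    (Seq (stages_com H 2 st) (ev H 0 acc)))).

Local Notation nm := (2 + size st).
Local Notation nc' := (H + 4).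

Lemma ok_addr k xs : 4 + 2 * k <= H -> ok nc' nm (addr_com H k xs).
Proof.
move=> hk; apply/andP; split; first by rewrite /=; lia.
elim: xs => // x xs IH; apply/andP; split; last exact: IH.
have hv : vc k x < H by rewrite /vc; case: ifP; lia.
by rewrite /addr_step /= !inE; lia.
Qed.

Lemma ok_ev f k : 4 + 2 * (k + depth f) <= H -> rels_lt nm f -> ok nc' nm (ev H k f).
Proof.
have hv k' i : 4 + 2 * k' <= H -> vc k' i < H by rewrite /vc; case: ifP; lia.
have h0 : 4 <= H by rewrite /scratch; lia.
elim: f k => [i|i j|i j|i j|r xs|a IHa b IHb|a IHa b IHb|a IHa|a IHa] k hk hr.
1-4: rewrite /= addn0 in hk; have := hv k i hk; try (have := hv k j hk); rewrite /=; lia.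
- rewrite /= addn0 in hk; apply/andP; split; first exact: ok_addr.
  by move: hr; rewrite /=; lia.
- move: hk hr => /= hk /andP[ra rb]; rewrite IHa ?IHb //=; lia.
- move: hk hr => /= hk /andP[ra rb]; rewrite IHa ?IHb //=; lia.
- move: hk hr => /= hk ra; rewrite IHa //=; lia.
move: hk hr => /= hk ra; rewrite IHa //=; last lia.
have w x : x < 4 + 2 * k.+1 -> x \notin wr (ev H k.+1 a).
  by move=> hx; apply/negP => /wr_ev; lia.
rewrite !mem_cat !negb_or !w ?inE; lia.
Qed.

Lemma ok_stage r k f : r < nm -> 4 + 2 * (k + depth f) <= H -> rels_lt nm f ->
  ok nc' nm (stage H r k f).
Proof.
move=> hr hk hf.
have hn m : m <= k -> ok nc' nm (nest H r k f m).
  elim: m => [|m IH] hm.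
    have ho : ok nc' nm (addr_com H k (iota 0 k)) by apply: ok_addr; lia.
    by rewrite -[ok _ _ _]/(ok nc' nm (ev H k f) && ((1 < nc'.+1) && (H < nc'.+1) &&
      ((ok nc' nm (addr_com H k (iota 0 k)) && ((r < nm) && (H.+1 < nc'.+1))) && true))) ok_ev // ho; lia.
  have w x : x <= 4 + 2 * (k - m.+1) -> x \notin wr (nest H r k f m).
    by move=> hx; apply/negP => /(wr_nest hk); lia.
  rewrite -[ok _ _ _]/[&& 4 + 2 * (k - m.+1) < nc'.+1, 0 < nc'.+1, 4 + 2 * (k - m.+1) != 0,
     4 + 2 * (k - m.+1) \notin wr (nest H r k f m), 0 \notin wr (nest H r k f m) & ok nc' nm (nest H r k f m)].
  rewrite !w ?IH //; lia.
have w x : x < 4 -> x \notin wr (nest H r k f k).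
  by move=> hx; apply/negP => /(wr_nest hk); lia.
rewrite -[ok _ _ _]/[&& 3 < nc'.+1, 2 < nc'.+1, 3 != 2,
     3 \notin wr (nest H r k f k), 2 \notin wr (nest H r k f k) & ok nc' nm (nest H r k f k)].
rewrite !w ?hn //; lia.
Qed.

Lemma ok_power j : j <= kk -> ok nc' nm (power_com j).
Proof.
elim: j => //= j IH hj.
have w x : x < 4 \/ x = 4 + 2 * j -> x \notin wr (power_com j).
  by move=> hx; apply/negP => /wr_power; lia.
rewrite !w ?IH; try lia; rewrite /scratch; lia.
Qed.

Lemma rels_lt_weak m m' f : m <= m' -> rels_lt m f -> rels_lt m' f.
Proof.
move=> hm; elim: f => //= [r _ h|a IHa b IHb|a IHa b IHb]; first lia.
  by move=> /andP[/IHa -> /IHb ->].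
by move=> /andP[/IHa -> /IHb ->].
Qed.

Definition fits (H k : nat) (p : nat * fm) :=
  (4 + 2 * (p.1 + depth p.2) <= H) && (arity p.2 <= k) && (p.1 <= k).

Lemma all_fits : all (fits H kk) st.
Proof.
suff h st' : \sum_(p <- st') (p.1 + arity p.2) <= \sum_(p <- st) (p.1 + arity p.2) ->
    \sum_(p <- st') (p.1 + depth p.2) <= \sum_(p <- st) (p.1 + depth p.2) -> all (fits H kk) st'.
  exact: h.
elim: st' => [//|p st' IH]; rewrite !big_cons => h1 h2; apply/andP; split; last by apply: IH; lia.
by rewrite /fits /scratch /max_arity; lia.
Qed.

Lemma ok_stages st' r : all (fits H kk) st' -> r + size st' <= nm -> stages_wf r st' ->
  ok nc' nm (stages_com H r st').
Proof.
elim: st' r => //= -[k f] st' IH r /andP[/andP[/andP[h1 h2] h3] hall] hr /andP[hw1 hw2].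
apply/andP; split; last by apply: IH => //; lia.
by apply: ok_stage => //; [lia | apply: rels_lt_weak hw1; lia].
Qed.

Lemma holds_local N (I J : interp) m e f : rels_lt m f -> (forall r, r < m -> I r =1 J r) ->
  holds N I e f <-> holds N J e f.
Proof.
by move=> h1 h2; split=> /satP h; apply/satP; [rewrite -(satb_local _ _ h1 h2) | rewrite (satb_local _ _ h1 h2)].
Qed.

Lemma stages_spec N st' r s : 0 < N -> all (fits H kk) st' -> stages_wf r st' ->
  env_ok N kk [::] s -> ctr s 2 = top s -> (forall r' i, r <= r' -> ~~ memo s r' i) ->
  let s' := sem (stages_com H r st') s in
  [/\ env_ok N kk [::] s', top s' = top s, (forall r' i, r' < r -> memo s' r' i = memo s r' i) &
      stages_lfp N (interp_of N s') r st'].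
Proof.
move=> N0; elim: st' r s => [|[k f] st' IH] r s //=.
move=> /andP[/andP[/andP[h1 h2] h3] hall] /andP[w1 w2] hs ht hm.
have hempty t : valid_tuple N k t -> ~~ interp_of N s r t by move=> _; exact: hm.
have [a1 a2 a3 a4 [a5 a6]] := @stage_spec H N kk N0 r k f h1 h2 h3 s hs ht hempty.
set s1 := sem (stage H r k f) s in a1 a2 a3 a4 a5 a6 *.
have hm1 r' i : r < r' -> ~~ memo s1 r' i by move=> hr; rewrite a4 ?hm //; lia.
have [b1 b2 b3 b4] := IH r.+1 s1 hall w2 a1 a2 hm1.
split=> //; [by rewrite b2 a3 | by move=> r' i hr; rewrite b3 ?a4 //; lia | split=> //].
set s2 := sem _ s1 in b1 b2 b3 b4 *.
have eI r' : r' < r.+1 -> interp_of N s2 r' =1 interp_of N s1 r'.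
  by move=> hr t; rewrite /interp_of b3.
split=> [t hv /(holds_local _ _ w1 eI)/satP hh|Q hQ t hv]; first by rewrite eI //; apply: a6.
rewrite eI //; apply: a5 => // s3 hs3 hR t' hv' hsat.
apply: (hQ (interp_of N s3)) => //; last exact/satP.
by move=> r' hr t''; rewrite eI /interp_of ?hs3 ?a4 //; lia.
Qed.

Hypothesis st_wf : stages_wf 2 st.
Hypothesis acc_wf : rels_lt nm acc.

Lemma ok_program : ok nc' nm program.
Proof.
rewrite -[ok _ _ _]/[&& 0 < nc'.+1, ok nc' nm (power_com kk), 2 < nc'.+1,
  ok nc' nm (stages_com H 2 st) & ok nc' nm (ev H 0 acc)].
rewrite ok_power // ok_stages ?all_fits // ok_ev //; last by rewrite /scratch; lia.
Qed.

Lemma program_spec w : w != [::] -> let N := size w in let s := sem program (store0 w) in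
  [/\ top s = N + N ^ kk,
      (forall x, interp_of N s 0 [:: x] = (x < N)) /\ (forall x, interp_of N s 1 [:: x] = nth false w x),
      stages_lfp N (interp_of N s) 2 st &
      do_test (TLt 1 H) s <-> holds N (interp_of N s) [::] acc].
Proof.
move=> hw N s.
have N0 : 0 < N by rewrite /N; case: (w) hw.
set s1 := do_op (Fill 0) (store0 w).
have [t2 m2] := @power_spec kk s1 N erefl.
set s2 := sem (power_com kk) s1 in t2 m2.
set s3 := do_op (Fill 2) s2.
have h0 x : x < 4 -> ctr s2 x = ctr s1 x.
  by move=> hx; apply: sem_frame; apply/negP => /wr_power; lia.
have he : env_ok N kk [::] s3.
  split=> //=; rewrite ?h0 // t2 /=; split; rewrite -/N; lia.
have hm r' i : 2 <= r' -> ~~ memo s3 r' i by rewrite /= m2; case: r' => [|[|r']].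
have [b1 b2 b3 b4] := stages_spec N0 all_fits st_wf he erefl hm.
set s4 := sem (stages_com H 2 st) s3 in b1 b2 b3 b4.
have es : s = sem (ev H 0 acc) s4 by [].
have [em et] := sem_pure s4 (pure_ev H 0 acc).
have eI : interp_of N s = interp_of N s4 by rewrite /interp_of es em.
have hH : 4 + 2 * (size (@nil nat) + depth acc) <= H by rewrite /scratch /=; lia.
have har : arity acc <= kk by rewrite /max_arity; lia.
split.
- by rewrite es et b2 /= t2.
- by split=> x; rewrite eI /interp_of b3 //= m2 /addr /= mul0n add0n.
- by rewrite eI.
rewrite eI /= es -[ev H 0 acc]/(ev H (size (@nil nat)) acc) (ev_spec N0 b1 hH har).
have -> : ctr (sem (ev H (size (@nil nat)) acc) s4) 1 = 0.
  rewrite sem_frame; first by have [_ -> _ _ _] := b1.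
  by apply/negP => /wr_ev; lia.
by split=> [h|/satP -> //]; apply/satP; case: (satb _ _ _ _) h.
Qed.

(** The bridge between machines and logic: from here on only the interpretation [I] is studied. The
    machine and the exponent depend on the formulas alone, not on the word. *)
Theorem fo_decides : exists (M : TM) (c : nat), forall w : seq bool, w != [::] ->
  exists I : interp,
    [/\ forall x, I 0 [:: x] = (x < size w),
        forall x, I 1 [:: x] = nth false w x,
        stages_lfp (size w) I 2 st &
        decides_within M w ((size w).+2 ^ c) (holds (size w) I [::] acc)].
Proof.
pose B n := n + n ^ kk.
have hB : polyb B by apply: polyb_add; [exact: polyb_id | apply: polyb_exp; exact: polyb_id].
have [c hc] := polyb_run_time (nc' + nm) hB (polyb_cost program hB).
exists (tm nc' nm (compile program 0 ++ [:: ITst (TLt 1 H) (len program).+1 (len program).+2])), c => w hw.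
have [p1 [p2 p2'] p3 p4] := program_spec hw.
exists (interp_of (size w) (sem program (store0 w))); split=> //.
have hot : ok_test nc' nm (TLt 1 H) by rewrite /=; lia.
have hB' : top (sem program (store0 w)) <= B (size w) by rewrite p1.
have hd := decides ok_program hot isT hw hB'.
have [d1 d2] := decides_mono (hc (size w)) hd.
by split=> //; rewrite d2.
Qed.

End Program.

(** * Rings of a cactus *)

Section Rings.
Variables (n : nat) (A : arcs n).
Local Notation V := 'I_n.
Local Notation g := (uadj A).

Lemma g_sym : symmetric g.
Proof. by move=> x y; rewrite /uadj orbC. Qed.

Definition gminus (s : seq V) : rel V := fun x y => g x y && ((x, y) \notin cycle_edges s).

Lemma cycle_edgesE (s : seq V) x y :
  ((x, y) \in cycle_edges s) = [&& x \in s, y \in s & (next s x == y) || (next s y == x)].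
Proof. by rewrite inE. Qed.

Lemma gminus_sym s : symmetric (gminus s).
Proof.
move=> x y; rewrite /gminus g_sym !cycle_edgesE; congr (_ && ~~ _).
by rewrite andbCA orbC.
Qed.

(* a simple cycle, or a bridge taken as a cycle of length two *)
Definition ring (s : seq V) : Prop :=
  [/\ 2 <= size s, uniq s, cycle g s &
      forall x y, x \in s -> y \in s -> connect (gminus s) x y -> x = y].

Lemma next_last (x : V) s : uniq (x :: s) -> next (x :: s) (last x s) = x.
Proof.
move=> u; rewrite next_nth mem_last (last_nth x) index_uniq //=.
by rewrite nth_default.
Qed.

Hypothesis cact : cactus A.

(** An ear between two vertices [x] and [y] of a simple cycle closes one of its two sides to a
    second simple cycle. Both cycles contain [x] and [y] but their edge sets differ, which a cactus
    excludes. *)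
Lemma no_ear (x y : V) (l1 l2 p : seq V) : simple_cycle A (x :: l1 ++ y :: l2) ->
  path (gminus (x :: l1 ++ y :: l2)) x (rcons p y) ->
  uniq p -> {in p, forall z, z \notin x :: l1 ++ y :: l2} -> False.
Proof.
set s := x :: l1 ++ y :: l2 => hs hp up hps.
have xs : x \in s by rewrite inE eqxx.
have ys : y \in s by rewrite inE mem_cat inE eqxx !orbT.
have [_ us cs] := and3P hs.
have gp : path g x (rcons p y) by apply: sub_path hp => a b /andP[].
have hxy : x != y.
  by move: us; rewrite /s /= mem_cat inE !negb_or => /andP[/and3P[]].
pose s2 := x :: l1 ++ y :: rev p.
have u2 : uniq s2.
  rewrite /s2 -cat_rcons -cat_cons cat_uniq rev_uniq up andbT.
  have u1 : uniq (x :: rcons l1 y).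
    by move: us; rewrite /s -cat_rcons -cat_cons cat_uniq => /andP[].
  rewrite u1 /=; apply/hasPn => z; rewrite mem_rev => /hps.
  by rewrite /s -cat_rcons -cat_cons mem_cat => /norP[].
have c2 : cycle g s2.
  rewrite /s2 /= rcons_cat cat_path /=.
  move: cs; rewrite /s /= rcons_cat cat_path /= => /and3P[-> -> _] /=.
  have := gp; rewrite -rev_path last_rcons belast_rcons rev_cons.
  by rewrite (eq_path (e' := g)) // => a b; exact: g_sym.
have hlast : last x (l1 ++ y :: rev p) = (if p is z :: _ then z else y).
  by rewrite last_cat /=; case: (p) => //= z p'; rewrite rev_cons last_rcons.
(* The last edge of the new cycle separates the two edge sets: it belongs to the ear. *)
have e2 : (last x (l1 ++ y :: rev p), x) \in cycle_edges s2.
  by rewrite cycle_edgesE mem_last inE eqxx next_last // eqxx.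
have e1 : (last x (l1 ++ y :: rev p), x) \notin cycle_edges s.
  rewrite hlast; case: (p) hp hps => [|z p'] hp hps.
    by move: hp; rewrite /= andbT /gminus !cycle_edgesE andbCA orbC => /andP[].
  by rewrite cycle_edgesE negb_and hps ?inE ?eqxx.
have sz2 : 3 <= size s2.
  have hne : l1 = [::] -> p = [::] -> False.
    move=> el ep; move/negP: e1; apply; rewrite ep /= el cycle_edgesE xs ys /=.
    by apply/orP; right; rewrite /s el /next /= !eqxx.
  rewrite /s2 /= size_cat /= size_rev.
  by case: (l1) (p) hne => [|? ?] [|? ?] //= h; rewrite ?addnS ?addSn //; case: h.
have hs2 : simple_cycle A s2 by apply/and3P.
have [_ hc] := cact.
have := hc s s2 hs hs2.
have -> : cycle_edges s != cycle_edges s2.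
  by apply/eqP => e; move: e1; rewrite e e2.
move=> /(_ isT); apply/negP; rewrite -ltnNge.
have : [set x; y] \subset [set z | (z \in s) && (z \in s2)].
  apply/subsetP => z; rewrite !inE => /orP[/eqP->|/eqP->]; rewrite ?eqxx ?mem_cat ?inE ?eqxx ?orbT //.
by move/subset_leq_card; rewrite cards2 hxy.
Qed.

Lemma cycle_edges_rot k (s : seq V) : uniq s -> cycle_edges (rot k s) = cycle_edges s.
Proof.
move=> us; apply/setP => -[x y]; rewrite !cycle_edgesE !mem_rot.
by rewrite !next_rot.
Qed.

(** A simple path between two cycle vertices that avoids the cycle edges, cut at its first return to
    the cycle, is an ear. *)
Lemma simple_cycle_ring (s : seq V) : simple_cycle A s -> ring s.
Proof.
move=> hs; have [h3 us cs] := and3P hs; split=> //; first by lia.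
move=> x y xs ys; case/connectP => p hp ey.
apply/eqP; case: (eqVneq x y) => // hxy.
case/shortenP: hp ey => p1 hp1 up1 _ ey {p}.
have hy : has (fun z => z \in s) p1.
  apply/hasP; exists y => //; move: hxy; rewrite ey; case/lastP: (p1) => [|p2 z]; rewrite ?eqxx //.
  by rewrite last_rcons mem_rcons inE eqxx.
have := hy; rewrite has_find => hf.
pose p := take (find (fun z => z \in s) p1) p1.
pose w := nth x p1 (find (fun z => z \in s) p1).
have ws : w \in s by exact: nth_find.
have ep : p1 = rcons p w ++ drop (find (fun z => z \in s) p1).+1 p1.
  by rewrite cat_rcons -drop_nth // cat_take_drop.
have pns : {in p, forall z, z \notin s}.
  move=> z; rewrite /p => /(nthP x)[i]; rewrite size_take hf => hi <-.
  by rewrite nth_take // (before_find x hi).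
have hpw : path (gminus s) x (rcons p w) by move: hp1; rewrite ep cat_path => /andP[].
have [upw xw] : uniq p /\ x != w.
  move: up1; rewrite ep -cat_cons cat_uniq /= rcons_uniq mem_rcons inE negb_or.
  by move=> /and3P[/andP[/andP[? _] /andP[_ ?]] _ _].
have [i s' ei] := rot_to xs.
have ws' : w \in s'.
  have : w \in x :: s' by rewrite -ei mem_rot.
  by rewrite inE eq_sym (negPf xw).
case/splitPr: ws' ei => l1 l2 ei.
have hs' : simple_cycle A (x :: l1 ++ w :: l2).
  by rewrite -ei /simple_cycle size_rot rot_uniq rot_cycle.
case: (no_ear (p := p) hs') => //.
  by apply: sub_path hpw => a b; rewrite /gminus -ei cycle_edges_rot.
by move=> z /pns; rewrite -ei mem_rot.
Qed.

Lemma bridge_ring (p q : V) : p != q -> g p q -> ~~ connect (gminus [:: p; q]) p q -> ring [:: p; q].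
Proof.
move=> hpq gpq hc; split=> //=.
- by rewrite inE hpq.
- by rewrite gpq g_sym gpq.
have hc' : ~~ connect (gminus [:: p; q]) q p.
  by rewrite (sym_connect_sym (@gminus_sym _)).
move=> x y; rewrite !inE => /orP[/eqP->|/eqP->] /orP[/eqP->|/eqP->] //.
  by rewrite (negPf hc).
by rewrite (negPf hc').
Qed.

Hypothesis noloop : loopless A.

Lemma g_irr x : g x x = false.
Proof. by rewrite /uadj orbb (negPf (noloop x)). Qed.

(** If the ends of an edge stay connected after its removal, a simple path between them closes to a
    cycle; otherwise the edge is a bridge. *)
Lemma ring_exists (p q : V) : g p q -> exists s, ring (p :: q :: s).
Proof.
move=> gpq.
have hpq : p != q by apply/eqP => e; move: gpq; rewrite e g_irr.
case: (boolP (connect (gminus [:: p; q]) p q)) => [|hc]; last by exists [::]; exact: bridge_ring.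
rewrite (sym_connect_sym (@gminus_sym _)) => /connectP[r hr er].
case/shortenP: hr er => r1 hr1 ur1 _ er.
case/lastP: r1 hr1 ur1 er => [|r2 z] hr1 ur1 er; first by rewrite /= er eqxx in hpq.
rewrite last_rcons in er; rewrite -er in hr1 ur1.
exists r2; apply: simple_cycle_ring; apply/and3P; split.
- case: r2 hr1 {ur1} => //=; rewrite andbT /gminus cycle_edgesE !inE !eqxx orbT /next /=.
  by rewrite (eq_sym q p) (negPf hpq) !eqxx andbF.
- by move: ur1; rewrite -rcons_cons rcons_uniq => /andP[/= -> ->].
by rewrite /= gpq /=; apply: sub_path hr1 => a b /andP[].
Qed.

Definition conn (v : V) : rel V := connect (fun a b => [&& g a b, a != v & b != v]).

Lemma conn_sym v : symmetric (conn v).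
Proof. by apply: sym_connect_sym => x y; rewrite g_sym (andbC (x != v)). Qed.

Lemma conn_trans v : transitive (conn v).
Proof. exact: connect_trans. Qed.

Lemma conn_refl v x : conn v x x.
Proof. exact: connect0. Qed.

Lemma conn_step v x y : g x y -> x != v -> y != v -> conn v x y.
Proof. by move=> h1 h2 h3; apply: connect1; rewrite h1 h2. Qed.

Lemma conn_self v x : conn v v x -> x = v.
Proof. by case/connectP => -[|y p] /=; [move=> _ -> | rewrite eqxx andbF]. Qed.

Lemma connect_ind (e : rel V) (P : V -> Prop) x y :
  P x -> (forall a b, P a -> e a b -> P b) -> connect e x y -> P y.
Proof.
move=> hx hs /connectP[p hp ->]; elim: p x hx hp => //= z p IH x hx /andP[hxz hp].
by apply: IH hp; apply: hs hxz.
Qed.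

Section Ring.
Variables (s : seq V) (x0 : V).
Hypothesis ringS : ring s.
Local Notation m := (size s).
(** Positions are taken modulo the ring length, so that going around needs no case distinction. *)
Definition rc (i : nat) : V := nth x0 s (i %% m).
Local Notation c := rc.

Lemma ring_size : 2 <= m. Proof. by case: ringS. Qed.
Lemma ring_uniq : uniq s. Proof. by case: ringS. Qed.
Lemma m_gt0 : 0 < m. Proof. by have := ring_size; lia. Qed.

Lemma rc_mem i : c i \in s.
Proof. by apply: mem_nth; rewrite ltn_mod m_gt0. Qed.

Lemma rc_surj x : x \in s -> exists2 i, i < m & x = c i.
Proof.
move=> hx; exists (index x s); first by rewrite index_mem.
by rewrite /rc modn_small ?index_mem // nth_index.
Qed.

Lemma rc_eq i j : (c i == c j) = (i == j %[mod m]).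
Proof. by rewrite /rc nth_uniq ?ltn_mod ?m_gt0 // ring_uniq. Qed.

Lemma rc_inj i j : i < m -> j < m -> c i = c j -> i = j.
Proof. by move=> hi hj /eqP; rewrite rc_eq !modn_small // => /eqP. Qed.

Lemma rc_mod i : c (i %% m) = c i.
Proof. by rewrite /rc modn_mod. Qed.

Lemma rc_addm i : c (i + m) = c i.
Proof. by rewrite /rc modnDr. Qed.

Lemma rc_next i : next s (c i) = c i.+1.
Proof.
have hi : i %% m < m by rewrite ltn_mod m_gt0.
rewrite -[c i.+1]rc_mod -addn1 -modnDml addn1 rc_mod -(rc_mod i).
move: (i %% m) hi => {}i hi.
rewrite next_nth rc_mem /rc (modn_small hi).
have us := ring_uniq; case: (s) hi us => // y s' hi us.
rewrite index_uniq //; case: (ltnP i.+1 (size (y :: s'))) => h.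
  by rewrite modn_small //=; apply: set_nth_default.
have -> : i = size s' by move: hi h => /=; lia.
by rewrite nth_default // modnn.
Qed.

Lemma rc_adj i : g (c i) (c i.+1).
Proof. by rewrite -rc_next; case: ringS => _ _ /next_cycle h _; apply: h; exact: rc_mem. Qed.

Lemma rc_edge i : (c i, c i.+1) \in cycle_edges s.
Proof. by rewrite cycle_edgesE !rc_mem rc_next eqxx. Qed.

Lemma ring_edgeP x y : (x, y) \in cycle_edges s ->
  exists2 i, i < m & (x = c i /\ y = c i.+1) \/ (y = c i /\ x = c i.+1).
Proof.
rewrite cycle_edgesE => /and3P[/rc_surj[i hi ex] /rc_surj[j hj ey]].
rewrite ex ey !rc_next => /orP[] /eqP <-; first by exists i => //; left.
by exists j => //; right.
Qed.

Lemma ring_edge_mem x y : (x, y) \in cycle_edges s -> x \in s /\ y \in s.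
Proof. by rewrite cycle_edgesE => /and3P[]. Qed.

(** What hangs at position [i]: the component of [c i] once the ring edges are removed. *)
Definition region (i : nat) : {set V} := [set x | connect (gminus s) (c i) x].
Local Notation X := region.

Lemma region_root i : c i \in X i.
Proof. by rewrite inE connect0. Qed.

Lemma region_mod i : X (i %% m) = X i.
Proof. by apply/setP => x; rewrite !inE rc_mod. Qed.

Lemma gms_sym : connect_sym (gminus s).
Proof. exact: (sym_connect_sym (@gminus_sym s)). Qed.

Lemma region_disj i j x : x \in X i -> x \in X j -> c i = c j.
Proof.
rewrite !inE => hi hj; case: ringS => _ _ _ h; apply: h; rewrite ?rc_mem //.
by apply: connect_trans hi _; rewrite gms_sym.
Qed.

Lemma region_ring i z : z \in s -> z \in X i -> z = c i.
Proof. by move=> /rc_surj[j _ ->] hz; apply: region_disj (region_root j) hz. Qed.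

Lemma region_step i x y : x \in X i -> g x y -> (x, y) \notin cycle_edges s -> y \in X i.
Proof.
rewrite ![_ \in X i]inE => hx hg he; apply: connect_trans hx (connect1 _).
by rewrite /gminus hg.
Qed.

Lemma region_cover x : exists2 i, i < m & x \in X i.
Proof.
suff [i hi] : exists i, x \in X i by exists (i %% m); rewrite ?region_mod // ltn_mod m_gt0.
have [hc _] := cact; move: (hc (c 0) x); apply: (connect_ind (P := fun x => exists i, x \in X i)).
  by exists 0; exact: region_root.
move=> a b [i hi] hab; case: (boolP ((a, b) \in cycle_edges s)) => he.
  by have [_ /rc_surj[j _ ->]] := ring_edge_mem he; exists j; exact: region_root.
by exists i; apply: region_step he.
Qed.

Lemma ring_conn i k : 0 < k < m -> conn (c i) (c i.+1) (c (i + k)).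
Proof.
elim: k => // -[|k] IH /andP[_ hk]; first by rewrite addn1 conn_refl.
apply: conn_trans (IH _) _; first by lia.
have hne k' : 0 < k' < m -> c (i + k') != c i.
  move=> hk'; rewrite rc_eq -[X in _ != X %[mod _]]addn0 eqn_modDl mod0n modn_small; lia.
apply: conn_step; [rewrite [i + k.+2]addnS; exact: rc_adj | apply: hne; lia | apply: hne; lia].
Qed.

Lemma ring_conn2 i y z : y \in s -> z \in s -> y != c i -> z != c i -> conn (c i) y z.
Proof.
have key w : w \in s -> w != c i -> conn (c i) (c i.+1) w.
  move=> /rc_surj[j hj ->] hne; pose k := (j + (m - i %% m)) %% m.
  have hi : i %% m < m by rewrite ltn_mod m_gt0.
  have ek : c (i + k) = c j.
    apply/eqP; rewrite rc_eq /k modnDmr addnCA -modnDmr -(modnDml i).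
    have -> : i %% m + (m - i %% m) = m by lia.
    by rewrite modnn addn0.
  rewrite -ek; apply: ring_conn; rewrite ltn_mod m_gt0 andbT lt0n.
  by apply: contraNneq hne => k0; rewrite -ek k0 addn0.
by move=> hy hz h1 h2; apply: conn_trans (key z hz h2); rewrite conn_sym key.
Qed.

(** A path that avoids [c i] cannot leave its region. From any other region it leads to another ring
    vertex, and the ring without [c i] is still connected. *)
Lemma region_conn i x z : x != c i -> z \in s -> z != c i -> conn (c i) x z = (x \notin X i).
Proof.
move=> hx hz hzi; apply/idP/idP => [hc|hn].
  apply/negP => hxi; suff : z \in X i /\ z != c i.
    by move=> [/(region_ring hz) -> ]; rewrite eqxx.
  apply: (connect_ind (P := fun z => z \in X i /\ z != c i) (conj hxi hx) _ hc) => a b [ha1 ha2] /and3P[hg _ hb].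
  split=> //; apply: (region_step ha1 hg); apply/negP => /ring_edge_mem[ha _].
  by rewrite (region_ring ha ha1) eqxx in ha2.
have [j hj hxj] := region_cover x.
have hji : c j != c i.
  by apply: contraNneq hn => e; rewrite inE -e; move: hxj; rewrite inE.
apply: (@conn_trans _ (c j)); last by apply: ring_conn2 => //; exact: rc_mem.
rewrite conn_sym; move: hxj; rewrite inE => hcx.
suff : conn (c i) (c j) x /\ x \in X j by case.
apply: (connect_ind (P := fun y => conn (c i) (c j) y /\ y \in X j) _ _ hcx).
  by rewrite conn_refl region_root.
move=> a b [h1 h2] hab; have hb : b \in X j.
  by move: h2; rewrite !inE => h2; apply: connect_trans h2 (connect1 hab).
split=> //; apply: conn_trans h1 _; apply: conn_step; first by case/andP: hab.
  by apply: contraNneq hji => e; rewrite (region_disj (i := j) (j := i) h2) // e region_root.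
by apply: contraNneq hji => e; rewrite (region_disj (i := j) (j := i) hb) // e region_root.
Qed.

(** The ring successor of [y] after [x] without mention of the ring: the other neighbour of [y] that
    remains connected to [x] when [y] is deleted. On a bridge there is none, and the ring of length
    two turns back to [x]. *)
Definition next_on (x y z : V) : Prop :=
  [/\ z != x, g y z & conn y x z] \/ (z = x /\ forall z', ~ [/\ z' != x, g y z' & conn y x z']).

Lemma ring_next i z : next_on (c i) (c i.+1) z <-> z = c i.+2.
Proof.
have h1 : c i != c i.+1 by apply/eqP => e; have := rc_adj i; rewrite -e g_irr.
have h2 : c i.+2 != c i.+1 by apply/eqP => e; have := rc_adj i.+1; rewrite e g_irr.
have only z' : z' != c i -> g (c i.+1) z' -> conn (c i.+1) (c i) z' -> z' = c i.+2.
  move=> hz hg; have hz1 : z' != c i.+1 by apply: contraTneq hg => ->; rewrite g_irr.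
  rewrite conn_sym (region_conn hz1 (rc_mem i) h1) => hn.
  have : (c i.+1, z') \in cycle_edges s.
    by apply: contraNT hn => he; apply: region_step hg he; exact: region_root.
  rewrite cycle_edgesE rc_next => /and3P[_ /rc_surj[j _ ej] /orP[/eqP -> //|]].
  rewrite ej rc_next rc_eq -(addn1 j) -(addn1 i) eqn_modDr => h.
  by move: hz; rewrite ej rc_eq h.
split=> [[[]|[-> hno]]|->]; first exact: only.
  case: (eqVneq (c i) (c i.+2)) => // hne; case: (hno (c i.+2)); split; first by rewrite eq_sym.
    exact: rc_adj.
  by apply: ring_conn2; rewrite ?rc_mem.
case: (eqVneq (c i.+2) (c i)) => [e|hne]; [right | left].
  split=> // z' [a b cc]; have := only z' a b cc; rewrite e => ez; by rewrite ez eqxx in a.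
split=> //; first exact: rc_adj.
by apply: ring_conn2; rewrite ?rc_mem.
Qed.

End Ring.

(** The first edge [v w] of a simple path from [v] to [u] lies on a ring, and the rest of the path
    avoids [v]. Hence each component of the graph minus [v] is entered by a ring through [v]. *)
Lemma comp_ring (v u : V) : u != v -> exists s w, [/\ ring (v :: w :: s), w != v & conn v u w].
Proof.
move=> huv; have [hc _] := cact; case/connectP: (hc v u) => p hp eu.
case/shortenP: hp eu => -[|w p1] /=; first by move=> _ _ _ e; rewrite e eqxx in huv.
move=> /andP[hvw hp1] /andP[hv hu] _ eu.
have [s hs] := ring_exists hvw; exists s, w.
have hwv : w != v by apply: contraTneq hvw => ->; rewrite g_irr.
split=> //; rewrite conn_sym eu.
elim: p1 w hvw hp1 hv hwv {hs hu eu} => [|z p1 IH] w hvw /=; first by rewrite conn_refl.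
move=> /andP[hwz hp1]; rewrite !inE !negb_or => /and3P[h1 h2 h3] hwv.
apply: (@conn_trans _ z); first by apply: conn_step; rewrite // eq_sym.
elim: p1 z {IH hwz h1} hp1 h2 h3 => [|y p1 IH] z /=; first by rewrite conn_refl.
move=> /andP[hzy hp1] h2; rewrite inE negb_or => /andP[h3 h4].
apply: (@conn_trans _ y); first by apply: conn_step; rewrite // eq_sym.
exact: IH.
Qed.

End Rings.

(** * Composing orientations *)

Section Walks.
Variable n : nat.
Local Notation V := 'I_n.
Implicit Types (B : arcs n) (x y z : V).

Lemma dist_refl B x : dist_le B x x 0.
Proof. by exists [::]. Qed.

Lemma dist_trans B y x z l1 l2 l : dist_le B x y l1 -> dist_le B y z l2 -> l1 + l2 <= l ->
  dist_le B x z l.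
Proof.
move=> [p [hp ep sp]] [q [hq eq sq]] hl; exists (p ++ q).
by rewrite cat_path hp ep hq last_cat ep eq size_cat; split=> //; lia.
Qed.

Lemma dist_weak B B' x y l l' : B \subset B' -> l <= l' -> dist_le B x y l -> dist_le B' x y l'.
Proof.
move=> /subsetP hB hl [p [hp ep sp]]; exists p; split=> //; last lia.
by apply: sub_path hp => a b; exact: hB.
Qed.

Lemma dist_arc B x y : (x, y) \in B -> dist_le B x y 1.
Proof. by move=> h; exists [:: y]; rewrite /= /arcrel h. Qed.

Lemma dist_step B x y l : dist_le B x y l.+1 -> x = y \/ exists2 z, (x, z) \in B & dist_le B z y l.
Proof.
move=> [[|z p] [/= hp ep sp]]; first by left.
by case/andP: hp => h1 h2; right; exists z => //; exists p.
Qed.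

Lemma dist0 B x y : dist_le B x y 0 -> x = y.
Proof. by move=> [[|z p] [_ /= e]]. Qed.

(* shortest walks repeat no vertex *)
Lemma dist_short B x y l : dist_le B x y l -> dist_le B x y n.-1.
Proof.
move=> [p [hp ep sp]]; case/shortenP: hp ep => q hq uq _ eq; exists q; split=> //.
have := max_card (mem (x :: q)); rewrite (card_uniqP uq) card_ord /=; lia.
Qed.

End Walks.

Section Sound.
Variables (n : nat).
Local Notation V := 'I_n.

(* [B] reorients some of the arcs of [A] and may drop others *)
Definition valid (A B : arcs n) := forall x y, (x, y) \in B -> (x, y) \notin A ->
  (y, x) \in A /\ (y, x) \notin B.

(** Arcs of [B] outside [A] are produced by one reversal each. Once none is left, [B] is a subset of
    the current digraph, and its walks survive there. *)
Lemma valid_krev (A B : arcs n) d k : valid A B -> #|B :\: A| <= k -> diam_le B d -> kReversals A d k.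
Proof.
move: {2}#|B :\: A| (erefl #|B :\: A|) => j; elim: j A k => [|j IH] A k.
  move=> /eqP; rewrite cards_eq0 setD_eq0 => hB _ _ hd; exists 0, A; split=> //; first exact: revs0.
  by move=> u w; apply: dist_weak hB (leqnn _) (hd u w).
move=> hj hv hk hd.
have : 0 < #|B :\: A| by rewrite hj.
case/card_gt0P => -[x y]; rewrite inE => /andP[hA hB].
have [hA' hB'] := hv x y hB hA.
pose A1 := reverse_arc A (y, x).
have inA1 z w : ((z, w) \in A1) = ((z, w) != (y, x)) && ((z, w) \in A) || ((z, w) == (x, y)).
  by rewrite !inE.
have e1 : B :\: A1 = (B :\: A) :\ (x, y).
  apply/setP => -[z w]; rewrite in_setD in_setD1 in_setD inA1 negb_or negb_and negbK.
  case: (eqVneq (z, w) (y, x)) => [[-> ->]|_]; first by rewrite (negPf hB') !andbF.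
  by case: ((z, w) \in A); case: ((z, w) \in B); case: ((z, w) == (x, y)).
have c1 : #|B :\: A1| = j.
  have := cardsD1 (x, y) (B :\: A); rewrite -e1 hj in_setD hA hB /= add1n => -[] //.
have hv1 : valid A1 B.
  move=> z w hzw hn.
  have hzA : (z, w) \notin A.
    apply: contraNN hn => h; rewrite inA1 h andbT orbC.
    by case: eqP => // _; apply: contraTneq hzw => ->.
  have [h1 h2] := hv z w hzw hzA; split=> //; rewrite inA1 h1 andbT.
  by case: eqP => // -[ew ez]; move: hn; rewrite inA1 ew ez eqxx orbT.
have hk1 : #|B :\: A1| <= k.-1 by rewrite c1; lia.
have [j' [B' [hj' hr hd']]] := IH A1 k.-1 c1 hv1 hk1 hd.
exists j'.+1, B'; split=> //; first by lia.
exact: revsS hA' hr.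
Qed.

Section Orient.
Variables (A : arcs n) (d : nat).
Local Notation g := (uadj A).

Definition inside (B : arcs n) (X : {set V}) := forall x y, (x, y) \in B -> x \in X /\ y \in X.

(** The numbers [a] and [b] bound the distances to and from [v], and [c] the number of reversed
    arcs. Upper bounds are enough, which makes [sol] monotone. *)
Definition sol_with (B : arcs n) (X : {set V}) (v : V) (a b c : nat) :=
  [/\ inside B X, valid A B, #|B :\: A| <= c,
      forall x, x \in X -> dist_le B x v a /\ dist_le B v x b &
      forall x y, x \in X -> y \in X -> dist_le B x y d].

Definition sol X v a b c := exists B, sol_with B X v a b c.

Lemma sol_weak X v a b c a' b' c' : a <= a' -> b <= b' -> c <= c' -> sol X v a b c -> sol X v a' b' c'.
Proof.
move=> ha hb hc [B [h1 h2 h3 h4 h5]]; exists B; split=> //; first lia.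
by move=> x /h4[ha' hb']; split; apply: dist_weak (subxx _) _ _; eauto.
Qed.

Lemma sol_point v : sol [set v] v 0 0 0.
Proof.
exists set0; split; rewrite ?set0D ?cards0 //; try by move=> x y; rewrite inE.
- by move=> x /set1P ->; split; exact: dist_refl.
by move=> x y /set1P -> /set1P ->; apply: dist_weak (subxx _) (leq0n _) (dist_refl _ _).
Qed.

Hypothesis noloop : loopless A.

Lemma valid_neq B x y : valid A B -> (x, y) \in B -> x != y.
Proof.
move=> hv hB; apply/eqP => e; subst y.
by have [] := hv x x hB (noloop x); rewrite (negPf (noloop x)).
Qed.

Lemma card_merge (B1 B2 : arcs n) c1 c2 : #|B1 :\: A| <= c1 -> #|B2 :\: A| <= c2 ->
  #|(B1 :|: B2) :\: A| <= c1 + c2.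
Proof. by move=> h1 h2; rewrite setDUl (leq_trans (leq_card_setU _ _)) // leq_add. Qed.

Lemma valid_merge (B1 B2 : arcs n) : valid A B1 -> valid A B2 ->
  (forall x y, (x, y) \in B1 -> (x, y) \notin A -> (y, x) \notin B2) ->
  (forall x y, (x, y) \in B2 -> (x, y) \notin A -> (y, x) \notin B1) -> valid A (B1 :|: B2).
Proof.
move=> v1 v2 h1 h2 x y; rewrite !inE negb_or => /orP[h|h] hA.
  by have [ha hb] := v1 x y h hA; rewrite hb h1.
by have [ha hb] := v2 x y h hA; rewrite hb h2.
Qed.

(** Walks between the two sides are concatenated at [v]. No arc lies on both sides, as their only
    common vertex is [v] and there are no loops, so the orientations cannot conflict. *)
Lemma sol_merge X1 X2 v a1 b1 c1 a2 b2 c2 a b :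
  sol X1 v a1 b1 c1 -> sol X2 v a2 b2 c2 -> (forall x, x \in X1 -> x \in X2 -> x = v) ->
  a1 + b2 <= d -> a2 + b1 <= d -> a1 <= a -> a2 <= a -> b1 <= b -> b2 <= b ->
  sol (X1 :|: X2) v a b (c1 + c2).
Proof.
move=> [B1 [i1 v1 k1 e1 d1]] [B2 [i2 v2 k2 e2 d2]] hX h12 h21 ha1 ha2 hb1 hb2.
have S1 : B1 \subset B1 :|: B2 by exact: subsetUl.
have S2 : B2 \subset B1 :|: B2 by exact: subsetUr.
exists (B1 :|: B2); split.
- by move=> x y; rewrite !inE => /orP[/i1[-> ->]|/i2[-> ->]]; rewrite ?orbT.
- apply: valid_merge => // x y hB _; apply/negP => hB'.
    have [x1 y1] := i1 _ _ hB; have [y2 x2] := i2 _ _ hB'.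
    by have := valid_neq v1 hB; rewrite (hX x) // (hX y) // eqxx.
  have [x1 y1] := i2 _ _ hB; have [y2 x2] := i1 _ _ hB'.
  by have := valid_neq v2 hB; rewrite (hX x) // (hX y) // eqxx.
- exact: card_merge.
- move=> x; rewrite inE => /orP[/e1|/e2] [p q].
    by split; [apply: dist_weak S1 ha1 p | apply: dist_weak S1 hb1 q].
  by split; [apply: dist_weak S2 ha2 p | apply: dist_weak S2 hb2 q].
move=> x y; rewrite !inE => /orP[hx|hx] /orP[hy|hy].
- exact: dist_weak S1 (leqnn _) (d1 x y hx hy).
- have [p _] := e1 x hx; have [_ q] := e2 y hy.
  exact: dist_trans (dist_weak S1 (leqnn _) p) (dist_weak S2 (leqnn _) q) h12.
- have [p _] := e2 x hx; have [_ q] := e1 y hy.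
  exact: dist_trans (dist_weak S2 (leqnn _) p) (dist_weak S1 (leqnn _) q) h21.
exact: dist_weak S2 (leqnn _) (d2 x y hx hy).
Qed.

Local Notation conn := (conn A).

(* [v] together with the components of the graph minus [v] that avoid [p] and
   contain a vertex below [i]: the part of the graph treated after [i] steps *)
Definition reg (v p : V) (i : nat) : {set V} :=
  [set x | (x == v) || (~~ conn v x p && [exists y : V, (y < i) && conn v y x])].

Definition comp (v u : V) : {set V} := [set x | (x == v) || conn v u x].

(** The cases in which vertex [i] opens no new component: it is [v] itself, it lies in the component
    of [p], which is left to the surrounding ring, or its component was opened by a smaller vertex.
    The choice [p = v] leaves out nothing. *)
Definition old (v p i : V) := [\/ i = v, conn v i p | exists2 y : V, y < i & conn v y i].

Lemma reg_old v p (i : V) : old v p i -> reg v p i.+1 = reg v p i.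
Proof.
move=> ho; apply/setP => x; rewrite !inE; case: (eqVneq x v) => //= hx.
case hp: (conn v x p) => //=.
apply/existsP/existsP => -[y /andP[hy hc]]; last by exists y; rewrite hc andbT; lia.
case: (ltnP y i) => hyi; first by exists y; rewrite hyi.
have ey : y = i by apply: val_inj => /=; lia.
subst y; case: ho => [ei|hi|[z hz hzi]].
- by subst i; move: hx; rewrite (conn_self hc) eqxx.
- by move: hp; rewrite (conn_trans _ hi) // conn_sym.
by exists z; rewrite hz (conn_trans hzi hc).
Qed.

Lemma reg_new v p (i : V) : ~ old v p i -> reg v p i.+1 = reg v p i :|: comp v i.
Proof.
move=> ho; apply/setP => x; rewrite !inE; case: (eqVneq x v) => //= hx.
apply/andP/orP => [[h1 /existsP[y /andP[hy hc]]]|[/andP[h1 /existsP[y /andP[hy hc]]]|hc]].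
- case: (ltnP y i) => hyi; first by left; rewrite h1; apply/existsP; exists y; rewrite hyi.
  by right; have <- : y = i by apply: val_inj => /=; lia.
- by split=> //; apply/existsP; exists y; rewrite hc andbT; lia.
split; last by apply/existsP; exists i; rewrite hc ltnSn.
by apply/negP => h; apply: ho; apply: Or32; exact: conn_trans hc h.
Qed.

Lemma reg_comp v p (i x : V) : ~ old v p i -> x \in reg v p i -> x \in comp v i -> x = v.
Proof.
move=> ho; rewrite !inE; case: (eqVneq x v) => //= hx /andP[h1 /existsP[y /andP[hy hc]]] h2.
by case: ho; apply: Or33; exists y => //; apply: conn_trans hc _; rewrite conn_sym.
Qed.

Lemma reg_self v p i : v \in reg v p i.
Proof. by rewrite inE eqxx. Qed.

Lemma comp_self v u : v \in comp v u.
Proof. by rewrite inE eqxx. Qed.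

Lemma reg0 v p : reg v p 0 = [set v].
Proof.
apply/setP => x; rewrite !inE; case: eqP => //= _; rewrite andbC.
by case: existsP => // -[y].
Qed.

Lemma reg_all v : reg v v n = [set: V].
Proof.
apply/setP => x; rewrite !inE; case: (eqVneq x v) => //= hx; apply/andP; split.
  by apply: contraNN hx => h; apply/eqP/(@conn_self _ A); rewrite conn_sym.
by apply/existsP; exists x; rewrite ltn_ord conn_refl.
Qed.

Hypothesis cact : cactus A.

(** * Attaching the parts along a ring, with soundness of the scan *)

Section RingScan.
Variables (s : seq V) (x0 v : V).
Hypothesis ringS : ring A s.
Local Notation m := (size s).
Local Notation c := (rc s x0).

Hypothesis vs : v \in s.

Lemma reg_region i : c i != v -> reg (c i) v n = region A s x0 i.
Proof.
move=> hi; apply/setP => x; rewrite [LHS]inE.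
case: (eqVneq x (c i)) => [->|hx] /=; first by rewrite region_root.
rewrite region_conn // ?(eq_sym v) // negbK.
rewrite andb_idr // => _; by apply/existsP; exists x; rewrite ltn_ord conn_refl.
Qed.

(** The component of [u] consists of all that does not hang at [v] with respect to the ring by which
    it is entered. *)
Lemma comp_region u i z : u != v -> v = c i -> z \in s -> z != v -> conn v u z ->
  forall x, (x \in comp v u) = (x == v) || (x \notin region A s x0 i).
Proof.
move=> hu ev hz hzv huz x; rewrite inE; case: (eqVneq x v) => //= hx.
have hxi : x != c i by rewrite -ev.
rewrite ev in hzv huz *; rewrite -(region_conn cact ringS hxi hz hzv).
by apply/idP/idP => h; [apply: (conn_trans _ huz) | apply: (conn_trans huz)]; rewrite conn_sym.
Qed.

(** At the position of [v] only [v] is attached: what else hangs there belongs to other components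
    and is joined by [sol_merge]. *)
Definition item (j : nat) : {set V} := if c j == v then [set v] else region A s x0 j.

Lemma item_region j x : x \in item j -> x \in region A s x0 j.
Proof. by rewrite /item; case: eqP => // <- /set1P ->; exact: region_root. Qed.

Lemma item_root j : c j \in item j.
Proof. by rewrite /item; case: eqP => [->|_]; [rewrite inE | exact: region_root]. Qed.

Lemma item_disj i j x : i < m -> j < m -> x \in item i -> x \in item j -> i = j.
Proof.
move=> hi hj /item_region h1 /item_region h2; apply: (rc_inj (x0 := x0) ringS hi hj).
exact: (region_disj ringS h1 h2).
Qed.

Lemma item_ring j x : j < m -> x \in s -> x \in item j -> x = c j.
Proof. by move=> hj hx /item_region h; exact: (region_ring ringS hx h). Qed.

(** Every ring edge is used forward, reversed if necessary, and also backward when [A] has both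
    arcs. These arcs are available from the start of a scan, although the forward reversals are
    charged position by position. *)
Definition ring_arcs : arcs n :=
  [set e in cycle_edges s | (next s e.1 == e.2) || ((e \in A) && ((e.2, e.1) \in A))].

Lemma ring_arcsE x y : ((x, y) \in ring_arcs) =
  ((x, y) \in cycle_edges s) && ((next s x == y) || (((x, y) \in A) && ((y, x) \in A))).
Proof. by rewrite [LHS]in_set. Qed.

Lemma ring_arcs_fwd j : (c j, c j.+1) \in ring_arcs.
Proof. by rewrite in_set (rc_edge x0 ringS) /= (rc_next x0 ringS) eqxx. Qed.

Lemma ring_arcs_bwd j : (c j, c j.+1) \in A -> (c j.+1, c j) \in A -> (c j.+1, c j) \in ring_arcs.
Proof.
move=> h1 h2; rewrite in_set h1 h2 orbT andbT.
have := rc_edge x0 ringS j; rewrite !cycle_edgesE => /and3P[-> ->].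
by rewrite orbC.
Qed.

Section ScanState.
Variables (X Y : nat).

Definition cost_edges (I : pred nat) := \sum_(j < m | I j) ((c j, c j.+1) \notin A : nat).

Definition covers (E : arcs n) (P : V -> Prop) (pos : nat -> nat -> V) (ia oa : nat -> nat -> nat) :=
  forall M, M < 3 -> forall x, P x ->
   (exists2 t, t < 2 & exists2 k, ia M t = k.+1 & dist_le E x (pos M t) k) /\
   (exists2 t, t < 2 & exists2 k, oa M t = k.+1 & dist_le E (pos M t) x k).

Definition done (I : pred nat) (x : V) := exists2 j, j < m /\ I j & x \in item j.

(* The parts hanging at the ring positions in [I] are attached. A scan remembers only
   bounds on the distances to and from two terminal vertices, in three modes: every
   attached vertex is covered by some terminal of each mode. A bound [k] is stored as
   [k.+1], and 0 says that the terminal covers nothing. *)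
Definition scan_sem (I : pred nat) (cst : nat) pos ia oa :=
  exists B : arcs n, let E := B :|: ring_arcs in
   [/\ forall x y, (x, y) \in B -> exists2 j, j < m /\ I j & x \in item j /\ y \in item j,
       valid A B, #|B :\: A| + cost_edges I <= cst,
       (forall x, done I x -> dist_le E x v X /\ dist_le E v x Y) /\
       (forall x y, done I x -> done I y -> dist_le E x y d) /\ covers E (done I) pos ia oa &
       m = 2 -> forall j, j < m -> I j -> (c j, c j.+1) \in A].

Lemma scan_init I cst pos ia oa : (forall j, j < m -> ~~ I j) -> scan_sem I cst pos ia oa.
Proof.
move=> hI; have hn x : ~ done I x by move=> [j [hj hIj]]; rewrite (negPf (hI j hj)) in hIj.
exists set0; split.
- by move=> x y; rewrite inE.
- by move=> x y; rewrite inE.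
- rewrite set0D cards0 /cost_edges big_pred0 // => j; exact/negbTE/hI/ltn_ord.
- by split; [move=> x /hn | split; [move=> x y /hn | move=> M _ x /hn]].
by move=> _ j hj hIj; move: (hI j hj); rewrite hIj.
Qed.

Definition rdist (x y : V) l := dist_le ring_arcs x y l.

(** All new distances come from concatenating an old walk, a ring walk and a walk inside the new
    part. Every old mode covers every attached vertex; hence one mode [M0] suffices for the diameter
    test, and each new mode may be derived from any old one. *)
Lemma scan_add I I' cst pos ia oa j a b c1 e M0 pos' ia' oa' :
  scan_sem I cst pos ia oa -> j < m -> ~~ I j -> (forall i, i < m -> I' i = I i || (i == j)) ->
  sol (item j) (c j) a b c1 ->
  ((c j, c j.+1) \in A /\ e = 0) \/ [/\ (c j, c j.+1) \notin A, e = 1 & m <> 2] ->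
  M0 < 3 ->
  (forall t, t < 2 -> ia M0 t = 0 \/ exists k l, [/\ ia M0 t = k.+1, rdist (pos M0 t) (c j) l & k + l + b <= d]) ->
  (forall t, t < 2 -> oa M0 t = 0 \/ exists k l, [/\ oa M0 t = k.+1, rdist (c j) (pos M0 t) l & a + l + k <= d]) ->
  (exists2 l, rdist (c j) v l & a + l <= X) -> (exists2 l, rdist v (c j) l & l + b <= Y) ->
  (forall M, M < 3 -> exists2 M2, M2 < 3 & forall t, t < 2 -> ia M2 t = 0 \/
      exists2 t', t' < 2 & exists k l k', [/\ ia M2 t = k.+1, ia' M t' = k'.+1, rdist (pos M2 t) (pos' M t') l & k + l <= k']) ->
  (forall M, M < 3 -> exists2 M2, M2 < 3 & forall t, t < 2 -> oa M2 t = 0 \/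
      exists2 t', t' < 2 & exists k l k', [/\ oa M2 t = k.+1, oa' M t' = k'.+1, rdist (pos' M t') (pos M2 t) l & l + k <= k']) ->
  (forall M, M < 3 -> exists2 t', t' < 2 & exists l k', [/\ ia' M t' = k'.+1, rdist (c j) (pos' M t') l & a + l <= k']) ->
  (forall M, M < 3 -> exists2 t', t' < 2 & exists l k', [/\ oa' M t' = k'.+1, rdist (pos' M t') (c j) l & l + b <= k']) ->
  scan_sem I' (cst + c1 + e) pos' ia' oa'.
Proof.
move=> [B [b1 b2 b3 [b4 [b5 b6]] b7]] hj hIj hI' [B1 [i1 v1 k1 e1 d1]] he hM0 h1 h2 hX hY t1 t2 y1 y2.
pose E := B :|: ring_arcs; pose E' := (B :|: B1) :|: ring_arcs.
have sE : E \subset E' by rewrite /E /E' setUAC subsetUl.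
have sB : B1 \subset E' by rewrite /E' (setUC B) -setUA subsetUl.
have sR : ring_arcs \subset E' by rewrite /E' subsetUr.
have eE x y l : dist_le E x y l -> dist_le E' x y l by exact: dist_weak.
have eB x y l : dist_le B1 x y l -> dist_le E' x y l by exact: dist_weak.
have eR x y l : rdist x y l -> dist_le E' x y l by exact: dist_weak.
have doneP x : done I' x -> done I x \/ x \in item j.
  move=> [i [hi hIi] hx]; move: hIi; rewrite hI' // => /orP[hIi|/eqP <-]; last by right.
  by left; exists i.
have itemI i x : i < m -> I i -> x \in item i -> x \in item j -> False.
  by move=> hi hIi hx hx'; move: hIj; rewrite -(item_disj hi hj hx hx') hIi.
exists (B :|: B1); rewrite -/E'; split.
- move=> x y; rewrite inE => /orP[/b1[i [hi hIi] hxy]|/i1 hxy].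
    by exists i => //; rewrite hI' // hIi.
  by exists j => //; rewrite hI' // eqxx orbT.
- apply: valid_merge => // x y hB _; apply/negP => hB'.
    have [i [hi hIi] [hx _]] := b1 _ _ hB; have [_ hx'] := i1 _ _ hB'.
    exact: itemI hi hIi hx hx'.
  have [i [hi hIi] [hx _]] := b1 _ _ hB'; have [_ hx'] := i1 _ _ hB.
  exact: itemI hi hIi hx hx'.
- have -> : cost_edges I' = cost_edges I + ((c j, c j.+1) \notin A).
    rewrite /cost_edges (bigD1 (Ordinal hj)) /=; last by rewrite hI' // eqxx orbT.
    rewrite addnC; congr (_ + _); apply: eq_bigl => i; rewrite hI' //.
    case: (eqVneq i (Ordinal hj)) => [->|ne] /=; first by rewrite (negPf hIj) andbF.
    by rewrite andbT (_ : (i == j :> nat) = false) ?orbF //; apply/negbTE.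
  have := card_merge (leqnn #|B :\: A|) k1.
  move=> hcard; have {hcard} := leq_add hcard (leqnn (cost_edges I)); rewrite addnAC => hcard.
  have {hcard} := leq_trans hcard (leq_add b3 (leqnn c1)); move: #|_| (cost_edges I) => u w.
  by case: he => [[-> ->]|[-> -> _]] /=; lia.
- split; [|split].
  + move=> x /doneP[/b4[p q]|hx]; first by split; exact: eE.
    have [p q] := e1 x hx; have [l hl hle] := hX; have [l' hl' hle'] := hY.
    by split; [apply: dist_trans (eB _ _ _ p) (eR _ _ _ hl) hle | apply: dist_trans (eR _ _ _ hl') (eB _ _ _ q) hle'].
  + move=> x y /doneP[hx|hx] /doneP[hy|hy].
    * exact/eE/b5.
    * have [[t ht [k hk hd]] _] := b6 _ hM0 x hx; have [_ q] := e1 y hy.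
      case: (h1 t ht) => [|[k' [l [hk' hl hle]]]]; first by rewrite hk.
      have ek : k' = k by move: hk'; rewrite hk => -[].
      subst k'; apply: dist_trans (dist_trans (eE _ _ _ hd) (eR _ _ _ hl) (leqnn _)) (eB _ _ _ q) hle.
    * have [_ [t ht [k hk hd]]] := b6 _ hM0 y hy; have [p _] := e1 x hx.
      case: (h2 t ht) => [|[k' [l [hk' hl hle]]]]; first by rewrite hk.
      have ek : k' = k by move: hk'; rewrite hk => -[].
      subst k'; apply: dist_trans (dist_trans (eB _ _ _ p) (eR _ _ _ hl) (leqnn _)) (eE _ _ _ hd) hle.
    * exact/eB/d1.
  move=> M hM x /doneP[hx|hx]; split.
  + have [M2 hM2 tr] := t1 M hM; have [[t ht [k hk hd]] _] := b6 _ hM2 x hx.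
    case: (tr t ht) => [|[t' ht' [k0 [l [k' [e0 e' hl hle]]]]]]; first by rewrite hk.
    have ek : k0 = k by move: e0; rewrite hk => -[].
    subst k0; exists t' => //; exists k' => //.
    exact: dist_trans (eE _ _ _ hd) (eR _ _ _ hl) hle.
  + have [M2 hM2 tr] := t2 M hM; have [_ [t ht [k hk hd]]] := b6 _ hM2 x hx.
    case: (tr t ht) => [|[t' ht' [k0 [l [k' [e0 e' hl hle]]]]]]; first by rewrite hk.
    have ek : k0 = k by move: e0; rewrite hk => -[].
    subst k0; exists t' => //; exists k' => //.
    exact: dist_trans (eR _ _ _ hl) (eE _ _ _ hd) hle.
  + have [t' ht' [l [k' [e' hl hle]]]] := y1 M hM; have [p _] := e1 x hx.
    by exists t' => //; exists k' => //; exact: dist_trans (eB _ _ _ p) (eR _ _ _ hl) hle.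
  have [t' ht' [l [k' [e' hl hle]]]] := y2 M hM; have [_ q] := e1 x hx.
  by exists t' => //; exists k' => //; exact: dist_trans (eR _ _ _ hl) (eB _ _ _ q) hle.
move=> hm i hi; rewrite hI' // => /orP[|/eqP ->]; first exact: b7.
by case: he => [[]|[_ _]].
Qed.

(** The ring arcs join the solution only here. They lie in no item, so they neither conflict with
    the parts nor share their costs. *)
Lemma scan_final I cst pos ia oa u i z : scan_sem I cst pos ia oa -> (forall j, j < m -> I j) ->
  u != v -> v = c i -> z \in s -> z != v -> conn v u z ->
  sol (comp v u) v X Y cst.
Proof.
move=> [B [b1 b2 b3 [b4 [b5 _]] b7]] hI hu ev hz hzv huz.
have hcomp := comp_region hu ev hz hzv huz.
have doneI x : x \in comp v u -> done I x.
  rewrite hcomp => hx.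
  case: (eqVneq x v) hx => [->|hxv] /= hx.
    have hm : i %% m < m by rewrite ltn_mod (m_gt0 ringS).
    by exists (i %% m); [split; rewrite ?hI | rewrite /item rc_mod -ev eqxx inE].
  have [j hj hxj] := region_cover cact x0 ringS x; exists j; first by split; rewrite ?hI.
  rewrite /item; case: eqP => // e; move: hx.
  suff -> : region A s x0 i = region A s x0 j by rewrite hxj.
  by apply/setP => y; rewrite !inE -ev e.
have itemC j x : j < m -> x \in item j -> x \in comp v u.
  move=> hj; rewrite hcomp /item; case: ifP => [_ /set1P ->|hne]; first by rewrite eqxx.
  move=> hx; apply/orP; right; apply/negP => hx'.
  by move: hne; rewrite (region_disj ringS hx hx') -ev eqxx.
have ringC x : x \in s -> x \in comp v u.
  by move=> /(rc_surj x0)[j hj ->]; exact: itemC hj (item_root j).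
have two x y j : j < m -> (x, y) \in cycle_edges s -> x \in item j -> y \in item j -> False.
  move=> hj he hx hy; have [xs ys] := ring_edge_mem he.
  have ex := item_ring hj xs hx; have ey := item_ring hj ys hy.
  have : g x y.
    by have [k _ [[-> ->]|[-> ->]]] := ring_edgeP x0 ringS he; rewrite ?(rc_adj x0 ringS) // g_sym (rc_adj x0 ringS).
  by rewrite ex ey (g_irr noloop).
exists (B :|: ring_arcs); split.
- move=> x y; rewrite in_setU => /orP[/b1[j [hj _] [hx hy]]|]; first by split; exact: itemC hj _.
  by rewrite ring_arcsE => /andP[/ring_edge_mem[hx hy] _]; split; exact: ringC.
- have vR : valid A ring_arcs.
    move=> x y; rewrite !ring_arcsE => /andP[he hor] hA.
    have e1 : next s x = y by move: hor; rewrite (negPf hA) orbF => /eqP.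
    have [hx hy] := ring_edge_mem he.
    have [j hj ex] := rc_surj x0 hx; have ey : y = c j.+1 by rewrite -e1 ex (rc_next x0 ringS).
    have hyA : (y, x) \in A by have := rc_adj x0 ringS j; rewrite -ex -ey /uadj (negPf hA).
    split=> //; rewrite hyA (negPf hA) andbF orbF; apply/negP => /andP[_ /eqP e2].
    (* Two opposite forward arcs occur only on a bridge, whose forward arcs are required to lie in
       [A]. *)
    have m2 : m = 2.
      have : c j.+2 == c j by rewrite -(rc_next x0 ringS) -ey e2 ex.
      rewrite (rc_eq _ ringS) -[X in _ == X %[mod _]]addn0 -addn2 eqn_modDl mod0n.
      by have := ring_size ringS; case: (ltngtP 2 m) => // h; rewrite modn_small.
    by move: hA; rewrite ex ey b7 // hI.
  apply: valid_merge => // x y hB hA; apply/negP => hB'.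
    have [j [hj _] [hx hy]] := b1 _ _ hB.
    by move: hB'; rewrite ring_arcsE => /andP[he _]; exact: two hj he hy hx.
  have [j [hj _] [hy hx]] := b1 _ _ hB'.
  by move: hB; rewrite ring_arcsE => /andP[he _]; exact: two hj he hx hy.
- apply: leq_trans (card_merge (leqnn _) (_ : #|ring_arcs :\: A| <= cost_edges I)) b3.
  have hsub : ring_arcs :\: A \subset [set (c j, c (val j).+1) | j : 'I_m in [pred j : 'I_m | (c j, c j.+1) \notin A]].
    apply/subsetP => -[x y]; rewrite in_setD ring_arcsE => /and3P[hA he hor].
    have e1 : next s x = y by move: hor; rewrite (negPf hA) orbF => /eqP.
    have [/(rc_surj x0)[j hj ex] _] := ring_edge_mem he.
    have ey : y = c j.+1 by rewrite -e1 ex (rc_next x0 ringS).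
    by apply/imsetP; exists (Ordinal hj); rewrite ?inE /= -?ex -?ey.
  apply: leq_trans (subset_leq_card hsub) (leq_trans (leq_imset_card _ _) _).
  rewrite -sum1_card /cost_edges [X in _ <= X](bigID [pred j : 'I_m | (c j, c j.+1) \notin A]) /=.
  apply: leq_trans (leq_addr _ _).
  rewrite (eq_bigl (fun j : 'I_m => I j && ((c j, c j.+1) \notin A))) => [|j]; last first.
    by rewrite hI.
  by apply: leq_sum => j /andP[_ ->].
- by move=> x /doneI/b4.
by move=> x y /doneI hx /doneI hy; exact: b5.
Qed.

End ScanState.
End RingScan.
End Orient.
End Sound.

(** * Scanning a ring *)

Section Scan.
Variables (m d : nat) (D : nat -> nat -> nat) (a b : nat -> nat).

Definition add_ok (j : nat) (pos ia oa pos' ia' oa' : nat -> nat -> nat) : Prop :=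
  [/\ exists2 M0, M0 < 3 & forall t, t < 2 ->
        (ia M0 t = 0 \/ (ia M0 t).-1 + D (pos M0 t) j + b j <= d) /\
        (oa M0 t = 0 \/ a j + D j (pos M0 t) + (oa M0 t).-1 <= d),
      forall M, M < 3 -> exists2 M2, M2 < 3 & forall t, t < 2 -> ia M2 t = 0 \/
        exists2 t', t' < 2 & 0 < ia' M t' /\
          (ia M2 t).-1 + D (pos M2 t) (pos' M t') <= (ia' M t').-1,
      forall M, M < 3 -> exists2 M2, M2 < 3 & forall t, t < 2 -> oa M2 t = 0 \/
        exists2 t', t' < 2 & 0 < oa' M t' /\
          D (pos' M t') (pos M2 t) + (oa M2 t).-1 <= (oa' M t').-1,
      forall M, M < 3 -> exists2 t', t' < 2 & 0 < ia' M t' /\ a j + D j (pos' M t') <= (ia' M t').-1 &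
      forall M, M < 3 -> exists2 t', t' < 2 & 0 < oa' M t' /\ D (pos' M t') j + b j <= (oa' M t').-1].

(** The best entry for a terminal responsible for the positions in [S]. It is 0 exactly when the set
    is empty. *)
Definition in_bound (S : nat -> nat -> pred nat) (pos : nat -> nat -> nat) M t :=
  \max_(i < m | S M t i) (a i + D i (pos M t)).+1.

Definition out_bound (S : nat -> nat -> pred nat) (pos : nat -> nat -> nat) M t :=
  \max_(i < m | S M t i) (D (pos M t) i + b i).+1.

Lemma max_attained (P : pred nat) (f : nat -> nat) :
  (\max_(i < m | P i) (f i).+1 = 0 /\ forall i, i < m -> ~~ P i) \/
  exists2 i, i < m /\ P i & \max_(i < m | P i) (f i).+1 = (f i).+1.
Proof.
case: (boolP [exists i : 'I_m, P i]) => [/existsP[i hi]|hn]; [right | left].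
  have h0 : 0 < #|[pred i : 'I_m | P i]| by apply/card_gt0P; exists i.
  by have [j hj ->] := eq_bigmax_cond (fun i : 'I_m => (f i).+1) h0; exists j.
have hP i : i < m -> ~~ P i.
  by move=> hi; apply: contraNN hn => h; apply/existsP; exists (Ordinal hi).
split=> //; rewrite big_pred0 // => i; exact/negbTE/hP/ltn_ord.
Qed.

Lemma le_max (P : pred nat) (f : nat -> nat) i : i < m -> P i -> f i < \max_(i < m | P i) (f i).+1.
Proof.
move=> hi hP.
exact: (@leq_bigmax_cond _ (fun i : 'I_m => P i) (fun i : 'I_m => (f i).+1) (Ordinal hi) hP).
Qed.

Hypothesis tight : forall x y, x < m -> y < m -> x != y -> a x + D x y + b y <= d.

(** Maxima are attained, so the inequalities on entries reduce to statements about sets of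
    positions: each terminal lies on a shortest ring route for the positions assigned to it. The
    diameter test then follows from [tight], which the given solution satisfies. *)
Lemma add_from_sets j M0 (SA SB SA' SB' : nat -> nat -> pred nat) pos pos' : j < m -> M0 < 3 ->
  (forall t x, t < 2 -> x < m -> SA M0 t x -> x != j /\ D x (pos M0 t) + D (pos M0 t) j <= D x j) ->
  (forall t x, t < 2 -> x < m -> SB M0 t x -> x != j /\ D j (pos M0 t) + D (pos M0 t) x <= D j x) ->
  (forall M, M < 3 -> exists2 M2, M2 < 3 & forall t, t < 2 -> exists2 t', t' < 2 &
     forall x, x < m -> SA M2 t x -> SA' M t' x /\ D x (pos M2 t) + D (pos M2 t) (pos' M t') <= D x (pos' M t')) ->
  (forall M, M < 3 -> exists2 M2, M2 < 3 & forall t, t < 2 -> exists2 t', t' < 2 &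
     forall x, x < m -> SB M2 t x -> SB' M t' x /\ D (pos' M t') (pos M2 t) + D (pos M2 t) x <= D (pos' M t') x) ->
  (forall M, M < 3 -> exists2 t', t' < 2 & SA' M t' j) ->
  (forall M, M < 3 -> exists2 t', t' < 2 & SB' M t' j) ->
  add_ok j pos (in_bound SA pos) (out_bound SB pos) pos' (in_bound SA' pos') (out_bound SB' pos').
Proof.
move=> hj hM0 hA hB tA tB yA yB; split.
- exists M0 => // t ht; split.
    have [[e0 _]|[x [hx hS] e]] := max_attained (SA M0 t) (fun i => a i + D i (pos M0 t)); [by left; exact: e0 | right].
    rewrite /in_bound e /=; have [hne hle] := hA t x ht hx hS; have := tight hx hj hne; lia.
  have [[e0 _]|[x [hx hS] e]] := max_attained (SB M0 t) (fun i => D (pos M0 t) i + b i); [by left; exact: e0 | right].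
  rewrite /out_bound e /=; have [hne hle] := hB t x ht hx hS.
  by rewrite eq_sym in hne; have := tight hj hx hne; lia.
- move=> M hM; have [M2 hM2 h] := tA M hM; exists M2 => // t ht; have [t' ht' h'] := h t ht.
  have [[e0 _]|[x [hx hS] e]] := max_attained (SA M2 t) (fun i => a i + D i (pos M2 t)); [by left; exact: e0 | right].
  exists t' => //; have [hS' hle] := h' x hx hS.
  have := le_max (fun i => a i + D i (pos' M t')) hx hS'.
  by rewrite /in_bound e /=; lia.
- move=> M hM; have [M2 hM2 h] := tB M hM; exists M2 => // t ht; have [t' ht' h'] := h t ht.
  have [[e0 _]|[x [hx hS] e]] := max_attained (SB M2 t) (fun i => D (pos M2 t) i + b i); [by left; exact: e0 | right].
  exists t' => //; have [hS' hle] := h' x hx hS.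
  have := le_max (fun i => D (pos' M t') i + b i) hx hS'.
  by rewrite /out_bound e /=; lia.
- move=> M hM; have [t' ht' hS] := yA M hM; exists t' => //.
  by have := le_max (fun i => a i + D i (pos' M t')) hj hS; rewrite /in_bound; lia.
move=> M hM; have [t' ht' hS] := yB M hM; exists t' => //.
by have := le_max (fun i => D (pos' M t') i + b i) hj hS; rewrite /out_bound; lia.
Qed.

(* [R i j]: all edges between positions [i] and [j] may be used in both directions *)
Variables (full : bool) (R : nat -> nat -> bool) (q : nat).
Hypothesis m2 : 2 <= m.
Hypothesis hDf : full -> forall i j, i < m -> j < m -> D i j = minn ((i - j) + (j - i)) (m - ((i - j) + (j - i))).
Hypothesis hDb : ~~ full -> forall i j, i < m -> j < m -> D i j =
  if i <= j then j - i else if R j i then minn (i - j) (m - (i - j)) else m - (i - j).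
Hypothesis q1 : 0 < q.
Hypothesis qm : q <= m.
Hypothesis qfull : full -> q = m.
Hypothesis R1 : forall i j, j <= i -> i < q -> R j i.
Hypothesis R2 : forall i j, j < q -> q <= i -> i < m -> ~~ R j i.
Hypothesis R3 : forall i j, q <= j -> j <= i -> i < m -> R j i -> 2 * (i - j) <= m.
Hypothesis R4 : forall i j k, i <= j -> j <= k -> R i k = R i j && R j k.
Hypothesis R0 : forall i, R i i.

(** Positions below [q] form the long two-way stretch. Cut at [h], both of its pieces have all their
    pairs at most half a ring apart. *)
Let h := minn m./2 q.

(* On a shortest walk between a new vertex and an attached one, the relevant entry points
   into the attached stretches are the ends of these stretches: these are the terminals. *)
Definition posA (g1 g2 M t : nat) : nat :=
  match M, t with
  | 0, 0 => g1.-1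
  | 0, _ => h
  | 1, 0 => maxn h g2.-1
  | 1, _ => 0
  | _, 0 => if full then g1.-1 else q.-1
  | _, _ => if full then h else 0
  end.

(** Mode 0 serves to extend the first lane, mode 1 the second, mode 2 to step past the stretch. If
    the whole ring is two-way there is nothing to step to, and mode 2 repeats mode 0. Sets for
    incoming and outgoing distances differ because a ring that is not two-way throughout favours the
    forward direction. *)
Definition SAA (g1 g2 M t : nat) : pred nat := fun i =>
  let l1 := i < g1 in let l2 := h <= i < g2 in
  match M, t with
  | 0, 0 => l1
  | 0, _ => l2
  | 1, 0 => l2 || (~~ full && l1)
  | 1, _ => full && l1
  | _, 0 => if full then l1 else l1 || l2
  | _, _ => full && l2
  end.

Definition SBA (g1 g2 M t : nat) : pred nat := fun i =>
  let l1 := i < g1 in let l2 := h <= i < g2 in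
  match M, t with
  | 0, 0 => l1
  | 0, _ => l2
  | 1, 0 => l2
  | 1, _ => l1
  | _, 0 => full && l1
  | _, _ => if full then l2 else l1 || l2
  end.

Definition iaA g1 g2 := in_bound (SAA g1 g2) (posA g1 g2).
Definition oaA g1 g2 := out_bound (SBA g1 g2) (posA g1 g2).

Lemma D_low i j : i < q -> j < q -> D i j = if full || (j < i)
  then minn ((i - j) + (j - i)) (m - ((i - j) + (j - i))) else j - i.
Proof.
move=> hi hj; case: (boolP full) => hf /=; first by apply: hDf => //; lia.
rewrite hDb //; try lia; case: ltnP => hij; last by [].
by rewrite R1 //; [have -> : j - i = 0 by lia | lia]; rewrite addn0.
Qed.

Lemma D_self i : i < m -> D i i = 0.
Proof.
move=> hi; case: (boolP full) => hf; first by rewrite hDf // subnn min0n.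
by rewrite hDb // leqnn subnn.
Qed.

Lemma D_via_up x p y : x <= p -> p <= y -> y < q -> 2 * (y - x) <= m \/ ~~ full ->
  D x p + D p y <= D x y.
Proof.
move=> h1 h2 hy hf; have -> : D x y = y - x.
  rewrite D_low //; last lia.
  by case: ifP => // /orP[hfl|]; [case: hf; [lia | rewrite hfl] | lia].
have le u w : u <= w -> w < q -> D u w <= w - u.
  by move=> huw hw; rewrite D_low //; [case: ifP; lia | lia].
have := le x p h1 (leq_ltn_trans h2 hy); have := le p y h2 hy; lia.
Qed.

Lemma D_via_down x p y : x <= p -> p <= y -> y < q -> 2 * (y - x) <= m ->
  D y p + D p x <= D y x.
Proof.
move=> h1 h2 hy hm; have -> : D y x = y - x.
  by rewrite D_low //; [case: ifP; lia | lia].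
have le u w : u <= w -> w < q -> D w u <= w - u.
  by move=> huw hw; rewrite D_low //; [case: ifP; lia | lia].
have := le x p h1 (leq_ltn_trans h2 hy); have := le p y h2 hy; lia.
Qed.

Lemma D_wrap_up x y : x < y -> y < q -> m <= 2 * (y - x) -> D y 0 + D 0 x <= D y x.
Proof.
move=> h1 hy hm; have -> : D y x = m - (y - x).
  by rewrite D_low; [rewrite h1 orbT; lia | lia | lia].
have : D y 0 <= m - y by rewrite D_low //; [case: ifP; lia].
have : D 0 x <= x by rewrite D_low //; [case: ifP; lia | lia].
lia.
Qed.

Lemma D_wrap_down x y : full -> x < y -> y < q -> m <= 2 * (y - x) -> D x 0 + D 0 y <= D x y.
Proof.
move=> hf h1 hy hm; rewrite !D_low ?hf /=; lia.
Qed.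

Lemma keep (p : nat) (P : Prop) x : p < m -> P -> P /\ D x p + D p p <= D x p.
Proof. by move=> hp hP; rewrite D_self // addn0. Qed.

Lemma keep' (p : nat) (P : Prop) x : p < m -> P -> P /\ D p p + D p x <= D p x.
Proof. by move=> hp hP; rewrite D_self. Qed.

(** Since the first lane lags, holding only positions below [j - h], all of it is at least half a
    ring behind [j]. Walks from [j] to it thus go around through position 0; walks from it to [j] do
    so if all edges are two-way, and run straight ahead otherwise. *)
Lemma addA2 g1 j : h <= j < q -> g1 = minn (j - h) h ->
  add_ok j (posA g1 j) (iaA g1 j) (oaA g1 j) (posA g1 j.+1) (iaA g1 j.+1) (oaA g1 j.+1).
Proof.
move=> hj eg.
have h2 : h = m./2 by rewrite /h; lia.
have h1 : 0 < h by rewrite h2; lia.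
have half x : h <= x -> x <= j -> 2 * (j - x) <= m by rewrite h2; lia.
have far x : x < g1 -> m <= 2 * (j - x) by rewrite eg h2; lia.
have hp : maxn h j.-1 <= j by lia.
have hx1 x : x < g1 -> x <= maxn h j.-1 by lia.
have hx2 x : h <= x < j -> x <= maxn h j.-1 by lia.
have hq : h < q by lia.
have e : maxn h j = j by lia.
have hjm : j < m by lia.
have hjq : j < q by lia.
have hm0 : 0 < m by lia.
have hqm : q.-1 < m by lia.
have hhm : h < m by lia.
have hg1q : g1.-1 < m by lia.
have hpq : maxn h j.-1 < q by lia.
have hne1 x : x < g1 -> x != j by lia.
have hne2 x : h <= x < j -> x != j by lia.
have l2m x : h <= x < j -> h <= x < j.+1 by lia.
have l2j : h <= j < j.+1 by lia.
have hx0 x : x < g1 -> x < j by lia.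
apply: (@add_from_sets j 1) => //.
- move=> [|[|//]] x _ _ /=.
    case/orP => [hx|/andP[hf hx]]; split; auto; apply: D_via_up; auto.
    by left; apply: half; case/andP: hx => // _; lia.
  by case/andP => hf hx; split; auto; apply: D_wrap_down; auto.
- move=> [|[|//]] x _ _ /= hx; split; auto.
    by apply: D_via_down; auto; apply: half; case/andP: hx => // _; lia.
  by apply: D_wrap_up; auto.
- move=> M hM; exists M => // t ht; exists t => // x hx.
  case: M t hM ht => [|[|[|//]]] [|[|//]] _ _ /=; rewrite ?e.
  + by move=> hS; apply: keep.
  + by move=> hS; apply: keep; auto.
  + case/orP => [hS|/andP[hf hS]].
      split; first by rewrite l2m.
      by apply: D_via_up; auto; left; apply: half; case/andP: hS => // _; lia.
    by split; [rewrite hf hS orbT | apply: D_via_up; auto].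
  + by move=> hS; apply: keep => //; lia.
  + case: (full) => hS; first by apply: keep.
    by apply: keep; [lia | case/orP: hS => [->//|/l2m ->]; rewrite orbT].
  + by case: (full) => //= hS; apply: keep; auto.
- move=> M hM; exists M => // t ht; exists t => // x hx.
  case: M t hM ht => [|[|[|//]]] [|[|//]] _ _ /=; rewrite ?e.
  + by move=> hS; apply: keep'.
  + by move=> hS; apply: keep'; auto.
  + move=> hS; split; first exact: l2m.
    by apply: D_via_down; auto; apply: half; case/andP: hS => // _; lia.
  + by move=> hS; apply: keep' => //; lia.
  + by case: (full) => //= hS; apply: keep'.
  + case: (full) => /= hS; first by apply: keep'; auto.
    by apply: keep'; [lia | case/orP: hS => [->//|/l2m ->]; rewrite orbT].
- move=> [|[|[|//]]] _; [exists 1 | exists 0 | exists (full : nat)] => //=; rewrite ?l2j ?orbT //; by case: (full) => //=; rewrite ?l2j ?orbT.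
move=> [|[|[|//]]] _; [exists 1 | exists 0 | exists 1] => //=; rewrite ?l2j ?orbT //; by case: (full) => //=; rewrite ?l2j ?orbT.
Qed.

(** The second lane has reached at most [h + j], so all of it is at most half a ring ahead of [j],
    and the direct route through [h] is shortest both ways. *)
Lemma addA1 g2 j : j < h -> g2 = minn (h + j.+1) q ->
  add_ok j (posA j g2) (iaA j g2) (oaA j g2) (posA j.+1 g2) (iaA j.+1 g2) (oaA j.+1 g2).
Proof.
move=> hj eg.
have hh : h <= m./2 /\ h <= q by rewrite /h; lia.
have hg : h < g2 -> h = m./2 by rewrite eg /h; lia.
have hjm : j < m by lia.
have hjq : j < q by lia.
have hm0 : 0 < m by lia.
have hqm : q.-1 < m by lia.
have hhm : h < m by lia.
have hpm : maxn h g2.-1 < m by lia.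
have up x : x <= j -> 2 * (j - x) <= m by lia.
have near x : h <= x < g2 -> 2 * (x - j) <= m.
  move=> hx; have e2 : h = m./2 by apply: hg; lia.
  by move: hx; rewrite eg; lia.
have hxq x : h <= x < g2 -> x < q by lia.
have hhq x : h <= x < g2 -> h < q by lia.
have lx x : h <= x < g2 -> h <= x by lia.
have jh : j <= h by lia.
have hne x : h <= x < g2 -> x != j by lia.
have hne1 x : x < j -> x != j by lia.
have lt1 x : x < j -> x <= j.-1 by lia.
have jp : j.-1 <= j by lia.
have lt2 x : x < j -> x < j.+1 by lia.
have hz : 0 < q by [].
have hx1 x : x < j -> x <= j by lia.
have hf2 x : h <= x < g2 -> maxn h g2.-1 < q by lia.
apply: (@add_from_sets j 0) => //.
- move=> [|[|//]] x _ _ /= hx; split; auto.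
    by apply: D_via_up; auto.
  by apply: D_via_down; eauto.
- move=> [|[|//]] x _ _ /= hx; split; auto.
    by apply: D_via_down; auto.
  by apply: D_via_up; eauto.
- move=> M hM; exists M => // t ht; exists t => // x hx.
  case: M t hM ht => [|[|[|//]]] [|[|//]] _ _ /=.
  + by move=> hS; split; auto; apply: D_via_up; auto.
  + by move=> hS; apply: keep; eauto.
  + by move=> hS; apply: keep => //; case/orP: hS => [->//|/andP[-> /lt2 ->]]; rewrite orbT.
  + by case/andP => hf hS; apply: keep => //; rewrite hf lt2.
  + case: (full) => hS; first by split; auto; apply: D_via_up; auto.
    by apply: keep; [lia | case/orP: hS => [/lt2 ->//|->]; rewrite orbT].
  + by case: (full) => //= hS; apply: keep; eauto.
- move=> M hM; exists M => // t ht; exists t => // x hx.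
  case: M t hM ht => [|[|[|//]]] [|[|//]] _ _ /=.
  + by move=> hS; split; auto; apply: D_via_down; auto.
  + by move=> hS; apply: keep'; eauto.
  + by move=> hS; apply: keep'; eauto.
  + by move=> hS; apply: keep'; auto.
  + by case: (full) => //= hS; split; auto; apply: D_via_down; auto.
  + case: (full) => /= hS; first by apply: keep'; eauto.
    by apply: keep' => //; case/orP: hS => [/lt2 ->//|->]; rewrite orbT.
- move=> [|[|[|//]]] _; [exists 0 | exists (full : nat) | exists 0] => //=; rewrite ?ltnSn ?orbT //; by case: (full) => //=; rewrite ?ltnSn ?orbT.
move=> [|[|[|//]]] _; [exists 0 | exists 1 | exists (~~ full : nat)] => //=; rewrite ?ltnSn ?orbT //; by case: (full) => //=; rewrite ?ltnSn ?orbT.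
Qed.

Definition posB (g M t : nat) : nat := if t is 0 then g.-1 else 0.
Definition SAB (g M t : nat) : pred nat := fun i => if t is 0 then i < g else false.
(** From a new position, the attached ones in the current two-way stretch are reached backward
    through the last position, all others around the ring through position 0. Only mode 0 makes this
    distinction; the other modes send everything through 0. *)
Definition SBB (g M t : nat) : pred nat := fun i =>
  match M, t with
  | 0, 0 => (i < g) && ((q <= i) && R i g.-1)
  | 0, _ => (i < g) && ~~ ((q <= i) && R i g.-1)
  | _, 0 => false
  | _, _ => i < g
  end.
Definition iaB g := in_bound (SAB g) (posB g).
Definition oaB g := out_bound (SBB g) (posB g).

Section Beyond.
Hypothesis nfull : ~~ full.

Lemma D_up i j : i <= j -> j < m -> D i j = j - i.
Proof. by move=> hij hj; rewrite hDb // ?hij //; lia. Qed.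

Lemma D_run i j : j <= i -> i < m -> R j i -> 2 * (i - j) <= m -> D i j = i - j.
Proof.
move=> hij hi hR hm; rewrite hDb //; last lia.
by rewrite hR; case: ifP; lia.
Qed.

Lemma D_around i j : j < i -> i < m -> ~~ R j i -> D i j = m - (i - j).
Proof.
move=> hij hi /negPf hR; rewrite hDb //; last lia.
by rewrite hR ifF //; lia.
Qed.

Lemma D_around_via0 x y : x < y -> q <= y -> y < m -> ~~ R x y -> D y 0 + D 0 x <= D y x.
Proof.
move=> h1 h2 h3 h4; rewrite (D_around h1) // (@D_up 0 x) //; last lia.
rewrite D_around //; [lia | lia | exact: R2].
Qed.

(** The layout of the tables changes here. The edge from [q.-1] to [q] is not two-way, so everything
    attached reaches [q] through [q.-1] and is reached from it through 0, as mode 2 records. *)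
Lemma addB0 : q < m -> add_ok q (posA h q) (iaA h q) (oaA h q) (posB q.+1) (iaB q.+1) (oaB q.+1).
Proof.
move=> hqm.
have hh : h <= q by rewrite /h; lia.
have lt x : (x < h) || (h <= x < q) -> x < q by lia.
have via x : x < q -> D x q.-1 + D q.-1 q <= D x q.
  by move=> hx; rewrite !D_up; lia.
apply: (@add_from_sets q 2) => //.
- move=> [|[|//]] x _ _ /=; rewrite (negPf nfull) //= => /lt hx; split; [lia | exact: via].
- move=> [|[|//]] x _ _ /=; rewrite (negPf nfull) //= => /lt hx; split; first lia.
  by apply: D_around_via0 => //; exact: R2.
- move=> M hM; exists 2 => // -[|[|//]] _ /=; exists 0 => // x _; rewrite (negPf nfull) //= => /lt hx.
  split; [lia | exact: via].
- move=> M hM; exists 2 => // -[|[|//]] _ /=; exists 1 => // x _; rewrite (negPf nfull) //= => /lt hx.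
  by apply: keep' => //; [lia | case: (M) => [|[|[|?]]] /=; lia].
- by move=> M _; exists 0 => //=.
move=> [|[|[|//]]] _; [exists 0 | exists 1 | exists 1] => //=.
by rewrite ltnSn leqnn R0.
Qed.

Lemma addB j : q < j -> j < m -> add_ok j (posB j) (iaB j) (oaB j) (posB j.+1) (iaB j.+1) (oaB j.+1).
Proof.
move=> hqj hjm; have hm0 : 0 < m by lia.
have via x : x < j -> D x j.-1 + D j.-1 j <= D x j.
  by move=> hx; rewrite !D_up; lia.
have jj : j = j.-1.+1 by lia.
have runS x : x < j -> R x j = R x j.-1 && R j.-1 j by move=> hx; apply: R4; lia.
have down x : x < j -> q <= x -> R x j.-1 -> R j.-1 j -> D j j.-1 + D j.-1 x <= D j x.
  move=> hx hqx r1 r2.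
  have r3 : R x j by rewrite runS // r1.
  have := R3 hqx (ltnW hx) hjm r3; move=> hm.
  by rewrite (@D_run j j.-1) ?(@D_run j.-1 x) ?(@D_run j x) //; lia.
(* When the edge into [j] is not two-way, the current stretch ends, nothing is reached backward, and
   a mode that routes everything through 0 is called for. *)
have M0P : exists2 M0, M0 < 3 & (if R j.-1 j then M0 = 0 else M0 = 2).
  by case: (R j.-1 j); [exists 0 | exists 2].
have [M0 hM0 eM0] := M0P.
apply: (@add_from_sets j M0) => //.
- move=> [|[|//]] x _ _ //= hx; split; [lia | exact: via].
- move=> t x ht hxm hS; have hx : x < j.
    by move: hS; case: (M0) t ht {eM0} => [|M] [|[|//]] _ //= => /andP[].
  split; first lia.
  move: eM0; case: ifP => hr eM; rewrite eM in hS *; last first.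
    case: t ht hS => [|[|//]] _ //= _.
    by apply: D_around_via0; [| lia | | rewrite runS // hr andbF].
  case: t ht hS => [|[|//]] _ /=; first by move=> /andP[_ /andP[h1 h2]]; exact: down.
  move=> /andP[_ hn]; apply: D_around_via0; [by [] | lia | by [] |].
  rewrite runS // hr andbT; case: (leqP q x) hn => // hxq _.
  by apply: R2 => //; lia.
- move=> M hM; exists M => // -[|[|//]] _ /=; exists 0 => // x _ //= hx.
  split; [lia | exact: via].
- case hr : (R j.-1 j).
    move=> [|[|[|//]]] _; [exists 0 | exists 1 | exists 2] => // -[|[|//]] _ /=.
    + exists 0 => // x _ /andP[hx /andP[h1 h2]]; split; last exact: down.
      by rewrite ltnS (ltnW hx) h1 runS // h2 hr.
    + exists 1 => // x _ /andP[hx hn]; apply: (@keep' 0) => //.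
      by rewrite ltnS (ltnW hx) runS // hr andbT hn.
    + by exists 1.
    + by exists 1 => // x _ hx; apply: (@keep' 0) => //; exact: ltnW.
    + by exists 1.
    by exists 1 => // x _ hx; apply: (@keep' 0) => //; exact: ltnW.
  move=> [|[|[|//]]] _; exists 2 => // -[|[|//]] _ /=; exists 1 => // x _ //= hx; apply: (@keep' 0) => //; rewrite ?ltnS ?(ltnW hx) //.
  by rewrite runS // hr !andbF.
- by move=> M _; exists 0 => //=.
move=> [|[|[|//]]] _; [exists 0 | exists 1 | exists 1] => //=.
by rewrite ltnSn R0 andbT; lia.
Qed.

End Beyond.

Variable W : nat.
Hypothesis hW : forall i j, i < m -> j < m -> a i + D i j < W /\ D i j + b j < W.

Definition bounded (pos ia oa : nat -> nat -> nat) :=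
  forall M t, M < 3 -> t < 2 -> [/\ pos M t < m, ia M t <= W & oa M t <= W].

Lemma bounded_sets SA SB pos : (forall M t, M < 3 -> t < 2 -> pos M t < m) ->
  bounded pos (in_bound SA pos) (out_bound SB pos).
Proof.
move=> hp M t hM ht; have h' := hp M t hM ht; split=> //.
  by apply/bigmax_leqP => i _; have [] := hW (ltn_ord i) h'.
by apply/bigmax_leqP => i _; have [] := hW h' (ltn_ord i).
Qed.

Lemma boundedA g1 g2 : g1 <= h -> g2 <= q -> bounded (posA g1 g2) (iaA g1 g2) (oaA g1 g2).
Proof.
move=> h1 h2; apply: bounded_sets; have hh : h < m by rewrite /h; lia.
by move=> [|[|[|//]]] [|[|//]] _ _ /=; try case: (full); lia.
Qed.

Lemma boundedB g : 0 < g -> g <= m -> bounded (posB g) (iaB g) (oaB g).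
Proof.
by move=> h1 h2; apply: bounded_sets => [] M [|[|//]] _ _ /=; lia.
Qed.

(** [DS] stands for derivability of a scan state. Only its closure under admissible extensions is
    used, so the schedule of the three lanes is settled here once and for all. *)
Lemma scan_complete (DS : nat -> nat -> nat -> (nat -> nat -> nat) -> (nat -> nat -> nat) -> (nat -> nat -> nat) -> Prop) :
  (forall pos ia oa, bounded pos ia oa -> DS 0 h q pos ia oa) ->
  (forall g1 g2 g3 pos ia oa pos' ia' oa', g1 < h -> bounded pos' ia' oa' ->
     DS g1 g2 g3 pos ia oa -> add_ok g1 pos ia oa pos' ia' oa' -> DS g1.+1 g2 g3 pos' ia' oa') ->
  (forall g1 g2 g3 pos ia oa pos' ia' oa', h <= g2 < q -> bounded pos' ia' oa' ->
     DS g1 g2 g3 pos ia oa -> add_ok g2 pos ia oa pos' ia' oa' -> DS g1 g2.+1 g3 pos' ia' oa') ->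
  (forall g1 g2 g3 pos ia oa pos' ia' oa', q <= g3 < m -> bounded pos' ia' oa' ->
     DS g1 g2 g3 pos ia oa -> add_ok g3 pos ia oa pos' ia' oa' -> DS g1 g2 g3.+1 pos' ia' oa') ->
  exists pos ia oa, DS h q m pos ia oa.
Proof.
move=> H0 H1 H2 H3.
have hh : h <= q by rewrite /h; lia.
pose T g1 g2 := DS g1 g2 q (posA g1 g2) (iaA g1 g2) (oaA g1 g2).
(* In each round the second lane moves before the first, which keeps the lead demanded by [addA1]
   and the lag demanded by [addA2]. *)
have A s : T (minn s h) (minn (h + s) q).
  elim: s => [|s IH].
    have -> : minn (h + 0) q = h by lia.
    by rewrite min0n; apply: H0; apply: boundedA; lia.
  have {}IH : T (minn s h) (minn (h + s.+1) q).
    case: (ltnP (h + s) q) => hs; last first.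
      by have -> : minn (h + s.+1) q = minn (h + s) q by lia.
    have e : minn (h + s) q = h + s by lia.
    rewrite e in IH; have -> : minn (h + s.+1) q = (h + s).+1 by lia.
    apply: (H2 _ _ _ _ _ _ _ _ _ _ _ IH); [lia | apply: boundedA; lia |].
    by apply: addA2; lia.
  case: (ltnP s h) => hs; last first.
    by have -> : minn s.+1 h = minn s h by lia.
  have e : minn s h = s by lia.
  rewrite e in IH; have -> : minn s.+1 h = s.+1 by lia.
  apply: (H1 _ _ _ _ _ _ _ _ _ _ _ IH) => //; [apply: boundedA; lia |].
  by apply: addA1; lia.
have {}A : DS h q q (posA h q) (iaA h q) (oaA h q).
  have e1 : minn m h = h by lia.
  have e2 : minn (h + m) q = q by lia.
  by have := A m; rewrite e1 e2.
case: (ltnP q m) => hqm; last first.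
  have e : q = m by lia.
  by exists (posA h q), (iaA h q), (oaA h q); move: A; rewrite {2}e.
have nf : ~~ full by apply/negP => /qfull; lia.
have B k : q + k < m -> let g := (q + k).+1 in DS h q g (posB g) (iaB g) (oaB g).
  elim: k => [|k IH] hk /=.
    by rewrite addn0; apply: (H3 _ _ _ _ _ _ _ _ _ _ _ A); [lia | apply: boundedB; lia | exact: addB0].
  rewrite addnS; apply: (H3 _ _ _ _ _ _ _ _ _ _ _ (IH _)); [lia | apply: boundedB; lia | lia |].
  by apply: addB; lia.
have := B (m.-1 - q); have -> : (q + (m.-1 - q)).+1 = m by lia.
by move=> {}B; exists (posB m), (iaB m), (oaB m); apply: B; lia.
Qed.

End Scan.

(** * Decomposing orientations *)

Section Restrict.
Variable n : nat.
Local Notation V := 'I_n.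
Implicit Types (B : arcs n) (x y z : V).

(** A map that sends each arc to an arc or to a single vertex does not lengthen walks. This is used
    for retractions onto a part and for the projection onto a ring. *)
Lemma dist_map B B' (f : V -> V) x y l :
  (forall a b, (a, b) \in B -> f a = f b \/ (f a, f b) \in B') ->
  dist_le B x y l -> dist_le B' (f x) (f y) l.
Proof.
move=> hf; elim: l x => [|l IH] x.
  by move/dist0 => ->; apply: dist_weak (subxx _) (leq0n _) (dist_refl _ _).
case/dist_step => [->|[z hz /IH h]]; first by apply: dist_weak (subxx _) (leq0n _) (dist_refl _ _).
case: (hf _ _ hz) => [->|hz']; first by apply: dist_weak (subxx _) (leqnSn _) h.
exact: dist_trans (dist_arc hz') h (leqnn _).
Qed.

Lemma gate_out B (X : {set V}) v x y l :
  (forall a b, (a, b) \in B -> a \in X -> b \notin X -> a = v) ->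
  dist_le B x y l -> x \in X -> y \notin X ->
  exists l1 l2, [/\ l1 + l2 <= l, dist_le B x v l1 & dist_le B v y l2].
Proof.
move=> hX; elim: l x => [|l IH] x; first by move=> /dist0 -> ->.
case/dist_step => [-> ->//|[z hz h]] hx hy.
case: (boolP (z \in X)) => hzX.
  have [l1 [l2 [h1 h2 h3]]] := IH z h hzX hy.
  exists l1.+1, l2; split=> //; exact: dist_trans (dist_arc hz) h2 (leqnn _).
have ex := hX _ _ hz hx hzX; subst x.
exists 0, l.+1; split=> //; first exact: dist_refl.
exact: dist_trans (dist_arc hz) h (leqnn _).
Qed.

Lemma gate_in B (X : {set V}) v x y l :
  (forall a b, (a, b) \in B -> a \notin X -> b \in X -> b = v) ->
  dist_le B x y l -> x \notin X -> y \in X ->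
  exists l1 l2, [/\ l1 + l2 <= l, dist_le B x v l1 & dist_le B v y l2].
Proof.
move=> hX; elim: l x => [|l IH] x; first by move=> /dist0 -> /negP.
case/dist_step => [-> /negP//|[z hz h]] hx hy.
case: (boolP (z \in X)) => hzX; last first.
  have [l1 [l2 [h1 h2 h3]]] := IH z h hzX hy.
  exists l1.+1, l2; split=> //; exact: dist_trans (dist_arc hz) h2 (leqnn _).
have ez := hX _ _ hz hx hzX; subst z.
by exists 1, l; split=> //; exact: dist_arc.
Qed.

(** The least valid bound is attained by some vertex. Attainment is what turns a diameter bound into
    an inequality between radii; classical reasoning enters because [P] is not decidable as
    stated. *)
Lemma eccentricity (P : V -> nat -> Prop) (X : {set V}) v a :
  v \in X -> (forall x l l', l <= l' -> P x l -> P x l') -> (forall x, x \in X -> P x a) ->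
  exists a0, [/\ a0 <= a, forall x, x \in X -> P x a0 & exists2 x, x \in X & forall l, P x l -> a0 <= l].
Proof.
move=> hv mono; elim: a => [|a IH] h; first by exists 0; split=> //; exists v.
case: (classic (forall x, x \in X -> P x a)) => [/IH[a0 [h1 h2 h3]]|hn].
  by exists a0; split=> //; lia.
exists a.+1; split=> //; apply: NNPP => hn2; apply: hn => x hx.
apply: NNPP => hn3; apply: hn2; exists x => // l hl; rewrite ltnNge; apply/negP => hla.
by apply: hn3; apply: mono hla hl.
Qed.

Lemma nat_choice (T : Type) (m : nat) (P : nat -> T -> Prop) (t0 : T) :
  (forall j, j < m -> exists t, P j t) -> exists f : nat -> T, forall j, j < m -> P j (f j).
Proof.
elim: m => [|m IH] h; first by exists (fun=> t0).
have [f hf] := IH (fun j hj => h j (ltnW hj)); have [t ht] := h m (ltnSn m).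
exists (fun j => if j == m then t else f j) => j; rewrite ltnS leq_eqVlt.
by case: eqP => [-> _|_ /=]; [| exact: hf].
Qed.

Definition restr B (X : {set V}) : arcs n := [set e in B | (e.1 \in X) && (e.2 \in X)].

Lemma restrE B X x y : ((x, y) \in restr B X) = [&& (x, y) \in B, x \in X & y \in X].
Proof. by rewrite inE. Qed.

End Restrict.

Section FullSolutions.
Variables (n : nat) (A : arcs n) (d : nat).
Local Notation V := 'I_n.
Local Notation g := (uadj A).

(** Every adjacency keeps an arc. This strengthens [sol], where arcs may be dropped, and is what
    allows a direction to be read off a ring. *)
Definition full_on (X : {set V}) (B : arcs n) :=
  forall x y, x \in X -> y \in X -> g x y -> (x, y) \in B \/ (y, x) \in B.

Definition solf X v a b c := exists2 B, sol_with A d B X v a b c & full_on X B.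

Hypothesis noloop : loopless A.

Lemma valid_restr B X : valid A B -> valid A (restr B X).
Proof.
move=> hv x y; rewrite !restrE => /and3P[hB _ _] hA; have [h1 /negPf h2] := hv x y hB hA.
by rewrite h2.
Qed.

Lemma valid_adj B x y : valid A B -> (x, y) \in B -> g x y.
Proof.
move=> hv hB; rewrite /uadj; case: (boolP ((x, y) \in A)) => //= hA.
by have [] := hv x y hB hA.
Qed.

(* restricting a solution to a set onto which the walks can be retracted *)
Lemma solf_restr B X (X1 : {set V}) v v1 a b c (f : V -> V) a1 b1 : sol_with A d B X v a b c -> full_on X B -> X1 \subset X ->
  (forall x, x \in X1 -> f x = x) ->
  (forall x y, (x, y) \in B -> f x = f y \/ (f x, f y) \in restr B X1) ->
  (forall x, x \in X1 -> dist_le B x v1 a1 /\ dist_le B v1 x b1) -> v1 \in X1 ->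
  solf X1 v1 a1 b1 #|restr B X1 :\: A|.
Proof.
move=> [s1 s2 s3 s4 s5] hf /subsetP hX h1 h2 h3 hv1.
have tr x y l : x \in X1 -> y \in X1 -> dist_le B x y l -> dist_le (restr B X1) x y l.
  by move=> hx hy /(dist_map h2); rewrite !h1.
exists (restr B X1); first split=> //.
- by move=> x y; rewrite restrE => /and3P[].
- exact: valid_restr.
- by move=> x hx; have [p q] := h3 x hx; split; apply: tr.
- by move=> x y hx hy; apply: tr => //; apply: s5; apply: hX.
move=> x y hx hy hg; rewrite !restrE hx hy !andbT.
by apply: hf => //; apply: hX.
Qed.

(** Reversing one arc of a two-way pair merges it with its opposite, so arcs can disappear. The
    invariant [Inv] says that adjacency is nevertheless preserved and that no two-way pair is
    created; the number of new arcs grows by at most one per reversal. *)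
Lemma revs_full B0 j : revs j A B0 -> diam_le B0 d -> forall v a b,
  d <= a -> d <= b -> solf [set: V] v a b j.
Proof.
move=> hr hd v a b ha hb.
pose Inv (A1 B1 : arcs n) := [/\ loopless B1, forall x y, uadj A1 x y -> uadj B1 x y,
  forall x y, (x, y) \in B1 -> uadj A1 x y &
  forall x y, (x, y) \in B1 -> (y, x) \in B1 -> (x, y) \in A1 /\ (y, x) \in A1].
have [[i1 i2 i3 i4] hc] : Inv A B0 /\ #|B0 :\: A| <= j.
  elim: hr noloop => {hd B0 j ha hb v a b} [A1|j A1 B1 [y x] hA1 _ IH] hl.
    by split; [split=> // x y h; rewrite /uadj h | rewrite setDv cards0].
  have inA2 z w : ((z, w) \in reverse_arc A1 (y, x)) = ((z, w) != (y, x)) && ((z, w) \in A1) || ((z, w) == (x, y)).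
    by rewrite !inE.
  have nxy : y != x by apply/eqP => e; move: hA1; rewrite e (negPf (hl x)).
  have hl2 : loopless (reverse_arc A1 (y, x)).
    move=> z; rewrite inA2 (negPf (hl z)) andbF /= xpair_eqE; apply/negP => /andP[/eqP e1 /eqP e2].
    by rewrite -e1 -e2 eqxx in nxy.
  have [[j1 j2 j3 j4] jc] := IH hl2; split; last first.
    have : #|B1 :\: A1| <= #|B1 :\: reverse_arc A1 (y, x)| + #|[set (x, y)]|.
      apply: leq_trans (subset_leq_card _) (leq_card_setU _ _).
      apply/subsetP => -[z w]; rewrite !in_setD in_setU in_setD in_set1 inA2 => /andP[/negPf -> ->].
      by rewrite andbF /= andbT orNb.
    by rewrite cards1; lia.
  split=> //.
  - move=> z w h; apply: j2; move: h; rewrite /uadj !inA2.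
    case: (eqVneq (z, w) (y, x)) => [[-> ->]|_] /=; first by rewrite eqxx !orbT.
    case: (eqVneq (w, z) (y, x)) => [[-> ->]|_] /=; first by rewrite eqxx !orbT.
    by case/orP => ->; rewrite ?orbT.
  - move=> z w /j3; rewrite /uadj !inA2; case/orP => /orP[/andP[_ ->]|/eqP[-> ->]]; rewrite ?orbT ?hA1 ?orbT //.
  move=> z w h1 h2; have [] := j4 z w h1 h2; rewrite !inA2.
  case: (eqVneq (z, w) (y, x)) => [[-> ->]|ne1] /=.
    by rewrite xpair_eqE (negPf nxy).
  case: (eqVneq (w, z) (y, x)) => [[-> ->]|ne2] /=.
    by rewrite [(y, x) == _]xpair_eqE (negPf nxy).
  case: (eqVneq (z, w) (x, y)) => [[ez ew]|_]; first by move: ne2; rewrite ez ew eqxx.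
  case: (eqVneq (w, z) (x, y)) => [[ez ew]|_]; first by move: ne1; rewrite ez ew eqxx.
  by rewrite !orbF.
exists B0; first split=> //.
- move=> x y hB hA; have := i3 x y hB; rewrite /uadj (negPf hA) /= => h; split=> //.
  by apply/negP => h2; have [] := i4 x y hB h2; rewrite (negPf hA).
- by move=> x _; split; apply: dist_weak (subxx _) _ (hd _ _).
by move=> x y _ _ /i2 /orP.
Qed.

End FullSolutions.

(** Unless all edges are two-way, the ring is read from the start of a longest run; [q] counts its
    vertices, one more than its edges. Any other run is no longer and is disjoint from it, hence
    covers at most half the ring. *)
Lemma run_shape (m : nat) (b : nat -> bool) : 0 < m -> (forall j, b (j + m) = b j) ->
  (forall j, b j) \/
  exists2 K, K < m & exists q, [/\ 0 < q <= m, ~~ b (K + m.-1), forall i, i < q.-1 -> b (K + i),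
    ~~ b (K + q.-1) &
    forall j i, q <= j -> j <= i -> i < m -> (forall k, j <= k < i -> b (K + k)) -> 2 * (i - j) <= m].
Proof.
move=> m0 hper.
have hmod j : b (j %% m) = b j.
  rewrite [in RHS](divn_eq j m) addnC; elim: (j %/ m) => [|k IH]; first by rewrite addn0.
  by rewrite mulSn addnCA addnC hper.
case: (boolP [forall j : 'I_m, b j]) => [/forallP hall|/forallPn[j0 hj0]]; [left => j | right].
  by rewrite -hmod; apply: (hall (Ordinal (ltn_pmod j m0))).
pose P L := (L < m) && [exists K : 'I_m, ~~ b (K + m.-1) && [forall i : 'I_L, b (K + i)]].
have P_intro K L : L < m -> ~~ b (K + m.-1) -> (forall i, i < L -> b (K + i)) -> P L.
  move=> hL h1 h2; rewrite /P hL; apply/existsP; exists (Ordinal (ltn_pmod K m0)) => /=.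
  rewrite -hmod modnDml hmod h1; apply/forallP => i /=.
  by rewrite -hmod modnDml hmod h2.
have exP : exists L, P L.
  exists 0; apply: (P_intro j0.+1) => //.
  by rewrite addSnnS prednK // hper.
have ubP L : P L -> L <= m by case/andP; lia.
case: (ex_maxnP exP ubP) => L /andP[hL /existsP[K /andP[hK /forallP hrun]]] hmax.
have hr i : i < L -> b (K + i) by move=> hi; exact: (hrun (Ordinal hi)).
have hnL : ~~ b (K + L).
  case: (ltnP L.+1 m) => hLm; last first.
    by have -> : L = m.-1 by lia.
  apply/negP => hb; suff : P L.+1 by move/hmax; lia.
  apply: (P_intro K) => // i; rewrite ltnS leq_eqVlt => /orP[/eqP ->//|]; exact: hr.
exists K => //; exists L.+1; split=> //=.
move=> j i hj hji him hb.
(* The run is extended to the left until an edge outside it is met, because [P] speaks of runs with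
   such a left end. *)
have : exists j0, (j0 <= j) && (L.+1 <= j0) && all (fun k => b (K + k)) (iota j0 (j - j0)).
  by exists j; rewrite leqnn hj subnn.
case/ex_minnP => j1 /andP[/andP[h1 h2] h3] hmin.
have h3' k : j1 <= k < i -> b (K + k).
  move=> hk; case: (ltnP k j) => hkj; last by apply: hb; lia.
  by apply: (allP h3); rewrite mem_iota; lia.
have hn1 : ~~ b (K + j1.-1).
  case: (ltnP L.+1 j1) => hlt; last by have -> : j1.-1 = L by lia.
  apply/negP => hb1; suff : j1 <= j1.-1 by lia.
  apply: hmin; apply/andP; split; first by lia.
  have -> : j - j1.-1 = (j - j1).+1 by lia.
  by rewrite /= hb1 prednK //; lia.
have hP : P (i - j1).
  apply: (P_intro (K + j1)); first by lia.
    have -> : K + j1 + m.-1 = K + j1.-1 + m by lia.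
    by rewrite hper.
  by move=> k hk; rewrite -addnA; apply: h3'; lia.
by have := hmax _ hP; lia.
Qed.

(** * Distances on a ring, and its orientation in a given solution *)

Section RingOps.
Variables (n : nat) (A : arcs n).
Local Notation V := 'I_n.
Local Notation g := (uadj A).

Lemma gminus_eq (s s' : seq V) : cycle_edges s = cycle_edges s' -> gminus A s =2 gminus A s'.
Proof. by move=> e x y; rewrite /gminus e. Qed.

Lemma ring_same (s s' : seq V) : ring A s -> size s' = size s -> uniq s' -> cycle g s' -> s' =i s ->
  cycle_edges s' = cycle_edges s -> ring A s'.
Proof.
move=> [h1 h2 h3 h4] e1 h5 h6 e2 e3; split; rewrite ?e1 // => x y; rewrite !e2 => hx hy.
by rewrite (eq_connect (gminus_eq e3)); exact: h4.
Qed.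

Lemma ring_rot k (s : seq V) : ring A s -> ring A (rot k s).
Proof.
move=> hs; have [h1 h2 h3 h4] := hs; apply: (ring_same hs); rewrite ?size_rot ?rot_uniq ?rot_cycle //.
- by move=> x; rewrite mem_rot.
exact: cycle_edges_rot.
Qed.

Lemma ring_rev (s : seq V) : ring A s -> ring A (rev s).
Proof.
move=> hs; have [h1 h2 h3 h4] := hs; apply: (ring_same hs); rewrite ?size_rev ?rev_uniq //.
- by rewrite rev_cycle; rewrite (eq_cycle (e' := g)) // => a b; exact: g_sym.
- by move=> x; rewrite mem_rev.
apply/setP => -[x y]; rewrite !cycle_edgesE !mem_rev !next_rev //.
case: (boolP (x \in s)) => //= hx; case: (boolP (y \in s)) => //= hy.
have key a b : (prev s a == b) = (next s b == a).
  by apply/eqP/eqP => <-; [rewrite next_prev | rewrite prev_next].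
by rewrite !key orbC.
Qed.

Lemma rc_rot (s : seq V) x0 K j : ring A s -> K < size s -> rc (rot K s) x0 j = rc s x0 (K + j).
Proof.
move=> hs hK; have us : uniq s by case: hs.
elim: j => [|j IH].
  rewrite addn0 /rc mod0n modn_small // /rot nth_cat size_drop subn_gt0 hK nth_drop.
  by rewrite addn0.
rewrite -(rc_next x0 (ring_rot K hs)) IH next_rot // (rc_next x0 hs).
by rewrite addnS.
Qed.

End RingOps.

Section RingDistance.
Variables (n : nat) (A : arcs n).
Local Notation V := 'I_n.
Hypothesis cact : cactus A.
Hypothesis noloop : loopless A.
Variables (s : seq V) (x0 : V).
Hypothesis ringS : ring A s.
Local Notation m := (size s).
Local Notation c := (rc s x0).

Definition two_way (j : nat) := ((c j, c j.+1) \in A) && ((c j.+1, c j) \in A).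

Lemma two_way_per j : two_way (j + m) = two_way j.
Proof. by rewrite /two_way -addSn !rc_addm. Qed.

Lemma rdist_fwd i k : dist_le (ring_arcs A s) (c i) (c (i + k)) k.
Proof.
elim: k => [|k IH]; first by rewrite addn0; exact: dist_refl.
by rewrite addnS; apply: (dist_trans IH (dist_arc (ring_arcs_fwd x0 ringS (i + k)))); rewrite addn1.
Qed.

Lemma rdist_bwd i k : (forall j, i <= j < i + k -> two_way j) ->
  dist_le (ring_arcs A s) (c (i + k)) (c i) k.
Proof.
elim: k => [|k IH] h; first by rewrite addn0; exact: dist_refl.
have /andP[h1 h2] : two_way (i + k) by apply: h; lia.
rewrite addnS; apply: dist_trans (dist_arc (ring_arcs_bwd ringS h1 h2)) (IH _) _; last by [].
by move=> j hj; apply: h; lia.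
Qed.

Definition linked (i j : nat) := all two_way (iota i (j - i)).

Lemma linkedP i j : reflect (forall k, i <= k < j -> two_way k) (linked i j).
Proof.
apply: (iffP allP) => h k hk; apply: h; rewrite ?mem_iota //; first by lia.
by move: hk; rewrite mem_iota; lia.
Qed.

(** In the case [full] this is the distance on an undirected cycle. Otherwise the edge from position
    [m.-1] to position 0 is not two-way, so a backward route cannot cross it: for [i <= j] only the
    forward route remains. *)
Definition ring_dist (full : bool) (i j : nat) : nat :=
  if full then minn ((i - j) + (j - i)) (m - ((i - j) + (j - i)))
  else if i <= j then j - i else if linked j i then minn (i - j) (m - (i - j)) else m - (i - j).

Lemma ring_dist_ub (full : bool) i j : i < m -> j < m -> (full -> forall k, two_way k) ->
  dist_le (ring_arcs A s) (c i) (c j) (ring_dist full i j).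
Proof.
move=> hi hj hf.
have fwd : i <= j -> dist_le (ring_arcs A s) (c i) (c j) (j - i).
  by move=> hij; have := rdist_fwd i (j - i); rewrite subnKC.
have around : j <= i -> dist_le (ring_arcs A s) (c i) (c j) (m - (i - j)).
  move=> hij; have := rdist_fwd i (m - (i - j)).
  have -> : i + (m - (i - j)) = j + m by lia.
  by rewrite rc_addm.
have bwd : j <= i -> linked j i -> dist_le (ring_arcs A s) (c i) (c j) (i - j).
  move=> hij /linkedP hr; have := @rdist_bwd j (i - j); rewrite subnKC //; apply=> k hk; apply: hr; lia.
have wrap : full -> i <= j -> dist_le (ring_arcs A s) (c i) (c j) (m - (j - i)).
  move=> ff hij; have := @rdist_bwd j (m - (j - i)) (fun k _ => hf ff k).
  have -> : j + (m - (j - i)) = i + m by lia.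
  by rewrite rc_addm.
rewrite /ring_dist; case: ifP => [ff|_].
  case: (leqP i j) => hij.
    have -> : i - j + (j - i) = j - i by lia.
    by case: (leqP (j - i) (m - (j - i))) => _; [exact: fwd | exact: wrap].
  have -> : i - j + (j - i) = i - j by lia.
  case: (leqP (i - j) (m - (i - j))) => _; [apply: bwd | apply: around]; try lia.
  by apply/linkedP => k _; exact: hf.
case: ifP => hij; first exact: fwd.
case: ifP => hr; last by apply: around; lia.
by case: (leqP (i - j) (m - (i - j))) => _; [apply: bwd | apply: around]; try lia.
Qed.

(** The formula drops by at most one along any ring arc and vanishes on the diagonal, so it bounds
    the length of every walk. *)
Lemma ring_dist_lb (full : bool) i j l : i < m -> j < m -> (full \/ ~~ two_way m.-1) ->
  dist_le (ring_arcs A s) (c i) (c j) l -> ring_dist full i j <= l.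
Proof.
move=> hi hj hfull; have hm := ring_size ringS; elim: l i hi => [|l IH] i hi.
  move/dist0/(rc_inj ringS hi hj) => ->.
  by rewrite /ring_dist subnn addn0 min0n leqnn; case: ifP.
have zero : ring_dist full j j = 0.
  by rewrite /ring_dist subnn addn0 min0n leqnn; case: ifP.
case/dist_step => [/(rc_inj ringS hi hj) ->|[z hz hd]]; first by rewrite zero.
suff [i' hi' [ez hle]] : exists2 i', i' < m & z = c i' /\ ring_dist full i j <= (ring_dist full i' j).+1.
  by rewrite ez in hd; apply: leq_trans hle _; rewrite ltnS; exact: IH.
move: hz; rewrite ring_arcsE => /andP[he hor].
have [_ hzs] := ring_edge_mem he.
have [/eqP e1|nfw] := boolP (next s (c i) == z).
  exists (if i.+1 < m then i.+1 else 0); first by case: ifP; lia.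
  rewrite -e1 (rc_next x0 ringS); split.
    case: ltnP => h //; have -> : i.+1 = m by lia.
    by rewrite -(add0n m) rc_addm.
  rewrite /ring_dist; case: (full) => /=; first by case: ltnP; lia.
  case: (ltnP i.+1 m) => h.
    case: (leqP i j) => hij; first by case: (leqP i.+1 j) => h2; lia.
    have -> : (i.+1 <= j) = false by lia.
    case r1: (linked j i.+1); last by case: ifP => _; move: h hij; clear; lia.
    have -> : linked j i by apply/linkedP => k hk; move/linkedP: r1; apply; lia.
    lia.
  by rewrite leq0n subn0; case: (leqP i j) => hij; [lia | case: ifP => _; lia].
have [j1 hj1 ej1] := rc_surj x0 hzs.
move: hor; rewrite (negPf nfw) /= => /andP[t1 t2].
have e2 : c j1.+1 = c i.
  move: he; rewrite cycle_edgesE (negPf nfw) /= => /and3P[_ _ /eqP <-].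
  by rewrite ej1 (rc_next x0 ringS).
have htw : two_way j1 by rewrite /two_way e2 -ej1 t1 t2.
exists j1 => //; split=> //.
case: (ltnP j1.+1 m) => h.
  have ei : i = j1.+1 by apply: (rc_inj (x0 := x0) ringS hi h); rewrite e2.
  subst i; rewrite /ring_dist; case: (full) => /=; first lia.
  case: (leqP j1.+1 j) => hij; first by case: (leqP j1 j) => h2; lia.
  have er : linked j j1 -> linked j j1.+1.
    move=> /linkedP r1; apply/linkedP => k hk; case: (ltnP k j1) => hk1; first by apply: r1; lia.
    by have -> : k = j1 by lia.
  case: (leqP j1 j) => h2.
    by rewrite er; [move: h h2 hij; clear; lia | apply/linkedP => k; move: h2 hij; clear; lia].
  case r1: (linked j j1); last by case: ifP => _; move: h h2 hij; clear; lia.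
  by rewrite er //; move: h h2 hij; clear; lia.
have ej : j1 = m.-1 by lia.
have ei : i = 0.
  apply: (rc_inj (x0 := x0) ringS hi); first by lia.
  have e3 : j1.+1 = 0 + m by lia.
  by rewrite -e2 e3 rc_addm.
case: hfull => [->|]; last by rewrite -ej htw.
by rewrite /ring_dist ei; lia.
Qed.

End RingDistance.

Section Orientation.
Variables (n : nat) (A : arcs n).
Local Notation V := 'I_n.
Local Notation g := (uadj A).
Hypothesis cact : cactus A.
Hypothesis noloop : loopless A.

(** Suppose one ring edge lacks its forward arc and another its backward arc. The regions on one
    side between these two edges then have no arc leaving them, against strong connectivity. So all
    forward arcs are present, or all backward ones. *)
Lemma orient (s : seq V) x0 (B : arcs n) : ring A s -> valid A B ->
  (forall x y, x \in s -> y \in s -> g x y -> (x, y) \in B \/ (y, x) \in B) ->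
  (forall x y, x \in s -> y \in s -> exists l, dist_le B x y l) ->
  exists s', [/\ ring A s', s' =i s & forall j, (rc s' x0 j, rc s' x0 j.+1) \in B].
Proof.
move=> hs hv hfull hdist; have hm := ring_size hs; have m0 := m_gt0 hs.
set c := rc s x0; set m := size s in hm m0.
case: (classic (forall j, (c j, c j.+1) \in B)) => [h|hn]; first by exists s.
have [i hi] : exists i, (c i, c i.+1) \notin B.
  by apply: NNPP => h; apply: hn => j; apply/negPn/negP => h'; apply: h; exists j.
have bwd j : (c j.+1, c j) \in B.
  apply/negPn/negP => hj.
  pose a := (j %% m + (m - i.+1 %% m)) %% m.
  have ea : c (i.+1 + a) = c j.
    apply/eqP; rewrite (rc_eq x0 hs) /a modnDmr -(modnDml i.+1) addnCA.
    have him : i.+1 %% m < m by rewrite ltn_mod.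
    have -> : i.+1 %% m + (m - i.+1 %% m) = m by lia.
    by rewrite modnDr modn_mod.
  have am : a < m by rewrite ltn_mod.
  have ea1 : c (i.+1 + a).+1 = c j.+1 by have := congr1 (next s) ea; rewrite /c !(rc_next x0 hs).
  have am1 : a < m.-1.
    rewrite ltnNge; apply/negP => h; have e : a = m.-1 by lia.
    have ei : c j = c i by rewrite -ea e addSnnS prednK // /c rc_addm.
    have ei1 : c j.+1 = c i.+1 by have := congr1 (next s) ei; rewrite /c !(rc_next x0 hs).
    have [] := hfull (c i) (c i.+1) (rc_mem x0 hs _) (rc_mem x0 hs _) (rc_adj x0 hs i).
      by rewrite (negPf hi).
    by rewrite -ei -ei1 (negPf hj).
  (* The regions from position [j.+1] around to position [i]. They could only be left by the two
     missing arcs. *)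
  pose Q x := exists2 k, a < k < m & x \in region A s x0 (i.+1 + k).
  have [l hl] := hdist (c i) (c i.+1) (rc_mem x0 hs _) (rc_mem x0 hs _).
  have Qi : Q (c i).
    exists m.-1; first by lia.
    by rewrite addSnnS prednK // -region_mod modnDr region_mod region_root.
  have nQ : ~ Q (c i.+1).
    move=> [k hk hx]; have := region_ring hs (rc_mem x0 hs i.+1) hx.
    move/eqP; rewrite (rc_eq x0 hs) -[X in X == _ %[mod _]]addn0 eqn_modDl mod0n modn_small; lia.
  suff step x y : Q x -> (x, y) \in B -> Q y.
    elim: l (c i) hl Qi => [|l IH] x; first by move/dist0 => ->.
    by case/dist_step => [->//|[z hz hd] /step/(_ hz)]; exact: IH.
  move=> [k hk hx] hxy; have hg := valid_adj hv hxy.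
  case: (boolP ((x, y) \in cycle_edges s)) => he; last first.
    by exists k => //; exact: region_step hx hg he.
  have [hxs hys] := ring_edge_mem he.
  have ex := region_ring hs hxs hx.
  move: he; rewrite cycle_edgesE hxs hys /= => /orP[/eqP e1|/eqP e1].
    have ey : y = c (i.+1 + k.+1) by rewrite -e1 ex (rc_next x0 hs) addnS.
    case: (ltnP k.+1 m) => hk1; first by exists k.+1; [lia | rewrite ey; exact: region_root].
    have ek : k = m.-1 by lia.
    have e1' : c (i.+1 + k) = c i by rewrite (_ : i.+1 + k = i + m); [exact: rc_addm | lia].
    have e2' : c (i.+1 + k.+1) = c i.+1.
      by rewrite (_ : i.+1 + k.+1 = i.+1 + m); [exact: rc_addm | lia].
    by move: hxy; rewrite ex ey -/c e1' e2' (negPf hi).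
  have [t ht ey] := rc_surj x0 hys.
  have ety : c t = c (i + k).
    have : c t.+1 = c (i + k).+1 by rewrite /c -(rc_next x0 hs) -ey e1 ex.
    move/eqP; rewrite /c !(rc_eq x0 hs) -(addn1 t) -(addn1 (i + k)) eqn_modDr -(rc_eq x0 hs).
    by move/eqP.
  case: (ltnP a.+1 k) => hk1.
    exists k.-1; first by lia.
    by rewrite ey -/c ety addSnnS prednK; [exact: region_root | lia].
  have ek : k = a.+1 by lia.
  have e1' : c (i.+1 + k) = c j.+1 by rewrite ek addnS.
  have e2' : c (i + k) = c j by rewrite (_ : i + k = i.+1 + a); [exact: ea | lia].
  by move: hxy; rewrite ex ey -/c ety e1' e2' (negPf hj).
exists (rev s); split; first exact: ring_rev.
  by move=> x; rewrite mem_rev.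
move=> j; rewrite -(rc_next x0 (ring_rev hs)) next_rev; last by case: hs.
set x := rc _ _ _; have hx : x \in s by rewrite -mem_rev; exact: (rc_mem x0 (ring_rev hs)).
have hp : prev s x \in s by rewrite mem_prev.
have [t ht et] := rc_surj x0 hp.
have ex : x = c t.+1 by rewrite /c -(rc_next x0 hs) -et next_prev //; case: hs.
by rewrite et ex; exact: bwd.
Qed.

(** Normal form of a ring: a longest two-way stretch starts at position 0, so that, unless all edges
    are two-way, no ring walk crosses backward from position 0 to the last one. *)
Lemma ring_shape (s : seq V) x0 (B : arcs n) : ring A s -> (forall j, (rc s x0 j, rc s x0 j.+1) \in B) ->
  exists s' (full : bool) q, [/\ ring A s', s' =i s, forall j, (rc s' x0 j, rc s' x0 j.+1) \in B,
   [/\ full -> forall k, two_way A s' x0 k, full \/ ~~ two_way A s' x0 (size s').-1,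
       0 < q, q <= size s' & full -> q = size s'] &
   [/\ forall i j, j <= i -> i < q -> linked A s' x0 j i,
       forall i j, j < q -> q <= i -> i < size s' -> ~~ linked A s' x0 j i &
       forall i j, q <= j -> j <= i -> i < size s' -> linked A s' x0 j i -> 2 * (i - j) <= size s']].
Proof.
move=> hs hB; have m0 := m_gt0 hs.
have [hall|[K hK [q [/andP[q0 qm] h1 h2 h3 h4]]]] := run_shape m0 (two_way_per A s x0).
  exists s, true, (size s); split=> //; first by split=> //; left.
  split; [|lia|lia].
  by move=> i j _ _; apply/linkedP => k _.
have hr := ring_rot K hs.
have er j : rc (rot K s) x0 j = rc s x0 (K + j) by exact: (rc_rot _ _ hs hK).
have et j : two_way A (rot K s) x0 j = two_way A s x0 (K + j) by rewrite /two_way !er !addnS.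
exists (rot K s), false, q; rewrite size_rot; split.
- exact: hr.
- by move=> x; rewrite mem_rot.
- by move=> j; rewrite !er addnS.
- by split=> //; right; rewrite et.
split.
- by move=> i j hij hi; apply/linkedP => k hk; rewrite et; apply: h2; lia.
- move=> i j hj hi _; apply/negP => /linkedP/(_ q.-1); rewrite et (negPf h3).
  by move=> h; have : false by apply: h; lia.
by move=> i j hqj hji hi /linkedP hr'; apply: (h4 _ _ hqj hji hi) => k hk; rewrite -et; exact: hr'.
Qed.

End Orientation.

Section Step.
Variable d : nat.

(** The conditions of [scan_add] over an arbitrary type of positions and an arbitrary distance
    relation, so that they can be carried between vertices and the numbers of a row. *)
Definition scan_step (T : Type) (RD : T -> T -> nat -> Prop) (v : T) (X Y : nat) (x : T) (a b : nat)
    (pos : nat -> nat -> T) (ia oa : nat -> nat -> nat) (pos' : nat -> nat -> T) (ia' oa' : nat -> nat -> nat) : Prop :=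
  [/\ exists2 M, M < 3 & forall t, t < 2 ->
        (ia M t = 0 \/ exists k l, [/\ ia M t = k.+1, RD (pos M t) x l & k + l + b <= d]) /\
        (oa M t = 0 \/ exists k l, [/\ oa M t = k.+1, RD x (pos M t) l & a + l + k <= d]),
      (exists2 l, RD x v l & a + l <= X) /\ (exists2 l, RD v x l & l + b <= Y),
      forall M, M < 3 -> exists2 M2, M2 < 3 & forall t, t < 2 -> ia M2 t = 0 \/
        exists2 t', t' < 2 & exists k l k', [/\ ia M2 t = k.+1, ia' M t' = k'.+1, RD (pos M2 t) (pos' M t') l & k + l <= k'],
      forall M, M < 3 -> exists2 M2, M2 < 3 & forall t, t < 2 -> oa M2 t = 0 \/
        exists2 t', t' < 2 & exists k l k', [/\ oa M2 t = k.+1, oa' M t' = k'.+1, RD (pos' M t') (pos M2 t) l & l + k <= k'] &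
      forall M, M < 3 -> (exists2 t', t' < 2 & exists l k', [/\ ia' M t' = k'.+1, RD x (pos' M t') l & a + l <= k']) /\
        (exists2 t', t' < 2 & exists l k', [/\ oa' M t' = k'.+1, RD (pos' M t') x l & l + b <= k'])].

Lemma scan_step_map (T T' : Type) (RD : T -> T -> nat -> Prop) (RD' : T' -> T' -> nat -> Prop) (f : T -> T') v X Y x a b
    pos ia oa pos' ia' oa' rpos ria roa rpos' ria' roa' :
  (forall x y l, RD x y l -> RD' (f x) (f y) l) ->
  (forall M t, M < 3 -> t < 2 -> [/\ rpos M t = f (pos M t), ria M t = ia M t & roa M t = oa M t]) ->
  (forall M t, M < 3 -> t < 2 -> [/\ rpos' M t = f (pos' M t), ria' M t = ia' M t & roa' M t = oa' M t]) ->
  scan_step RD v X Y x a b pos ia oa pos' ia' oa' ->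
  scan_step RD' (f v) X Y (f x) a b rpos ria roa rpos' ria' roa'.
Proof.
move=> hf h h' [[M0 hM0 h1] [[l1 a1 b1] [l2 a2 b2]] t1 t2 y]; split.
- exists M0 => // t ht; have [-> -> ->] := h M0 t hM0 ht; have [u1 u2] := h1 t ht; split.
    by case: u1 => [->|[k [l [e1 /hf e2 e3]]]]; [left | right; exists k, l].
  by case: u2 => [->|[k [l [e1 /hf e2 e3]]]]; [left | right; exists k, l].
- by split; [exists l1 => //; exact: hf | exists l2 => //; exact: hf].
- move=> M hM; have [M2 hM2 u] := t1 M hM; exists M2 => // t ht; have [-> -> _] := h M2 t hM2 ht.
  case: (u t ht) => [->|[t' ht' [k [l [k' [e1 e2 /hf e3 e4]]]]]]; [by left | right; exists t' => //].
  by have [-> -> _] := h' M t' hM ht'; exists k, l, k'.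
- move=> M hM; have [M2 hM2 u] := t2 M hM; exists M2 => // t ht; have [-> _ ->] := h M2 t hM2 ht.
  case: (u t ht) => [->|[t' ht' [k [l [k' [e1 e2 /hf e3 e4]]]]]]; [by left | right; exists t' => //].
  by have [-> _ ->] := h' M t' hM ht'; exists k, l, k'.
move=> M hM; have [[t1' ht1 [l [k' [e1 /hf e2 e3]]]] [t2' ht2 [l' [k2 [e4 /hf e5 e6]]]]] := y M hM; split.
  by exists t1' => //; have [-> -> _] := h' M t1' hM ht1; exists l, k'.
by exists t2' => //; have [-> _ ->] := h' M t2' hM ht2; exists l', k2.
Qed.

End Step.

Section Completeness.
Variables (n : nat) (A : arcs n) (d : nat).
Local Notation V := 'I_n.
Local Notation g := (uadj A).
Hypothesis cact : cactus A.
Hypothesis noloop : loopless A.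
Local Notation conn := (conn A).
Local Notation reg := (reg A).
Local Notation comp := (comp A).
Local Notation old := (old A).

Definition lane h q m j g1 g2 g3 g1' g2' g3' := [\/ [/\ g1 < h, j = g1, g1' = g1.+1, g2' = g2 & g3' = g3],
  [/\ g2 < q, j = g2, g1' = g1, g2' = g2.+1 & g3' = g3] | [/\ g3 < m, j = g3, g1' = g1, g2' = g2 & g3' = g3.+1]].

Definition arc_cost (x y : V) m e := ((x, y) \in A /\ e = 0) \/ [/\ (x, y) \notin A, e = 1 & m <> 2].

Lemma scan_step_add D (a b : nat -> nat) (c : nat -> V) RD v X Y m W j pos ia oa pos' ia' oa' :
  (forall x y, x < m -> y < m -> RD (c x) (c y) (D x y)) -> j < m ->
  (exists2 l, RD (c j) v l & a j + l <= X) -> (exists2 l, RD v (c j) l & l + b j <= Y) ->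
  bounded m W pos ia oa -> bounded m W pos' ia' oa' ->
  add_ok d D a b j pos ia oa pos' ia' oa' ->
  scan_step d RD v X Y (c j) (a j) (b j) (fun M t => c (pos M t)) ia oa (fun M t => c (pos' M t)) ia' oa'.
Proof.
move=> hD hj hX hY bd bd' [[M0 hM0 h1] t1 t2 y1 y2].
have hp M t : M < 3 -> t < 2 -> pos M t < m by move=> hM ht; have [] := bd M t hM ht.
have hp' M t : M < 3 -> t < 2 -> pos' M t < m by move=> hM ht; have [] := bd' M t hM ht.
split=> //.
- exists M0 => // t ht; have [h2 h3] := h1 t ht; split.
    move: h2; case E : (ia M0 t) => [|k] [] //= h2; try by left.
    by right; exists k, (D (pos M0 t) j); split=> //; apply: hD => //; exact: hp.
  move: h3; case E : (oa M0 t) => [|k] [] //= h3; try by left.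
  by right; exists k, (D j (pos M0 t)); split=> //; apply: hD => //; exact: hp.
- move=> M hM; have [M2 hM2 h] := t1 M hM; exists M2 => // t ht.
  case E : (ia M2 t) => [|k]; first by left.
  right; have [|[t' ht' [h2]]] := h t ht; first by rewrite E.
  rewrite E; case E' : (ia' M t') h2 => [//|k'] _ /= h3; exists t' => //.
  by exists k, (D (pos M2 t) (pos' M t')), k'; split=> //; apply: hD; [exact: hp | exact: hp'].
- move=> M hM; have [M2 hM2 h] := t2 M hM; exists M2 => // t ht.
  case E : (oa M2 t) => [|k]; first by left.
  right; have [|[t' ht' [h2]]] := h t ht; first by rewrite E.
  rewrite E; case E' : (oa' M t') h2 => [//|k'] _ /= h3; exists t' => //.
  by exists k, (D (pos' M t') (pos M2 t)), k'; split=> //; apply: hD; [exact: hp' | exact: hp].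
move=> M hM; split.
  have [t' ht' [h2 h3]] := y1 M hM; exists t' => //.
  case E' : (ia' M t') h2 h3 => [//|k'] _ /= h3; exists (D j (pos' M t')), k'.
  by split=> //; apply: hD => //; exact: hp'.
have [t' ht' [h2 h3]] := y2 M hM; exists t' => //.
case E' : (oa' M t') h2 h3 => [//|k'] _ /= h3; exists (D (pos' M t') j), k'.
by split=> //; apply: hD => //; exact: hp'.
Qed.

(** A walk from [x] to [y] passes the gate [v]. With [x] and [y] chosen as vertices attaining the
    radii, its length bounds the sum of the radii. *)
Lemma gate_sum (B : arcs n) (X1 : {set V}) v x y l a b :
  (forall a b, (a, b) \in B -> a \in X1 -> b \notin X1 -> a = v) -> x \in X1 -> y \notin X1 \/ y = v ->
  dist_le B x y l -> (forall l, dist_le B x v l -> a <= l) -> (forall l, dist_le B v y l -> b <= l) -> a + b <= l.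
Proof.
move=> hX hx [hy|ey] hd ha hb.
  by have [l1 [l2 [h /ha h1 /hb h2]]] := gate_out hX hd hx hy; lia.
by subst y; have := ha _ hd; have := hb _ (dist_refl B v); lia.
Qed.

Lemma gate_sum3 (B : arcs n) (X1 X2 : {set V}) u w x y l a b e :
  (forall a b, (a, b) \in B -> a \in X1 -> b \notin X1 -> a = u) ->
  (forall a b, (a, b) \in B -> a \notin X2 -> b \in X2 -> b = w) ->
  x \in X1 -> y \in X2 -> y \notin X1 -> u \notin X2 ->
  dist_le B x y l -> (forall l, dist_le B x u l -> a <= l) -> (forall l, dist_le B u w l -> e <= l) ->
  (forall l, dist_le B w y l -> b <= l) -> a + e + b <= l.
Proof.
move=> h1 h2 hx hy hyx hux hd ha he hb.
have [l1 [l2 [hl /ha la hd2]]] := gate_out h1 hd hx hyx.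
have [l3 [l4 [hl2 /he le /hb lb]]] := gate_in h2 hd2 hux hy; lia.
Qed.

Lemma reg_closed v p i x y : x \in reg v p i -> x != v -> y != v -> g x y -> y \in reg v p i.
Proof.
rewrite !inE => hx /[dup] hxv /negPf hx' /negPf hy hg; move: hx; rewrite hx' hy /= => /andP[h1 /existsP[w /andP[hw hc]]].
have hc2 : conn v x y by apply: conn_step => //; rewrite ?hy.
apply/andP; split; first by apply: contraNN h1 => h; apply: conn_trans hc2 h.
by apply/existsP; exists w; rewrite hw (conn_trans hc hc2).
Qed.

Lemma comp_closed v u x y : x \in comp v u -> x != v -> y != v -> g x y -> y \in comp v u.
Proof.
rewrite !inE => hx /[dup] hxv /negPf hx' /negPf hy hg; move: hx; rewrite hx' hy /= => h1.
by apply: conn_trans h1 _; apply: conn_step => //; rewrite ?hy.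
Qed.

End Completeness.

(** * Restriction of a solution to a ring and to the parts hanging on it *)

Section RingSolution.
Variables (n : nat) (A : arcs n) (d : nat).
Local Notation V := 'I_n.
Local Notation g := (uadj A).
Hypothesis cact : cactus A.
Hypothesis noloop : loopless A.
Local Notation conn := (conn A).
Local Notation reg := (reg A).
Local Notation comp := (comp A).

Variables (v u : V) (B : arcs n) (X Y c0 : nat).
Hypothesis huv : u != v.
Hypothesis solB : sol_with A d B (comp v u) v X Y c0.
Hypothesis fullB : full_on A (comp v u) B.

Variables (s : seq V) (z : V).
Hypothesis hs : ring A s.
Hypothesis hv : v \in s.
Hypothesis hz : z \in s.
Hypothesis hzv : z != v.
Hypothesis huz : conn v u z.
Local Notation m := (size s).
Local Notation c := (rc s v).
Hypothesis fwd : forall j, (c j, c j.+1) \in B.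
Local Notation It := (item A s v v).
Local Notation R := (region A s v).

Lemma item_comp j x : j < m -> x \in It j -> x \in comp v u.
Proof.
have [i hi ev] := rc_surj v hv.
move=> hj; rewrite (comp_region cact hs huv ev hz hzv huz) /item.
case: ifP => [_ /set1P ->|hne hx]; first by rewrite eqxx.
apply/orP; right; apply/negP => hx'.
by move: hne; rewrite (region_disj hs hx hx') -ev eqxx.
Qed.

Lemma ring_comp x : x \in s -> x \in comp v u.
Proof. by move=> /(rc_surj v)[j hj ->]; exact: (item_comp hj (item_root A s v v j)). Qed.

Lemma comp_item x : x \in comp v u -> exists2 j, j < m & x \in It j.
Proof.
have [i hi ev] := rc_surj v hv.
rewrite (comp_region cact hs huv ev hz hzv huz) => hx.
case: (eqVneq x v) hx => [->|hxv] /= hx; first by exists i => //; rewrite /item -ev eqxx inE.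
have [j hj hxj] := region_cover cact v hs x; exists j => //.
rewrite /item; case: eqP => // e; move: hx.
suff -> : R i = R j by rewrite hxj.
by apply/setP => y; rewrite !inE e -ev.
Qed.

Lemma arc_cases x y : (x, y) \in B -> (exists2 j, j < m & x \in It j /\ y \in It j) \/ (x, y) \in ring_arcs A s.
Proof.
move=> hB; have [i1 v1 _ _ _] := solB; have hg := valid_adj v1 hB.
have [hx hy] := i1 _ _ hB.
have [j hj hxj] := comp_item hx.
case: (boolP ((x, y) \in cycle_edges s)) => he; last first.
  left; exists j => //; split=> //.
  have hyj : y \in R j by apply: (region_step _ hg he); apply: item_region hxj.
  move: hxj; rewrite /item; case: eqP => // ej /set1P ex; subst x.
  have [j' hj' hyj'] := comp_item hy.
  have e' : c j' = c j by apply: (region_disj hs (item_region hyj') hyj).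
  by move: hyj'; rewrite /item e' ej eqxx.
right; rewrite ring_arcsE he /=; have [hxs hys] := ring_edge_mem he.
move: he; rewrite cycle_edgesE => /and3P[_ _ /orP[->//|/eqP e]].
have [k hk ey] := rc_surj v hys.
have hB2 : (y, x) \in B by rewrite -e ey (rc_next v hs).
apply/orP; right; apply/andP; split; apply/negPn/negP => h.
  by have [_] := v1 _ _ hB h; rewrite hB2.
by have [_] := v1 _ _ hB2 h; rewrite hB.
Qed.

Lemma item_out j x y : j < m -> (x, y) \in B -> x \in It j -> y \notin It j -> x = c j.
Proof.
move=> hj hB hx hy; have [[k hk [hxk hyk]]|] := arc_cases hB.
  by move: hy; rewrite (item_disj hs hj hk hx hxk) hyk.
by rewrite ring_arcsE => /andP[/ring_edge_mem[hxs _] _]; exact: (item_ring hs hj hxs hx).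
Qed.

Lemma item_in j x y : j < m -> (x, y) \in B -> x \notin It j -> y \in It j -> y = c j.
Proof.
move=> hj hB hx hy; have [[k hk [hxk hyk]]|] := arc_cases hB.
  by move: hx; rewrite (item_disj hs hj hk hy hyk) hxk.
by rewrite ring_arcsE => /andP[/ring_edge_mem[_ hys] _]; exact: (item_ring hs hj hys hy).
Qed.

Definition ring_proj (x : V) : V := if [pick j : 'I_m | x \in It j] is Some j then c j else v.

Lemma ring_projE j x : j < m -> x \in It j -> ring_proj x = c j.
Proof.
move=> hj hx; rewrite /ring_proj; case: pickP => [k hk|/(_ (Ordinal hj))]; last by rewrite hx.
by rewrite (item_disj hs (ltn_ord k) hj hk hx).
Qed.

(** Contracting each item to its ring vertex maps arcs of the solution to ring arcs or to points, so
    detours through the parts never shorten a ring distance. *)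
Lemma ring_dist_le (full : bool) i j l : i < m -> j < m -> full \/ ~~ two_way A s v (size s).-1 ->
  dist_le B (c i) (c j) l -> ring_dist A s v full i j <= l.
Proof.
move=> hi hj hf hd; apply: (ring_dist_lb hs hi hj hf).
have ri := ring_projE hi (item_root A s v v i); have rj := ring_projE hj (item_root A s v v j).
rewrite -ri -rj; apply: dist_map hd => x y hB.
have [[k hk [hx hy]]|hR] := arc_cases hB; [left | right].
  by rewrite !(ring_projE hk).
have [hxs hys] : x \in s /\ y \in s by move: hR; rewrite ring_arcsE => /andP[/ring_edge_mem].
have [a ha ex] := rc_surj v hxs; have [b hb ey] := rc_surj v hys.
by rewrite ex ey (ring_projE ha (item_root A s v v a)) (ring_projE hb (item_root A s v v b)) -ex -ey.
Qed.

Lemma item_sol j a b : j < m -> (forall x, x \in It j -> dist_le B x (c j) a /\ dist_le B (c j) x b) ->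
  solf A d (It j) (c j) a b #|restr B (It j) :\: A|.
Proof.
move=> hj hab; have sub : It j \subset comp v u by apply/subsetP => x; exact: item_comp.
apply: (solf_restr (f := fun x => if x \in It j then x else c j) solB fullB sub) => //; last exact: item_root.
  by move=> x ->.
move=> x y hB; case: ifP => hx; case: ifP => hy.
- by right; rewrite restrE hB hx hy.
- by left; apply: (item_out hj hB hx); rewrite hy.
- by left; rewrite (item_in hj hB _ hy) // hx.
by left.
Qed.

(** The cost charged to position [j]: reversals inside its item and that of the ring edge that
    follows. These sets of arcs are pairwise disjoint. *)
Definition weight j := #|restr B (It j) :\: A| + ((c j, c j.+1) \notin A).

Lemma weight_sum : \sum_(j < m) weight j <= c0.
Proof.
have [_ v1 k1 _ _] := solB; apply: leq_trans k1.
pose F (j : 'I_m) : arcs n := (restr B (It j) :\: A) :|: ([set (c j, c j.+1)] :\: A).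
have adj j : j < m -> c j.+1 \in It j -> False.
  move=> hj /(item_ring hs hj (rc_mem v hs _)) e.
  by have := rc_adj v hs j; rewrite e (g_irr noloop).
have inF j x y : (x, y) \in F j -> (x \in It j /\ y \in It j) \/ (x = c j /\ y = c j.+1).
  rewrite in_setU !in_setD restrE in_set1 => /orP[/andP[_ /and3P[_ hx hy]]|/andP[_ /eqP[-> ->]]]; by [left | right].
have cF j : #|F j| = weight j.
  rewrite /F /weight cardsU; set I := (_ :&: _).
  have -> : I = set0.
    apply/setP => -[x y]; rewrite in_setI !in_setD restrE in_set1 in_set0.
    apply/negP => /andP[/andP[_ /and3P[_ _ hy]] /andP[_ /eqP[_ ey]]].
    by apply: (adj j (ltn_ord j)); rewrite -ey.
  rewrite cards0 subn0; congr (_ + _).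
  case: (boolP ((c j, c j.+1) \in A)) => h /=.
    by apply/eqP; rewrite cards_eq0; apply/eqP/setP => e; rewrite in_setD in_set1 in_set0; case: eqP => [->|]; rewrite ?h ?andbF.
  by rewrite -(cards1 (c j, c j.+1)); congr #|pred_of_set _|; apply/setP => e; rewrite in_setD in_set1; case: eqP => [->|]; rewrite ?h ?andbF.
have dis (i j : 'I_m) : i != j -> [disjoint F i & F j].
  move=> hij; apply/pred0P => -[x y] /=; apply/negP => /andP[/inF h1 /inF h2].
  have ne : nat_of_ord i = j -> False by move=> e; move: hij; rewrite (_ : i = j) ?eqxx //; apply: val_inj.
  case: h1 h2 => [[h1 h2]|[h1 h2]] [[h3 h4]|[h3 h4]].
  - by apply: ne; apply: (item_disj hs (ltn_ord i) (ltn_ord j) h1 h3).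
  - have e : nat_of_ord i = j by apply: (item_disj hs (ltn_ord i) (ltn_ord j) h1); rewrite h3; exact: item_root.
    exact: ne e.
  - have e : nat_of_ord i = j by apply: (item_disj hs (ltn_ord i) (ltn_ord j) _ h3); rewrite h1; exact: item_root.
    exact: ne e.
  by apply: ne; apply: (rc_inj (x0 := v) hs (ltn_ord i) (ltn_ord j)); rewrite -h1 -h3.
have -> : \sum_(j < m) weight j = \sum_(j < m) \sum_(e in F j) 1.
  by apply: eq_bigr => j _; rewrite sum1_card cF.
rewrite -(partition_disjoint_bigcup _ _ dis) sum1_card.
apply/subset_leq_card/subsetP => e /bigcupP[j _]; case: e => x y.
rewrite !in_setD in_setU !in_setD restrE in_set1 => /orP[/andP[-> /and3P[->]]//|/andP[-> /eqP[-> ->]]].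
exact: fwd.
Qed.

End RingSolution.

(** * Every solution of a component arises from a scan of its ring *)

Section Closed.
Variables (n : nat) (A : arcs n) (d Nb Cb : nat).
Local Notation V := 'I_n.
Hypothesis cact : cactus A.
Hypothesis noloop : loopless A.
Local Notation conn := (conn A).
Local Notation reg := (reg A).
Local Notation comp := (comp A).
Local Notation old := (old A).
Variable PD : V -> V -> nat -> nat -> nat -> nat -> Prop.
Variable SD : seq V -> nat -> nat -> V -> nat -> nat -> nat -> nat -> nat -> nat ->
  (nat -> nat -> V) -> (nat -> nat -> nat) -> (nat -> nat -> nat) -> Prop.

Definition tab_lt (ia oa : nat -> nat -> nat) := forall M t, M < 3 -> t < 2 -> ia M t < Nb /\ oa M t < Nb.

(** [PD] and [SD] stand for derivable facts about parts and scans. Completeness relies only on their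
    closure properties, restricted to radii below [Nb] and costs below [Cb], so no logic appears in
    it. *)
Definition scan_init_closed := forall s v h q X Y pos ia oa, ring A s -> v \in s -> h <= q -> q <= size s ->
  X < Nb -> Y < Nb -> tab_lt ia oa -> SD s h q v X Y 0 h q 0 pos ia oa.

Definition scan_step_closed := forall s v h q X Y g1 g2 g3 cst pos ia oa j g1' g2' g3' a b c1 e pos' ia' oa',
  let x := rc s v j in
  ring A s -> v \in s -> h <= q -> q <= size s -> X < Nb -> Y < Nb ->
  SD s h q v X Y g1 g2 g3 cst pos ia oa -> lane h q (size s) j g1 g2 g3 g1' g2' g3' -> j < size s ->
  [/\ x = v, a = 0, b = 0 & c1 = 0] \/ [/\ x != v, a < Nb, b < Nb & PD x v n a b c1] ->
  arc_cost A x (rc s v j.+1) (size s) e ->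
  scan_step d (fun x y l => rdist A s x y l /\ l < Nb) v X Y x a b pos ia oa pos' ia' oa' ->
  tab_lt ia oa -> tab_lt ia' oa' -> cst + c1 + e < Cb ->
  SD s h q v X Y g1' g2' g3' (cst + c1 + e) pos' ia' oa'.

(** The ring is oriented and brought to normal form, each item receives its exact radii in the given
    solution, and the schedule of [scan_complete] is followed. Items are strictly smaller than the
    component, as they miss [v] or consist of it, which justifies the induction hypothesis. *)
Lemma scan_exists v u B X Y c0 : scan_init_closed -> scan_step_closed ->
  (forall x a b c, x \in comp v u -> x != v -> solf A d (reg x v n) x a b c -> a < Nb -> b < Nb -> c < Cb ->
     #|reg x v n| < #|comp v u| -> PD x v n a b c) ->
  u != v -> sol_with A d B (comp v u) v X Y c0 -> full_on A (comp v u) B -> 2 * n < Nb -> X < Nb -> Y < Nb -> c0 < Cb ->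
  exists s z h q c2 pos ia oa, [/\ ring A s, v \in s, z \in s, z != v & conn v u z] /\
    [/\ h <= q, q <= size s, c2 <= c0, tab_lt ia oa & SD s h q v X Y h q (size s) c2 pos ia oa].
Proof.
move=> cl0 cl1 IH huv solB fullB hNb hX hY hc0.
have n0 : 0 < n by apply: leq_ltn_trans (leq0n _) (ltn_ord v).
have [s0 [w [hs0 hzv huz]]] := comp_ring cact noloop huv.
have vs0 : v \in v :: w :: s0 by rewrite inE eqxx.
have ws0 : w \in v :: w :: s0 by rewrite !inE eqxx orbT.
have rc0 := ring_comp cact huv hs0 vs0 ws0 hzv huz.
have [i1 v1 k1 e1 d1] := solB.
have [|x y hx hy|s1 [hs1 es1 fw1]] := orient v hs0 v1.
- by move=> x y /rc0 hx /rc0 hy; apply: fullB.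
- by exists d; apply: d1; exact: rc0.
have [s [full [q [hs es fwd [hf hnf q0 qm qf] [r1 r2 r3]]]]] := ring_shape hs1 fw1.
have hv : v \in s by rewrite es es1.
have hz : w \in s by rewrite es es1.
have [jv hjv ev] := rc_surj v hv.
set c := rc s v in fwd ev; set m := size s in qm qf r2 r3 hjv hnf.
pose It := item A s v v.
have itc j x : j < m -> x \in It j -> x \in comp v u by exact: (item_comp cact huv hs hv hz hzv huz).
have dle i j l : i < m -> j < m -> dist_le B (c i) (c j) l -> ring_dist A s v full i j <= l.
  by move=> hi hj; exact: (ring_dist_le cact huv solB hs hv hz hzv huz fwd).
have iout j x y : j < m -> (x, y) \in B -> x \in It j -> y \notin It j -> x = c j.
  exact: (item_out cact huv solB hs hv hz hzv huz fwd).
have iin j x y : j < m -> (x, y) \in B -> x \notin It j -> y \in It j -> y = c j.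
  exact: (item_in cact huv solB hs hv hz hzv huz fwd).
have rcc j : c j \in comp v u by apply: (ring_comp cact huv hs hv hz hzv huz); exact: (rc_mem v hs).
pose D := ring_dist A s v full.
have [a ha] : exists a : nat -> nat, forall j, j < m -> [/\ a j < n, forall x, x \in It j -> dist_le B x (c j) (a j) &
    exists2 x, x \in It j & forall l, dist_le B x (c j) l -> a j <= l].
  apply: (@nat_choice _ m (fun j k => [/\ k < n, forall x, x \in It j -> dist_le B x (c j) k &
    exists2 x, x \in It j & forall l, dist_le B x (c j) l -> k <= l]) 0) => j hj.
  have [||k [k1' k2 k3]] := @eccentricity _ (fun x l => dist_le B x (c j) l) (It j) (c j) n.-1 (item_root A s v v j).
  - by move=> x l l' hl; apply: dist_weak.
  - by move=> x hx; apply: dist_short (d1 _ _ (itc _ _ hj hx) (rcc j)).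
  by exists k; split=> //; move: k1' n0; clear; lia.
have [b hb] : exists b : nat -> nat, forall j, j < m -> [/\ b j < n, forall x, x \in It j -> dist_le B (c j) x (b j) &
    exists2 x, x \in It j & forall l, dist_le B (c j) x l -> b j <= l].
  apply: (@nat_choice _ m (fun j k => [/\ k < n, forall x, x \in It j -> dist_le B (c j) x k &
    exists2 x, x \in It j & forall l, dist_le B (c j) x l -> k <= l]) 0) => j hj.
  have [||k [k1' k2 k3]] := @eccentricity _ (fun x l => dist_le B (c j) x l) (It j) (c j) n.-1 (item_root A s v v j).
  - by move=> x l l' hl; apply: dist_weak.
  - by move=> x hx; apply: dist_short (d1 _ _ (rcc j) (itc _ _ hj hx)).
  by exists k; split=> //; move: k1' n0; clear; lia.
pose RD x y l := rdist A s x y l /\ l < Nb.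
have Dn i j : i < m -> j < m -> D i j < n.
  move=> hi hj; have := dist_short (ring_dist_ub hs hi hj hf).
  by move=> /(ring_dist_lb hs hi hj hnf); rewrite -/D => h1; move: n0 h1; clear; lia.
have hRD i j : i < m -> j < m -> RD (c i) (c j) (D i j).
  by move=> hi hj; split; [exact: ring_dist_ub | move: (Dn i j hi hj) hNb; clear; lia].
have D0 i : i < m -> D i i = 0.
  by move=> hi; apply/eqP; rewrite -leqn0; apply: dle => //; exact: dist_refl.
(* Both radii are attained, and a walk between the attaining vertices crosses two gates with a ring
   distance between them. *)
have tight x y : x < m -> y < m -> x != y -> a x + D x y + b y <= d.
  move=> hx hy hxy; have [_ _ [x' hx' hax]] := ha x hx; have [_ _ [y' hy' hby]] := hb y hy.
  apply: (gate_sum3 (X1 := It x) (X2 := It y) (u := c x) (w := c y) _ _ hx' hy') => //.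
  - by move=> p r; exact: iout.
  - by move=> p r; exact: iin.
  - by apply/negP => h; move: hxy; rewrite (item_disj hs hx hy h hy') eqxx.
  - by apply/negP => h; move: hxy; rewrite (item_disj hs hx hy (item_root A s v v x) h) eqxx.
  - by apply: d1; [exact: itc hx hx' | exact: itc hy hy'].
  - exact: hax.
  - by move=> l; exact: dle.
  exact: hby.
have itv : item A s v v jv = [set v] by rewrite /item -/c -ev eqxx.
have ax j : j < m -> a j + D j jv <= X.
  move=> hj; have [_ _ [x hx hax]] := ha j hj.
  have [hxv _] := e1 x (itc _ _ hj hx).
  apply: (gate_sum (X1 := It j) (v := c j) _ hx _ hxv hax).
  - by move=> p r; exact: iout.
  - case: (eqVneq j jv) => [->|hne]; [by right | left; apply/negP => h].
    by move: hne; rewrite (item_disj hs hj hjv h) ?eqxx // itv inE.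
  by move=> l; rewrite {1}ev; exact: dle.
have yb j : j < m -> D jv j + b j <= Y.
  move=> hj; have [_ _ [x hx hbx]] := hb j hj.
  have [_ hvx] := e1 x (itc _ _ hj hx); rewrite addnC.
  case: (boolP (v \in It j)) => hvj.
    have ej : j = jv by apply: (item_disj hs hj hjv hvj); rewrite itv inE.
    by rewrite ej D0 // addn0; rewrite ej in hbx; apply: hbx; rewrite -ev.
  have [l1 [l2 [hl h1 h2]]] := gate_in (fun p r => @iin j p r hj) hvx hvj hx.
  by have := hbx _ h2; have : D jv j <= l1; [apply: dle; rewrite -?ev | move: hl; clear; lia].
pose W := 2 * n; pose h := minn m./2 q.
have hW i j : i < m -> j < m -> a i + D i j < W /\ D i j + b j < W.
  by move=> hi hj; have [h1 _ _] := ha i hi; have [h2 _ _] := hb j hj; have h3 := Dn i j hi hj; rewrite /W; move: h1 h2 h3; clear; lia.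
pose wt := weight A v B s.
pose Wt g1 g2 g3 := \sum_(0 <= j < g1) wt j + \sum_(h <= j < g2) wt j + \sum_(q <= j < g3) wt j.
have hq : h <= q by exact: geq_minr.
have Wsum g1 g2 g3 : g1 <= h -> h <= g2 -> g2 <= q -> q <= g3 -> g3 <= m -> Wt g1 g2 g3 <= c0.
  move=> h1 h2 h3 h4 h5; apply: leq_trans (weight_sum noloop solB hs fwd).
  rewrite -(big_mkord xpredT (weight A v B s)) -/wt -/m /Wt.
  have cat x y t : x <= y -> y <= t -> \sum_(x <= j < t) wt j = \sum_(x <= j < y) wt j + \sum_(y <= j < t) wt j.
    by move=> hxy hyt; exact: big_cat_nat.
  rewrite (cat 0 q m) // (cat 0 h q) // (cat 0 g1 h) // (cat h g2 q) // (cat q g3 m) //; try (move: h1 h2 h3 h4 h5; clear; lia).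
have m2 : 2 <= m by exact: ring_size hs.
have bnd pos ia oa : bounded m W pos ia oa -> tab_lt ia oa.
  by move=> hb' M t hM ht; have [_ h1 h2] := hb' M t hM ht; rewrite !(leq_ltn_trans _ hNb).
pose DS g1 g2 g3 (pos ia oa : nat -> nat -> nat) := [/\ [/\ g1 <= h, h <= g2, g2 <= q, q <= g3 & g3 <= m], bounded m W pos ia oa &
  SD s h q v X Y g1 g2 g3 (Wt g1 g2 g3) (fun M t => c (pos M t)) ia oa].
have stepDS g1 g2 g3 g1' g2' g3' j pos ia oa pos' ia' oa' : lane h q m j g1 g2 g3 g1' g2' g3' -> j < m ->
    [/\ g1' <= h, h <= g2', g2' <= q, q <= g3' & g3' <= m] -> Wt g1' g2' g3' = Wt g1 g2 g3 + wt j ->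
    bounded m W pos' ia' oa' -> DS g1 g2 g3 pos ia oa -> add_ok d D a b j pos ia oa pos' ia' oa' ->
    DS g1' g2' g3' pos' ia' oa'.
  move=> hl hj hg hwt hb' [_ hb0 hSD] hadd; split=> //.
  have hcost : Wt g1' g2' g3' <= c0 by case: hg => *; exact: Wsum.
  rewrite hwt /wt /weight addnA in hcost *.
  have [an ax1 _] := ha j hj; have [bn bx1 _] := hb j hj.
  apply: (cl1 _ _ _ _ _ _ _ _ _ _ _ _ _ _ _ _ _ (a j) (b j) _ _ _ _ _ hs hv hq qm hX hY hSD hl hj) => //.
  - case: (eqVneq (rc s v j) v) => hxv; [left | right].
      have eI : It j = [set v] by rewrite /It /item hxv eqxx.
      have ev0 : c j = v by [].
      split=> //.
      + have [_ _ [x]] := ha j hj; rewrite eI inE => /eqP -> /(_ 0) h0.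
        by apply/eqP; rewrite -leqn0; apply: h0; rewrite ev0; exact: dist_refl.
      + have [_ _ [x]] := hb j hj; rewrite eI inE => /eqP -> /(_ 0) h0.
        by apply/eqP; rewrite -leqn0; apply: h0; rewrite ev0; exact: dist_refl.
      apply/eqP; rewrite cards_eq0; apply/eqP/setP => -[x y]; rewrite in_setD restrE -/(It j) eI !in_set1 in_set0.
      apply/negP => /andP[_ /and3P[hB /eqP ex /eqP ey]].
      by have := valid_neq noloop v1 hB; rewrite ex ey eqxx.
    have eI : It j = reg (rc s v j) v n by rewrite reg_region // /It /item (negPf hxv).
    have aN : a j < Nb by move: an hNb; clear; lia.
    have bN : b j < Nb by move: bn hNb; clear; lia.
    split=> //; apply: IH => //.
    + rewrite -eI; apply: (item_sol cact huv solB fullB hs hv hz hzv huz fwd hj) => x hx.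
      by split; [exact: ax1 | exact: bx1].
    + by apply: leq_ltn_trans (leq_trans (leq_addl _ _) (leq_trans (leq_addr _ _) hcost)) hc0.
    rewrite -eI; apply: proper_card; rewrite properE; apply/andP; split.
      by apply/subsetP => x; exact: itc.
    apply/subsetPn; exists v; first exact: comp_self.
    apply/negP => h0; have ej : j = jv by apply: (item_disj hs hj hjv h0); rewrite itv inE.
    by move: hxv; rewrite ej -/c -ev eqxx.
  (* On a bridge the two forward arcs are opposite, so neither of them can be a reversed one. *)
  - case: (boolP ((rc s v j, rc s v j.+1) \in A)) => hA; [by left | right; split=> // em].
    have [_] := v1 _ _ (fwd j) hA; have := fwd j.+1.
    rewrite (_ : c j.+2 = c j) ?/c => [->//|]; rewrite -[j.+2]addn2 -em; exact: rc_addm.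
  - apply: (scan_step_add (D := D) (m := m) (W := W) (c := c)) => //.
    + by exists (D j jv); [have := hRD j jv hj hjv; rewrite -ev | exact: ax].
    by exists (D jv j); [have := hRD jv j hjv hj; rewrite -ev | exact: yb].
  - exact: bnd hb0.
  - exact: bnd hb'.
  exact: leq_ltn_trans hcost hc0.
have hDf : full -> forall i j, i < m -> j < m -> D i j = minn ((i - j) + (j - i)) (m - ((i - j) + (j - i))).
  by move=> hfull i j hi hj; rewrite /D /ring_dist hfull.
have hDb : ~~ full -> forall i j, i < m -> j < m -> D i j =
  if i <= j then j - i else if linked A s v j i then minn (i - j) (m - (i - j)) else m - (i - j).
  by move=> /negPf hfull i j hi hj; rewrite /D /ring_dist hfull.
have R4 : forall i j k, i <= j -> j <= k -> linked A s v i k = linked A s v i j && linked A s v j k.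
  move=> i j k hij hjk; apply/linkedP/andP => [hr|[/linkedP h1 /linkedP h2] l hl].
    by split; apply/linkedP => l hl; apply: hr; move: hij hjk hl; clear; lia.
  by case: (ltnP l j) => hlj; [apply: h1 | apply: h2]; move: hl hlj; clear; lia.
have R0 : forall i, linked A s v i i.
  by move=> i; apply/linkedP => k hk; move: hk; clear; lia.
case: (@scan_complete m d D a b tight full (linked A s v) q m2 hDf hDb q0 qm qf r1 r2 r3 R4 R0 W hW DS); rewrite -/h.
- move=> pos ia oa hbd; split; [by split | exact: hbd | rewrite /Wt !big_geq //].
  by apply: cl0 => //; exact: bnd hbd.
- move=> g1 g2 g3 pos ia oa pos' ia' oa' hg hbd hDS; have [[l1 l2 l3 l4 l5] _ _] := hDS.
  rewrite -/h in hg.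
  have hln : lane h q m g1 g1 g2 g3 g1.+1 g2 g3.
    by apply: Or31; split=> //; move: hg; clear; lia.
  have hgm : g1 < m by move: hg l1 l2 l3 l4 l5 hq qm; clear; lia.
  apply: (stepDS _ _ _ _ _ _ _ _ _ _ _ _ _ hln hgm _ _ hbd hDS).
    by split=> //; move: hg l1 l2 l3 l4 l5 hq qm; clear; lia.
  rewrite /Wt (big_nat_recr g1) //=.
  by move: (wt _) (\sum_(0 <= j < g1) _) (\sum_(h <= j < g2) _) (\sum_(q <= j < g3) _); clear; lia.
- move=> g1 g2 g3 pos ia oa pos' ia' oa' hg hbd hDS; have [[l1 l2 l3 l4 l5] _ _] := hDS.
  rewrite -/h in hg.
  have hln : lane h q m g2 g1 g2 g3 g1 g2.+1 g3.
    by apply: Or32; split=> //; move: hg; clear; lia.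
  have hgm : g2 < m by move: hg l1 l2 l3 l4 l5 hq qm; clear; lia.
  apply: (stepDS _ _ _ _ _ _ _ _ _ _ _ _ _ hln hgm _ _ hbd hDS).
    by split=> //; move: hg l1 l2 l3 l4 l5 hq qm; clear; lia.
  rewrite /Wt (big_nat_recr g2) //=.
  by move: (wt _) (\sum_(0 <= j < g1) _) (\sum_(h <= j < g2) _) (\sum_(q <= j < g3) _); clear; lia.
- move=> g1 g2 g3 pos ia oa pos' ia' oa' hg hbd hDS; have [[l1 l2 l3 l4 l5] _ _] := hDS.
  rewrite -/h in hg.
  have hln : lane h q m g3 g1 g2 g3 g1 g2 g3.+1.
    by apply: Or33; split=> //; move: hg; clear; lia.
  have hgm : g3 < m by move: hg l1 l2 l3 l4 l5 hq qm; clear; lia.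
  apply: (stepDS _ _ _ _ _ _ _ _ _ _ _ _ _ hln hgm _ _ hbd hDS).
    by split=> //; move: hg l1 l2 l3 l4 l5 hq qm; clear; lia.
  rewrite /Wt (big_nat_recr g3) //=.
  by move: (wt _) (\sum_(0 <= j < g1) _) (\sum_(h <= j < g2) _) (\sum_(q <= j < g3) _); clear; lia.
- move=> pos [ia [oa [_ hbd hSD]]]; exists s, w, h, q, (Wt h q m), (fun M t => c (pos M t)), ia, oa; split=> //; split=> //.
    exact: Wsum.
  exact: bnd hbd.
Qed.

End Closed.

(** * Every solution of a part is derivable *)

Section Parts.
Variables (n : nat) (A : arcs n) (d Nb Cb : nat).
Local Notation V := 'I_n.
Local Notation g := (uadj A).
Hypothesis cact : cactus A.
Hypothesis noloop : loopless A.
Local Notation conn := (conn A).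
Local Notation reg := (reg A).
Local Notation comp := (comp A).
Local Notation old := (old A).
Variable PD : V -> V -> nat -> nat -> nat -> nat -> Prop.
Variable SD : seq V -> nat -> nat -> V -> nat -> nat -> nat -> nat -> nat -> nat ->
  (nat -> nat -> V) -> (nat -> nat -> nat) -> (nat -> nat -> nat) -> Prop.

Definition part_init_closed := forall v p a b c, a < Nb -> b < Nb -> c < Cb -> PD v p 0 a b c.

Definition part_skip_closed := forall v p (i : V) a b c, a < Nb -> b < Nb -> c < Cb ->
  old v p i -> PD v p i a b c -> PD v p i.+1 a b c.

Definition part_add_closed := forall v p (i : V) a b c a1 b1 c1 s z h q X Y c2 pos ia oa,
  [/\ a < Nb, b < Nb & c < Cb] -> ~ old v p i -> PD v p i a1 b1 c1 ->
  [/\ ring A s, v \in s, z \in s, z != v & conn v i z] -> h <= q -> q <= size s -> tab_lt Nb ia oa ->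
  SD s h q v X Y h q (size s) c2 pos ia oa ->
  a1 + Y <= d -> X + b1 <= d -> a1 <= a -> X <= a -> b1 <= b -> Y <= b -> c1 + c2 <= c -> PD v p i.+1 a b c.

(** Induction on the size of the region, then on [i]. Skipping an old vertex keeps the region and
    lowers [i]; splitting off a component or passing to an item makes the region smaller, so that
    [i] may restart at [n]. *)
Lemma part_complete : scan_init_closed A Nb SD -> scan_step_closed A d Nb Cb PD SD ->
  part_init_closed -> part_skip_closed -> part_add_closed -> 2 * n < Nb ->
  forall v p i a b c, i <= n -> solf A d (reg v p i) v a b c -> a < Nb -> b < Nb -> c < Cb -> PD v p i a b c.
Proof.
move=> s0 s1 p0 p1 p2 hNb v p i a b c.
move: {2}(_ * n.+1 + _).+1 (ltnSn (#|reg v p i| * n.+1 + i)) => k.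
elim: k v p i a b c => [//|k IH] v p [|i] a b c hk hi; first by move=> _ *; exact: p0.
move=> [B solB fullB] ha hb hc.
have [io ei] : exists io : V, i = io by exists (Ordinal hi).
subst i.
case: (classic (old v p io)) => ho.
  apply: (p1 v p io) => //; have er := reg_old ho; rewrite er in hk solB fullB.
  apply: IH => //; [by rewrite addnS in hk | exact: ltnW | by exists B].
have er := reg_new ho; rewrite er in hk solB fullB.
have [i1 v1 k1 e1 d1] := solB.
have nv : io != v by apply/eqP => e; apply: ho; apply: Or31.
have v1r : v \in reg v p io by exact: reg_self.
have v2r : v \in comp v io by exact: comp_self.
set R1 := reg v p io in er solB fullB hk v1r i1 e1 d1 *; set R2 := comp v io in er solB fullB hk v2r i1 e1 d1 *.
have sR1 : R1 \subset R1 :|: R2 by exact: subsetUl.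
have sR2 : R2 \subset R1 :|: R2 by exact: subsetUr.
have both x : x \in R1 -> x \in R2 -> x = v by exact: reg_comp.
have out1 x y : (x, y) \in B -> x \in R1 -> y \notin R1 -> x = v.
  move=> hB hx hy; apply/eqP; apply: contraNT hy => hxv.
  case: (eqVneq y v) => [->//|hyv]; exact: reg_closed hx hxv hyv (valid_adj v1 hB).
have in1 x y : (x, y) \in B -> x \notin R1 -> y \in R1 -> y = v.
  move=> hB hx hy; apply/eqP; apply: contraNT hx => hyv.
  by case: (eqVneq x v) => [->//|hxv]; apply: reg_closed hy hyv hxv _; rewrite g_sym; exact: valid_adj v1 hB.
have out2 x y : (x, y) \in B -> x \in R2 -> y \notin R2 -> x = v.
  move=> hB hx hy; apply/eqP; apply: contraNT hy => hxv.
  by case: (eqVneq y v) => [->//|hyv]; exact: comp_closed hx hxv hyv (valid_adj v1 hB).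
have in2 x y : (x, y) \in B -> x \notin R2 -> y \in R2 -> y = v.
  move=> hB hx hy; apply/eqP; apply: contraNT hx => hyv.
  by case: (eqVneq x v) => [->//|hxv]; apply: comp_closed hy hyv hxv _; rewrite g_sym; exact: valid_adj v1 hB.
have retr (R : {set V}) : R \subset R1 :|: R2 -> v \in R ->
    (forall x y, (x, y) \in B -> x \in R -> y \notin R -> x = v) ->
    (forall x y, (x, y) \in B -> x \notin R -> y \in R -> y = v) ->
    forall a1 b1, (forall x, x \in R -> dist_le B x v a1 /\ dist_le B v x b1) ->
    solf A d R v a1 b1 #|restr B R :\: A|.
  move=> sR vR oR iR a1 b1 hab.
  apply: (solf_restr (f := fun x => if x \in R then x else v) solB fullB sR) => //.
    by move=> x ->.
  move=> x y hB; case: ifP => hx; case: ifP => hy; [| | |by left].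
  - by right; rewrite restrE hB hx hy.
  - by left; apply: (oR x y hB hx); rewrite hy.
  by left; rewrite (iR x y hB _ hy) // hx.
have ecc (R : {set V}) : R \subset R1 :|: R2 -> v \in R -> exists a1 b1, [/\ a1 <= a, b1 <= b,
    forall x, x \in R -> dist_le B x v a1 /\ dist_le B v x b1,
    exists2 x, x \in R & forall l, dist_le B x v l -> a1 <= l &
    exists2 x, x \in R & forall l, dist_le B v x l -> b1 <= l].
  move=> /subsetP sR vR.
  have [||a1 [ha1 ha2 ha3]] := @eccentricity _ (fun x l => dist_le B x v l) R v a vR.
  - by move=> x l l' hl; apply: dist_weak.
  - by move=> x /sR/e1[].
  have [||b1 [hb1 hb2 hb3]] := @eccentricity _ (fun x l => dist_le B v x l) R v b vR.
  - by move=> x l l' hl; apply: dist_weak.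
  - by move=> x /sR/e1[].
  by exists a1, b1; split=> // x hx; split; [exact: ha2 | exact: hb2].
have [a1 [b1 [ha1 hb1 hR1 [xa xaR hxa] [xb xbR hxb]]]] := ecc R1 sR1 v1r.
have [X [Y [hX hY hR2 [ya yaR hya] [yb ybR hyb]]]] := ecc R2 sR2 v2r.
have sum1 : a1 + Y <= d.
  apply: (gate_sum out1 xaR _ _ hxa hyb).
    case: (boolP (yb \in R1)) => h; [right; exact: both | by left].
  by apply: d1; [apply: (subsetP sR1) | apply: (subsetP sR2)].
have sum2 : X + b1 <= d.
  apply: (gate_sum out2 yaR _ _ hya hxb).
    case: (boolP (xb \in R2)) => h; [right; exact: both | by left].
  by apply: d1; [apply: (subsetP sR2) | apply: (subsetP sR1)].
have costs : #|restr B R1 :\: A| + #|restr B R2 :\: A| <= c.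
  apply: leq_trans k1; rewrite -cardsUI.
  have -> : (restr B R1 :\: A) :&: (restr B R2 :\: A) = set0.
    apply/setP => -[x y]; rewrite in_setI !in_setD !restrE in_set0.
    apply/negP => /andP[/and4P[_ hB hx1 hy1] /and4P[_ _ hx2 hy2]].
    by have := valid_neq noloop v1 hB; rewrite (both x) // (both y) // eqxx.
  rewrite cards0 addn0; apply/subset_leq_card/subsetP => -[x y].
  by rewrite in_setU !in_setD !restrE => /orP[/and4P[-> ->]|/and4P[-> ->]].
have [B2 solB2 fullB2] := retr R2 sR2 v2r out2 in2 X Y hR2.
have cR2 : #|R2| <= #|R1 :|: R2| by exact: subset_leq_card.
have cR1 : #|R1| < #|R1 :|: R2|.
  apply: proper_card; rewrite properE sR1 /=; apply/subsetPn; exists io.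
    by rewrite !inE conn_refl !orbT.
  by apply/negP => h; move: nv; rewrite (both io) ?eqxx // inE conn_refl orbT.
have hIH x a' b' c' : x \in comp v io -> x != v -> solf A d (reg x v n) x a' b' c' -> a' < Nb -> b' < Nb -> c' < Cb ->
    #|reg x v n| < #|comp v io| -> PD x v n a' b' c'.
  move=> hx hxv hsol ha' hb' hc' hlt; apply: IH => //.
  have hk2 : #|reg x v n| * n.+1 + n < #|R1 :|: R2| * n.+1.
    apply: leq_trans (_ : #|reg x v n|.+1 * n.+1 <= _); first by rewrite mulSn addnC -addSn.
    by rewrite leq_mul2r /=; exact: leq_trans hlt cR2.
  by apply: leq_trans hk2 _; move: hk; clear; rewrite addnS; lia.
have [| | |s [z [h [q [c2 [pos [ia [oa [hr1 [hq1 hq2 hc2 htab hSD]]]]]]]]]] :=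
    scan_exists cact noloop s0 s1 hIH nv solB2 fullB2 hNb.
- exact: leq_ltn_trans hX ha.
- exact: leq_ltn_trans hY hb.
- by move: costs hc; clear; lia.
apply: (p2 v p io a b c a1 b1 #|restr B R1 :\: A| s z h q X Y c2 pos ia oa) => //.
  apply: IH.
  - move: hk cR1; rewrite /=; move: #|R1| #|R1 :|: R2| => u1 u2 h1 h2.
    have : u1 * n.+1 <= u2 * n.+1 by rewrite leq_mul2r (ltnW h2) orbT.
    by move: h1; clear; lia.
  - exact: ltnW.
  - exact: retr.
  - exact: leq_ltn_trans ha1 ha.
  - exact: leq_ltn_trans hb1 hb.
  by move: costs hc; clear; lia.
by apply: leq_trans costs; rewrite leq_add2l.
Qed.

End Parts.

(** * Reading the input *)

Definition FAnds (l : seq fm) := foldr FAnd (FEq 0 0) l.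
Definition FLe i j := FNot (FLt j i).
(* out of range, hence read as the default value 0 *)
Notation zz := 99.

Definition f_plus := FOr (FAnd (FZ 1) (FEq 0 2)) (FEx (FEx (FAnds [:: FSuc 1 3; FSuc 0 4; FRel 2 [:: 2; 1; 0]]))).
Definition f_times := FOr (FAnd (FZ 1) (FZ 2)) (FEx (FEx (FAnds [:: FSuc 1 3; FRel 3 [:: 2; 1; 0]; FRel 2 [:: 0; 2; 4]]))).
Definition f_tok (b1 b2 : bool) :=
  let lit b i := if b then FRel 1 [:: i] else FNot (FRel 1 [:: i]) in
  FEx (FEx (FAnds [:: FRel 2 [:: 2; 2; 1]; FSuc 1 0; lit b1 1; lit b2 0])).
(** Binary numbers are read from their least significant digit: the number at a token is twice the
    number at the next one, plus the digit. Only lower bounds are derived, because [d] and [k] may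
    exceed the universe. *)
Definition f_value := FOr (FZ 1) (FEx (FEx (FEx (FAnds [:: FSuc 3 2; FRel 2 [:: 1; 1; 0]; FRel 7 [:: 2; 1];
  FOr (FAnd (FRel 5 [:: 3]) (FLe 4 0)) (FAnd (FRel 4 [:: 3]) (FOr (FLe 4 0) (FSuc 0 4)))])))).
Definition f_seps := FAnds [:: FRel 6 [:: 0]; FNot (FEx (FAnd (FLt 0 1) (FRel 6 [:: 0])));
  FRel 6 [:: 1]; FLt 0 1; FNot (FEx (FAnds [:: FLt 1 0; FLt 0 2; FRel 6 [:: 0]]));
  FRel 6 [:: 2]; FLt 1 2; FNot (FEx (FAnds [:: FLt 2 0; FLt 0 3; FRel 6 [:: 0]]))].
Definition f_order := FAnd (FRel 7 [:: zz; 0]) (FNot (FEx (FAnd (FSuc 1 0) (FRel 7 [:: zz; 0])))).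
Definition FExn n f := iter n FEx f.
Definition f_arc := FExn 8 (FAnds [:: FRel 8 [:: 7; 6; 5]; FRel 9 [:: 4]; FLt 8 4; FLt 9 4; FRel 3 [:: 4; 8; 3];
  FRel 2 [:: 3; 9; 2]; FRel 2 [:: 2; 7; 1]; FSuc 1 0; FRel 4 [:: 0]]).
Definition f_bound s := FExn 4 (FAnds [:: FRel 8 [:: 3; 2; 1]; FSuc s 0; FRel 7 [:: 0; 4]]).

(* Relation 0 is the universe and relation 1 the input word; the stages define, from
   relation 2 on: sum, product, token 1, token 0, separator, lower bounds of a binary
   number, the three separators, the order of the graph, arc, at most d, at most k. *)
Definition parse_stages : seq (nat * fm) := [:: (3, f_plus); (3, f_times); (1, f_tok true true); (1, f_tok false false);
  (1, f_tok false true); (2, f_value); (3, f_seps); (1, f_order); (2, f_arc); (1, f_bound 2); (1, f_bound 1)].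

Section General.
Variables (N : nat) (I : interp).

(** A formula that mentions only earlier relations has its own extension as least fixed point, so
    such a stage is an explicit definition. *)
Lemma lfp_def r k f t : stage_lfp N I r k f -> rels_lt r f -> tuple_in N k t -> I r t <-> holds N I t f.
Proof.
move=> [h1 h2] hf ht; split; last exact: h1.
move: t ht; apply: (h2 (fun t => holds N I t f)) => J eJ _ t ht.
by move/(holds_local N t hf eJ).
Qed.

Lemma stages_nth st r i : stages_lfp N I r st -> i < size st ->
  stage_lfp N I (r + i) (nth (0, FZ 0) st i).1 (nth (0, FZ 0) st i).2.
Proof.
elim: st r i => [//|[k f] st IH] r [|i] /= [h1 h2] hi; first by rewrite addn0.
by rewrite addnS -addSn; exact: IH.
Qed.

Lemma tuple_in3 x y z : tuple_in N 3 [:: x; y; z] = [&& x < N, y < N & z < N].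
Proof. by rewrite /tuple_in /= andbT. Qed.

End General.

Fixpoint tok_value (s : seq (option bool)) : nat :=
  if s is Some b :: s' then b + 2 * tok_value s' else 0.

Lemma tok_value_bits m s : (if s is Some _ :: _ then False else True) -> tok_value (map Some (nat_bits m) ++ s) = m.
Proof.
move=> hs; rewrite /nat_bits; move: {2 3}m (leqnn m) => f; elim: f m => [|f IH] m hm /=.
  have -> : m = 0 by lia.
  by move: hs; clear; case: s => [|[]].
case: eqP => [->|hm0] /=; first by move: hs; clear; case: s => [|[]].
by rewrite IH; lia.
Qed.

Section Parse.
Variables (w : seq bool) (toks : seq (option bool)).
Hypothesis ew : w = flatten (map tok_bits toks).
Local Notation N := (size w).
Variable I : interp.
Hypothesis I1 : forall x, I 1 [:: x] = nth false w x.
Hypothesis hst : stages_lfp N I 2 parse_stages.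

Lemma size_w : N = 2 * size toks.
Proof. by rewrite ew; elim: toks => //= -[b|] l IH; rewrite /= IH mulnS. Qed.

Lemma nth_tok t : t < size toks ->
  (nth false w (t + t), nth false w (t + t).+1) = if nth None toks t is Some b then (b, b) else (false, true).
Proof.
rewrite ew; elim: toks t => //= x l IH [|t] ht; first by case: x => [[]|].
by rewrite addSn addnS; case: x => [b|] /=; rewrite IH.
Qed.

(** The pattern of all recursive stages: induction over the least fixed point gives soundness,
    closedness along the recursion gives completeness. All intermediate values stay in the universe
    because they are below [z]. *)
Lemma plusP x y z : x < N -> y < N -> z < N -> I 2 [:: x; y; z] <-> x + y = z.
Proof.
have [c1 c2] := stages_nth hst (isT : 0 < 11) => hx hy hz; split.
  pose Q t := nth 0 t 0 + nth 0 t 1 = nth 0 t 2.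
  move=> h; apply: (c2 Q _ [:: x; y; z]) => //; last by rewrite tuple_in3 hx hy hz.
  move=> J eJ hJ [|a [|b [|c [|]]]] //; rewrite tuple_in3 => /and3P[ha hb hc] [] /=; rewrite /Q /=; first by lia.
  move=> [b' hb' [c' hc' [e1 [e2 [e3 _]]]]].
  by have := hJ [:: a; b'; c'] _ e3; rewrite tuple_in3 ha hb' hc' => /(_ isT); rewrite /Q /=; lia.
elim: y z hy hz => [|y IH] z hy hz e; apply: c1; rewrite ?tuple_in3 ?hx ?hy ?hz //=; first by left; lia.
right; exists y; first by lia.
exists z.-1; first by lia.
by split; [|split; [lia | split=> //; apply: IH; lia]].
Qed.

Lemma timesP x y z : x < N -> y < N -> z < N -> I 3 [:: x; y; z] <-> x * y = z.
Proof.
have [c1 c2] := stages_nth hst (isT : 1 < 11) => hx hy hz; split.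
  pose Q t := nth 0 t 0 * nth 0 t 1 = nth 0 t 2.
  move=> h; apply: (c2 Q _ [:: x; y; z]) => //; last by rewrite tuple_in3 hx hy hz.
  move=> J eJ hJ [|a [|b [|c [|]]]] //; rewrite tuple_in3 => /and3P[ha hb hc] [] /=; rewrite /Q /=.
    by move=> [-> ->]; rewrite muln0.
  move=> [b' hb' [c' hc' [e1 [e2 []]]]]; rewrite (eJ 2) // => /plusP => /(_ hc' ha hc) e3 _.
  by have := hJ [:: a; b'; c'] _ e2; rewrite tuple_in3 ha hb' hc' => /(_ isT); rewrite /Q /= -e1 mulnS; lia.
elim: y z hy hz => [|y IH] z hy hz e; apply: c1; rewrite ?tuple_in3 ?hx ?hy ?hz //=; first by left; rewrite muln0 in e.
rewrite mulnS in e; right; exists y; first by lia.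
exists (x * y); first by lia.
by split=> //; split; [apply: IH; lia | split=> //; apply/plusP; lia].
Qed.

Lemma tokP b1 b2 r t : stage_lfp N I r 1 (f_tok b1 b2) -> 2 < r -> t < N ->
  I r [:: t] <-> t < size toks /\ (if nth None toks t is Some b then (b, b) else (false, true)) = (b1, b2).
Proof.
move=> hs hr ht; rewrite (lfp_def hs); last by rewrite /tuple_in /= ht.
  have lit b x e i : nth 0 e i = x -> holds N I e (if b then FRel 1 [:: i] else FNot (FRel 1 [:: i])) <-> nth false w x = b.
    by move=> <-; case: b => /=; rewrite I1 //; split=> [/negP/negbTE|->].
  rewrite /f_tok /=; split=> [[x hx [y hy [e1 [e2 [e3 [e4 _]]]]]]|[hts e]].
    move/plusP: e1 => /(_ ht ht hx) e1; have hts : t < size toks by have := size_w; lia.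
    split=> //; rewrite -nth_tok //; congr (_, _).
      by move: e3; rewrite (lit _ x) // -e1.
    by move: e4; rewrite (lit _ y) // -e2 -e1.
  have hN := size_w; exists (t + t); first by lia.
  exists (t + t).+1; first by lia.
  move: (nth_tok hts); rewrite e => -[n1 n2].
  split; first by apply/plusP; lia.
  by split=> //; split; [|split=> //]; [rewrite (lit _ (t + t)) | rewrite (lit _ (t + t).+1)].
by move: hr; clear; case: b1 b2 => -[] /=; lia.
Qed.

Lemma bitP b t : t < N -> I (if b then 4 else 5) [:: t] <-> t < size toks /\ nth None toks t = Some b.
Proof.
move=> ht; case: b.
  rewrite (tokP (stages_nth hst (isT : 2 < 11))) //.
  by case: (nth None toks t) => [[]|]; split=> -[h1 h2].
rewrite (tokP (stages_nth hst (isT : 3 < 11))) //.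
by case: (nth None toks t) => [[]|]; split=> -[h1 h2].
Qed.

Lemma sepP t : t < N -> I 6 [:: t] <-> t < size toks /\ nth None toks t = None.
Proof.
move=> ht; rewrite (tokP (stages_nth hst (isT : 4 < 11))) //.
by case: (nth None toks t) => [[]|]; split=> -[h1 h2].
Qed.

Lemma tok_value_drop t b : t < size toks -> nth None toks t = Some b ->
  tok_value (drop t toks) = b + 2 * tok_value (drop t.+1 toks).
Proof. by move=> ht e; rewrite (drop_nth None ht) e. Qed.

Lemma value_sound t x : t < N -> x < N -> I 7 [:: t; x] -> x <= tok_value (drop t toks).
Proof.
have [c1 c2] := stages_nth hst (isT : 5 < 11) => ht hx h.
pose Q s := nth 0 s 1 <= tok_value (drop (nth 0 s 0) toks).
apply: (c2 Q _ [:: t; x]) => //; last by rewrite /tuple_in /= ht hx.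
move=> J eJ hJ [|a [|b [|]]] //; rewrite /tuple_in /= andbT => /andP[ha hb] []; rewrite /Q /=; first by move=> ->.
move=> [a' ha' [y hy [s hs [e1 []]]]]; rewrite (eJ 2) // => /plusP => /(_ hy hy hs) e2 [e3 [e4 _]].
have := hJ [:: a'; y] _ e3; rewrite /tuple_in /= ha' hy => /(_ isT); rewrite /Q /= -e1.
case: e4 => -[]; rewrite (eJ 5) // || rewrite (eJ 4) //.
  by move/(bitP false ha) => [hat /(tok_value_drop hat) ->]; lia.
by move/(bitP true ha) => [hat /(tok_value_drop hat) ->]; lia.
Qed.

Lemma value_complete t x : t < N -> x.+1 < N -> x <= tok_value (drop t toks) -> I 7 [:: t; x].
Proof.
have [c1 c2] := stages_nth hst (isT : 5 < 11).
move: {2}(size toks - t) (leqnn (size toks - t)) => k; elim: k t x => [|k IH] t x hk ht hx hv; apply: c1; rewrite ?/tuple_in /= ?ht ?andbT; try lia.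
  by left; move: hv; rewrite drop_oversize /=; lia.
case: (posnP x) => [->|x0]; [by left | right].
have hts : t < size toks by rewrite ltnNge; apply/negP => h; rewrite drop_oversize // in hv; move: hv x0; rewrite /=; lia.
have hN := size_w.
case e : (nth None toks t) => [b|]; last by move: hv; rewrite (drop_nth None hts) e /=; lia.
move: hv; rewrite (tok_value_drop hts e) => hv.
have ht1 : t.+1 < N by lia.
exists t.+1 => //.
case: b e hv => e hv.
  exists x./2; first by lia.
  exists (x./2 + x./2); first by lia.
  split=> //; split; first by apply/plusP; lia.
  split; first by apply: IH; lia.
  split=> //=; right; split; first by apply/(bitP true).
  by case: (leqP x (x./2 + x./2)) => h; [left; lia | right; lia].
(* For odd [x] and digit 0 the doubled value is [x.+1]; this is why the universe must contain it. *)
exists (uphalf x); first by lia.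
exists (uphalf x + uphalf x); first by lia.
split=> //; split; first by apply/plusP; lia.
split; first by apply: IH; lia.
by split=> //=; left; split; [apply/(bitP false) | lia].
Qed.
End Parse.

Lemma nth_allpairs_grid (S T R : Type) (f : S -> T -> R) x0 y0 z0 (s : seq S) (t : seq T) i j :
  i < size s -> j < size t -> nth z0 [seq f x y | x <- s, y <- t] (i * size t + j) = f (nth x0 s i) (nth y0 t j).
Proof.
move=> + hj; elim: s i => [//|x s IH] [|i] /= hi; rewrite nth_cat size_map.
  by rewrite mul0n add0n hj (nth_map y0).
by rewrite mulSn -addnA ltnNge leq_addr /= addKn IH.
Qed.

Lemma nat_bits_gt0 m : 0 < m -> 0 < size (nat_bits m).
Proof. by case: m. Qed.

Lemma nat_bits_gt1 m : 1 < m -> 1 < size (nat_bits m).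
Proof. by case: m => [|[|m]]. Qed.

Section Encoding.
Variables (n : nat) (A : arcs n) (d k : nat).
Hypothesis n0 : 0 < n.
Hypothesis d2 : 1 < d.
Local Notation w := (encode A d k).
Local Notation N := (size w).
Variable I : interp.
Hypothesis I1 : forall x, I 1 [:: x] = nth false w x.
Hypothesis hst : stages_lfp N I 2 parse_stages.

Let bn := nat_bits n.
Let bd := nat_bits d.
Let bk := nat_bits k.
Let toks := map Some bn ++ None :: map Some (adj_bits A) ++ None :: map Some bd ++ None :: map Some bk.
Let s1 := size bn.
Let s2 := s1 + (n * n).+1.
Let s3 := s2 + (size bd).+1.
Let ew : w = flatten (map tok_bits toks).
Proof. by []. Qed.

Lemma size_adj_bits : size (adj_bits A) = n * n.
Proof. by rewrite size_allpairs size_enum_ord. Qed.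

Let size_toks : size toks = (s3 + size bk).+1.
Proof. by rewrite /toks !size_cat /= !size_cat /= !size_cat /= !size_map size_adj_bits /s3 /s2 /s1; lia. Qed.

(** Besides the adjacency bits there are three separators, at least one bit for [n] and at least two
    for [d], and each token takes two bits. The slack makes sums of three stored numbers fit into
    the universe even for small [n]. *)
Lemma size_encode : 2 * (n * n) + 12 <= N.
Proof.
rewrite (size_w ew) size_toks /s3 /s2 /s1.
by have := nat_bits_gt0 n0; have := nat_bits_gt1 d2; rewrite -/bn -/bd; lia.
Qed.

Let nth_sep t : t < size toks -> nth None toks t = None <-> [\/ t = s1, t = s2 | t = s3].
Proof.
move=> ht; have hs := size_toks; rewrite /toks nth_cat size_map -/s1.
have some (l : seq bool) j : j < size l -> nth None (map Some l) j = None -> False by move=> hj; rewrite (nth_map false).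
case: ltnP => h1.
  split=> [/(some _ _ h1)//|[]]; rewrite ?/s3 ?/s2; lia.
case e1 : (t - s1) => [|j1] /=; first by split=> // _; apply: Or31; lia.
rewrite nth_cat size_map size_adj_bits; case: ltnP => h2.
  split=> [/some|[]]; rewrite ?size_adj_bits ?/s3 ?/s2; try lia.
case e2 : (j1 - n * n) => [|j2] /=; first by split=> // _; apply: Or32; rewrite /s2; lia.
rewrite nth_cat size_map; case: ltnP => h3.
  split=> [/(some _ _ h3)//|[]]; rewrite ?/s3 ?/s2; lia.
case e3 : (j2 - size bd) => [|j3] /=; first by split=> // _; apply: Or33; rewrite /s3 /s2; lia.
split=> [/some|[]]; rewrite ?/s3 ?/s2; try lia.
Qed.

Let sep t : t < N -> I 6 [:: t] <-> [\/ t = s1, t = s2 | t = s3].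
Proof.
move=> ht; rewrite (sepP ew I1 hst) //; split=> [[h /(nth_sep h)]//|h].
by have hl : t < size toks; [rewrite size_toks; case: h; rewrite /s3 /s2; lia | rewrite nth_sep].
Qed.

Let s3N : s3 < N.
Proof. by rewrite (size_w ew) size_toks; lia. Qed.

Lemma sepsP a b c : a < N -> b < N -> c < N -> I 8 [:: a; b; c] <-> [/\ a = s1, b = s2 & c = s3].
Proof.
move=> ha hb hc; rewrite (lfp_def (stages_nth hst (isT : 6 < 11))) //; last by rewrite tuple_in3 ha hb hc.
have h12 : s1 < s2 by rewrite /s2; lia.
have h23 : s2 < s3 by rewrite /s3; lia.
rewrite /=; split; last first.
  move=> [-> -> ->]; rewrite !sep; try lia.
  split; first by apply: Or31.
  split; first by move=> [u hu [hu1]]; rewrite sep // => -[]; lia.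
  split; first by apply: Or32.
  split=> //; split; first by move=> [u hu [hu1 [hu2 []]]]; rewrite sep // => -[]; lia.
  split; first by apply: Or33.
  split=> //; split=> //; by move=> [u hu [hu1 [hu2 []]]]; rewrite sep // => -[]; lia.
move=> [/(sep ha) h1 [m1 [/(sep hb) h2 [l1 [m2 [/(sep hc) h3 [l2 [m3 _]]]]]]]].
have ea : a = s1.
  case: (ltnP s1 a) => h; last by case: h1; lia.
  case: m1; exists s1; first by lia.
  by split=> //; apply/sep; [lia | apply: Or31].
have eb : b = s2.
  case: (ltnP s2 b) => h; last by case: h2; lia.
  case: m2; exists s2; first by lia.
  by split; [lia | split=> //; split=> //; apply/sep; [lia | apply: Or32]].
by split=> //; case: h3; lia.
Qed.

Let value0 : tok_value (drop 0 toks) = n.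
Proof. by rewrite drop0 /toks tok_value_bits. Qed.

Lemma orderP x : x < N -> I 9 [:: x] <-> x = n.
Proof.
have hN := size_encode; have hn : n <= n * n by rewrite leq_pmulr.
move=> hx; rewrite (lfp_def (stages_nth hst (isT : 7 < 11))) //; last by rewrite /tuple_in /= hx.
have z0 : 0 < N by lia.
rewrite /=; split=> [[h1 h2]|->].
  have := value_sound ew I1 hst z0 hx h1; rewrite value0 => h3.
  case: (ltnP x n) => h; last by lia.
  case: h2; exists x.+1; first by lia.
  by split=> //; apply: (value_complete ew I1 hst) => //; [lia | rewrite value0].
split; first by apply: (value_complete ew I1 hst) => //; [lia | rewrite value0].
by move=> [y hy [<-]] /(value_sound ew I1 hst z0); rewrite value0 => h; have : n.+1 <= n; [apply: h; lia | lia].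
Qed.

Lemma arcP i j : i < N -> j < N -> I 10 [:: i; j] <-> exists hi : i < n, exists hj : j < n, (Ordinal hi, Ordinal hj) \in A.
Proof.
have hN := size_encode; have hn : n <= n * n by rewrite leq_pmulr.
have h3 := s3N; have hs := size_w ew; have hst' := size_toks.
have grid (hi : i < n) (hj : j < n) : nth None toks (s1 + (i * n + j)).+1 = Some ((Ordinal hi, Ordinal hj) \in A).
  have lt : i * n + j < n * n by apply: leq_trans (_ : i.+1 * n <= _); [rewrite mulSn; lia | rewrite leq_mul2r hi orbT].
  rewrite /toks nth_cat size_map -/s1 ltnNge -addnS leq_addr /= addKn /=.
  rewrite nth_cat size_map size_adj_bits lt (nth_map false) ?size_adj_bits //; congr Some.
  have := @nth_allpairs_grid _ _ _ (fun i j => (i, j) \in A) (Ordinal hi) (Ordinal hj) false (enum 'I_n) (enum 'I_n) i j.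
  rewrite size_enum_ord => -> //; congr ((_, _) \in A); apply: val_inj; rewrite /= nth_enum_ord //.
move=> hi hj; rewrite (lfp_def (stages_nth hst (isT : 8 < 11))) //; last by rewrite /tuple_in /= hi hj.
rewrite /=; split.
  move=> [v1 l1 [v2 l2 [v3 l3 [n' ln [m lm [r lr [r' lr' [t lt]]]]]]]].
  move=> [/(sepsP l1 l2 l3) [e1 _ _] [/(orderP ln) en [hin [hjn [/(timesP hst ln hi lm) em [/(plusP hst lm hj lr) er [/(plusP hst lr l1 lr') er' [et [/(bitP ew I1 hst true lt)[_ hb] _]]]]]]]]].
  rewrite en in hin hjn em; exists hin, hjn; move: hb.
  by rewrite -et -er' -er -em e1 (mulnC n) (addnC _ s1) grid => -[].
move=> [hin [hjn hA]].
have lt : i * n + j < n * n by apply: leq_trans (_ : i.+1 * n <= _); [rewrite mulSn; lia | rewrite leq_mul2r hin orbT].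
have lt2 : (i * n + j + s1).+1 < s3 by rewrite /s3 /s2; lia.
have sN : [/\ s1 < N, s2 < N & s3 < N] by rewrite /s3 /s2 in h3 *; split; lia.
have [q1 q2 q3] := sN.
exists s1 => //; exists s2 => //; exists s3 => //; exists n; first by lia.
exists (i * n); first by lia.
exists (i * n + j); first by lia.
exists (i * n + j + s1); first by lia.
exists (i * n + j + s1).+1; first by lia.
split; first by apply/sepsP.
split; first by apply/orderP; lia.
split=> //; split=> //; split; first by apply/(timesP hst); lia.
split; first by apply/(plusP hst); lia.
split; first by apply/(plusP hst); lia.
split=> //; split=> //; apply/(bitP ew I1 hst true); first by lia.
by split; [lia | rewrite (addnC _ s1) grid hA].
Qed.

Let value_d : tok_value (drop s2.+1 toks) = d.
Proof.
rewrite /toks /s2 /s1 -addnS drop_cat size_map ltnNge leq_addr /= addKn /=.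
by rewrite drop_cat size_map size_adj_bits ltnNge leqnSn /= subSnn /= drop0 tok_value_bits.
Qed.

Let value_k : tok_value (drop s3.+1 toks) = k.
Proof.
rewrite /toks /s3 /s2 /s1 -addnA -addnS drop_cat size_map ltnNge leq_addr /= addKn /=.
rewrite addSnnS drop_cat size_map size_adj_bits ltnNge leq_addr /= addKn /=.
rewrite drop_cat size_map ltnNge leqnSn /= subSnn /= drop0.
by rewrite -[map Some bk]cats0 tok_value_bits.
Qed.

Lemma bound_sound x : x < N -> (I 11 [:: x] -> x <= d) /\ (I 12 [:: x] -> x <= k).
Proof.
move=> hx; split.
  rewrite (lfp_def (stages_nth hst (isT : 9 < 11))) //; last by rewrite /tuple_in /= hx.
  move=> [v1 l1 [v2 l2 [v3 l3 [t lt]]]] /= [/(sepsP l1 l2 l3)[_ e2 _] [et [/(value_sound ew I1 hst lt hx) + _]]].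
  by rewrite -et e2 value_d.
rewrite (lfp_def (stages_nth hst (isT : 10 < 11))) //; last by rewrite /tuple_in /= hx.
move=> [v1 l1 [v2 l2 [v3 l3 [t lt]]]] /= [/(sepsP l1 l2 l3)[_ _ e3] [et [/(value_sound ew I1 hst lt hx) + _]]].
by rewrite -et e3 value_k.
Qed.

Lemma bound_complete x : x.+1 < N -> (x <= d -> I 11 [:: x]) /\ (x <= k -> I 12 [:: x]).
Proof.
move=> hx; have h3 := s3N; have hs := size_w ew; have hst' := size_toks; have hx' := ltnW hx.
have sN : [/\ s1 < N, s2 < N & s3.+1 < N] by rewrite /s3 /s2 in h3 hst' *; split; lia.
have [q1 q2 q3] := sN.
split=> hle.
  rewrite (lfp_def (stages_nth hst (isT : 9 < 11))) //; last by rewrite /tuple_in /= hx'.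
  have q4 : s2.+1 < N by rewrite /s3 in q3; lia.
  exists s1 => //; exists s2 => //; exists s3; first by lia.
  exists s2.+1 => //=; split; first by apply/sepsP => //; lia.
  by split=> //; split=> //; apply: (value_complete ew I1 hst) => //; rewrite value_d.
rewrite (lfp_def (stages_nth hst (isT : 10 < 11))) //; last by rewrite /tuple_in /= hx'.
exists s1 => //; exists s2 => //; exists s3; first by lia.
exists s3.+1 => //=; split; first by apply/sepsP => //; lia.
by split=> //; split=> //; apply: (value_complete ew I1 hst) => //; rewrite value_k.
Qed.

End Encoding.

(** * Walks and distances on rings *)

Definition f_adj := FOr (FRel 10 [:: 0; 1]) (FRel 10 [:: 1; 0]).
Definition f_conn := FOr (FEq 1 2) (FEx (FAnds [:: FRel 14 [:: 1; 2; 0]; FRel 13 [:: 0; 3]; FNot (FEq 0 1); FNot (FEq 3 1)])).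
Definition f_next := FOr (FAnds [:: FNot (FEq 2 0); FRel 13 [:: 1; 2]; FRel 14 [:: 1; 0; 2]])
  (FAnd (FEq 2 0) (FNot (FEx (FAnds [:: FNot (FEq 0 1); FRel 13 [:: 2; 0]; FRel 14 [:: 2; 1; 0]])))).
(** Iterates the ring successor from a given first edge. The two vertices of that edge thus serve as
    the name of the ring together with its starting point and direction. *)
Definition f_walk := FOr (FAnds [:: FZ 2; FEq 3 0; FEq 4 1])
  (FExn 2 (FAnds [:: FSuc 1 4; FRel 16 [:: 2; 3; 1; 0; 5]; FRel 15 [:: 0; 5; 6]])).
Definition f_ring := FAnd (FRel 13 [:: 0; 1]) (FRel 16 [:: 0; 1; 2; 3; 4]).
Definition f_len := FAnds [:: FNot (FZ 2); FRel 17 [:: 0; 1; 2; 0; 1];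
  FNot (FEx (FAnds [:: FNot (FZ 0); FLt 0 3; FRel 17 [:: 1; 2; 0; 1; 2]]))].
Definition f_mem := FExn 2 (FRel 17 [:: 2; 3; 1; 4; 0]).
Definition f_rarc := FEx (FOr (FRel 17 [:: 1; 2; 0; 3; 4])
  (FAnds [:: FRel 17 [:: 1; 2; 0; 4; 3]; FRel 10 [:: 3; 4]; FRel 10 [:: 4; 3]])).
Definition f_dist := FOr (FEq 2 3) (FExn 2 (FAnds [:: FSuc 1 6; FRel 20 [:: 2; 3; 4; 0]; FRel 21 [:: 2; 3; 0; 5; 1]])).
Definition f_le2 := FEx (FAnd (FRel 2 [:: 1; 2; 0]) (FLe 0 3)).
Definition f_led2 := FEx (FAnd (FRel 2 [:: 1; 2; 0]) (FRel 11 [:: 0])).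
Definition f_led3 := FEx (FAnd (FRel 2 [:: 1; 2; 0]) (FRel 23 [:: 0; 3])).
Definition f_move := FExn 3 (FAnds [:: FSuc 2 5; FSuc 0 8; FRel 21 [:: 3; 4; 6; 7; 1]; FRel 22 [:: 2; 1; 0]]).
Definition f_cover := FExn 2 (FAnds [:: FSuc 0 7; FRel 21 [:: 2; 3; 5; 6; 1]; FRel 22 [:: 4; 1; 0]]).
Definition f_check := FExn 2 (FAnds [:: FSuc 1 4; FRel 21 [:: 2; 3; 5; 6; 0]; FRel 24 [:: 1; 0; 7]]).
Definition f_reach := FEx (FAnd (FRel 21 [:: 1; 2; 4; 5; 0]) (FRel 22 [:: 3; 0; 6])).
Definition f_old := FOr (FEq 2 0) (FOr (FRel 14 [:: 0; 2; 1]) (FEx (FAnd (FLt 0 3) (FRel 14 [:: 1; 0; 3])))).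

(** Relations 13 to 29: adjacency, connection avoiding a vertex, ring successor, walk, ring
    position, ring length, ring membership, ring arc, ring distance, the three sum comparisons, the
    atoms for moving, covering, checking and reaching in a scan step, and [old]. *)
Definition graph_stages : seq (nat * fm) := [:: (2, f_adj); (3, f_conn); (3, f_next); (5, f_walk); (5, f_ring);
  (3, f_len); (3, f_mem); (4, f_rarc); (5, f_dist); (3, f_le2); (2, f_led2); (3, f_led3);
  (6, f_move); (6, f_cover); (6, f_check); (6, f_reach); (3, f_old)].

Section GraphStages.
Variables (n : nat) (A : arcs n) (d N : nat) (I : interp).
Local Notation V := 'I_n.
Local Notation vv := (@nat_of_ord n).
Local Notation g := (uadj A).
Hypothesis cact : cactus A.
Hypothesis noloop : loopless A.
Hypothesis nN : n < N.
Hypothesis plus : forall x y z, x < N -> y < N -> z < N -> I 2 [:: x; y; z] <-> x + y = z.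
Hypothesis arc : forall i j, i < N -> j < N -> I 10 [:: i; j] <-> exists hi : i < n, exists hj : j < n, (Ordinal hi, Ordinal hj) \in A.
Hypothesis bd_sound : forall x, x < N -> I 11 [:: x] -> x <= d.
Hypothesis bd_complete : forall x, x.+1 < N -> x <= d -> I 11 [:: x].
Hypothesis hst : stages_lfp N I 13 graph_stages.

Let VN (x : V) : x < N. Proof. exact: ltn_trans (ltn_ord x) nN. Qed.

Let ordE (x : V) (h : vv x < n) : Ordinal h = x. Proof. exact: ord_inj. Qed.

Lemma arc_ord (x y : V) : I 10 [:: vv x; vv y] <-> (x, y) \in A.
Proof.
rewrite arc ?VN //; split=> [[hi [hj]]|h]; first by rewrite !ordE.
by exists (ltn_ord x), (ltn_ord y); rewrite !ordE.
Qed.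

Lemma arc_lift x y : x < N -> y < N -> I 10 [:: x; y] -> exists X Y : V, x = X /\ y = Y.
Proof. by move=> hx hy; rewrite arc // => -[hi [hj _]]; exists (Ordinal hi), (Ordinal hj). Qed.

Lemma adj_ord (x y : V) : I 13 [:: vv x; vv y] <-> g x y.
Proof.
rewrite (lfp_def (stages_nth hst (isT : 0 < 17))) //; last by rewrite /tuple_in /= !VN.
rewrite /= !arc_ord /uadj; split=> [[]->|/orP[]->]; rewrite ?orbT //; by [left | right].
Qed.

Lemma adj_lift x y : x < N -> y < N -> I 13 [:: x; y] -> exists X Y : V, [/\ x = X, y = Y & g X Y].
Proof.
move=> hx hy h; have [X [Y [ex ey]]] : exists X Y : V, x = X /\ y = Y.
  move: h; rewrite (lfp_def (stages_nth hst (isT : 0 < 17))) //; last by rewrite /tuple_in /= hx hy.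
  by move=> /= [/arc_lift|/arc_lift] => /(_ _ _)[//|//|X [Y [? ?]]]; [exists X, Y | exists Y, X].
by exists X, Y; split=> //; apply/adj_ord; rewrite -ex -ey.
Qed.

Lemma connP (v x y : V) : I 14 [:: vv v; vv x; vv y] <-> conn A v x y.
Proof.
have [c1 c2] := stages_nth hst (isT : 1 < 17); split.
  pose Q t := forall v x y : V, t = [:: vv v; vv x; vv y] -> conn A v x y.
  move=> h; apply: (c2 Q _ _ _ h) => //; last by rewrite tuple_in3 !VN.
  move=> J eJ hJ t ht hh v' x' y' et; subst t; case: hh => /= [/ord_inj ->|]; first exact: conn_refl.
  move=> [u hu [h1 [h2 [h3 [h4 _]]]]].
  move: h2; rewrite eJ // => /(adj_lift hu (VN _))[U [Y' [eu /ord_inj eY hUY]]]; subst u Y'.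
  apply: conn_trans (hJ _ _ h1 v' x' U erefl) _; first by rewrite tuple_in3 !VN.
  by apply: conn_step => //; apply/eqP => e; [apply: h3 | apply: h4]; rewrite e.
have cl (a : V) : I 14 [:: vv v; vv a; vv a] by apply: c1; [rewrite tuple_in3 !VN | left].
apply: (connect_ind (P := fun y : V => I 14 [:: vv v; vv x; vv y])) => // a b ha /and3P[hab hav hbv].
apply: c1; first by rewrite tuple_in3 !VN.
right; exists (vv a) => //=; split=> //; split; first exact/adj_ord.
by split; [|split=> //]; move=> /ord_inj e; move: hav hbv; rewrite e eqxx.
Qed.

Lemma nextP (u x : V) y : y < N -> I 15 [:: vv u; vv x; y] <-> exists2 Y : V, y = Y & next_on A u x Y.
Proof.
move=> hy; rewrite (lfp_def (stages_nth hst (isT : 2 < 17))) //; last by rewrite tuple_in3 !VN hy.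
rewrite /=; split=> [[[h1 [h2 [h3 _]]]|[h1 h2]]|[Y ey [[h1 h2 h3]|[h1 h2]]]].
- have [X [Y [/ord_inj eX ey hXY]]] := adj_lift (VN _) hy h2; subst X y.
  by exists Y => //; left; split; [apply/eqP => e; apply: h1; rewrite e | | apply/connP].
- exists u => //; right; split=> // z' [z1 z2 z3]; apply: h2; exists (vv z'); first exact: VN.
  split; first by move=> /ord_inj e; rewrite e eqxx in z1.
  by split; [apply/adj_ord | split=> //; apply/connP].
- subst y; left; split; first by move=> /ord_inj e; rewrite e eqxx in h1.
  by split; [apply/adj_ord | split=> //; apply/connP].
subst y Y; right; split=> // -[z hz [z1 [z2 [z3 _]]]].
have [X [Z [/ord_inj eX ez hXZ]]] := adj_lift (VN _) hz z2; subst X z.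
by apply: (h2 Z); split; [apply/eqP => e; apply: z1; rewrite e | | apply/connP].
Qed.

Section OneRing.
Variables (s : seq V) (x0 : V).
Hypothesis hs : ring A s.
Local Notation c := (rc s x0).

Lemma size_ring_le : size s <= n.
Proof. by have := max_card [pred x | x \in s]; rewrite card_ord (card_uniqP (ring_uniq hs)). Qed.

Lemma ringP i x y : i < N -> x < N -> y < N ->
  I 17 [:: vv (c 0); vv (c 1); i; x; y] <-> x = c i /\ y = c i.+1.
Proof.
move=> hi hx hy; rewrite (lfp_def (stages_nth hst (isT : 4 < 17))) //; last by rewrite /tuple_in /= !VN hi hx hy.
have [c1 c2] := stages_nth hst (isT : 3 < 17).
rewrite /=; split.
  move=> [_ h].
  pose Q t := forall i x y, t = [:: vv (c 0); vv (c 1); i; x; y] -> x = c i /\ y = c i.+1.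
  apply: (c2 Q _ _ _ h) => //; last by rewrite /tuple_in /= !VN hi hx hy.
  move=> J eJ hJ t ht hh i' x' y' et; subst t.
  move: ht; rewrite /tuple_in /= => /and4P[_ _ hi' /and3P[hx' hy' _]].
  case: hh => /= [[e1 [e2 [e3 _]]]|]; first by rewrite e1 e2 e3.
  move=> [j hj [u hu [e1 [h1 [h2 _]]]]].
  have ht1 : tuple_in N 5 [:: vv (c 0); vv (c 1); j; u; x'] by rewrite /tuple_in /= !VN hj hu hx'.
  have [eu ex] := hJ _ ht1 h1 j u x' erefl.
  move: h2; rewrite eJ // eu ex => /(nextP _ _ hy') [Y ey].
  by rewrite (ring_next cact noloop x0 hs) => eY; rewrite ey eY -e1.
move=> [-> ->]; split; first by apply/adj_ord; exact: rc_adj.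
elim: i hi {hx hy x y} => [|i IH] hi; apply: c1; rewrite /tuple_in /= ?hi ?VN //; first by left.
right; exists i; first exact: ltnW.
exists (vv (c i)); first exact: VN.
split=> //=; split; first exact: IH (ltnW hi).
split=> //; apply/(nextP _ _ (VN _)); exists (c i.+2) => //.
by rewrite (ring_next cact noloop x0 hs).
Qed.

Lemma lenP m : m < N -> I 18 [:: vv (c 0); vv (c 1); m] <-> m = size s.
Proof.
have sn := size_ring_le; have s2 := ring_size hs.
move=> hm; rewrite (lfp_def (stages_nth hst (isT : 5 < 17))) //; last by rewrite tuple_in3 !VN hm.
have key j : j < N -> I 17 [:: vv (c 0); vv (c 1); j; vv (c 0); vv (c 1)] <-> j %% size s = 0.
  move=> hj; rewrite ringP ?VN //; split=> [[/ord_inj e _]|e].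
    by move/eqP: e; rewrite (rc_eq x0 hs) mod0n => /eqP.
  rewrite -(rc_mod s x0 j) -(rc_mod s x0 j.+1) -[j.+1]addn1 -modnDml e add0n rc_mod; split=> //.
rewrite /=; split.
  move=> [/eqP m0 [/(key _ hm) em [hmin _]]].
  have dm : size s %| m by rewrite /dvdn em.
  case: (ltngtP m (size s)) => // h; first by have := dvdn_leq _ dm; lia.
  by case: hmin; exists (size s); [lia | split; [lia | split=> //; split=> //; apply/key; [lia | rewrite modnn]]].
move=> ->; split; first lia.
split; first by apply/key; rewrite ?modnn; lia.
split=> // -[j hj [j0 [jm [/(key _ hj)]]]].
by rewrite modn_small.
Qed.

Lemma memP x : x < N -> I 19 [:: vv (c 0); vv (c 1); x] <-> exists2 X : V, x = X & X \in s.
Proof.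
have sn := size_ring_le.
move=> hx; rewrite (lfp_def (stages_nth hst (isT : 6 < 17))) //; last by rewrite tuple_in3 !VN hx.
rewrite /=; split=> [[j hj [y hy /(ringP hj hx hy)[-> _]]]|[X -> hX]].
  by exists (c j) => //; exact: (rc_mem x0 hs).
have [j hj ->] := rc_surj x0 hX; exists j; first by lia.
by exists (vv (c j.+1)); [exact: VN | apply/ringP; rewrite ?VN //; lia].
Qed.

Lemma rarcP x y : x < N -> y < N -> I 20 [:: vv (c 0); vv (c 1); x; y] <->
  exists X Y : V, [/\ x = X, y = Y & (X, Y) \in ring_arcs A s].
Proof.
have sn := size_ring_le.
move=> hx hy; rewrite (lfp_def (stages_nth hst (isT : 7 < 17))) //; last by rewrite /tuple_in /= !VN hx hy.
rewrite /=; split=> [[j hj []]|[X [Y [-> -> hXY]]]].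
- by move=> /(ringP hj hx hy)[-> ->]; exists (c j), (c j.+1); split=> //; exact: ring_arcs_fwd.
- move=> [/(ringP hj hy hx)[-> ->] [/arc_ord h1 [/arc_ord h2 _]]].
  by exists (c j.+1), (c j); split=> //; apply: ring_arcs_bwd.
move: hXY; rewrite ring_arcsE => /andP[he hor].
have [hXs hYs] := ring_edge_mem he.
case/orP: (hor) => [/eqP e|/andP[h1 h2]].
  have [j hj eX] := rc_surj x0 hXs; exists j; first by lia.
  by left; apply/ringP; rewrite ?VN //; [lia | rewrite -e eX (rc_next x0 hs)].
have [j hj [[eX eY]|[eY eX]]] := ring_edgeP x0 hs he; subst X Y; (exists j; first exact: ltn_trans (leq_trans hj sn) nN).
  by left; apply/ringP; rewrite ?VN //; lia.
by right; split; [apply/ringP; rewrite ?VN //; lia | split; [exact/arc_ord | split=> //; exact/arc_ord]].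
Qed.

Definition rd (x y : V) l := l < N /\ I 21 [:: vv (c 0); vv (c 1); vv x; vv y; l].

Lemma distP (x y : V) l : rd x y l <-> l < N /\ rdist A s x y l.
Proof.
have [c1 c2] := stages_nth hst (isT : 8 < 17).
suff h : l < N -> I 21 [:: vv (c 0); vv (c 1); vv x; vv y; l] <-> rdist A s x y l.
  by rewrite /rd; split=> -[h1 h2]; split=> //; apply/h.
move=> hl; split.
  pose Q t := forall x y l, t = [:: vv (c 0); vv (c 1); vv x; vv y; l] -> rdist A s x y l.
  move=> h; apply: (c2 Q _ _ _ h) => //; last by rewrite /tuple_in /= !VN hl.
  move=> J eJ hJ t ht hh x' y' l' et; subst t.
  have hl' : l' < N by move: ht; rewrite /tuple_in /= !VN andbT.
  case: hh => /= [/ord_inj ->|]; first by apply: dist_weak (subxx _) (leq0n _) (dist_refl _ _).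
  move=> [k hk [u hu [e1 [h1 [h2 _]]]]].
  move: h1; rewrite eJ // => /(rarcP (VN _) hu) [X [U [/ord_inj eX eu hXU]]]; subst X u.
  have ht1 : tuple_in N 5 [:: vv (c 0); vv (c 1); vv U; vv y'; k] by rewrite /tuple_in /= !VN hk.
  by apply: dist_trans (dist_arc hXU) (hJ _ ht1 h2 U y' k erefl) _; lia.
elim: l x hl => [|l IH] x hl.
  by move/dist0 => ->; apply: c1; [rewrite /tuple_in /= !VN hl | left].
case/dist_step => [->|[u hxu hd]]; apply: c1; rewrite ?/tuple_in /= ?VN ?hl //; first by left.
right; exists l; first by lia.
exists (vv u); first exact: VN.
split=> //; split; first by apply/(rarcP (VN _) (VN _)); exists x, u.
by split=> //; apply: IH => //; lia.
Qed.

(** The distance relation also contains diagonal pairs of numbers that are no vertices; apart from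
    these both ends are vertices. *)
Lemma dist_lift x y l : x < N -> y < N -> l < N -> I 21 [:: vv (c 0); vv (c 1); x; y; l] ->
  x = y \/ exists X Y : V, x = X /\ y = Y.
Proof.
have [c1 c2] := stages_nth hst (isT : 8 < 17) => hx hy hl.
pose Q t := nth 0 t 2 = nth 0 t 3 \/ exists X Y : V, nth 0 t 2 = X /\ nth 0 t 3 = Y.
have Qt t : tuple_in N 5 t -> nth 0 t 0 = c 0 -> nth 0 t 1 = c 1 -> I 21 t -> Q t; last first.
  by move=> h; apply: (Qt [:: vv (c 0); vv (c 1); x; y; l]); rewrite // /tuple_in /= !VN hx hy hl.
move=> ht e0 e1 hI; pose Q' t := nth 0 t 0 = c 0 -> nth 0 t 1 = c 1 -> Q t.
apply: (c2 Q' _ t ht hI) => // J eJ hJ {ht e0 e1 hI}t ht hh e0 e1.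
move: ht hh e0 e1; case: t => [|p [|q [|x' [|y' [|l' [|]]]]]] //.
rewrite /tuple_in /= => /and5P[hp hq hx' hy' hl'] [e|]; first by move=> *; left.
move=> [k hk [u hu [e1 [h1 [h2 _]]]]] ep eq; subst p q.
move: h1; rewrite eJ // => /(rarcP hx' hu) [X [U [eX eu hXU]]]; subst x' u; right.
have ht1 : tuple_in N 5 [:: vv (c 0); vv (c 1); vv U; y'; k] by rewrite /tuple_in /= !VN hy' hk.
case: (hJ _ ht1 h2 erefl erefl) => /= [<-|[_ [Y [_ ->]]]]; first by exists X, U.
by exists X, Y.
Qed.

End OneRing.

Lemma le2P x y z : x < N -> y < N -> z < N -> I 22 [:: x; y; z] <-> x + y <= z.
Proof.
move=> hx hy hz; rewrite (lfp_def (stages_nth hst (isT : 9 < 17))) //; last by rewrite tuple_in3 hx hy hz.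
rewrite /=; split=> [[t ht [/(plus hx hy ht)]]|h]; first by lia.
by exists (x + y); [lia | split; [apply/plus; lia | lia]].
Qed.

Lemma led2_sound x y : x < N -> y < N -> I 23 [:: x; y] -> x + y <= d.
Proof.
move=> hx hy; rewrite (lfp_def (stages_nth hst (isT : 10 < 17))) //; last by rewrite /tuple_in /= hx hy.
by move=> [t ht [/(plus hx hy ht) ->]]; exact: bd_sound.
Qed.

Lemma led2_complete x y : (x + y).+1 < N -> x + y <= d -> I 23 [:: x; y].
Proof.
move=> h1 h2; rewrite (lfp_def (stages_nth hst (isT : 10 < 17))) //; last by rewrite /tuple_in /=; lia.
exists (x + y); first by lia.
rewrite /=; split; [apply/plus => //; lia | exact: bd_complete].
Qed.

Lemma led3_sound x y z : x < N -> y < N -> z < N -> I 24 [:: x; y; z] -> x + y + z <= d.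
Proof.
move=> hx hy hz; rewrite (lfp_def (stages_nth hst (isT : 11 < 17))) //; last by rewrite tuple_in3 hx hy hz.
by move=> [t ht [/(plus hx hy ht) -> /=]]; exact: led2_sound.
Qed.

Lemma led3_complete x y z : (x + y + z).+1 < N -> x + y + z <= d -> I 24 [:: x; y; z].
Proof.
move=> h1 h2; rewrite (lfp_def (stages_nth hst (isT : 11 < 17))) //; last by rewrite tuple_in3; lia.
exists (x + y); first by lia.
rewrite /=; split; [apply/plus => //; lia | apply: led2_complete; lia].
Qed.

Lemma oldP (v p i : V) : I 29 [:: vv v; vv p; vv i] <-> old A v p i.
Proof.
rewrite (lfp_def (stages_nth hst (isT : 16 < 17))) //; last by rewrite tuple_in3 !VN.
rewrite /= connP; split=> [[/ord_inj ->|[h|[y hy [hyi h]]]]|[->|h|[y hyi h]]].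
- exact: Or31.
- exact: Or32.
- pose Y := Ordinal (ltn_trans hyi (ltn_ord i)).
  by apply: Or33; exists Y => //; apply/connP.
- by left.
- by right; left.
by right; right; exists (vv y); [exact: VN | split=> //; apply/connP].
Qed.

Section Atoms.
Variables (p q : nat).
Hypothesis hp : p < N.
Hypothesis hq : q < N.
Definition rdn x y l := [/\ x < N, y < N & l < N] /\ I 21 [:: p; q; x; y; l].

Lemma moveP i x y i' : i < N -> x < N -> y < N -> i' < N ->
  I 25 [:: p; q; i; x; y; i'] <-> exists k l k', [/\ i = k.+1, i' = k'.+1, rdn x y l & k + l <= k'].
Proof.
move=> hi hx hy hi'; rewrite (lfp_def (stages_nth hst (isT : 12 < 17))) //; last by rewrite /tuple_in /= hp hq hi hx hy ?hi'.
rewrite /=; split=> [[k hk [l hl [k' hk' [e1 [e2 [e3 [/(le2P hk hl hk') e4 _]]]]]]]|[k [l [k' [e1 e2 [[_ _ hl] e3] e4]]]]].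
  by exists k, l, k'.
exists k; first by lia.
exists l => //; exists k'; first by lia.
by do ![split=> //]; apply/le2P => //; lia.
Qed.

Lemma coverP a x y i' : a < N -> x < N -> y < N -> i' < N ->
  I 26 [:: p; q; a; x; y; i'] <-> exists l k', [/\ i' = k'.+1, rdn x y l & a + l <= k'].
Proof.
move=> hi hx hy hi'; rewrite (lfp_def (stages_nth hst (isT : 13 < 17))) //; last by rewrite /tuple_in /= hp hq hi hx hy ?hi'.
rewrite /=; split=> [[l hl [k' hk' [e2 [e3 [/(le2P hi hl hk') e4 _]]]]]|[l [k' [e2 [[_ _ hl] e3] e4]]]].
  by exists l, k'.
exists l => //; exists k'; first by lia.
by do ![split=> //]; apply/le2P => //; lia.
Qed.

Lemma check_sound i x y b : i < N -> x < N -> y < N -> b < N ->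
  I 27 [:: p; q; i; x; y; b] -> exists k l, [/\ i = k.+1, rdn x y l & k + l + b <= d].
Proof.
move=> hi hx hy hb; rewrite (lfp_def (stages_nth hst (isT : 14 < 17))) //; last by rewrite /tuple_in /= hp hq hi hx hy ?hb.
move=> [k hk [l hl [e1 [e3 [/(led3_sound hk hl hb) e4 _]]]]].
by exists k, l.
Qed.

Lemma check_complete i x y b k l : i < N -> x < N -> y < N -> b < N -> i = k.+1 -> rdn x y l ->
  k + l + b <= d -> (k + l + b).+1 < N -> I 27 [:: p; q; i; x; y; b].
Proof.
move=> hi hx hy hb e1 [[_ _ hl] e2] e3 e4; rewrite (lfp_def (stages_nth hst (isT : 14 < 17))) //; last by rewrite /tuple_in /= hp hq hi hx hy ?hb.
exists k; first by lia.
by exists l => //=; do ![split=> //]; exact: led3_complete.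
Qed.

Lemma reachP a x y X : a < N -> x < N -> y < N -> X < N ->
  I 28 [:: p; q; a; x; y; X] <-> exists2 l, rdn x y l & a + l <= X.
Proof.
move=> hi hx hy hX; rewrite (lfp_def (stages_nth hst (isT : 15 < 17))) //; last by rewrite /tuple_in /= hp hq hi hx hy ?hX.
rewrite /=; split=> [[l hl [e3 /(le2P hi hl hX) e4]]|[l [[_ _ hl] e3] e4]]; first by exists l.
by exists l => //; split=> //; apply/le2P.
Qed.
End Atoms.

End GraphStages.

(** * The dynamic program *)

Definition FOrs (l : seq fm) := foldr FOr (FNot (FEq 0 0)) l.
Definition fall m (F : nat -> fm) := FAnds [seq F i | i <- iota 0 m].
Definition fexi m (F : nat -> fm) := FOrs [seq F i | i <- iota 0 m].

(* the three entries (position, bound in, bound out) of terminal [t] in mode [M] of a table starting at [tb] *)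
Definition idx tb o M t := tb + (6 * M + 3 * t + o).
Local Notation ps tb := (idx tb 0).
Local Notation bi tb := (idx tb 1).
Local Notation bo tb := (idx tb 2).

Definition f_step P Q v X Y x a b tb tb' := FAnds [::
  fexi 3 (fun M => fall 2 (fun t => FAnd
    (FOr (FZ (bi tb M t)) (FRel 27 [:: P; Q; bi tb M t; ps tb M t; x; b]))
    (FOr (FZ (bo tb M t)) (FRel 27 [:: P; Q; bo tb M t; x; ps tb M t; a]))));
  FRel 28 [:: P; Q; a; x; v; X]; FRel 28 [:: P; Q; b; v; x; Y];
  fall 3 (fun M => fexi 3 (fun M2 => fall 2 (fun t => FOr (FZ (bi tb M2 t)) (fexi 2 (fun t' =>
    FRel 25 [:: P; Q; bi tb M2 t; ps tb M2 t; ps tb' M t'; bi tb' M t'])))));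
  fall 3 (fun M => fexi 3 (fun M2 => fall 2 (fun t => FOr (FZ (bo tb M2 t)) (fexi 2 (fun t' =>
    FRel 25 [:: P; Q; bo tb M2 t; ps tb' M t'; ps tb M2 t; bo tb' M t'])))));
  fall 3 (fun M => FAnd (fexi 2 (fun t' => FRel 26 [:: P; Q; a; x; ps tb' M t'; bi tb' M t']))
    (fexi 2 (fun t' => FRel 26 [:: P; Q; b; ps tb' M t'; x; bo tb' M t'])))].

(** Rows of parts have 7 entries and are padded to 30, the length of the rows of scans: 12 entries
    and a table of 18. *)
Definition zs := nseq 23 zz.
Definition f_scan_init := FAnds [:: FZ 8; FEq 9 3; FEq 10 4; FZ 11; FLe 3 4;
  FEx (FAnd (FRel 18 [:: 2; 3; 0]) (FLe 5 0)); FRel 19 [:: 1; 2; 5]].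
Definition f_lane := FOrs [:: FAnds [:: FLt 25 34; FEq 18 25; FSuc 25 39; FEq 26 40; FEq 27 41];
  FAnds [:: FLt 26 35; FEq 18 26; FEq 25 39; FSuc 26 40; FEq 27 41];
  FAnds [:: FLt 27 29; FEq 18 27; FEq 25 39; FEq 26 40; FSuc 27 41]].
(** Indices 0 to 17 hold the previous table; 18 to 30 hold the position, its vertex and the next
    one, the radii and cost of the part, the edge cost, the three lane ends and the cost before the
    step, the ring length and [n]. The row being derived starts at 31, its table at 43. *)
Definition f_scan_step := FExn 31 (FAnds [::
  FRel 30 ([:: 31; 32; 33; 34; 35; 36; 37; 38; 25; 26; 27; 28] ++ iota 0 18);
  FRel 18 [:: 32; 33; 29]; FRel 9 [:: 30]; FRel 17 [:: 32; 33; 18; 19; 20]; f_lane;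
  FOr (FAnds [:: FEq 19 36; FZ 21; FZ 22; FZ 23]) (FAnd (FNot (FEq 19 36)) (FRel 30 ([:: zz; 19; 36; 30; 21; 22; 23] ++ zs)));
  FOr (FAnd (FRel 10 [:: 19; 20]) (FZ 24)) (FAnds [:: FNot (FRel 10 [:: 19; 20]); FSuc zz 24;
    FNot (FEx (FAnd (FSuc zz 0) (FSuc 0 30)))]);
  FEx (FAnd (FRel 2 [:: 29; 24; 0]) (FRel 2 [:: 0; 25; 43]));
  f_step 32 33 36 37 38 19 21 22 0 43]).
(** Indices 18 to 20 describe the region before the step, 21 to 23 the cost and radii of the new
    component, 24 to 26 the completed lane ends, 27 a ring vertex in the component, 28 and 29 the
    first ring edge. Index 31 is the vertex treated, and the row starts at 32. *)
Definition f_part_add := FExn 31 (FAnds [:: FRel 30 ([:: zz; 33; 34; 31; 18; 19; 20] ++ zs);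
  FRel 18 [:: 28; 29; 26]; FRel 13 [:: 28; 29]; FRel 19 [:: 28; 29; 33]; FRel 19 [:: 28; 29; 27];
  FNot (FEq 27 33); FRel 14 [:: 33; 31; 27]; FNot (FZ 30);
  FRel 30 ([:: 30; 28; 29; 24; 25; 33; 22; 23; 24; 25; 26; 21] ++ iota 0 18);
  FRel 23 [:: 18; 23]; FRel 23 [:: 22; 19]; FLe 18 36; FLe 22 36; FLe 19 37; FLe 23 37; FRel 22 [:: 20; 21; 38]]).
Definition f_part := FOr (FZ 3) (FEx (FAnd (FSuc 0 4) (FOr
  (FAnd (FRel 29 [:: 2; 3; 0]) (FRel 30 ([:: zz; 2; 3; 0; 5; 6; 7] ++ zs)))
  (FAnd (FNot (FRel 29 [:: 2; 3; 0])) f_part_add)))).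
(* Row [0; v; p; i; a; b; c]: the region [reg v p i] has a solution with in-radius [a],
   out-radius [b] at [v] and cost [c]. Row [1; p; q; h; q'; v; X; Y; g1; g2; g3; c] followed
   by a table: the ring through the edge [p q] has been attached at the positions
   [0, g1), [h, g2) and [q', g3). *)
Definition f_dp := FOr (FAnd (FZ 0) f_part) (FAnd (FNot (FZ 0)) (FOr f_scan_init f_scan_step)).
(** With vertex 0 both as root and as excluded vertex nothing is excluded, and after [n] steps the
    region is the whole graph. *)
Definition f_accept := FExn 4 (FAnds [:: FRel 9 [:: 0]; FRel 12 [:: 1]; FRel 30 ([:: zz; zz; zz; 0; 3; 2; 1] ++ zs)]).
Definition all_stages := parse_stages ++ graph_stages ++ [:: (30, f_dp)].

Lemma stages_ok : stages_wf 2 all_stages && rels_lt (2 + size all_stages) f_accept.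
Proof. by []. Qed.

Section Combinators.
Variables (N : nat) (I : interp).

Lemma holds_FAnds e F s : holds N I e (FAnds [seq F i | i <- s]) <-> forall i : nat, i \in s -> holds N I e (F i).
Proof.
elim: s => [|i s IH] /=; first by split.
split=> [[h1 /IH h2] j|h]; first by rewrite inE => /orP[/eqP ->|/h2].
split; first by apply: h; rewrite inE eqxx.
by apply/IH => j hj; apply: h; rewrite inE hj orbT.
Qed.

Lemma FOrP e a b : holds N I e (FOr a b) <-> holds N I e a \/ holds N I e b.
Proof. by []. Qed.

Lemma FAndP e a b : holds N I e (FAnd a b) <-> holds N I e a /\ holds N I e b.
Proof. by []. Qed.

Lemma FExP e a : holds N I e (FEx a) <-> exists2 v, v < N & holds N I (v :: e) a.
Proof. by []. Qed.

Lemma FAndsP e l : holds N I e (FAnds l) <-> foldr (fun f P => holds N I e f /\ P) True l.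
Proof. by elim: l => [|f l IH] /=; [split | rewrite IH]. Qed.

Lemma fallP e m F : holds N I e (fall m F) <-> forall i, i < m -> holds N I e (F i).
Proof. by rewrite /fall holds_FAnds; split=> h i hi; apply: h; move: hi; rewrite mem_iota. Qed.

Lemma fexiP e m F : holds N I e (fexi m F) <-> exists2 i, i < m & holds N I e (F i).
Proof.
have h s : holds N I e (FOrs [seq F i | i <- s]) <-> exists2 i : nat, i \in s & holds N I e (F i).
  elim: s => [|i s IH] /=; first by split=> [[]//|[i]].
  split=> [[h|/IH[j hj h]]|[j]]; first by exists i; rewrite ?inE ?eqxx.
    by exists j; rewrite ?inE ?hj ?orbT.
  by rewrite inE => /orP[/eqP ->|hj] h; [left | right; apply/IH; exists j].
by rewrite /fexi h; split=> -[i hi hF]; exists i => //; move: hi; rewrite mem_iota.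
Qed.

Lemma FExnP e k f : holds N I e (FExn k f) <-> exists2 t, tuple_in N k t & holds N I (t ++ e) f.
Proof.
elim: k e => [|k IH] e /=; first by split=> [h|[[|//] _]] //; exists [::].
split=> [[v hv /IH[t /andP[/eqP st ht] h]]|[t /andP[/eqP st ht] h]].
  by exists (rcons t v); rewrite ?cat_rcons // /tuple_in size_rcons st all_rcons hv ht eqxx.
case/lastP: t st ht h => [//|t v]; rewrite size_rcons all_rcons cat_rcons => -[st] /andP[hv ht] h.
by exists v => //; apply/IH; exists t => //; rewrite /tuple_in st ht eqxx.
Qed.
End Combinators.

Section StepFormula.
Variables (n d N : nat) (I : interp).
Hypothesis nN : n < N.
Hypothesis plus : forall x y z, x < N -> y < N -> z < N -> I 2 [:: x; y; z] <-> x + y = z.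
Hypothesis bd_sound : forall x, x < N -> I 11 [:: x] -> x <= d.
Hypothesis bd_complete : forall x, x.+1 < N -> x <= d -> I 11 [:: x].
Hypothesis hst : stages_lfp N I 13 graph_stages.

Local Notation val3 e f := (fun M t => nth 0 e (f M t)).

Lemma step_sound e P Q v X Y x a b tb tb' : (forall i, nth 0 e i < N) ->
  holds N I e (f_step P Q v X Y x a b tb tb') ->
  scan_step d (rdn N I (nth 0 e P) (nth 0 e Q)) (nth 0 e v) (nth 0 e X) (nth 0 e Y) (nth 0 e x) (nth 0 e a) (nth 0 e b)
    (val3 e (ps tb)) (val3 e (bi tb)) (val3 e (bo tb)) (val3 e (ps tb')) (val3 e (bi tb')) (val3 e (bo tb')).
Proof.
move=> he /FAndsP[h1 [h2 [h3 [h4 [h5 [h6 _]]]]]].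
have {h1}[M0 hM0 h1] := (fexiP N I e 3 _).1 h1.
have {}h4 := (fallP N I e 3 _).1 h4; have {}h5 := (fallP N I e 3 _).1 h5; have {}h6 := (fallP N I e 3 _).1 h6; split.
- exists M0 => // t ht; move/fallP: h1 => /(_ t ht) /= [h7 h8]; split.
    by case: h7 => [->|/(check_sound plus bd_sound hst (he P) (he Q) (he _) (he _) (he _) (he _))]; [left | right].
  case: h8 => [->|/(check_sound plus bd_sound hst (he P) (he Q) (he _) (he _) (he _) (he _))]; first by left.
  by move=> [k [l [e1 e2 e3]]]; right; exists k, l; split=> //; lia.
- split; first by move/(reachP nN plus hst (he P) (he Q) (he _) (he _) (he _) (he _)): h2.
  move/(reachP nN plus hst (he P) (he Q) (he _) (he _) (he _) (he _)): h3 => [l e1 e2].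
  by exists l => //; lia.
- move=> M hM; have /fexiP[M2 hM2 /fallP h] := h4 M hM; exists M2 => // t ht.
  have /FOrP[h0|/fexiP[t' ht' hm]] := h t ht; [by left | right; exists t' => //].
  by move/(moveP nN plus hst (he P) (he Q) (he _) (he _) (he _) (he _)): hm.
- move=> M hM; have /fexiP[M2 hM2 /fallP h] := h5 M hM; exists M2 => // t ht.
  have /FOrP[h0|/fexiP[t' ht' hm]] := h t ht; [by left | right; exists t' => //].
  move/(moveP nN plus hst (he P) (he Q) (he _) (he _) (he _) (he _)): hm => [k [l [k' [e1 e2 e3 e4]]]].
  by exists k, l, k'; split=> //; lia.
move=> M hM; have /FAndP[/fexiP[t1 ht1 hc1] /fexiP[t2 ht2 hc2]] := h6 M hM; split.
  by exists t1 => //; move/(coverP nN plus hst (he P) (he Q) (he _) (he _) (he _) (he _)): hc1.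
exists t2 => //; move/(coverP nN plus hst (he P) (he Q) (he _) (he _) (he _) (he _)): hc2 => [l [k' [e1 e2 e3]]].
by exists l, k'; split=> //; lia.
Qed.

Lemma step_complete Nb e P Q v X Y x a b tb tb' : (forall i, nth 0 e i < N) -> 3 * Nb <= N ->
  nth 0 e a < Nb -> nth 0 e b < Nb -> tab_lt Nb (val3 e (bi tb)) (val3 e (bo tb)) ->
  scan_step d (fun x y l => rdn N I (nth 0 e P) (nth 0 e Q) x y l /\ l < Nb)
    (nth 0 e v) (nth 0 e X) (nth 0 e Y) (nth 0 e x) (nth 0 e a) (nth 0 e b)
    (val3 e (ps tb)) (val3 e (bi tb)) (val3 e (bo tb)) (val3 e (ps tb')) (val3 e (bi tb')) (val3 e (bo tb')) ->
  holds N I e (f_step P Q v X Y x a b tb tb').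
Proof.
move=> he hN ha hb htab [[M0 hM0 h1] [[l1 [e1 _] e1'] [l2 [e2 _] e2']] h4 h5 h6].
apply/FAndsP; split; [|split; [|split; [|split; [|split; [|split=> //]]]]].
- apply/fexiP; exists M0 => //; apply/fallP => t ht; have [h7 h8] := h1 t ht; have [b1 b2] := htab M0 t hM0 ht.
  split=> /=.
    case: h7 => [h7|[k [l [f1 [f2 f2'] f3]]]]; [by left | right].
    by apply: (check_complete nN plus bd_complete hst (he P) (he Q) (he _) (he _) (he _) (he _) f1 f2 f3); lia.
  case: h8 => [h8|[k [l [f1 [f2 f2'] f3]]]]; [by left | right].
  by apply: (check_complete nN plus bd_complete hst (he P) (he Q) (he _) (he _) (he _) (he _) f1 f2); lia.
- by apply/(reachP nN plus hst (he P) (he Q) (he _) (he _) (he _) (he _)); exists l1.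
- by apply/(reachP nN plus hst (he P) (he Q) (he _) (he _) (he _) (he _)); exists l2 => //; lia.
- apply/fallP => M hM; have [M2 hM2 h] := h4 M hM; apply/fexiP; exists M2 => //; apply/fallP => t ht.
  apply/FOrP; case: (h t ht) => [h0|[t' ht' [k [l [k' [f1 f2 [f3 _] f4]]]]]]; [by left | right; apply/fexiP; exists t' => //].
  by apply/(moveP nN plus hst (he P) (he Q) (he _) (he _) (he _) (he _)); exists k, l, k'.
- apply/fallP => M hM; have [M2 hM2 h] := h5 M hM; apply/fexiP; exists M2 => //; apply/fallP => t ht.
  apply/FOrP; case: (h t ht) => [h0|[t' ht' [k [l [k' [f1 f2 [f3 _] f4]]]]]]; [by left | right; apply/fexiP; exists t' => //].
  by apply/(moveP nN plus hst (he P) (he Q) (he _) (he _) (he _) (he _)); exists k, l, k'; split=> //; lia.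
apply/fallP => M hM; have [[t1 ht1 [l [k' [f1 [f2 _] f3]]]] [t2 ht2 [l' [k2 [f4 [f5 _] f6]]]]] := h6 M hM.
apply/FAndP; split; apply/fexiP; [exists t1 => // | exists t2 => //].
  by apply/(coverP nN plus hst (he P) (he Q) (he _) (he _) (he _) (he _)); exists l, k'.
by apply/(coverP nN plus hst (he P) (he Q) (he _) (he _) (he _) (he _)); exists l', k2; split=> //; lia.
Qed.
End StepFormula.

Definition in_lanes h q g1 g2 g3 j := [|| j < g1, h <= j < g2 | q <= j < g3].

Lemma lane_step h q m j g1 g2 g3 g1' g2' g3' : lane h q m j g1 g2 g3 g1' g2' g3' ->
  [/\ g1 <= h, h <= g2, g2 <= q, q <= g3 & g3 <= m] ->
  [/\ j < m, ~~ in_lanes h q g1 g2 g3 j, forall i, in_lanes h q g1' g2' g3' i = in_lanes h q g1 g2 g3 i || (i == j) &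
    [/\ g1' <= h, h <= g2', g2' <= q, q <= g3' & g3' <= m]].
Proof. by move=> [[? -> -> -> ->]|[? -> -> -> ->]|[? -> -> -> ->]] [? ? ? ? ?]; rewrite /in_lanes; split; [lia|lia|lia|split; lia|lia|lia|lia|split; lia|lia|lia|lia|split; lia]. Qed.

Lemma scan_sem_ext n (A : arcs n) d s x0 v X Y J c pos ia oa pos' ia' oa' :
  (forall M t, M < 3 -> t < 2 -> [/\ pos' M t = pos M t, ia' M t = ia M t & oa' M t = oa M t]) ->
  scan_sem A d s x0 v X Y J c pos ia oa -> scan_sem A d s x0 v X Y J c pos' ia' oa'.
Proof.
move=> h [B [h1 h2 h3 [h4 [h5 h6]] h7]]; exists B; split=> //; split=> //; split=> // M hM x hx.
have [[t ht [k e1 e2]] [t2 ht2 [k2 e3 e4]]] := h6 M hM x hx; split.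
  by exists t => //; have [p1 p2 _] := h M t hM ht; exists k; rewrite ?p1 ?p2.
by exists t2 => //; have [p1 _ p2] := h M t2 hM ht2; exists k2; rewrite ?p1 ?p2.
Qed.

(** * Soundness of the derived rows *)

Section DynamicProgram.
Variables (n : nat) (A : arcs n) (d N : nat) (I : interp).
Local Notation V := 'I_n.
Local Notation vv := (@nat_of_ord n).
Hypothesis cact : cactus A.
Hypothesis noloop : loopless A.
Hypothesis nN : n < N.
Hypothesis plus : forall x y z, x < N -> y < N -> z < N -> I 2 [:: x; y; z] <-> x + y = z.
Hypothesis arc : forall i j, i < N -> j < N -> I 10 [:: i; j] <-> exists hi : i < n, exists hj : j < n, (Ordinal hi, Ordinal hj) \in A.
Hypothesis ord : forall x, x < N -> I 9 [:: x] <-> x = n.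
Hypothesis bd_sound : forall x, x < N -> I 11 [:: x] -> x <= d.
Hypothesis hst : stages_lfp N I 13 graph_stages.
Hypothesis hdp : stage_lfp N I 30 30 f_dp.

Definition tab_val t o (M i : nat) := nth 0 t (idx 12 o M i).

Definition part_ok (t : seq nat) := forall v p : V, nth 0 t 1 = v -> nth 0 t 2 = p -> nth 0 t 3 <= n ->
  sol A d (reg A v p (nth 0 t 3)) v (nth 0 t 4) (nth 0 t 5) (nth 0 t 6).

(** Table positions that are no vertices are read as [v]. This does no harm, since the distance
    relation links such numbers only to themselves, which becomes a trivial walk. *)
Definition scan_ok (t : seq nat) := forall s (v : V), ring A s ->
  nth 0 t 1 = rc s v 0 -> nth 0 t 2 = rc s v 1 -> nth 0 t 5 = v ->
  [/\ v \in s, [/\ nth 0 t 8 <= nth 0 t 3, nth 0 t 3 <= nth 0 t 9, nth 0 t 9 <= nth 0 t 4, nth 0 t 4 <= nth 0 t 10 & nth 0 t 10 <= size s] &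
    scan_sem A d s v v (nth 0 t 6) (nth 0 t 7) (in_lanes (nth 0 t 3) (nth 0 t 4) (nth 0 t 8) (nth 0 t 9) (nth 0 t 10))
      (nth 0 t 11) (fun M i => insubd v (tab_val t 0 M i)) (tab_val t 1) (tab_val t 2)].

(** Parts and scans depend on each other, and a stage defines a single relation; the first entry of
    a row therefore tells the two kinds apart, and both are handled in one induction. *)
Definition dp_ok (t : seq nat) := (nth 0 t 0 = 0 -> part_ok t) /\ (nth 0 t 0 <> 0 -> scan_ok t).

Let len s x0 hs m := @lenP n A N I cact noloop nN arc hst s x0 hs m.

Lemma nth_lt k t : tuple_in N k t -> forall i, nth 0 t i < N.
Proof.
move=> /andP[_ /allP h] i; case: (ltnP i (size t)) => hi; first exact/h/mem_nth.
by rewrite nth_default //; apply: leq_ltn_trans nN.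
Qed.

Lemma nth_lt_cat (s t : seq nat) : (forall i, nth 0 s i < N) -> (forall i, nth 0 t i < N) -> forall i, nth 0 (s ++ t) i < N.
Proof. by move=> h1 h2 i; rewrite nth_cat; case: ifP. Qed.

Section Step.
Variable J : interp.
Hypothesis eJ : forall r, r < 30 -> J r =1 I r.
Hypothesis hJ : forall t, tuple_in N 30 t -> J 30 t -> dp_ok t.

Let row_in (E : seq nat) (l : seq nat) : size l = 30 -> (forall i, nth 0 E i < N) -> tuple_in N 30 (map (nth 0 E) l).
Proof. by move=> sl h; rewrite /tuple_in size_map sl eqxx /=; apply/allP => x /mapP[i _ ->]. Qed.

Lemma scan_init_sound t : tuple_in N 30 t -> holds N J t f_scan_init -> scan_ok t.
Proof.
move=> ht /FAndsP[h8 [h9 [h10 [h11 [h34 [[m hm [hlen h5]] [hmem _]]]]]]] s v hs e1 e2 ev.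
have hN := nth_lt ht.
move: h8 h9 h10 h11 h34 hlen h5 hmem => /= h8 h9 h10 h11 h34.
rewrite !eJ // e1 e2 => /(len v hs hm) em h5 /(memP cact noloop nN arc hst v hs (hN 5)) [v' ev' hv'].
have ev2 : v' = v by apply: ord_inj; rewrite -ev' ev.
subst v' m; split=> //; first by rewrite h8 h9 h10; split; lia.
by apply: scan_init => j hj; rewrite /in_lanes h8 h9 h10; lia.
Qed.

Lemma scan_step_sound t : tuple_in N 30 t -> nth 0 t 0 <> 0 -> holds N J t f_scan_step -> scan_ok t.
Proof.
move=> ht t0 /FExnP[tt htt /FAndsP[h1 [h2 [h3 [h4 [h5 [h6 [h7 [h8 [h9 _]]]]]]]]]] s v hs e1 e2 ev.
set E := tt ++ t in h1 h2 h3 h4 h5 h6 h7 h8 h9.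
have hN : forall i, nth 0 E i < N by apply: nth_lt_cat; [exact: nth_lt htt | exact: nth_lt ht].
have stt : size tt = 31 by case/andP: htt => /eqP.
have sh i : nth 0 E (31 + i) = nth 0 t i by rewrite nth_cat stt ltnNge leq_addr /= addKn.
have [s0 s1 s2 s3] : [/\ nth 0 E 31 = nth 0 t 0, nth 0 E 32 = nth 0 t 1, nth 0 E 33 = nth 0 t 2 & nth 0 E 34 = nth 0 t 3].
  by split; [exact: (sh 0) | exact: (sh 1) | exact: (sh 2) | exact: (sh 3)].
have [s4 s5 s6 s7] : [/\ nth 0 E 35 = nth 0 t 4, nth 0 E 36 = nth 0 t 5, nth 0 E 37 = nth 0 t 6 & nth 0 E 38 = nth 0 t 7].
  by split; [exact: (sh 4) | exact: (sh 5) | exact: (sh 6) | exact: (sh 7)].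
have [s8 s9 s10 s11] : [/\ nth 0 E 39 = nth 0 t 8, nth 0 E 40 = nth 0 t 9, nth 0 E 41 = nth 0 t 10 & nth 0 E 42 = nth 0 t 11].
  by split; [exact: (sh 8) | exact: (sh 9) | exact: (sh 10) | exact: (sh 11)].
have ez : nth 0 E 99 = 0.
  by rewrite nth_default // size_cat stt; case/andP: ht => /eqP -> _.
have [_ h1ok] : dp_ok (map (nth 0 E) ([:: 31; 32; 33; 34; 35; 36; 37; 38; 25; 26; 27; 28] ++ iota 0 18)).
  by apply: hJ h1; exact: row_in.
have nz : nth 0 E 31 <> 0 by rewrite s0.
have [|||hvs hinv hsem] := h1ok nz s v hs.
- by rewrite /= s1.
- by rewrite /= s2.
- by rewrite /= s5.
move: h2 h3 h4; rewrite /= !eJ // s1 s2 e1 e2 => /(len v hs (hN _)) em /(ord (hN _)) en.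
move=> /(ringP cact noloop nN arc hst v hs (hN _) (hN _) (hN _)) [ex ex1].
have hlane : lane (nth 0 t 3) (nth 0 t 4) (size s) (nth 0 E 18) (nth 0 E 25) (nth 0 E 26) (nth 0 E 27) (nth 0 t 8) (nth 0 t 9) (nth 0 t 10).
  rewrite -em -s3 -s4 -s8 -s9 -s10; case/FOrP: h5 => [/FAndsP[? [? [? [? [? _]]]]]|/FOrP[/FAndsP[? [? [? [? [? _]]]]]|/FOrP[/FAndsP[? [? [? [? [? _]]]]]|h]]]; last by case: h.
  - exact: Or31.
  - exact: Or32.
  exact: Or33.
have hinv0 : [/\ nth 0 E 25 <= nth 0 t 3, nth 0 t 3 <= nth 0 E 26, nth 0 E 26 <= nth 0 t 4, nth 0 t 4 <= nth 0 E 27 & nth 0 E 27 <= size s].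
  by move: hinv; rewrite /= s3 s4.
have [hj hnj hI' hinv'] := lane_step hlane hinv0.
split=> //.
have hsol : sol A d (item A s v v (nth 0 E 18)) (rc s v (nth 0 E 18)) (nth 0 E 21) (nth 0 E 22) (nth 0 E 23).
  rewrite /item; case: eqP => hx.
    case/FOrP: h6 => [/FAndsP[_ [/= -> [/= -> [/= -> _]]]]|/FAndP[/= hne _]]; first by rewrite hx; exact: sol_point.
    by case: hne; rewrite ex s5 ev hx.
  case/FOrP: h6 => [/FAndsP[/= hxv _]|/FAndP[_ h6]].
    by case: hx; apply: ord_inj; rewrite -ex -ev -s5.
  have [hpart _] : dp_ok (map (nth 0 E) ([:: zz; 19; 36; 30; 21; 22; 23] ++ zs)).
    by apply: hJ h6; exact: row_in.
  have := hpart ez (rc s v (nth 0 E 18)) v; rewrite /= en => h.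
  rewrite -(reg_region cact hs hvs); last by apply/eqP.
  by apply: h; rewrite // s5.
have harc : (rc s v (nth 0 E 18), rc s v (nth 0 E 18).+1) \in A /\ nth 0 E 24 = 0 \/
    [/\ (rc s v (nth 0 E 18), rc s v (nth 0 E 18).+1) \notin A, nth 0 E 24 = 1 & size s <> 2].
  have ea := arc_ord nN arc (rc s v (nth 0 E 18)) (rc s v (nth 0 E 18).+1).
  case/FOrP: h7 => [/FAndP[h7 h7']|/FAndsP[h7 [h7' [h7'' _]]]]; move: h7; rewrite /= eJ // ex ex1.
    by move/ea => h7; left.
  move=> h7; right; split; first by apply/negP => /ea.
    by move: h7'; rewrite /= ez => <-.
  move=> es; apply: h7''; exists 1; first exact: leq_ltn_trans (leq_trans (ltn0Sn _) (ltn_ord v)) nN.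
  by rewrite /=; split; [rewrite (nth_default _ _) // size_cat stt; case/andP: ht => /eqP -> | rewrite em es].
have hc : nth 0 E 28 + nth 0 E 23 + nth 0 E 24 = nth 0 t 11.
  case: h8 => x hx []; rewrite /= !eJ // -s11.
  by move=> /(plus (hN _) (hN _) hx) -> /(plus hx (hN _) (hN _)) ->.
have hw : rels_lt 30 (f_step 32 33 36 37 38 19 21 22 0 43) by [].
have hstep := step_sound nN plus bd_sound hst hN ((holds_local N E hw eJ).1 h9).
have RDmap x y l : rdn N I (nth 0 E 32) (nth 0 E 33) x y l -> rdist A s (insubd v x) (insubd v y) l.
  rewrite s1 s2 e1 e2 => -[[hx hy hl] hd].
  have [->|[X [Y [eX eY]]]] := dist_lift cact noloop nN arc hst hs hx hy hl hd.
    by apply: dist_weak (subxx _) (leq0n _) (dist_refl _ _).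
  have [_ h] : l < N /\ rdist A s X Y l by apply/(distP cact noloop nN arc hst v hs); split=> //; rewrite -eX -eY.
  by rewrite eX eY !valKd.
have tabs o M i : M < 3 -> i < 2 -> nth 0 E (idx 43 o M i) = tab_val t o M i.
  by move=> _ _; rewrite /tab_val -sh /idx.
have [[M0 hM0 m1] [x1' x2'] c1' c2' y'] := scan_step_map (f := insubd v) (T' := V) (RD' := rdist A s)
  (rpos := fun M i => insubd v (nth 0 E (idx 0 0 M i))) (ria := fun M i => nth 0 E (idx 0 1 M i)) (roa := fun M i => nth 0 E (idx 0 2 M i))
  (rpos' := fun M i => insubd v (tab_val t 0 M i)) (ria' := tab_val t 1) (roa' := tab_val t 2)
  RDmap (fun M i hM hi => And3 erefl erefl erefl)
  (fun M i hM hi => And3 (congr1 (insubd v) (esym (tabs 0 M i hM hi))) (esym (tabs 1 M i hM hi)) (esym (tabs 2 M i hM hi))) hstep.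
have exv : insubd v (nth 0 E 19) = rc s v (nth 0 E 18) by rewrite ex valKd.
have evv : insubd v (nth 0 E 36) = v by rewrite s5 ev valKd.
rewrite exv evv s6 s7 in m1 x1' x2' y'.
rewrite -hc; apply: (scan_add hs hvs (I := in_lanes (nth 0 t 3) (nth 0 t 4) (nth 0 E 25) (nth 0 E 26) (nth 0 E 27))
  (pos := fun M i => insubd v (nth 0 E (idx 0 0 M i))) (ia := fun M i => nth 0 E (idx 0 1 M i)) (oa := fun M i => nth 0 E (idx 0 2 M i))
  _ hj hnj (fun i _ => hI' i) hsol harc hM0 _ _ x1' x2' c1' c2').
- move: hsem; rewrite /= s3 s4 s6 s7; apply: scan_sem_ext => M i hM hi.
  by move: M i hM hi => [|[|[|]]] // [|[|]] // _ _; split.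
- by move=> i hi; have [] := m1 i hi.
- by move=> i hi; have [] := m1 i hi.
- by move=> M hM; have [] := y' M hM.
by move=> M hM; have [] := y' M hM.
Qed.
Lemma part_add_sound t (i v p : V) : tuple_in N 30 t -> nth 0 t 1 = v -> nth 0 t 2 = p -> ~ old A v p i ->
  holds N J (vv i :: t) f_part_add -> sol A d (reg A v p i.+1) v (nth 0 t 4) (nth 0 t 5) (nth 0 t 6).
Proof.
move=> ht ev ep hold /FExnP[tt htt /FAndsP[h1 [h2 [h3 [h4 [h5 [h6 [h7 [h8 [h9 [g1 [g2 [g3 [g4 [g5 [g6 [g7 _]]]]]]]]]]]]]]]]].
set E := tt ++ vv i :: t in h1 h2 h3 h4 h5 h6 h7 h8 h9 g1 g2 g3 g4 g5 g6 g7.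
have iN : vv i < N by exact: ltn_trans (ltn_ord i) nN.
have hN : forall k, nth 0 E k < N.
  by apply: nth_lt_cat; [exact: nth_lt htt | case=> [|k] //; exact: nth_lt ht k].
have stt : size tt = 31 by case/andP: htt => /eqP.
have si : nth 0 E 31 = i by rewrite nth_cat stt ltnn subnn.
have sh k : nth 0 E (32 + k) = nth 0 t k by rewrite nth_cat stt (_ : 32 + k = 31 + k.+1) ?ltnNge ?leq_addr ?addKn // -addSnnS.
have [s1 s2] : nth 0 E 33 = v /\ nth 0 E 34 = p by split; [rewrite (sh 1) | rewrite (sh 2)].
have [s4 s5 s6] : [/\ nth 0 E 36 = nth 0 t 4, nth 0 E 37 = nth 0 t 5 & nth 0 E 38 = nth 0 t 6].
  by split; [exact: (sh 4) | exact: (sh 5) | exact: (sh 6)].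
have ez : nth 0 E 99 = 0 by rewrite nth_default // size_cat stt /=; case/andP: ht => /eqP -> _.
have [hpart _] : dp_ok (map (nth 0 E) ([:: zz; 33; 34; 31; 18; 19; 20] ++ zs)).
  by apply: hJ h1; exact: row_in.
have [_ hscan] : dp_ok (map (nth 0 E) ([:: 30; 28; 29; 24; 25; 33; 22; 23; 24; 25; 26; 21] ++ iota 0 18)).
  by apply: hJ h9; exact: row_in.
have {hpart h1}hp1 := hpart ez v p s1 s2.
rewrite /= si in hp1; have {}hp1 := hp1 (ltnW (ltn_ord i)).
move: h2 h3 h4 h5 h7 g1 g2 g7; rewrite /= !eJ // s1 si.
move=> h2 /(adj_lift nN arc hst (hN _) (hN _)) [P [Q [eP eQ hPQ]]].
have [s' hs] := ring_exists cact noloop hPQ; set s := [:: P, Q & s'] in hs.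
have e0 : nth 0 E 28 = rc s v 0 by rewrite eP /rc mod0n.
have e1 : nth 0 E 29 = rc s v 1 by rewrite eQ /rc modn_small.
rewrite e0 e1 in h2 *; move/(len v hs (hN _)): h2 => em.
move=> /(memP cact noloop nN arc hst v hs (ltn_trans (ltn_ord v) nN)) [v' /ord_inj <- hv].
move=> /(memP cact noloop nN arc hst v hs (hN _)) [z ez' hz].
rewrite ez' => /(connP nN arc hst) hc.
move=> /(led2_sound plus bd_sound hst (hN _) (hN _)) sum1 /(led2_sound plus bd_sound hst (hN _) (hN _)) sum2.
move=> /(le2P nN plus hst (hN _) (hN _) (hN _)) costs.
have hzv : z != v by apply/eqP => e; apply: h6; rewrite /= s1 ez' e.
have hiv : i != v by apply/eqP => e; apply: hold; apply: Or31.
have [|||hv' [l1 l2 l3 l4 l5] hsem] := hscan h8 s v hs.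
- by rewrite /= e0.
- by rewrite /= e1.
- by rewrite /= s1.
have [jv hjv ejv] := rc_surj v hv.
have hsol : sol A d (comp A v i) v (nth 0 E 22) (nth 0 E 23) (nth 0 E 21).
  apply: (scan_final noloop cact hs hsem _ hiv ejv hz hzv hc) => j hj.
  have key h q : [|| j < h, h <= j < q | q <= j < size s] by move: hj; clear; lia.
  by rewrite -em in key; exact: key.
rewrite (reg_new hold); apply: sol_weak (leqnn _) (leqnn _) _ (sol_merge noloop hp1 hsol _ sum1 sum2 _ _ _ _).
- by rewrite -s6.
- by move=> x; exact: reg_comp.
- by rewrite -s4 leqNgt; apply/negP.
- by rewrite -s4 leqNgt; apply/negP.
- by rewrite -s5 leqNgt; apply/negP.
by rewrite -s5 leqNgt; apply/negP.
Qed.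

Lemma part_sound t : tuple_in N 30 t -> holds N J t f_part -> part_ok t.
Proof.
move=> ht /FOrP[h0|/FExP[i' hi' /FAndP[hs ho]]] v p ev ep hi.
  by rewrite (_ : nth 0 t 3 = 0) // reg0; apply: sol_weak (sol_point A d v).
have hin : i' < n by move: hs hi => /= <-.
have [i ei] : exists i : V, i' = i by exists (Ordinal hin).
subst i'; have ei : nth 0 t 3 = i.+1 by move: hs => /= ->.
have hN := nth_lt ht.
have iff_old : holds N J (vv i :: t) (FRel 29 [:: 2; 3; 0]) <-> old A v p i.
  by rewrite /= ev ep eJ //; exact: (oldP nN arc hst).
rewrite ei; case/FOrP: ho => [/FAndP[/iff_old hold hpart]|/FAndP[hold hadd]]; last first.
  by apply: part_add_sound ht ev ep _ hadd => h; apply: hold; apply/iff_old.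
rewrite (reg_old hold).
have [hok _] : dp_ok (map (nth 0 (vv i :: t)) ([:: zz; 2; 3; 0; 5; 6; 7] ++ zs)).
  apply: hJ hpart; apply: row_in => // -[|k] //=; exact: ltn_trans (ltn_ord i) nN.
have ez : nth 0 (vv i :: t) 99 = 0 by rewrite nth_default //=; case/andP: ht => /eqP -> _.
by have := hok ez v p ev ep (ltnW (ltn_ord i)).
Qed.

End Step.

Lemma dp_sound t : tuple_in N 30 t -> I 30 t -> dp_ok t.
Proof.
move=> ht; apply: (hdp.2 dp_ok) => // J eJ hJ {}t {}ht /FOrP[/FAndP[h0 h]|/FAndP[h0 h]]; split=> ht0.
- exact: (part_sound eJ hJ ht h).
- by case: ht0.
- by case: h0.
by case/FOrP: h => h; [exact: (scan_init_sound eJ ht h) | exact: (scan_step_sound eJ hJ ht ht0 h)].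
Qed.

End DynamicProgram.

(** * Closure of the derived rows under the steps of the dynamic program *)

Section Closure.
Variables (n : nat) (A : arcs n) (d N Nb : nat) (I : interp).
Local Notation V := 'I_n.
Local Notation vv := (@nat_of_ord n).
Hypothesis cact : cactus A.
Hypothesis noloop : loopless A.
Hypothesis nN : n < N.
Hypothesis hNb : 3 * Nb <= N.
Hypothesis n1N : 1 < N.
Hypothesis plus : forall x y z, x < N -> y < N -> z < N -> I 2 [:: x; y; z] <-> x + y = z.
Hypothesis arc : forall i j, i < N -> j < N -> I 10 [:: i; j] <-> exists hi : i < n, exists hj : j < n, (Ordinal hi, Ordinal hj) \in A.
Hypothesis ord : forall x, x < N -> I 9 [:: x] <-> x = n.
Hypothesis bd_complete : forall x, x.+1 < N -> x <= d -> I 11 [:: x].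
Hypothesis hst : stages_lfp N I 13 graph_stages.
Hypothesis hdp : stage_lfp N I 30 30 f_dp.

Definition tab (pos : nat -> nat -> V) (ia oa : nat -> nat -> nat) : seq nat :=
  [:: vv (pos 0 0); ia 0 0; oa 0 0; vv (pos 0 1); ia 0 1; oa 0 1;
      vv (pos 1 0); ia 1 0; oa 1 0; vv (pos 1 1); ia 1 1; oa 1 1;
      vv (pos 2 0); ia 2 0; oa 2 0; vv (pos 2 1); ia 2 1; oa 2 1].
Definition scan_row (s : seq V) h q (v : V) X Y g1 g2 g3 c pos ia oa :=
  [:: 1; vv (rc s v 0); vv (rc s v 1); h; q; vv v; X; Y; g1; g2; g3; c] ++ tab pos ia oa.
Definition part_row (v p : V) i a b c := [:: 0; vv v; vv p; i; a; b; c] ++ nseq 23 0.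
Definition scan_fact s h q v X Y g1 g2 g3 c pos ia oa :=
  tuple_in N 30 (scan_row s h q v X Y g1 g2 g3 c pos ia oa) /\ I 30 (scan_row s h q v X Y g1 g2 g3 c pos ia oa).
Definition part_fact v p i a b c := tuple_in N 30 (part_row v p i a b c) /\ I 30 (part_row v p i a b c).

Let VN (x : V) : x < N. Proof. exact: ltn_trans (ltn_ord x) nN. Qed.
Let NbN x : x < Nb -> x < N. Proof. by move: hNb; clear; lia. Qed.

Lemma tab_in pos ia oa : tab_lt Nb ia oa -> all (fun x => x < N) (tab pos ia oa).
Proof.
move=> h; have h' M t : M < 3 -> t < 2 -> (ia M t < N) * (oa M t < N).
  by move=> hM ht; have [/NbN ? /NbN ?] := h M t hM ht.
by rewrite /= !VN !h'.
Qed.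

Lemma part_row_in v p i a b c : i < N -> a < N -> b < N -> c < N -> tuple_in N 30 (part_row v p i a b c).
Proof. by move=> h1 h2 h3 h4; rewrite /tuple_in /= !VN h1 h2 h3 h4 (ltn_trans _ n1N). Qed.

Lemma scan_row_in s h q v X Y g1 g2 g3 c pos ia oa : h < N -> q < N -> X < N -> Y < N -> g1 < N -> g2 < N -> g3 < N -> c < N ->
  tab_lt Nb ia oa -> tuple_in N 30 (scan_row s h q v X Y g1 g2 g3 c pos ia oa).
Proof.
move=> h1 h2 h3 h4 h5 h6 h7 h8 /(tab_in pos) ht; apply/andP; split=> //.
by rewrite /scan_row all_cat ht andbT /= n1N !VN h1 h2 h3 h4 h5 h6 h7 h8.
Qed.

Lemma scan_fact_init : scan_init_closed A Nb scan_fact.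
Proof.
move=> s v h q X Y pos ia oa hs hv hhq hqs hX hY htab.
have sn := size_ring_le hs.
have hq : q < N by exact: leq_ltn_trans (leq_trans hqs sn) nN.
have hh : h < N by exact: leq_ltn_trans hhq hq.
have sN : size s < N by exact: leq_ltn_trans sn nN.
have n0 : 0 < N by exact: ltn_trans n1N.
have ht : tuple_in N 30 (scan_row s h q v X Y 0 h q 0 pos ia oa) by apply: scan_row_in => //; exact: NbN.
split=> //; apply: (hdp.1 _ ht); apply/FOrP; right; apply/FAndP; split=> //; apply/FOrP; left.
apply/FAndsP; do 4 (split; first by []); split; first by rewrite /= ltnNge hhq.
split; last first.
  by split=> //; apply/(memP cact noloop nN arc hst v hs (VN v)); exists v.
exists (size s) => //; split; first by apply/(lenP cact noloop nN arc hst v hs sN).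
by rewrite /= ltnNge hqs.
Qed.

Let t3 (P : nat -> nat -> Prop) : P 0 0 -> P 0 1 -> P 1 0 -> P 1 1 -> P 2 0 -> P 2 1 ->
  forall M t, M < 3 -> t < 2 -> P M t.
Proof. by move=> ? ? ? ? ? ? [|[|[|]]] // [|[|]]. Qed.

Lemma scan_fact_step : scan_step_closed A d Nb N part_fact scan_fact.
Proof.
move=> s v h q X Y g1 g2 g3 cst pos ia oa j g1' g2' g3' a b c1 e pos' ia' oa' x.
move=> hs hv hhq hqs hX hY [hin hold] hl hj hitem harc hstep htab htab' hcost.
have sn := size_ring_le hs.
have hq : q < N by exact: leq_ltn_trans (leq_trans hqs sn) nN.
have hh : h < N by exact: leq_ltn_trans hhq hq.
have sN : size s < N by exact: leq_ltn_trans sn nN.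
have [hg1 hg2 hg3] : [/\ g1 < N, g2 < N & g3 < N].
  by have hk := nth_lt nN hin; split; [exact: (hk 8) | exact: (hk 9) | exact: (hk 10)].
have [hg1' hg2' hg3'] : [/\ g1' < N, g2' < N & g3' < N].
  case: hl => [[hlt _ -> -> ->]|[hlt _ -> -> ->]|[hlt _ -> -> ->]]; split=> //.
  - exact: leq_ltn_trans hlt hh.
  - exact: leq_ltn_trans hlt hq.
  exact: leq_ltn_trans hlt sN.
have [aN bN] : a < Nb /\ b < Nb.
  have Nb0 : 0 < Nb by apply: leq_ltn_trans hX.
  by case: hitem => [[_ -> -> _]|[_ ? ? _]].
have hx : x < N by exact: VN.
have ht : tuple_in N 30 (scan_row s h q v X Y g1' g2' g3' (cst + c1 + e) pos' ia' oa').
  by apply: scan_row_in => //; exact: NbN.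
split=> //; apply: (hdp.1 _ ht); apply/FOrP; right; apply/FAndP; split=> //; apply/FOrP; right.
pose tt := tab pos ia oa ++ [:: j; vv x; vv (rc s v j.+1); a; b; c1; e; g1; g2; g3; cst; size s; n].
have [c1N eN csN sumN] : [/\ c1 < N, e < N, cst < N & cst + c1 < N] by move: hcost; clear; split; lia.
have jN : j < N by exact: ltn_trans hj sN.
have htt : tuple_in N 31 tt.
  apply/andP; split=> //; rewrite /tt all_cat (tab_in pos htab) /=.
  by rewrite jN !VN (NbN aN) (NbN bN) c1N eN hg1 hg2 hg3 csN sN nN.
apply/FExnP; exists tt => //; set E := tt ++ _.
have hE : forall k, nth 0 E k < N by apply: (nth_lt_cat (nth_lt nN htt) (nth_lt nN ht)).
apply/FAndsP; split; first exact: hold.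
split; first by apply/(lenP cact noloop nN arc hst v hs sN).
split; first by apply/ord.
split; first by apply/(ringP cact noloop nN arc hst v hs jN (VN _) (VN _)).
split.
  case: hl => [[? ? ? ? ?]|[? ? ? ? ?]|[? ? ? ? ?]]; apply/FOrP; [left | right; apply/FOrP; left | right; apply/FOrP; right; apply/FOrP; left];
  by apply/FAndsP; do 5 (split; first by []).
split.
  apply/FOrP; case: hitem => [[h1 h2 h3 h4]|[h1 h2 h3 [h4 h5]]]; [left | right].
    apply/FAndsP; split; first exact: (congr1 vv h1).
    by split; [exact: h2 | split; [exact: h3 | split; [exact: h4 |]]].
  by apply/FAndP; split; [move=> /ord_inj h6; rewrite h6 eqxx in h1 | exact: h5].
split.
  have ea := arc_ord nN arc x (rc s v j.+1).
  apply/FOrP; case: harc => [[h1 h2]|[h1 h2 h3]]; [left | right].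
    by apply/FAndP; split=> //; apply/ea.
  apply/FAndsP; split; first by move=> /ea; rewrite (negPf h1).
  split=> //; split=> // -[o ho [/= e1 e2]]; apply: h3.
  by rewrite -e2 -e1.
split.
  by exists (cst + c1) => //; split; apply/plus.
split=> //; apply: (@step_complete n d N I nN plus bd_complete hst Nb E 32 33 36 37 38 19 21 22 0 43 hE hNb aN bN).
  by apply: t3; apply: htab.
apply: (scan_step_map (f := vv) _ _ _ hstep).
- move=> y z l [hr hl']; split=> //; have /(distP cact noloop nN arc hst v hs) [hl2 h2] : l < N /\ rdist A s y z l.
    by split=> //; exact: NbN.
  by split=> //; split=> //; exact: VN.
- by apply: t3.
by apply: t3.
Qed.

Lemma part_fact_init : part_init_closed Nb N part_fact.
Proof.
move=> v p a b c ha hb hc.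
have ht : tuple_in N 30 (part_row v p 0 a b c) by apply: part_row_in => //; [exact: ltn_trans n1N | exact: NbN | exact: NbN].
by split=> //; apply: (hdp.1 _ ht); left; split=> //; left.
Qed.

Lemma part_fact_skip : part_skip_closed A Nb N part_fact.
Proof.
move=> v p i a b c ha hb hc hold [_ hp].
have ht : tuple_in N 30 (part_row v p i.+1 a b c).
  by apply: part_row_in => //; [exact: leq_ltn_trans (ltn_ord i) nN | exact: NbN | exact: NbN].
split=> //; apply: (hdp.1 _ ht); left; split=> //; right; exists (vv i) => //; split=> //.
by left; split; [exact/(oldP nN arc hst) | exact: hp].
Qed.

Lemma part_fact_add : part_add_closed A d Nb N part_fact scan_fact.
Proof.
move=> v p i a b c a1 b1 c1 s z h q X Y c2 pos ia oa [ha hb hc] hold [hpi hp] [hs hv hz hzv hcon] hhq hqs htab [hsi hsc] sum1 sum2 la1 lX lb1 lY lc.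
have sn := size_ring_le hs.
have hq : q < N by exact: leq_ltn_trans (leq_trans hqs sn) nN.
have hh : h < N by exact: leq_ltn_trans hhq hq.
have sN : size s < N by exact: leq_ltn_trans sn nN.
have ht : tuple_in N 30 (part_row v p i.+1 a b c).
  by apply: part_row_in => //; [exact: leq_ltn_trans (ltn_ord i) nN | exact: NbN | exact: NbN].
split=> //; apply: (hdp.1 _ ht); left; split=> //; right; exists (vv i) => //; split=> //.
right; split; first by move=> /(oldP nN arc hst).
pose tt := tab pos ia oa ++ [:: a1; b1; c1; c2; X; Y; h; q; size s; vv z; vv (rc s v 0); vv (rc s v 1); 1].
have [a1N b1N XN YN] : [/\ a1 < N, b1 < N, X < N & Y < N].
  by move: ha hb la1 lb1 lX lY hNb; clear; split; lia.
have [c1N c2N] : c1 < N /\ c2 < N by move: lc hc; clear; split; lia.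
have htt : tuple_in N 31 tt.
  apply/andP; split=> //; rewrite /tt all_cat (tab_in pos htab) /=.
  by rewrite a1N b1N c1N c2N XN YN hh hq sN !VN n1N.
apply/FExnP; exists tt => //; apply/FAndsP.
split; first exact: hp.
split; first by apply/(lenP cact noloop nN arc hst v hs sN).
split; first by apply/(adj_ord nN arc hst); exact: rc_adj.
split; first by apply/(memP cact noloop nN arc hst v hs (VN v)); exists v.
split; first by apply/(memP cact noloop nN arc hst v hs (VN z)); exists z.
split; first by move=> /ord_inj e; rewrite e eqxx in hzv.
split; first by apply/(connP nN arc hst).
split; first by [].
split; first exact: hsc.
have sa : (a1 + Y).+1 < N by move: ha hb la1 lY hNb; clear; lia.
split; first exact: (@led2_complete n d N I nN plus bd_complete hst a1 Y).
have sb : (X + b1).+1 < N by move: ha hb lX lb1 hNb; clear; lia.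
split; first exact: (@led2_complete n d N I nN plus bd_complete hst X b1).
split; first by rewrite /= ltnNge la1.
split; first by rewrite /= ltnNge lX.
split; first by rewrite /= ltnNge lb1.
split; first by rewrite /= ltnNge lY.
by split=> //; apply/(le2P nN plus hst).
Qed.

End Closure.

Lemma stages_lfp_cat N I r s1 s2 : stages_lfp N I r (s1 ++ s2) ->
  stages_lfp N I r s1 /\ stages_lfp N I (r + size s1) s2.
Proof.
elim: s1 r => [|[k f] s1 IH] r /=; first by rewrite addn0.
by move=> [h1 /IH[h2 h3]]; rewrite addnS -addSn.
Qed.

Lemma decides_iff (M : TM) w t (P Q : Prop) : (P <-> Q) -> decides_within M w t P -> decides_within M w t Q.
Proof. by move=> e [h1 h2]; split=> //; rewrite h2. Qed.

(** A derived row for the whole graph yields a valid orientation, hence few reversals. Conversely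
    the outcome of the reversals is a solution whose radii are below [n], because shortest walks
    repeat no vertex, so its row is derivable. *)
Lemma accept_correct n (A : arcs n) d k I : let w := encode A d k in let N := size w in
  0 < n -> 1 < d -> loopless A -> cactus A -> (forall x, I 1 [:: x] = nth false w x) ->
  stages_lfp N I 2 all_stages -> holds N I [::] f_accept <-> kReversals A d k.
Proof.
move=> w N n0 d2 noloop cact I1 hst.
have [hst1 /stages_lfp_cat[hst2 [hdp _]]] := stages_lfp_cat hst.
rewrite -/(stages_lfp _ _ _ graph_stages) /= in hst2 hdp.
have hN : 2 * (n * n) + 12 <= N := size_encode A k n0 d2.
have nn : n <= n * n by rewrite leq_pmulr.
have nN : n < N by move: hN nn; clear; lia.
have n1N : 1 < N by move: hN; clear; lia.
have plus := @plusP w I hst1.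
have arc := arcP n0 d2 I1 hst1.
have ord := orderP n0 d2 I1 hst1.
have bs x hx := (bound_sound n0 d2 I1 hst1 (x := x) hx).1.
have bc x hx := (bound_complete n0 d2 I1 hst1 (x := x) hx).1.
pose v := Ordinal n0.
split.
  move=> /FExnP[t ht]; rewrite cats0 => /FAndsP[h1 [h2 [h3 _]]].
  have hlt := nth_lt nN ht.
  have ez : nth 0 t 99 = 0 by rewrite nth_default //; case/andP: ht => /eqP ->.
  have [hp _] : dp_ok A d (map (nth 0 t) ([:: zz; zz; zz; 0; 3; 2; 1] ++ zs)).
    apply: (dp_sound cact noloop nN plus arc ord bs hst2 hdp _ h3).
    by apply/andP; split=> //; apply/allP => x /mapP[i _ ->].
  have hn : nth 0 t 0 = n by apply/(ord _ (hlt 0)).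
  have := hp ez v v ez ez; rewrite /= hn reg_all => /(_ (leqnn _)) [B [_ hv hc _ hd]].
  have hk := (bound_sound n0 d2 I1 hst1 (hlt 1)).2 h2.
  by apply: (valid_krev hv (leq_trans hc hk)) => x y; apply: hd.
move=> [j [B0 [hj hrev hdiam]]].
have [B [s1 s2 s3 s4 s5] hfull] := revs_full noloop hrev hdiam v (leqnn d) (leqnn d).
pose c := #|B :\: A|.
have hc : c <= n * n by apply: leq_trans (max_card _) _; rewrite card_prod card_ord.
have hsol : solf A d (reg A v v n) v n.-1 n.-1 c.
  rewrite reg_all; exists B => //; split=> //.
  by move=> x hx; have [p q] := s4 x hx; split; [exact: dist_short p | exact: dist_short q].
(* A table entry is a radius below [n] plus a ring distance below [n], shifted by one, hence at most
   [2 * n]. The sums that a scan step tests have three terms below [Nb]. *)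
pose Nb := (2 * n).+1.
have hNb : 3 * Nb <= N.
  apply: leq_trans hN; rewrite /Nb; clear; move: n => [|[|[|x]]] //; nia.
have hNb2 : 2 * n < Nb by [].
have hnb : n.-1 < Nb by rewrite /Nb; clear; lia.
have hcN : c.+1 < N by move: hc hN; clear; lia.
have [_ hI] := part_complete cact noloop
  (scan_fact_init cact noloop nN hNb n1N arc hst2 hdp)
  (scan_fact_step cact noloop nN hNb n1N plus arc ord bc hst2 hdp)
  (part_fact_init nN hNb n1N hdp) (part_fact_skip nN hNb n1N arc hst2 hdp)
  (part_fact_add cact noloop nN hNb n1N plus arc bc hst2 hdp) hNb2 (leqnn n) hsol hnb hnb (ltnW hcN).
have hn1 : n.-1 < N by move: nN; clear; lia.
apply/FExnP; exists [:: n; c; n.-1; n.-1]; first by rewrite /tuple_in /= nN hn1 (ltnW hcN).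
apply/FAndsP; split; first by apply/ord.
split; first by apply: (bound_complete n0 d2 I1 hst1 hcN).2; exact: leq_trans s3 hj.
by split=> //; exact: hI.
Qed.

(* k-Reversals restricted to cactus digraphs is decided by some Turing
   machine in time polynomial in the length of the encoded instance. *)
Theorem theorem5 :
  exists (M : TM) (c : nat),
    forall (n : nat) (A : {set 'I_n * 'I_n}) (d k : nat),
      loopless A -> cactus A -> 2 <= d -> ~ diam_le A d ->
      decides_within M (encode A d k) ((size (encode A d k)).+2 ^ c)
                     (kReversals A d k).
Proof.
have /andP[wf acc] := stages_ok; have [M [c h]] := fo_decides wf acc.
exists M, c => n A d k noloop cact d2 ndiam.
(* Without vertices every diameter bound would hold vacuously. *)
have n0 : 0 < n.
  by rewrite lt0n; apply/eqP => e; apply: ndiam => u; have := ltn_ord u; move: e; clear; lia.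
have hw : encode A d k != [::].
  by rewrite -size_eq0 -lt0n; apply: leq_trans (size_encode A k n0 d2); rewrite addnC.
have [I [_ I1 hst hdec]] := h _ hw.
exact: decides_iff (accept_correct n0 d2 noloop cact I1 hst) hdec.
Qed.
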